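(* Let $\Omega\subset\mathbb{R}^2$ be a bounded convex domain with Lipschitz boundary. Let $p\colon\Omega\to[p_1,p_2]$ be a log-Hölder continuous function with $1<p_1\le p_2\le 2$. Let $u\in W^{1,p(\cdot)}_g(\Omega)$ be the unique weak solution of $-\operatorname{div}(|\nabla u|^{p(x)-2}\nabla u)=f$ in $\Omega$, $u=g$ on $\partial\Omega$, and let $u^h\in S^h_g$ be the unique solution of its finite element approximation on the triangulation $\mathcal{T}^h$ of mesh size $h$. Suppose that $$\int_\Omega|\nabla u|^{p(x)-2}H[u]^2\,dx<+\infty,\qquad H[u]=|u_{x_1x_1}|+|u_{x_1x_2}|+|u_{x_2x_2}|,$$ and that $$u\in C^{2,\alpha^+}(\tau)\quad\text{for each }\tau\in\mathcal{T}^h,\qquad \alpha^+=\frac{2-p^+}{p^+},\quad p^+=\max_{x\in\tau}p(x)$$ (so $p^+$ and $\alpha^+$ depend on the triangle $\tau$). Then there is a constant $C$, independent of $h$, such that $$\|u-u^h\|_{W^{1,p(\cdot)}(\Omega^h)}\le C\,h.$$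
   Context: **Variable exponent spaces.** For a measurable bounded $p\colon\Omega\to[1,+\infty)$, $L^{p(\cdot)}(\Omega)$ is the space of measurable $u\colon\Omega\to\mathbb{R}$ with $\varrho_{p(\cdot),\Omega}(u)=\int_\Omega|u(x)|^{p(x)}\,dx<\infty$, with the Luxemburg norm $\|u\|_{p(\cdot),\Omega}=\inf\{k>0:\varrho_{p(\cdot),\Omega}(u/k)\le1\}$. $W^{1,p(\cdot)}(\Omega)$ is the space of measurable functions $u$ such that $u$ and its distributional gradient $\nabla u$ are in $L^{p(\cdot)}(\Omega)$, with norm $\|u\|_{W^{1,p(\cdot)}(\Omega)}=\|u\|_{p(\cdot),\Omega}+\|\nabla u\|_{p(\cdot),\Omega}$. The same definitions apply with $\Omega$ replaced by $\Omega^h$. $W^{1,p(\cdot)}_0(\Omega)$ is the closure of $C_0^\infty(\Omega)$ in $W^{1,p(\cdot)}(\Omega)$, and $W^{1,p(\cdot)}_g(\Omega)=\{v\in W^{1,p(\cdot)}(\Omega): v=g\text{ on }\partial\Omega\}$. **Log-Hölder continuity.** $p$ is log-Hölder continuous in $\Omega$ if there is a constant $C_{\log}$ with $|p(x)-p(y)|\le \dfrac{C_{\log}}{\log(e+\frac1{|x-y|})}$ for all $x,y\in\Omega$. Such a $p$ extends continuously to $\overline\Omega$. **Weak solution.** $u\in W^{1,p(\cdot)}_g(\Omega)$ is a weak solution if $\int_\Omega|\nabla u|^{p(x)-2}\nabla u\cdot\nabla v\,dx=\int_\Omega fv\,dx$ for all $v\in W^{1,p(\cdot)}_0(\Omega)$.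 The data $f,g$ are given functions for which the weak solution and its finite element approximation exist and are unique, with $u\in C(\overline\Omega)$. **Finite element approximation.** For $h>0$, $\Omega^h\subset\Omega$ is a polygonal approximation of $\Omega$ with $\overline{\Omega^h}=\bigcup_{\kappa\in\mathcal{T}^h}\overline\kappa$, where $\mathcal{T}^h$ is a finite collection of disjoint open triangles, regular (shape-regular uniformly in $h$), each of diameter at most $h$. The closures of two distinct triangles are disjoint, or share exactly a common vertex, or share exactly a common side. Any vertex belonging to $\partial\Omega^h$ also belongs to $\partial\Omega$. Let $S^h=\{v\in C(\overline{\Omega^h}): v|_\kappa\text{ is linear (affine) for all }\kappa\in\mathcal{T}^h\}$. Let $\pi_h\colon C(\overline{\Omega^h})\to S^h$ be the interpolation operator with $\pi_hv(P)=v(P)$ for every vertex $P$ of $\mathcal{T}^h$. Put $g^h=\pi_hu$, $S^h_0=\{v\in S^h:v=0\text{ on }\partial\Omega^h\}$ and $S^h_g=\{v\in S^h:v=g^h\text{ on }\partial\Omega^h\}$. Then $u^h\in S^h_g$ is the solution of $\int_{\Omega^h}|\nabla u^h|^{p(x)-2}\nabla u^h\cdot\nabla v\,dx=\int_{\Omega^h}fv\,dx$ for all $v\in S^h_0$. Convention: $0^0=1$. *)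

(* Defs.v *)
From HB Require Import structures.
From mathcomp Require Import all_boot all_order all_algebra.
From mathcomp Require Import all_classical all_reals all_analysis.

Set Implicit Arguments.
Unset Strict Implicit.
Unset Printing Implicit Defensive.

Import Order.TTheory GRing.Theory Num.Theory.
Import numFieldNormedType.Exports.

Local Open Scope classical_set_scope.
Local Open Scope ring_scope.

Section Plane.
Context {R : realType}.
Implicit Types (x y v w a b : R * R) (A B : set (R * R)).

Definition leb2 :
    {measure set (measurableTypeR R * measurableTypeR R) -> \bar R} :=
  (@lebesgue_measure R \x @lebesgue_measure R)%E.

Definition dot v w : R := v.1 * w.1 + v.2 * w.2.

(* The library's norm on a product is the sup norm; this is the Euclidean
   one.  The two induce the same topology. *)
Definition enorm v : R := Num.sqrt (dot v v).

Definition boundary A : set (R * R) := closure A `\` interior A.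

Definition segment a b : set (R * R) :=
  [set ((1 - t) *: a + t *: b : R * R) | t in `[0, 1]%classic].

(* In some rotated orthonormal frame (e, e^perp) centred at the boundary
   point, A is locally the strict epigraph of a Lipschitz function. *)
Definition lipschitz_boundary A : Prop :=
  forall z, boundary A z ->
  exists (r : R) (e : R * R) (gam : R -> R) (L : R),
    [/\ 0 < r, enorm e = 1,
        forall s t : R, `|gam s - gam t| <= L * `|s - t| &
        forall y, enorm (y - z) < r ->
          (A y <-> gam (dot (y - z) e) < dot (y - z) (- e.2, e.1))].

Definition log_holder A (p : R * R -> R) : Prop :=
  exists Clog : R, forall x y, A x -> A y ->
    `|p x - p y| <= Clog / ln (expR 1 + (enorm (x - y))^-1).

End Plane.

Section Derivatives.
Context {R : realType}.
Implicit Types (x y : R * R) (A : set (R * R)) (u w phi : R * R -> R).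
Implicit Types (i j : 'I_2) (s : seq 'I_2).

Definition coord i x : R := if i == 0 then x.1 else x.2.

Definition unitv i : R * R := if i == 0 then (1, 0) else (0, 1).

Definition partial i u : R * R -> R := fun x => 'D_(unitv i) u x.

Definition partials s u : R * R -> R := foldr partial u s.

(* k times continuously differentiable on the (open) set A. *)
Definition Ck (k : nat) A u : Prop :=
  (forall s, (size s < k)%N -> forall i x, A x ->
     derivable (partials s u) x (unitv i)) /\
  (forall s, (size s <= k)%N -> {within A, continuous (partials s u)}).

(* C^{2,alpha} up to the boundary of the open set A: the derivatives of order
   at most 2 extend continuously to the closure of A, and those of order 2 are
   Hoelder continuous with exponent alpha. Since [0 `^ 0 = 1], alpha = 0 gives
   C^2 up to the boundary. *)
Definition C2alpha A (alpha : R) u : Prop :=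
  [/\ Ck 2 A u,
      forall s, (size s <= 2)%N -> exists w,
        {within closure A, continuous w} /\
        (forall x, A x -> w x = partials s u x) &
      exists K : R, forall s, size s = 2%N -> forall x y, A x -> A y ->
        `|partials s u x - partials s u y| <= K * enorm (x - y) `^ alpha].

(* C_0^infty(A). *)
Definition test_function A phi : Prop :=
  [/\ forall k, Ck k setT phi,
      compact (closure [set x | phi x != 0]) &
      closure [set x | phi x != 0] `<=` A].

Definition loc_integrable A u : Prop :=
  forall K, compact K -> K `<=` A -> leb2.-integrable K (EFin \o u).

(* w is the distributional derivative of u on A in the i-th direction. *)
Definition weak_partial A i u w : Prop :=
  [/\ loc_integrable A u, loc_integrable A w &
      forall phi, test_function A phi ->
        \int[leb2]_(x in A) (u x * partial i phi x) =
        - \int[leb2]_(x in A) (w x * phi x)].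

Definition is_weak_grad A u (G : R * R -> R * R) : Prop :=
  forall i, weak_partial A i u (coord i \o G).

(* The distributional gradient (a representative of it; the default value 0 is
   only used when u has none). *)
Definition wgrad A u : R * R -> R * R :=
  xget (fun=> (0, 0)) [set G | is_weak_grad A u G].

(* H[u] = |u_{11}| + |u_{12}| + |u_{22}| from second derivatives D i j. *)
Definition hess_sum (D : 'I_2 -> 'I_2 -> R * R -> R) x : R :=
  `|D 0 0 x| + `|D 0 1 x| + `|D 1 1 x|.

(* D is the matrix of second distributional derivatives of u on A. *)
Definition is_weak_hess A u (D : 'I_2 -> 'I_2 -> R * R -> R) : Prop :=
  forall i j, weak_partial A j (coord i \o wgrad A u) (D i j).

(* t^r for t >= 0 with 0^0 = 1 and 0^r = +oo when r < 0 (whereas the library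
   sets 0 `^ r = 0 in that case). *)
Definition epow (t r : R) : \bar R :=
  if (t == 0) && (r < 0) then +oo%E else (t `^ r)%:E.

End Derivatives.

Section VariableExponent.
Context {R : realType}.
Implicit Types (A : set (R * R)) (p f g u v w : R * R -> R).

Definition modular A p u : \bar R :=
  (\int[leb2]_(x in A) (`|u x| `^ p x)%:E)%E.

Definition Lp A p u : Prop := measurable_fun A u /\ (modular A p u < +oo)%E.

(* The infimum is taken in the extended reals: inf of the empty set is +oo. *)
Definition Lp_norm A p u : \bar R :=
  ereal_inf [set k%:E | k in
    [set k : R | 0 < k /\ (modular A p (fun x => (u x / k)%R) <= 1)%E]].

Definition W1p A p u : Prop :=
  [/\ Lp A p u, exists G, is_weak_grad A u G &
      forall i, Lp A p (coord i \o wgrad A u)].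

Definition W1p_norm A p u : \bar R :=
  (Lp_norm A p u + Lp_norm A p (fun x => enorm (wgrad A u x)))%E.

(* The closure of C_0^infty(A) in W^{1,p(.)}(A). *)
Definition W1p0 A p u : Prop :=
  W1p A p u /\
  forall eps : R, 0 < eps -> exists phi, [/\ test_function A phi,
    W1p A p (u \- phi) & (W1p_norm A p (u \- phi)%R < eps%:E)%E].

(* The boundary datum is given as (the trace of) a function g of
   W^{1,p(.)}(A), and "v = g on the boundary" means v - g in W^{1,p(.)}_0. *)
Definition W1pg A p g u : Prop :=
  [/\ W1p A p g, W1p A p u & W1p0 A p (u \- g)].

(* |grad u|^{p(x)-2} grad u . grad v, which is 0 where grad u = 0. *)
Definition plap_form A p u v : R :=
  \int[leb2]_(x in A)
    (enorm (wgrad A u x) `^ (p x - 2) * dot (wgrad A u x) (wgrad A v x)).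

Definition weak_solution A p f g u : Prop :=
  W1pg A p g u /\
  forall v, W1p0 A p v ->
    leb2.-integrable A (EFin \o (f \* v)) /\
    plap_form A p u v = \int[leb2]_(x in A) (f x * v x).

Definition unique_weak_solution A p f g u : Prop :=
  weak_solution A p f g u /\
  forall w, weak_solution A p f g w -> {ae leb2, forall x, A x -> w x = u x}.

End VariableExponent.

Section FiniteElements.
Context {R : realType}.

(* A triangle is given by its vertices, a triangulation by a set of those. *)
Definition triangle := 'I_3 -> R * R.

Implicit Types (k : triangle) (T : set triangle) (A : set (R * R)).
Implicit Types (p f u v w : R * R -> R).

Definition nondegenerate k : Prop :=
  let a := k 1 - k 0 in let b := k 2%:R - k 0 in a.1 * b.2 - a.2 * b.1 != 0.

(* The open triangle with vertices k. *)
Definition opent k : set (R * R) :=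
  [set x | exists c : 'I_3 -> R, [/\ forall i, 0 < c i, \sum_i c i = 1 &
             x = \sum_i c i *: k i]].

Definition diam A : R := sup [set enorm (x - y) | x in A & y in A].

(* The supremum of the diameters of the discs contained in A. *)
Definition indiam A : R :=
  sup [set d : R | exists x r, [/\ 0 < r, d = 2 * r &
             [set y | enorm (y - x) < r] `<=` A]].

(* p^+: as p extends continuously to the closure of a triangle, its supremum
   over the open triangle is its maximum over the closed one. *)
Definition pplus A p : R := sup [set p x | x in A].

Definition is_vertex k x : Prop := exists i, x = k i.

Definition is_side k A : Prop :=
  exists i j, i != j /\ A = segment (k i) (k j).

(* The polygon Omega^h: the interior of the union of the closed triangles. *)
Definition polygon T : set (R * R) :=
  interior (\bigcup_(k in T) closure (opent k)).

Definition conforming T : Prop :=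
  forall k k', T k -> T k' -> k <> k' ->
    opent k `&` opent k' = set0 /\
    let I := closure (opent k) `&` closure (opent k') in
    [\/ I = set0,
        exists x, [/\ I = [set x], is_vertex k x & is_vertex k' x] |
        is_side k I /\ is_side k' I].

(* T is an admissible triangulation of mesh size h, with shape-regularity
   constant sigma, of a polygonal approximation of Omega. *)
Record triangulation (Omega : set (R * R)) (sigma h : R) T : Prop := {
  tr_finite : finite_set T;
  tr_nondegenerate : forall k, T k -> nondegenerate k;
  tr_conforming : conforming T;
  tr_diam : forall k, T k -> diam (opent k) <= h;
  tr_regular : forall k, T k -> diam (opent k) <= sigma * indiam (opent k);
  tr_sub : polygon T `<=` Omega;
  tr_boundary : forall k x, T k -> is_vertex k x ->
    boundary (polygon T) x -> boundary Omega x }.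

Definition affine_on A v : Prop :=
  exists a b c : R, forall x, A x -> v x = a + b * x.1 + c * x.2.

(* S^h; only the values on the closure of the polygon are meaningful. *)
Definition Sh T v : Prop :=
  {within closure (polygon T), continuous v} /\
  forall k, T k -> affine_on (opent k) v.

(* pi_h *)
Definition interp T v : R * R -> R :=
  xget (fun=> 0) [set w | Sh T w /\
    forall k x, T k -> is_vertex k x -> w x = v x].

Definition Sh0 T v : Prop :=
  Sh T v /\ forall x, boundary (polygon T) x -> v x = 0.

Definition Shg T u v : Prop :=
  Sh T v /\ forall x, boundary (polygon T) x -> v x = interp T u x.

(* u only enters through the boundary values g^h = pi_h u. *)
Definition fe_solution T p f u w : Prop :=
  Shg T u w /\
  forall v, Sh0 T v ->
    leb2.-integrable (polygon T) (EFin \o (f \* v)) /\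
    plap_form (polygon T) p w v = \int[leb2]_(x in polygon T) (f x * v x).

Definition unique_fe_solution T p f u w : Prop :=
  fe_solution T p f u w /\
  forall w', fe_solution T p f u w' ->
    forall x, closure (polygon T) x -> w' x = w x.

End FiniteElements.

(* Main.v *)
(* Monotonicity of [xi |-> |xi|^(p-2) xi] and Galerkin orthogonality bound the
   quasi-norm error [\int (|grad u| + |grad (u - uh)|)^(p-2) |grad (u - uh)|^2]
   by the same integral for the interpolant [pi u], so that it suffices to show
   that the latter is at most [C h^2] times the weighted Hessian integral, one
   triangle at a time.

   Let [d] be the diameter of a triangle and [P] the infimum of [p] on it.  With
   [V xi = (de^2 + |xi|^2)^((P-2)/4) xi], where [de] is of order [d^2], the
   Poincare inequality [\int |f - f x0|^2 <= C (\int |grad f|)^2], applied to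
   [V (grad u)], controls the oscillation of [grad u]; as [u - pi u] vanishes at
   the vertices, its sup norm and the slope of [pi u] are controlled by integrals
   of second derivatives.  Log-Hoelder continuity allows one to replace [p] by [P]
   where [de <= |grad u| <= La], [La] being a negative power of [d]; where
   [|grad u| > La], the Poincare inequality for [(1 + |grad u|^2)^(ga/2)] shows
   that [\int |grad u|^p] is itself of order [d^2].  The estimates hold on
   triangles shrunk into the open one, with uniform constants, and pass to the
   limit by Fatou's lemma.

   Finite element functions vanishing on the boundary of the polygon are test
   functions for the continuous problem: extended by zero, they are limits of
   mollifications of their soft thresholdings, which have compact support.  The zero
   order part of the norm follows from [\int v^2 <= (\int |grad v|)^2], available
   since [p <= 2]. *)
From HB Require Import structures.
From mathcomp Require Import all_boot all_order all_algebra.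
From mathcomp Require Import ring lra.
From mathcomp Require Import all_classical all_reals all_analysis.
From mathcomp Require Import measurable_realfun.
Require Import Defs.

Set Implicit Arguments.
Unset Strict Implicit.
Unset Printing Implicit Defensive.

Import Order.TTheory GRing.Theory Num.Theory.
Import numFieldNormedType.Exports.

Local Open Scope classical_set_scope.
Local Open Scope ring_scope.

Notation plane R := (measurableTypeR R * measurableTypeR R)%type.
Notation uv i := (unitv i : (Real.sort _ * Real.sort _)%type).
Notation meas2 A := (measurable (A : set (plane _))).
Notation mfun2 A f := (measurable_fun (A : set (plane _)) (f : plane _ -> Real.sort _)).

(** The field [|grad u|^((p-2)/2) grad u] cannot be differentiated, since [p] has only a logarithmic
    modulus of continuity; hence one exponent per triangle, and a price [t^(p-P)] for the exchange.
    As [p] oscillates by [O(1/log(1/d))], this price is a bounded factor for [t] between two fixed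
    powers of [d], which is why both cut-offs are powers of [d]. Below the lower one the error
    density is itself at most [de = O(d^2)]; above the upper one nothing is exchanged.

    Every local bound is linear in one local quantity, the integral over the triangle of
    [1 + |grad u|^p + |grad u|^(p-2) H^2], with factors that depend only on a bound of its global
    value. Summation over the mesh therefore involves no count of triangles.

    The passage to norms rests on scaling: if [\int (|w|/h)^p <= C] then the Luxemburg norm of [w]
    is at most [h max(1, C)], because [p >= 1]. A quasi-norm of order [h^2] gives such a bound
    through [(z/h)^p <= x^(p-2) z^2 / h^2 + x^p], where [x] is the base of the weight and
    [z <= 2 x]. *)

Lemma eqle d (T : porderType d) (x y : T) : x = y -> (x <= y)%O.
Proof. by move->. Qed.

(** * Lebesgue measure in the plane *)

Section MeasurePlane.
Context {R : realType}.
Local Notation mu := (@lebesgue_measure R).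
Local Notation T2 := (plane R).
Implicit Types (A B : set (R * R)).

Lemma ball2 (x y : R * R) r : `|x.1 - y.1| < r -> `|x.2 - y.2| < r -> ball x r y.
Proof. by move=> h1 h2; split. Qed.

(** Closed rectangles inside [A] are compact, as local integrability requires, while their interiors
    still cover [A]. Centres are rational and radii are [1/(n+1)]. *)
Lemma open_rect_cover A : open A ->
  exists a b c d : nat -> R,
    (forall n, `[a n, b n] `*` `[c n, d n] `<=` A) /\
    A `<=` \bigcup_n (`]a n, b n[ `*` `]c n, d n[).
Proof.
move=> oA.
pose e (q : rat * rat * nat) : R := q.2.+1%:R^-1.
pose good (q : rat * rat * nat) := `[< `[ratr q.1.1 - e q, ratr q.1.1 + e q] `*`
   `[ratr q.1.2 - e q, ratr q.1.2 + e q] `<=` A >].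
(* Codes of rectangles that leave [A] are sent to the empty rectangle with sides [[1, 0]]. *)
pose F (q : option (rat * rat * nat)) : R * R * (R * R) :=
  if q is Some q then if good q then
    ((ratr q.1.1 - e q, ratr q.1.1 + e q), (ratr q.1.2 - e q, ratr q.1.2 + e q))
    else ((1, 0), (1, 0)) else ((1, 0), (1, 0)).
pose G n := F (unpickle n).
exists (fun n => (G n).1.1), (fun n => (G n).1.2), (fun n => (G n).2.1), (fun n => (G n).2.2).
have E0 (B : set R) : `[(1 : R), 0]%classic `*` B `<=` A.
  by move=> -[x y] [/=]; rewrite in_itv /= => h; exfalso; lra.
split=> [n|x Ax].
  rewrite /G /F; case: (unpickle n) => [q|]; last exact: E0.
  by case: ifPn => [/asboolP //|_]; exact: E0.
have [r r0 rA] : exists2 r : R, 0 < r & ball (x : R * R) r `<=` A.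
  by have /nbhs_ballP[r r0 ?] := oA _ Ax; exists r.
have [n ne] : exists n : nat, (n.+1%:R^-1 : R) < r / 2.
  have e20 : 0 < r / 2 by rewrite divr_gt0.
  have [n _ /(_ n (leqnn n))] := near_infty_natSinv_lt (PosNum e20).
  by exists n.
have i0 : (0 : R) < n.+1%:R^-1 by rewrite invr_gt0.
have qe y : exists q : rat, `|ratr q - y| < (n.+1%:R^-1 : R).
  have y1 : y < y + n.+1%:R^-1 by rewrite ltrDl invr_gt0.
  have [q] := rat_in_itvoo y1.
  rewrite in_itv /= => /andP[q1 q2]; exists q.
  by rewrite ger0_norm ?subr_ge0 ?ltW // ltrBlDl.
have [q1] := qe x.1; have [q2] := qe x.2.
rewrite !ltr_norml.
have [ep epE] : exists ep : R, ep = n.+1%:R^-1 by exists (n.+1%:R^-1).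
rewrite -epE in ne i0 * => /andP[h1 h2] /andP[h3 h4].
have gq : good ((q1, q2), n).
  apply/asboolP => y [/=]; rewrite /e /= -epE !in_itv /= => /andP[k1 k2] /andP[k3 k4].
  by apply/rA/ball2; rewrite ltr_norml; apply/andP; split; lra.
have [k kE] : exists k, G k = F (Some ((q1, q2), n)).
  by exists (pickle ((q1, q2), n)); rewrite /G pickleK.
exists k; first by [].
rewrite kE /F gq /=.
split; rewrite /e /= -epE in_itv /=; apply/andP; split; lra.
Qed.

Lemma open_measurable2 A : open A -> meas2 A.
Proof.
move=> /open_rect_cover [a [b [c [d [h1 h2]]]]].
have -> : (A : set T2) = \bigcup_n (`]a n, b n[ `*` `]c n, d n[).
  apply/seteqP; split => // x [n _ [/= x1 x2]]; apply: (h1 n).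
  by split; exact: subset_itv_oo_cc.
by apply: bigcupT_measurable => n; apply: measurableX.
Qed.

Lemma closed_measurable2 A : closed A -> meas2 A.
Proof.
by move=> cA; rewrite -(setCK A); apply: measurableC; apply: open_measurable2; exact: closed_openC.
Qed.

Lemma within_continuous_measurable2 A (f : R * R -> R) : meas2 A ->
  {within A, continuous f} -> mfun2 A f.
Proof.
move=> mD /continuousP cf; apply: (measurability _ (RGenOpens.measurableE R)).
move=> _ [_ [a [b ->] <-]].
have /open_subspaceP [V oV VD] : open ((f : subspace A -> R) @^-1` `]a, b[%classic).
  by apply: cf; exact: interval_open.
rewrite setIC -VD.
by apply: measurableI => //; exact: open_measurable2.
Qed.

Lemma open_continuous_measurable2 A (f : R * R -> R) : open A ->
  (forall x, A x -> {for x, continuous f}) ->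
  mfun2 A f.
Proof.
move=> oA cf; apply: within_continuous_measurable2; first exact: open_measurable2.
rewrite continuous_open_subspace //; move=> x; rewrite inE; exact: cf.
Qed.

Definition aff1 (al be : R) : measurableTypeR R -> measurableTypeR R :=
  fun s => al * s + be.

Lemma measurable_aff1 (al be : R) : measurable_fun setT (aff1 al be).
Proof. by apply: measurable_funD => //; apply: measurable_funM. Qed.

(** Uniqueness of Lebesgue measure: [|al|] times the push-forward has the right value on half-open
    intervals. For [al < 0] the preimage of such an interval is half-open on the other side. *)
Lemma affine_lebesgue (al be : R) (A : set (measurableTypeR R)) : al != 0 ->
  measurable A -> mu (aff1 al be @^-1` A) = (`|al|^-1%:E * mu A)%E.
Proof.
move=> al0 mA.
have mf := measurable_aff1 al be.
pose nu : {measure set (measurableTypeR R) -> \bar R} :=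
  mscale (NngNum (normr_ge0 al))
      (measure_function_pushforward__canonical__measure_function_Measure mu mf).
have nuE X : measurable X -> mu X = nu X.
  apply: lebesgue_measure_unique => _ [[a b] /= ab <-].
  rewrite /nu /mscale /= /pushforward.
  have -> : aff1 al be @^-1` `]a, b] = if 0 < al then `](a - be) / al, (b - be) / al]%classic
                              else `[(b - be) / al, (a - be) / al[%classic.
    by apply/seteqP; split => x; rewrite /aff1 /=; case: ltrgt0P al0 => // al0 _ /=;
      rewrite !in_itv /= => /andP[];
      rewrite ?ltr_pdivrMr ?ler_pdivlMr ?ltr_ndivlMr ?ler_ndivrMr //;
      move=> h1 h2; apply/andP; split;
      rewrite ?ltr_pdivrMr ?ler_pdivlMr ?ltr_ndivlMr ?ler_ndivrMr //; lra.
  case: ltrgt0P al0 => // al0 _.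
    rewrite !lebesgue_measure_itv /= !lte_fin ltr_pM2r ?invr_gt0 //.
    rewrite ltrD2r; case: ifP => _; last by rewrite mule0.
    rewrite -!EFinB -EFinM; congr (_%:E).
    by field; rewrite gt_eqF.
  rewrite !lebesgue_measure_itv /= !lte_fin ltr_nM2r ?invr_lt0 //.
  rewrite ltrD2r; case: ifP => _; last by rewrite mule0.
  rewrite -!EFinB -EFinM; congr (_%:E).
  by field; rewrite lt_eqF.
rewrite (nuE _ mA) /nu /mscale /= /pushforward muleA -EFinM mulVf ?mul1e //.
by rewrite normr_eq0.
Qed.

Lemma affine_integral1 (al be : R) (F : measurableTypeR R -> \bar R) : al != 0 ->
  measurable_fun setT F -> (forall s, 0 <= F s)%E ->
  (\int[mu]_s F (al * s + be)%R = `|al|^-1%:E * \int[mu]_s F s)%E.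
Proof.
move=> al0 mF F0.
have mf := measurable_aff1 al be.
have nal : 0 <= `|al|^-1 by rewrite invr_ge0.
transitivity (\int[pushforward mu (aff1 al be)]_s F s)%E.
  by rewrite (ge0_integral_pushforward mf).
transitivity (\int[mscale (NngNum nal) mu]_s F s)%E; last first.
  by rewrite ge0_integral_mscale.
by apply: eq_measure_integral => //= A mA _; exact: affine_lebesgue.
Qed.

Definition aff2 (P a b : R * R) : T2 -> T2 :=
  fun z => (P.1 + z.1 * a.1 + z.2 * b.1, P.2 + z.1 * a.2 + z.2 * b.2).

Lemma aff2E P a b z : aff2 P a b z = P + z.1 *: a + z.2 *: b.
Proof. by []. Qed.

Lemma measurable_aff2 P a b : measurable_fun setT (aff2 P a b).
Proof.
apply: measurable_fun_pair => /=;
  do 2?[apply: measurable_funD => //]; apply: measurable_funM => //.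
Qed.

(** The affine map is [m], which changes only the second coordinate, after a substitution that
    changes only the first. Tonelli's theorem reduces the claim to two one-dimensional
    substitutions, with factors [a.1] and [det / a.1]. *)
Lemma affine_integral2_aux (P a b : R * R) (F : T2 -> \bar R) :
  a.1 * b.2 - a.2 * b.1 != 0 -> a.1 != 0 ->
  measurable_fun setT F -> (forall s, 0 <= F s)%E ->
  (\int[leb2]_z F (aff2 P a b z) =
   `|a.1 * b.2 - a.2 * b.1|^-1%:E * \int[leb2]_z F z)%E.
Proof.
set det := _ - _ => det0 a0 mF F0.
have mF1 : measurable_fun setT (F \o aff2 P a b).
  exact: measurableT_comp mF (measurable_aff2 P a b).
have F10 : (forall s, 0 <= (F \o aff2 P a b) s)%E by move=> s; exact: F0.
pose m : T2 -> T2 := fun z => (z.1, a.2 / a.1 * (z.1 - P.1) + P.2 + z.2 * (det / a.1)).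
have mm : measurable_fun setT m.
  apply: measurable_fun_pair => //=.
  apply: measurable_funD => //=; last exact: measurable_funM.
  apply: measurable_funD => //=; apply: measurable_funM => //=.
  exact: measurable_funB.
have mH : measurable_fun setT (F \o m) by exact: measurableT_comp mF mm.
have H0 : (forall s, 0 <= (F \o m) s)%E by move=> s; exact: F0.
rewrite /leb2 (@fubini_tonelli2 _ _ _ _ _ mu mu (F \o aff2 P a b)) //.
have -> : (\int[mu]_y fubini_G mu (F \o aff2 P a b) y =
   \int[mu]_y (`|a.1|^-1%:E * fubini_G mu (F \o m) y))%E.
  apply: eq_integral => y _; rewrite /fubini_G.
  transitivity (\int[mu]_x ((F \o m) ((a.1 * x + (P.1 + y * b.1))%R, y)))%E.
    apply: eq_integral => x _ /=; congr F; rewrite /aff2 /m /=; congr pair.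
      by lra.
    by rewrite /det; field.
  rewrite -(@affine_integral1 a.1 (P.1 + y * b.1) (fun x => (F \o m) (x, y))) //.
  exact: (measurableT_comp mH (measurable_pair2 y)).
rewrite ge0_integralZl //; last 2 first.
- exact: measurable_fun_fubini_tonelli_G.
- by move=> y _; apply: integral_ge0.
have -> : (\int[mu]_y fubini_G mu (F \o m) y = \int[leb2]_z (F \o m) z)%E.
  by rewrite /leb2 fubini_tonelli2.
rewrite /leb2 (@fubini_tonelli1 _ _ _ _ _ mu mu (F \o m)) //.
have -> : (\int[mu]_x fubini_F mu (F \o m) x =
   \int[mu]_x (`|det / a.1|^-1%:E * fubini_F mu F x))%E.
  apply: eq_integral => x _; rewrite /fubini_F.
  transitivity (\int[mu]_y (F (x, ((det / a.1) * y + (a.2 / a.1 * (x - P.1) + P.2))%R)))%E.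
    by apply: eq_integral => y _ /=; congr F; rewrite /m /=; congr pair; lra.
  rewrite -(@affine_integral1 _ (a.2 / a.1 * (x - P.1) + P.2) (fun y => F (x, y))) //.
    by rewrite mulf_neq0 // invr_neq0.
  exact: (measurableT_comp mF (measurable_pair1 x)).
rewrite ge0_integralZl //; last 2 first.
- exact: measurable_fun_fubini_tonelli_F.
- by move=> y _; apply: integral_ge0.
rewrite -fubini_tonelli1 // muleA -EFinM; congr (_%:E * _)%E.
rewrite normrM invfM normfV invrK; field.
by rewrite !normr_eq0 det0.
Qed.

Lemma integral_swap2 (F : T2 -> \bar R) :
  measurable_fun setT F -> (forall s, 0 <= F s)%E ->
  (\int[leb2]_z F (z.2, z.1) = \int[leb2]_z F z)%E.
Proof.
move=> mF F0.
have mS : measurable_fun setT (fun z : T2 => (z.2, z.1) : T2).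
  exact: measurable_fun_pair.
rewrite /leb2 (@fubini_tonelli2 _ _ _ _ _ mu mu (fun z : T2 => F (z.2, z.1))) //.
  by rewrite (@fubini_tonelli1 _ _ _ _ _ mu mu F).
exact: measurableT_comp mF mS.
Qed.

(** When [a.1 = 0] the determinant forces [b.1 <> 0], and exchanging the two parameters exchanges
    [a] and [b]. *)
Lemma affine_integral2 (P a b : R * R) (F : T2 -> \bar R) :
  a.1 * b.2 - a.2 * b.1 != 0 ->
  measurable_fun setT F -> (forall s, 0 <= F s)%E ->
  (\int[leb2]_z F (aff2 P a b z) =
   `|a.1 * b.2 - a.2 * b.1|^-1%:E * \int[leb2]_z F z)%E.
Proof.
move=> det0 mF F0.
have [a0|a0] := eqVneq a.1 0; last exact: affine_integral2_aux.
have b0 : b.1 != 0.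
  by apply: contraNneq det0 => b0; rewrite a0 b0 mul0r mulr0 subrr.
rewrite (_ : _ - _ = - (b.1 * a.2 - b.2 * a.1)); last by ring.
rewrite normrN -(@affine_integral2_aux P b a) //; last first.
  by apply: contra_neq det0 => e; lra.
rewrite -(@integral_swap2 (F \o aff2 P b a)); last 2 first.
- exact: measurableT_comp mF (measurable_aff2 P b a).
- by move=> s; exact: F0.
apply: eq_integral => z _ /=; congr F; rewrite /aff2 /=; congr pair; ring.
Qed.

Lemma leb2X (A B : set (measurableTypeR R)) : measurable A -> measurable B ->
  leb2 (A `*` B) = (mu A * mu B)%E.
Proof. by move=> mA mB; have := product_measure1E mu mu mA mB. Qed.

Lemma line_null (a b c : R) : (a != 0) || (b != 0) ->
  leb2 ([set x : T2 | a * x.1 + b * x.2 = c]) = 0%E.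
Proof.
have [b0|b0] := eqVneq b 0.
  rewrite orbF => a0.
  rewrite (_ : [set _ | _] = [set c / a] `*` setT); last first.
    apply/seteqP; split => -[x y]; rewrite b0 /= mul0r addr0.
      by move=> <-; split => //; field.
    by case=> -> _; field.
  rewrite leb2X // lebesgue_measure_set1 mul0e //.
pose L : set T2 := [set x : T2 | a * x.1 + b * x.2 = c].
move=> _; change ((\int[mu]_x (mu \o xsection L) x)%E = 0%E).
rewrite integral0_eq // => x _ /=.
rewrite (_ : xsection _ _ = [set (c - a * x) / b]) ?lebesgue_measure_set1 //.
apply/seteqP; split => y /=; rewrite /xsection /= inE /L /=.
  by move=> <-; field.
by move=> ->; field.
Qed.

Lemma bounded_leb2 A : bounded_set A ->
  exists M : R, forall x, A x -> `|x.1| <= M /\ `|x.2| <= M.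
Proof.
case=> M [_ /(_ (M + 1)) H]; exists (M + 1) => x /H /=.
rewrite ltrDl ltr01 => /(_ isT); rewrite prod_normE ge_max => /andP[]; by [].
Qed.

Lemma leb2_square (M : R) :
  leb2 ([set x : T2 | `|x.1| <= M /\ `|x.2| <= M]) = (((Num.max 0 (M *+ 2)) ^+ 2)%:E).
Proof.
rewrite (_ : [set _ | _] = `[- M, M] `*` `[- M, M]); last first.
  by apply/seteqP; split => -[x y] /=; rewrite !in_itv /= !ler_norml.
rewrite leb2X // lebesgue_measure_itv /= lte_fin.
rewrite -EFinB opprK -mulr2n.
case: ifPn => h; rewrite ?mule0 -?EFinM; congr (_%:E).
  by rewrite max_r ?expr2 // -(pmulrn_lge0 _ (ltn0Sn 1)); lra.
by rewrite max_l ?expr0n //=; move: h; rewrite -leNgt; lra.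
Qed.

End MeasurePlane.

(** * Smooth cutoffs and the fundamental lemma *)

Section Smooth1.
Context {R : realType}.
Implicit Types (f g : R -> R) (t a b : R) (P Q : {poly R}).

Lemma poly_le_exp Q (m : nat) : exists C : R, forall y, 0 <= y ->
  `|Q.[y]| * y ^+ m <= C * expR y.
Proof.
elim/poly_ind: Q m => [|Q c IH] m.
  by exists 0 => y y0; rewrite horner0 normr0 !mul0r.
have [C HC] := IH m.+1.
(* This is [y / n <= exp (y / n)] raised to the power [n]; for [n = 0] the constant is
   [0 ^+ 0 = 1]. *)
have pm (n : nat) y : 0 <= y -> y ^+ n <= n%:R ^+ n * expR y.
  move=> y0; case: n => [|n]; first by rewrite !expr0 mul1r; have := expR_ge1Dx y; lra.
  have -> : expR y = expR (y / n.+1%:R) ^+ n.+1.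
    by rewrite -expRM_natl; congr expR; rewrite -mulr_natl mulrC divfK // pnatr_eq0.
  rewrite -exprMn lerXn2r // ?nnegrE //; last first.
    have := expR_ge1Dx (y / n.+1%:R) => h.
    rewrite -ler_pdivrMl ?ltr0n // mulrC.
    by apply: le_trans h; rewrite lerDr.
exists (C + `|c| * m%:R ^+ m) => y y0.
rewrite hornerMXaddC mulrDl.
apply: (@le_trans _ _ ((`|Q.[y]| * y + `|c|) * y ^+ m)).
  rewrite ler_wpM2r ?exprn_ge0 //.
  by rewrite (le_trans (ler_normD _ _)) // normrM (ger0_norm y0).
rewrite mulrDl lerD //; first by rewrite -mulrA -exprS; exact: HC.
by rewrite -mulrA ler_wpM2l // pm.
Qed.

(* [Q(1/t) exp(-1/t)], extended by 0 to [t <= 0]; this class is stable under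
   derivation. *)
Definition polyexp Q t : R := if 0 < t then Q.[t^-1] * expR (- t^-1) else 0.

(** A quadratic bound makes the difference quotients at 0 tend to 0, which glues the two halves
    differentiably. *)
Lemma polyexp_quad Q : exists C : R, forall t, `|polyexp Q t| <= C * t ^+ 2.
Proof.
have [C HC] := poly_le_exp Q 2.
have C0 : 0 <= C.
  have := HC 0 (lexx _); rewrite expr0n /= mulr0 expR0 mulr1; exact.
exists C => t; rewrite /polyexp; case: ifPn => t0; last first.
  by rewrite normr0 mulr_ge0 // sqr_ge0.
have ti : 0 <= t^-1 by rewrite invr_ge0 ltW.
have := HC _ ti; rewrite normrM (ger0_norm (expR_ge0 _)) expRN => H.
rewrite -(ler_pM2r (expR_gt0 t^-1)).
rewrite -mulrA mulVf ?gt_eqF ?expR_gt0 // mulr1.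
rewrite -(@ler_pM2r _ (t^-1 ^+ 2)) ?exprn_gt0 ?invr_gt0 //.
apply: le_trans H _; have -> : C * t ^+ 2 * expR t^-1 * t^-1 ^+ 2 = C * expR t^-1.
  by field; rewrite gt_eqF.
by [].
Qed.

(** For [t > 0] the chain rule gives [t^-2 (Q - Q')(1/t) exp(-1/t)], again a function of the
    class. *)
Lemma is_derive_polyexp Q t :
  is_derive t 1 (polyexp Q) (polyexp ('X^2 * (Q - Q^`()%R)) t).
Proof.
have [t0|t0|->] := ltgtP t 0.
- have -> : polyexp ('X^2 * (Q - Q^`()%R)) t = 0.
    by rewrite /polyexp ltNge (ltW t0).
  apply: near_eq_is_derive (is_derive_cst (0 : R) t 1).
  near=> s; rewrite /polyexp ifF //; apply/negbTE; rewrite -leNgt ltW //.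
  by near: s; exact: lt_nbhsl.
- have tn0 : t != 0 by rewrite gt_eqF.
  have dV : is_derive t 1 (fun s : R => s^-1) (- (t^-1) ^+ 2).
    apply: DeriveDef; first exact: derivableV.
    by rewrite deriveV // derive_id scaler1 exprVn.
  rewrite /polyexp t0.
  have dQ := @is_derive1_comp _ (horner Q) (fun s : R => s^-1) t _ _ (is_derive_poly Q t^-1) dV.
  have dE := @is_derive1_comp _ expR (fun s : R => - s^-1) t _ _ (is_derive_expR _) (is_deriveN dV).
  apply: is_derive_eq; first apply: near_eq_is_derive (is_deriveM dQ dE).
    by near=> s; rewrite /polyexp ifT //; near: s; exact: lt_nbhsr.
  rewrite /= !hornerE /=  /GRing.scale /=; ring.
- have [C HC] := polyexp_quad Q.
  have -> : polyexp ('X^2 * (Q - Q^`()%R)) 0 = 0 by rewrite /polyexp ltxx.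
  have L : h^-1 *: (polyexp Q (h *: 1 + 0) - polyexp Q 0) @[h --> 0^'] --> (0 : R).
    apply/cvgr0Pnorm_le => e e0; near=> h.
    have h0 : h != 0 by near: h; exact: nbhs_dnbhs_neq.
    have he : `|h| < e / (`|C| + 1).
      by near: h; apply: dnbhs0_lt; rewrite divr_gt0 // ltr_pwDr.
    rewrite {2}/polyexp ltxx subr0 addr0 /GRing.scale /= mulr1 normrM normfV.
    rewrite ler_pdivrMl ?normr_gt0 //; apply: le_trans (HC h) _.
    rewrite -(real_normK (num_real h)) expr2 mulrCA ler_wpM2l //.
    move: he; rewrite ltr_pdivlMr ?ltr_pwDr // => he.
    have := ler_norm C; have := normr_ge0 h; nra.
  apply: DeriveDef; first by apply/cvg_ex; exists 0.
  by apply/cvg_lim.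
Unshelve. all: by end_near.
Qed.

Fixpoint Cn (n : nat) f : Prop :=
  if n is n'.+1 then (forall t, derivable f t 1) /\ Cn n' (derive1 f) else True.

Lemma CnW n f : Cn n.+1 f -> Cn n f.
Proof. by elim: n f => [//|n IH] f [df /IH]. Qed.

Lemma CnD n f g : Cn n f -> Cn n g -> Cn n (fun t => f t + g t).
Proof.
elim: n f g => [//|n IH] f g [df cf] [dg cg]; split.
  by move=> t; exact: derivableD.
rewrite (_ : derive1 _ = fun t => derive1 f t + derive1 g t); first exact: IH.
by apply/funext => t; rewrite !derive1E deriveD.
Qed.

Lemma CnM n f g : Cn n f -> Cn n g -> Cn n (fun t => f t * g t).
Proof.
elim: n f g => [//|n IH] f g hf hg.
have [[df cf] [dg cg]] := (hf, hg); split.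
  by move=> t; exact: derivableM.
rewrite (_ : derive1 _ = fun t => f t * derive1 g t + g t * derive1 f t).
  by apply: CnD; apply: IH => //; exact: CnW.
by apply/funext => t; rewrite !derive1E deriveM.
Qed.

Lemma Cn_cst n a : Cn n (fun=> a).
Proof.
elim: n a => [//|n IH] a; split; first by move=> t; exact: derivable_cst.
rewrite (_ : derive1 _ = fun=> 0); first exact: IH.
by apply/funext => t; rewrite derive1E derive_cst.
Qed.

Lemma Cn_aff n f a b : Cn n f -> Cn n (fun t => f (a * t + b)).
Proof.
elim: n f => [//|n IH] f [df cf].
have D t : is_derive t 1 (fun t => f (a * t + b)) (derive1 f (a * t + b) * a).
  apply: (@is_derive1_comp _ f (fun t => a * t + b)).
    by rewrite derive1E; exact: derivableP.
  have H : is_derive t 1 (a \*: @id R + cst b) (a *: 1 + 0).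
    by typeclasses eauto.
  by apply: is_derive_eq H _; rewrite addr0 /GRing.scale /= mulr1.
split; first by move=> t; have [] := D t.
rewrite (_ : derive1 _ = fun t => derive1 f (a * t + b) * a).
  apply: CnM; first exact: IH.
  exact: Cn_cst.
by apply/funext => t; rewrite derive1E; have [] := D t.
Qed.

Lemma Cn_polyexp n Q : Cn n (polyexp Q).
Proof.
elim: n Q => [//|n IH] Q; split; first by move=> t; have [] := is_derive_polyexp Q t.
rewrite (_ : derive1 _ = polyexp ('X^2 * (Q - Q^`()%R))) //.
by apply/funext => t; rewrite derive1E; have [] := is_derive_polyexp Q t.
Qed.

Lemma Cn_derive1n n f t : Cn n.+1 f -> derivable (derive1n n f) t 1.
Proof.
elim: n f => [|n IH] f; first by case.
by case=> df cf; rewrite derive1Sn; exact: IH.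
Qed.

Definition smooth1 f := forall n t, derivable (derive1n n f) t 1.

Lemma smooth1_cont f n : smooth1 f -> continuous (derive1n n f).
Proof.
by move=> sf t; apply: differentiable_continuous; apply/derivable1_diffP.
Qed.

(* As [n] tends to infinity this increases to the indicator of ]a, b[. *)
Definition hump (n : nat) a b t : R :=
  polyexp 1 (n.+1%:R * (t - a)) * polyexp 1 (n.+1%:R * (b - t)).

Lemma hump_smooth n a b : smooth1 (hump n a b).
Proof.
move=> m t; apply: Cn_derive1n; apply: CnM.
  rewrite (_ : (fun t => _) = fun t => polyexp 1 (n.+1%:R * t + - (n.+1%:R * a))).
    by apply: Cn_aff; exact: Cn_polyexp.
  by apply/funext => s; congr polyexp; ring.
rewrite (_ : (fun t => _) = fun t => polyexp 1 (- n.+1%:R * t + (n.+1%:R * b))).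
  by apply: Cn_aff; exact: Cn_polyexp.
by apply/funext => s; congr polyexp; ring.
Qed.

Lemma hump_cont n a b : continuous (hump n a b).
Proof. by have := @smooth1_cont _ 0%N (@hump_smooth n a b); rewrite derive1n0. Qed.

Lemma polyexp1_itv t : 0 <= polyexp 1 t <= 1.
Proof.
rewrite /polyexp; case: ifPn => t0; last by rewrite lexx ler01.
rewrite hornerC mul1r expR_ge0 /= -expR0 ler_expR oppr_le0 invr_ge0 ltW //.
Qed.

Lemma hump_itv n a b t : 0 <= hump n a b t <= 1.
Proof.
have /andP[h1 h2] := polyexp1_itv (n.+1%:R * (t - a)).
have /andP[h3 h4] := polyexp1_itv (n.+1%:R * (b - t)).
by rewrite /hump mulr_ge0 //= mulr_ile1.
Qed.

Lemma hump_gt0 n a b t : (0 < hump n a b t) = (a < t < b).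
Proof.
have E s : 0 <= polyexp 1 s by have /andP[] := polyexp1_itv s.
have E0 s : (0 < polyexp 1 (n.+1%:R * s)) = (0 < s).
  rewrite /polyexp pmulr_rgt0 ?ltr0n //; case: ifP => h; last by rewrite ltxx.
  by rewrite hornerC mul1r expR_gt0.
rewrite /hump lt0r mulf_eq0 negb_or mulr_ge0 // andbT.
have := E0 (t - a); have := E0 (b - t); rewrite !lt0r !E !andbT => -> ->.
by rewrite -!lt0r !subr_gt0.
Qed.

Lemma hump_out n a b t : ~~ (a < t < b) -> hump n a b t = 0.
Proof.
rewrite -(hump_gt0 n) lt0r; have /andP[-> _] := hump_itv n a b t.
by rewrite andbT negbK => /eqP.
Qed.

Lemma hump_cvg a b t : a < t < b -> hump n a b t @[n --> \oo] --> (1 : R).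
Proof.
move=> /andP[at_ tb].
have L s : 0 < s -> polyexp 1 (n.+1%:R * s) @[n --> \oo] --> (1 : R).
  move=> s0; rewrite (_ : (fun n : nat => _) = fun n : nat => expR (- (s^-1 * harmonic n))).
    rewrite -[X in _ --> X]expR0; apply: continuous_cvg; first exact: continuous_expR.
    rewrite -oppr0 -(mulr0 s^-1); apply: cvgN; apply: cvgMr.
    exact: cvg_harmonic.
  apply/funext => n; rewrite /polyexp pmulr_rgt0 ?ltr0n // s0 hornerC mul1r.
  by congr (expR (- _)); rewrite /harmonic /= invfM mulrC.
rewrite -[X in _ --> X](mulr1 1); apply: cvgM; apply: L; by rewrite subr_gt0.
Qed.

End Smooth1.

(** * Restriction to lines, and products of one-variable functions *)

Section Lines.
Context {R : realType}.
Implicit Types (u v w phi : R * R -> R) (x y e : R * R) (i : 'I_2) (f g : R -> R).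

Lemma line_quotient u x e t :
  (fun h : R => h^-1 *: ((u \o shift (x + t *: e)) (h *: e) - u (x + t *: e))) =
  (fun h : R => h^-1 *: (((fun s : R => u (x + s *: e)) \o shift t) (h *: 1) -
     (fun s : R => u (x + s *: e)) t)).
Proof.
apply/funext => h /=; congr (_ *: (u _ - _)).
by rewrite /GRing.scale /= mulr1 addrCA -scalerDl.
Qed.

Lemma derivable_line u x e t :
  derivable u (x + t *: e) e <-> derivable (fun s : R => u (x + s *: e)) t 1.
Proof. by rewrite /derivable line_quotient. Qed.

Lemma derive_line u x e t :
  'D_e u (x + t *: e) = 'D_1 (fun s : R => u (x + s *: e)) t.
Proof. by rewrite /derive line_quotient. Qed.

Lemma derivable_line0 u x e :
  derivable u x e <-> derivable (fun s : R => u (x + s *: e)) 0 1.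
Proof. by rewrite -derivable_line scale0r addr0. Qed.

Lemma derive_line0 u x e : 'D_e u x = 'D_1 (fun s : R => u (x + s *: e)) 0.
Proof. by rewrite -derive_line scale0r addr0. Qed.

Lemma unitv_line x i t : x + t *: unitv i =
  (if i == 0 then (x.1 + t, x.2) else (x.1, x.2 + t)).
Proof.
by rewrite /unitv; case: ifP => _; case: x => a b;
  congr pair; rewrite /= /GRing.scale /= ?mulr1 ?mulr0 ?addr0.
Qed.

Definition tensor f g : R * R -> R := fun x => f x.1 * g x.2.

Lemma tensor_quotient f g x i :
  (fun h : R => h^-1 *: ((tensor f g \o shift x) (h *: unitv i) - tensor f g x)) =
  if i == 0 then
    (fun h : R => h^-1 *: (((g x.2 \*: f) \o shift x.1) (h *: 1) - (g x.2 \*: f) x.1))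
  else
    (fun h : R => h^-1 *: (((f x.1 \*: g) \o shift x.2) (h *: 1) - (f x.1 \*: g) x.2)).
Proof.
rewrite /unitv /tensor; case: ifP => _; apply/funext => h /=; congr (_ *: (_ - _)).
all: rewrite /GRing.scale /= ?mulr1 ?mulr0 ?add0r //; by rewrite mulrC.
Qed.

Lemma is_derive_tensor f g x i : (forall t, derivable f t 1) -> (forall t, derivable g t 1) ->
  is_derive x (unitv i) (tensor f g)
    (if i == 0 then tensor (derive1 f) g x else tensor f (derive1 g) x).
Proof.
move=> df dg.
have [D E] : derivable (tensor f g) x (unitv i) /\ 'D_(unitv i) (tensor f g) x =
  if i == 0 then tensor (derive1 f) g x else tensor f (derive1 g) x.
  rewrite /derivable /derive tensor_quotient; case: ifP => _; split.
  - exact: derivableZ.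
  - change ('D_1 (g x.2 \*: f) x.1 = tensor f^`()%classic g x).
    by rewrite deriveZ // /tensor derive1E mulrC.
  - exact: derivableZ.
  - change ('D_1 (f x.1 \*: g) x.2 = tensor f g^`()%classic x).
    by rewrite deriveZ // /tensor derive1E.
by rewrite -E; exact: DeriveDef.
Qed.

Lemma partials_tensor f g s : smooth1 f -> smooth1 g ->
  exists m n, partials s (tensor f g) = tensor (derive1n m f) (derive1n n g).
Proof.
move=> sf sg; elim: s => [|i s [m [n E]]]; first by exists 0%N, 0%N.
rewrite /= E /partial.
exists (if i == 0 then m.+1 else m), (if i == 0 then n else n.+1).
apply/funext => x.
have [_ ->] := is_derive_tensor x i (sf m) (sg n).
by case: ifP => _; rewrite derive1nS.
Qed.

Lemma tensor_cont f g : continuous f -> continuous g -> continuous (tensor f g).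
Proof.
move=> cf cg x; apply: cvgM.
  by apply: (@cvg_comp _ _ _ fst f _ (nbhs x.1)); [exact: cvg_fst | exact: cf].
by apply: (@cvg_comp _ _ _ snd g _ (nbhs x.2)); [exact: cvg_snd | exact: cg].
Qed.

Lemma Ck_tensor k A f g : smooth1 f -> smooth1 g -> Ck k A (tensor f g).
Proof.
move=> sf sg; split => s _.
  move=> i x _; have [m [n ->]] := partials_tensor s sf sg.
  by have [] := is_derive_tensor x i (sf m) (sg n).
have [m [n ->]] := partials_tensor s sf sg.
apply: continuous_subspaceT.
by apply: tensor_cont; exact: smooth1_cont.
Qed.

Lemma test_tensor A f g a b c d : smooth1 f -> smooth1 g ->
  (forall t, ~~ (a < t < b) -> f t = 0) -> (forall t, ~~ (c < t < d) -> g t = 0) ->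
  `[a, b] `*` `[c, d] `<=` A -> test_function A (tensor f g).
Proof.
move=> sf sg f0 g0 HA.
have cK : compact (`[a, b] `*` `[c, d] : set (R * R)).
  by apply: compact_setX; exact: segment_compact.
have sub : closure [set x | tensor f g x != 0] `<=` `[a, b] `*` `[c, d].
  rewrite [X in _ `<=` X](closure_id _).1; last by apply: compact_closed => //; exact: norm_hausdorff.
  apply: closure_subset => x; rewrite /= /tensor mulf_eq0 negb_or => /andP[h1 h2].
  split; rewrite /= in_itv /=.
    have /andP[u1 u2] : a < x.1 < b by apply: contraNT h1 => h; rewrite f0.
    by rewrite !ltW.
  have /andP[u1 u2] : c < x.2 < d by apply: contraNT h2 => h; rewrite g0.
  by rewrite !ltW.
split.
- by move=> k; exact: Ck_tensor.
- exact: subclosed_compact (@closed_closure _ _) cK sub.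
- exact: subset_trans HA.
Qed.

End Lines.

(** * Fundamental lemma of the calculus of variations *)

Section Fundamental.
Context {R : realType}.
Local Notation mu := (@lebesgue_measure R).
Local Notation T2 := (plane R).
Implicit Types (A : set (R * R)) (w : R * R -> R).

Lemma ae2S (P Q : T2 -> Prop) : (forall x, P x -> Q x) ->
  {ae leb2, forall x, P x} -> {ae leb2, forall x, Q x}.
Proof. by move=> PQ; apply: filterS. Qed.

Lemma ae2I (P Q S : T2 -> Prop) : (forall x, P x -> Q x -> S x) ->
  {ae leb2, forall x, P x} -> {ae leb2, forall x, Q x} -> {ae leb2, forall x, S x}.
Proof. by move=> PQ; apply: filterS2. Qed.

Lemma loc_integrable_measurable A w : open A -> loc_integrable A w ->
  mfun2 A w.
Proof.
move=> oA iw; have [a [b [c [d [h1 h2]]]]] := open_rect_cover oA.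
have -> : (A : set T2) = \bigcup_n (`[a n, b n] `*` `[c n, d n]).
  apply/seteqP; split; last by move=> x [n _]; exact: h1.
  move=> x /h2 [n _ [x1 x2]]; exists n => //.
  by split; exact: subset_itv_oo_cc.
apply/measurable_fun_bigcup => n; first exact: measurableX.
apply/measurable_EFinP; apply: (measurable_int leb2); apply: iw (h1 n).
by apply: compact_setX; exact: segment_compact.
Qed.

Section ZeroClass.
Context d (T : measurableType d) (m : {measure set T -> \bar R}) (D : set T) (f : T -> \bar R).
Hypothesis mD : measurable D.
Hypothesis fi : m.-integrable D f.

(** These sets form a Dynkin class, so that vanishing spreads from rectangles to all measurable sets
    and then gives [f = 0] almost everywhere on [D]. *)
Definition zero_on (S : set T) := (\int[m]_(x in S `&` D) f x = 0)%E.

Lemma zero_onD (S S' : set T) : measurable S -> measurable S' -> S `<=` S' ->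
  zero_on S -> zero_on S' -> zero_on (S' `\` S).
Proof.
rewrite /zero_on => mS mS' SS' S0 S'0.
have mfS : measurable_fun D f by exact: measurable_int fi.
have E : S' `&` D = (S `&` D) `|` ((S' `\` S) `&` D).
  apply/seteqP; split => x.
    by case=> xS' xD; have [xS|xS] := pselect (S x); [left|right].
  by case=> -[xS xD]; split => //; [exact: SS' | case: xS].
move: S'0; rewrite E integral_setU.
- by rewrite S0 add0e.
- exact: measurableI.
- by apply: measurableI => //; exact: measurableD.
- by rewrite -E; apply: measurable_funS mfS => //; exact: subIsetr.
- by apply/disj_setPS => x [[xS _] [[_ xS'] _]].
Qed.

Lemma zero_onU (F : (set T)^nat) : (forall n, measurable (F n)) -> trivIset setT F ->
  (forall n, zero_on (F n)) -> zero_on (\bigcup_n F n).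
Proof.
rewrite /zero_on => mF tF F0; rewrite setI_bigcupl integral_bigcup.
- by rewrite eseries0.
- by apply: trivIset_setIr.
- by move=> k; apply: measurableI.
- apply: (integrableS mD _ _ fi); last by move=> x [k _ []].
  by apply: bigcupT_measurable => n; exact: measurableI.
Qed.

End ZeroClass.

Lemma RGenOpens_setI : setI_closed (@RGenOpens.G R).
Proof.
move=> _ _ [a [b ->]] [c [d ->]]; exists (Num.max a c), (Num.min b d).
apply/seteqP; split => x; rewrite /= !in_itv /= gt_max lt_min.
  by case=> /andP[-> ->] /andP[-> ->].
by move=> /andP[/andP[-> ->] /andP[-> ->]].
Qed.

(** Dynkin's theorem is used three times: in the second factor, in the first factor, and for the
    measurable rectangles of the plane. As [D] lies in an open rectangle, a factor [setT] may be
    replaced by a bounded interval, which starts each induction on the line. *)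
Lemma zero_on_rects (D : set T2) (f : T2 -> \bar R) (p q r s : R) : measurable D ->
  D `<=` `]p, q[ `*` `]r, s[ ->
  leb2.-integrable D f ->
  (forall a b c d : R, zero_on leb2 D f (`]a, b[ `*` `]c, d[)) ->
  forall S, measurable S -> zero_on leb2 D f S.
Proof.
move=> mD DQ fi H.
have GT (P : set (measurableTypeR R) -> Prop) : P setT -> (forall a b, P `]a, b[%classic) ->
    (forall F : (set (measurableTypeR R))^nat, (forall n, measurable (F n)) ->
      (forall n, P (F n)) -> trivIset setT F -> P (\bigcup_n F n)) ->
    (forall S S', measurable S -> measurable S' -> S `<=` S' -> P S -> P S' -> P (S' `\` S)) ->
    forall S, measurable S -> P S.
  move=> PT P1 P2 P3.
  move=> S mS; have mS' : (@RGenOpens.G R).-sigma.-measurable S by rewrite -RGenOpens.measurableE.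
  have h1 : @RGenOpens.G R `<=` P by move=> _ [a [b ->]]; exact: P1.
  have h2 S' : measurable S' -> P S' -> P (~` S').
    by move=> mS'' PS; rewrite -setTD; apply: P3.
  have h3 (F : (set (measurableTypeR R))^nat) : (forall n, measurable (F n)) ->
    trivIset setT F -> (forall n, P (F n)) -> P (\bigcup_k F k).
    by move=> mF tF PF; exact: P2.
  exact: (@dynkin_induction _ (measurableTypeR R) (@RGenOpens.G R) P
    (@RGenOpens.measurableE R) RGenOpens_setI PT h1 h2 h3 S mS').
have H1 a b B : measurable B -> zero_on leb2 D f (`]a, b[ `*` B).
  move: B; apply: GT => [|c d| F mF F0 tF | S S' mS mS' SS' S0 S'0].
  - rewrite /zero_on (_ : _ `&` D = `]a, b[ `*` `]r, s[ `&` D); first exact: H.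
    apply/seteqP; split => x [[x1 x2] xD]; split => //; split => //.
    by have [] := DQ _ xD.
  - exact: H.
  - rewrite (_ : _ `*` _ = \bigcup_n (`]a, b[ `*` F n)).
      apply: zero_onU => //; first by move=> n; exact: measurableX.
      by move=> i j _ _ [[x y] [[/= _ h1] [/= _ h2]]]; apply: tF => //; exists y.
    by apply/seteqP; split => [[x y] [h1 [n _ h2]]|[x y] [n _ [h1 h2]]]; [exists n|split => //; exists n].
  - rewrite (_ : _ `*` _ = (`]a, b[ `*` S') `\` (`]a, b[ `*` S)).
      apply: zero_onD => //; try exact: measurableX.
      by move=> [x y] [h1 h2]; split => //; exact: SS'.
    apply/seteqP; split => [[x y] [/= h1 [h2 h3]]|[x y] [[/= h1 h2] h3]].
      by split => // -[].
    by split => //; split => // h4; apply: h3; split.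
have H2 (A B : set (measurableTypeR R)) : measurable A -> measurable B -> zero_on leb2 D f (A `*` B).
  move=> mA mB; move: A mA; apply: GT => [|c d| F mF F0 tF | S S' mS mS' SS' S0 S'0].
  - rewrite /zero_on (_ : _ `&` D = `]p, q[ `*` B `&` D); first exact: H1.
    apply/seteqP; split => x [[x1 x2] xD]; split => //; split => //.
    by have [] := DQ _ xD.
  - exact: H1.
  - rewrite (_ : _ `*` _ = \bigcup_n (F n `*` B)).
      apply: zero_onU => //; first by move=> n; exact: measurableX.
      by move=> i j _ _ [[x y] [[/= h1 _] [/= h2 _]]]; apply: tF => //; exists x.
    by apply/seteqP; split => [[x y] [[n _ h2] h1]|[x y] [n _ [h1 h2]]]; [exists n|split => //; exists n].
  - rewrite (_ : _ `*` _ = (S' `*` B) `\` (S `*` B)).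
      apply: zero_onD => //; try exact: measurableX.
      by move=> [x y] [h1 h2]; split => //; exact: SS'.
    apply/seteqP; split => [[x y] [[/= h1 h2] h3]|[x y] [[/= h1 h2] h3]].
      by split => // -[].
    by split => //; split => // h4; apply: h3; split.
have := @dynkin_induction _ T2 [set A `*` B | A in measurable & B in measurable] (zero_on leb2 D f).
move=> H3 S mS; apply: H3; last by rewrite -measurable_prod_measurableType.
- exact: measurable_prod_measurableType.
- move=> _ _ [A1 mA1 [B1 mB1 <-]] [A2 mA2 [B2 mB2 <-]]; rewrite -setXI.
  by exists (A1 `&` A2); [exact: measurableI|exists (B1 `&` B2) => //; exact: measurableI].
- by rewrite -setXTT; exact: H2.
- by move=> _ [A mA [B mB <-]]; exact: H2.
- move=> S' mS' S0; rewrite -setTD; apply: zero_onD => //.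
  by rewrite -setXTT; exact: H2.
- by move=> F mF tF F0; exact: zero_onU.
Qed.

Lemma compact_rect (a b c d : R) : compact (`[a, b] `*` `[c, d] : set (R * R)).
Proof. by apply: compact_setX; exact: segment_compact. Qed.

Lemma measurable_rect (i j : interval R) : measurable ([set` i] `*` [set` j] : set T2).
Proof. by apply: measurableX. Qed.

Lemma DCT2 (D : set T2) (f_ : nat -> T2 -> R) (f g : T2 -> R) : measurable D ->
  (forall n, measurable_fun D (f_ n)) -> measurable_fun D f ->
  {ae leb2, forall x, D x -> f_ n x @[n --> \oo] --> f x} ->
  leb2.-integrable D (EFin \o g) -> (forall n x, D x -> `|f_ n x| <= g x) ->
  leb2.-integrable D (EFin \o f) /\
  ((\int[leb2]_(x in D) (f_ n x)%:E)%E @[n --> \oo] --> (\int[leb2]_(x in D) (f x)%:E)%E).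
Proof.
move=> mD mf_ mf cf ig fg.
have [] := @dominated_convergence _ T2 _ leb2 D mD (fun n => EFin \o f_ n) (EFin \o f) (EFin \o g).
- by move=> n; apply/measurable_EFinP.
- by apply/measurable_EFinP.
- by apply: filterS cf => x H Dx; apply/fine_cvgP; split; [exact: nearW | exact: H].
- by [].
- by apply: aeW => x n Dx /=; rewrite lee_fin; exact: fg.
- by move=> ? _ ?.
Qed.

(** Products of humps are test functions that tend to the indicator of the intersection of the two
    open rectangles; [|w|] dominates. *)
Lemma rect_zero A w (a b c d a' b' c' d' : R) : `[a, b] `*` `[c, d] `<=` A ->
  loc_integrable A w ->
  (forall phi, test_function A phi -> \int[leb2]_(x in A) (w x * phi x) = 0) ->
  zero_on leb2 (`]a, b[ `*` `]c, d[ : set T2) (EFin \o w) (`]a', b'[ `*` `]c', d'[).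
Proof.
move=> QA iw w0; rewrite /zero_on.
set D := (X in _ `&` X); set S := (X in X `&` _).
have mD : meas2 D by exact: measurable_rect.
have mS : meas2 S by exact: measurable_rect.
have DQ : D `<=` `[a, b] `*` `[c, d].
  by move=> x [h1 h2]; split; exact: subset_itv_oo_cc.
have iD : leb2.-integrable D (EFin \o w).
  apply: (integrableS (measurable_rect _ _) mD DQ).
  by apply: iw => //; exact: compact_rect.
have mw : measurable_fun D w by apply/measurable_EFinP; exact: (measurable_int leb2).
pose a1 := Num.max a a'; pose b1 := Num.min b b'.
pose c1 := Num.max c c'; pose d1 := Num.min d d'.
pose phi n := tensor (hump n a1 b1) (hump n c1 d1).
have phit n : test_function A (phi n).
  apply: (@test_tensor _ _ _ _ a1 b1 c1 d1).
  - exact: hump_smooth.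
  - exact: hump_smooth.
  - exact: hump_out.
  - exact: hump_out.
  - apply: subset_trans QA => x [h1 h2]; split; [move: h1|move: h2];
    rewrite /= !in_itv /= ge_max le_min => /andP[/andP[-> _] /andP[-> _]] //.
have phiI n x : 0 <= phi n x <= 1.
  rewrite /phi /tensor; have /andP[h1 h2] := hump_itv n a1 b1 x.1.
  have /andP[h3 h4] := hump_itv n c1 d1 x.2.
  by rewrite mulr_ge0 //= mulr_ile1.
have phi0 n x : ~ (S `&` D) x -> phi n x = 0.
  rewrite /phi /tensor; have [h1|h1] := boolP (a1 < x.1 < b1); last by rewrite (hump_out _ h1) mul0r.
  have [h2|h2] := boolP (c1 < x.2 < d1); last by rewrite (hump_out _ h2) mulr0.
  case; move: h1 h2; rewrite !gt_max !lt_min => /andP[/andP[u1 u2] /andP[u3 u4]] /andP[/andP[u5 u6] /andP[u7 u8]].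
  by split; split; rewrite /= in_itv /=; apply/andP.
have phi1 x : (S `&` D) x -> phi n x @[n --> \oo] --> (1 : R).
  case=> -[/= s1 s2] [/= d_1 d_2]; rewrite /phi /tensor -[X in _ --> X](mulr1 1).
  move: s1 s2 d_1 d_2; rewrite !in_itv /= => /andP[u1 u2] /andP[u3 u4] /andP[u5 u6] /andP[u7 u8].
  by apply: cvgM; apply: hump_cvg; rewrite gt_max lt_min; apply/andP; split; apply/andP.
have mphi n : measurable_fun D (phi n : T2 -> R).
  apply: (@measurable_funS _ _ _ _ setT) => //.
  apply: open_continuous_measurable2; first exact: openT.
  by move=> x _; move: x; apply: tensor_cont; exact: hump_cont.
have Dw n : (\int[leb2]_(x in D) (EFin \o (w \* phi n)%R) x = 0)%E.
  have iwp : leb2.-integrable D (EFin \o (w \* phi n)).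
    apply: le_integrable iD => //.
      by apply/measurable_EFinP; exact: (measurable_funM mw (mphi n)).
    move=> x _ /=; rewrite lee_fin normrM ler_piMr //.
    by have /andP[p0 p1] := phiI n x; rewrite ger0_norm.
  have E : (\int[leb2]_(x in A) (EFin \o (w \* phi n)%R) x =
            \int[leb2]_(x in D) (EFin \o (w \* phi n)%R) x)%E.
    rewrite integral_mkcond [RHS]integral_mkcond; apply: eq_integral => x _.
    rewrite /patch; case: ifPn => xA; case: ifPn => xD //=.
      by rewrite phi0 ?mulr0 // => -[_ /mem_set]; rewrite (negbTE xD).
    by case/negP: xA; apply/mem_set/QA/DQ/set_mem.
  have := w0 _ (phit n); rewrite /Rintegral E => F0.
  have fi := integrable_fin_num mD iwp.
  by rewrite -(fineK fi) F0.
rewrite integral_mkcondl.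
have [] := @DCT2 D (fun n => w \* phi n) (w \_ S) (fun x => `|w x|) mD.
- by move=> n; exact: (measurable_funM mw (mphi n)).
- by apply/(measurable_restrict w mS mD); exact: (measurable_funS mD (@subIsetl _ _ _) mw).
- apply: aeW => x Dx; rewrite /patch; case: ifPn => xS.
    rewrite -[X in _ --> X]mulr1; apply: cvgM; first exact: cvg_cst.
    by apply: phi1; split => //; exact: set_mem.
  rewrite (_ : (fun n => _) = fun=> 0); first exact: cvg_cst.
  apply/funext => n /=; rewrite phi0 ?mulr0 // => -[/mem_set]; by rewrite (negbTE xS).
- exact: integrable_norm.
- move=> n x Dx /=; rewrite normrM ler_piMr //.
  by have /andP[p0 p1] := phiI n x; rewrite ger0_norm.
move=> _ L.
have L0 : ((\int[leb2]_(x in D) ((w \* phi n) x)%:E)%E @[n --> \oo] --> (0 : \bar R)%E).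
  by rewrite (_ : (fun n => _) = fun=> 0%E); [exact: cvg_cst|apply/funext => n; exact: Dw].
have -> : ((EFin \o w) \_ S = EFin \o (w \_ S))%E.
  by apply/funext => x; rewrite /patch /=; case: ifP.
by have /cvg_unique := L => /(_ (@ereal_hausdorff _) _ L0).
Qed.

(** Countably many rectangles cover [A], and on each of them [w] has integral zero over every
    measurable subset. *)
Lemma fundamental A w : open A -> loc_integrable A w ->
  (forall phi, test_function A phi -> \int[leb2]_(x in A) (w x * phi x) = 0) ->
  {ae leb2, forall x, A x -> w x = 0}.
Proof.
move=> oA iw w0; have [a [b [c [d [h1 h2]]]]] := open_rect_cover oA.
have H n : {ae leb2, forall x, (`]a n, b n[ `*` `]c n, d n[) x -> w x = 0}.
  set D := (X in forall x, X x -> _).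
  have mD : meas2 D by exact: measurable_rect.
  have DQ : D `<=` `[a n, b n] `*` `[c n, d n].
    by move=> x [k1 k2]; split; exact: subset_itv_oo_cc.
  have iD : leb2.-integrable D (EFin \o w).
    apply: (integrableS (measurable_rect _ _) mD DQ).
    by apply: iw (h1 n); exact: compact_rect.
  have : ae_eq leb2 D (EFin \o w) (cst 0%E).
    apply: integral_ae_eq => // E ED mE.
    rewrite (_ : \int[leb2]_(x in E) (cst 0 x) = 0)%E; last exact: integral0.
    have := @zero_on_rects D (EFin \o w) (a n) (b n) (c n) (d n) mD (@subset_refl _ _) iD _ E mE.
    rewrite /zero_on (setIidl ED); apply => a' b' c' d'.
    by apply: rect_zero => //; exact: h1.
  by apply: ae2S => x H Dx; have := H Dx => -[].
have : {ae leb2, forall x, forall n, (`]a n, b n[ `*` `]c n, d n[) x -> w x = 0}.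
  exact/ae_foralln.
apply: ae2S => x Hx /h2[n _ xn]; exact: Hx xn.
Qed.

Lemma compact_measurable2 (K : set (R * R)) : compact K -> meas2 K.
Proof. by move=> cK; apply: closed_measurable2; exact: (compact_closed (@norm_hausdorff _ _) cK). Qed.

Lemma continuous_measurable2 (f : R * R -> R) (D : set T2) : continuous f -> measurable_fun D (f : T2 -> R).
Proof.
move=> cf; apply: (@measurable_funS _ _ _ _ setT) => //.
by apply: open_continuous_measurable2; [exact: openT|move=> x _; exact: cf].
Qed.

Lemma compact_bound (K : set (R * R)) (f : R * R -> R) : compact K ->
  {within K, continuous f} -> exists M : R, 0 <= M /\ forall x, K x -> `|f x| <= M.
Proof.
move=> cK cf; have : compact (f @` K) by exact: continuous_compact.
move/compact_bounded => [M [_ H]]; exists (`|M| + 1); split; first by rewrite addr_ge0.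
move=> x Kx; apply: (H (`|M| + 1)); last by exists x.
by have := ler_norm M; lra.
Qed.

Lemma integrable_cut A (K : set (R * R)) v phi : open A -> loc_integrable A v ->
  continuous phi -> compact K -> K `<=` A -> (forall x, ~ K x -> phi x = 0) ->
  leb2.-integrable A (EFin \o (v \* phi)).
Proof.
move=> oA iv cphi cK KA phi0.
have mA : meas2 A := open_measurable2 oA.
have mK : meas2 K := compact_measurable2 cK.
have [M [M0 HM]] := compact_bound cK (continuous_subspaceT cphi).
have iK : leb2.-integrable K (EFin \o (v \* phi)).
  have iv' := iv K cK KA.
  apply: (@le_integrable _ _ _ _ _ mK _ (EFin \o (fun x => M * v x))).
  - apply/measurable_EFinP/measurable_funM; last exact: continuous_measurable2.
    by apply/measurable_EFinP; exact: measurable_int iv'.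
  - move=> x Kx /=; rewrite lee_fin !normrM mulrC ler_wpM2r // (ger0_norm M0).
    exact: HM.
  - exact: (integrableZl mK M iv').
move: iK; rewrite (integrable_mkcond _ mK) (integrable_mkcond _ mA).
apply: eq_integrable => // x _; rewrite /patch; case: ifPn => xK; case: ifPn => xA //=.
  by case/negP: xA; apply/mem_set/KA/set_mem.
by rewrite phi0 ?mulr0 // => /mem_set; rewrite (negbTE xK).
Qed.

Lemma partials_rcons s i (f : R * R -> R) : partials s (partial i f) = partials (rcons s i) f.
Proof. by elim: s => //= j s ->. Qed.

Lemma test_cont A phi : test_function A phi -> continuous phi.
Proof. by case=> CK _ _; have [_ /(_ [::] isT)] := CK 0%N; move=> h; exact/continuous_subspace_setT. Qed.

Lemma test_out (phi : R * R -> R) x : ~ closure [set x | phi x != 0] x -> phi x = 0.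
Proof.
by move=> h; apply/eqP; apply: contra_notT h => h; exact: subset_closure.
Qed.

Lemma derive_out (phi : R * R -> R) (B : set (R * R)) x e : open B -> B x ->
  (forall y, B y -> phi y = 0) -> 'D_e phi x = 0.
Proof.
move=> oB Bx phi0.
rewrite (@near_eq_derive _ _ _ phi (cst 0)) ?derive_cst //.
have : \near x, B x by exact: open_nbhs_nbhs.
by apply: filterS => y /phi0.
Qed.

Lemma test_partial A phi i : test_function A phi -> test_function A (partial i phi).
Proof.
case=> CK cS SA.
have sub : closure [set x | partial i phi x != 0] `<=` closure [set x | phi x != 0].
  rewrite [X in _ `<=` X](closure_id _).1; last exact: closed_closure.
  apply: closure_subset => x /= h; apply: contrapT => nx; case/eqP: h.
  apply: (@derive_out _ (~` closure [set x | phi x != 0])) => //.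
    by apply: closed_openC; exact: closed_closure.
  by move=> y; exact: test_out.
split.
- move=> k; have [C1 C2] := CK k.+1; split => s sk.
    by move=> j x _; rewrite partials_rcons; apply: C1 => //; rewrite size_rcons.
  by rewrite partials_rcons; apply: C2; rewrite size_rcons.
- exact: subclosed_compact (@closed_closure _ _) cS sub.
- exact: subset_trans SA.
Qed.

Lemma integrable_test A v phi : open A -> loc_integrable A v -> test_function A phi ->
  leb2.-integrable A (EFin \o (v \* phi)).
Proof.
move=> oA iv tp; have [_ cS SA] := tp.
apply: (integrable_cut oA iv (test_cont tp) cS SA) => x; exact: test_out.
Qed.

Lemma weak_partial_unique A i u w w' : open A ->
  weak_partial A i u w -> weak_partial A i u w' -> {ae leb2, forall x, A x -> w x = w' x}.
Proof.
move=> oA [iu iw hw] [_ iw' hw'].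
have mA := open_measurable2 oA.
suff : {ae leb2, forall x, A x -> (w \- w') x = 0}.
  by apply: ae2S => x H /H /eqP; rewrite subr_eq0 => /eqP.
apply: fundamental => //.
  move=> K cK KA; have mK := compact_measurable2 cK.
  by have := integrableB mK (iw K cK KA) (iw' K cK KA); apply: eq_integrable.
move=> phi tphi.
have := hw' _ tphi; rewrite (hw _ tphi) => /eqP; rewrite eqr_opp => /eqP E.
transitivity (\int[leb2]_(x in A) ((w \* phi) x - (w' \* phi) x)).
  by apply: eq_Rintegral => x _; rewrite /= mulrBl.
rewrite RintegralB //; try exact: integrable_test.
by rewrite /= E subrr.
Qed.

End Fundamental.

(** * Weak and classical derivatives *)

Section WeakPartial.
Context {R : realType}.
Local Notation mu := (@lebesgue_measure R).
Local Notation T2 := (plane R).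
Implicit Types (A K : set (R * R)) (u w phi : R * R -> R) (i : 'I_2).

Lemma lip1 (f : R -> R) (a b L : R) : a <= b ->
  (forall s, a <= s <= b -> derivable f s 1) ->
  (forall s, a <= s <= b -> `|'D_1 f s| <= L) -> `|f b - f a| <= L * (b - a).
Proof.
move=> ab df bf.
have [||c] := MVT_segment ab (f := f) (df := fun s => 'D_1 f s).
- move=> s; rewrite in_itv /= => /andP[h1 h2]; apply: derivableP; apply: df.
  by rewrite !ltW.
- apply: derivable_within_continuous => s; rewrite in_itv /=; exact: df.
- rewrite in_itv /= => cab ->; rewrite normrM (ger0_norm (_ : 0 <= b - a)) ?subr_ge0 //.
  by rewrite ler_wpM2r ?subr_ge0 //; exact: bf.
Qed.

Lemma line_lip u x e (t L : R) :
  (forall s, `|s| <= `|t| -> derivable u (x + s *: e) e) ->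
  (forall s, `|s| <= `|t| -> `|'D_e u (x + s *: e)| <= L) ->
  `|u (x + t *: e) - u x| <= L * `|t|.
Proof.
move=> du bu.
pose f s := u (x + s *: e).
have df s : `|s| <= `|t| -> derivable f s 1 by move=> /du /derivable_line.
have bf s : `|s| <= `|t| -> `|'D_1 f s| <= L.
  by move=> h; rewrite /f -derive_line; exact: bu.
have -> : u x = f 0 by rewrite /f scale0r addr0.
have [t0|t0] := leP 0 t.
  rewrite (ger0_norm t0) -[X in _ * X]subr0; apply: lip1 => // s /andP[h1 h2];
  [apply: df|apply: bf]; by rewrite !ger0_norm.
rewrite distrC (ltr0_norm t0) -[X in _ * X]sub0r; apply: lip1; rewrite ?(ltW t0) // => s /andP[h1 h2];
[apply: df|apply: bf]; rewrite (ltr0_norm t0) ler0_norm ?lerN2 //.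
Qed.

Lemma compact_ball_sub A K : open A -> compact K -> K `<=` A ->
  exists2 r : R, 0 < r & forall x, K x -> ball x r `<=` A.
Proof.
move=> oA /compact_near_coveringP cK KA.
have : \forall r \near (0 : R)^'+, K `<=` (fun x => ball x r `<=` A).
  apply: cK => x Kx.
  have /nbhs_ballP[e /= e0 eA] := oA _ (KA _ Kx).
  exists (ball x (e / 2), [set r : R | 0 < r < e / 2]) => /=.
    split; first by apply: nbhsx_ballx; rewrite divr_gt0.
    near=> r; apply/andP; split; near: r.
      exact: nbhs_right_gt.
    by apply: nbhs_right_lt; rewrite divr_gt0.
  move=> [y r] /= [xy /andP[r0 re]] z yz; apply: eA.
  rewrite (splitr e); apply: ball_triangle xy _.
  by apply: le_ball yz; exact: ltW.
move=> H; have : \forall r \near (0 : R)^'+, 0 < r by exact: nbhs_right_gt.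
move=> H'; have [r [r0 rA]] := filter_ex (filterI H' H).
by exists r.
Unshelve. all: by end_near.
Qed.

(** Contains the support of every difference quotient, in the direction [e] and with step at most
    [r], of a function supported in [K]. *)
Definition thick K e (r : R) : set (R * R) :=
  [set x + t *: e | x in K & t in `[- r, r]%classic].

Lemma thick_compact K e r : compact K -> compact (thick K e r).
Proof.
move=> cK.
have -> : thick K e r = (fun z : (R * R) * R => z.1 + z.2 *: e) @` (K `*` `[- r, r]).
  apply/seteqP; split => x.
    by move=> [y Ky [t tr <-]]; exists (y, t).
  by move=> [[y t] [/= Ky tr] <-]; exists y => //; exists t.
apply: continuous_compact; last by apply: compact_setX => //; exact: segment_compact.
apply: continuous_subspaceT => z; apply: cvgD; first exact: cvg_fst.
by apply: cvgZr_tmp; exact: cvg_snd.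
Qed.

Lemma sub_thick K e r : 0 <= r -> K `<=` thick K e r.
Proof.
move=> r0 x Kx; exists x => //; exists 0; rewrite ?scale0r ?addr0 //=.
by rewrite in_itv /= r0 oppr_le0 r0.
Qed.

Lemma measurable_trans (h : R * R) : measurable_fun setT (fun x : T2 => (x + h : R * R) : T2).
Proof.
have := @measurable_aff2 R h (1, 0) (0, 1); apply: eq_measurable_fun => x _.
by rewrite /aff2 /= !mulr0 !mulr1 !addr0 (addrC x); case: h => a b; congr pair; rewrite /= ?addr0.
Qed.

Lemma integral_trans (h : R * R) (F : T2 -> R) : measurable_fun setT F ->
  (\int[leb2]_x (F (x + h))%:E = \int[leb2]_x (F x)%:E)%E.
Proof.
move=> mF.
have P (G : T2 -> \bar R) : measurable_fun setT G -> (forall x, 0 <= G x)%E ->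
    (\int[leb2]_x (G (x + h)%R) = \int[leb2]_x (G x))%E.
  move=> mG G0; have := @affine_integral2 R h (1, 0) (0, 1) G.
  have -> : ((1, 0).1 * (0, 1).2 - (1, 0).2 * (0, 1).1 : R) = 1.
    by rewrite /= mulr1 mul0r subr0.
  rewrite normr1 invr1 mul1e oner_eq0 => /(_ isT mG G0) <-.
  apply: eq_integral => x _; congr G.
  by rewrite /aff2 /= !mulr0 !mulr1 !addr0 (addrC x); case: h => a b; congr pair; rewrite /= ?addr0.
rewrite integralE [RHS]integralE; congr (_ - _)%E.
  transitivity (\int[leb2]_x ((EFin \o F)^\+ (x + h)%R))%E; first by apply: eq_integral => x _; rewrite ?funeposE ?funenegE.
  apply: P; last by move=> x; exact: funepos_ge0.
  by apply: measurable_funepos; exact/measurable_EFinP.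
transitivity (\int[leb2]_x ((EFin \o F)^\- (x + h)%R))%E; first by apply: eq_integral => x _; rewrite ?funeposE ?funenegE.
apply: P; last by move=> x; exact: funeneg_ge0.
by apply: measurable_funeneg; exact/measurable_EFinP.
Qed.

Lemma ler_divS (r : R) n : 0 < r -> r / n.+1%:R <= r.
Proof. by move=> r0; rewrite ler_pdivrMr // ler_peMr ?(ltW r0) // ler1n. Qed.

Lemma compact_leb2_fin K : compact K -> (leb2 (K : set T2) < +oo)%E.
Proof.
move=> cK; have [M HM] := bounded_leb2 (compact_bounded cK).
apply: (@le_lt_trans _ _ (leb2 [set x : T2 | `|x.1| <= M /\ `|x.2| <= M])).
  apply: le_measure; rewrite ?inE; first exact: compact_measurable2.
    rewrite (_ : [set _ | _] = `[- M, M] `*` `[- M, M]); first exact: measurableX.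
    by apply/seteqP; split => -[x y] /=; rewrite !in_itv /= !ler_norml.
  by move=> x /HM.
by rewrite leb2_square ltry.
Qed.

Lemma integrable_bnd K (M : R) (f : T2 -> R) : compact K -> measurable_fun setT f ->
  (forall x, K x -> `|f x| <= M) -> (forall x, ~ K x -> f x = 0) ->
  leb2.-integrable setT (EFin \o f).
Proof.
move=> cK mf fM f0.
have mK := compact_measurable2 cK.
have : leb2.-integrable (K : set T2) (EFin \o f).
  apply: measurable_bounded_integrable => //; first exact: compact_leb2_fin.
    exact: (measurable_funS measurableT _ mf).
  exists M; split; [exact: num_real|] => y My x Kx; apply: le_trans (fM _ Kx) _; exact: ltW.
rewrite (integrable_mkcond _ mK); apply: eq_integrable => // x _.
rewrite /patch; case: ifPn => // /negP xK /=; rewrite f0 // => /mem_set //.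
Qed.

(** The sign of [c] is free: forward quotients serve the test function, backward ones the function
    whose weak derivative is sought. *)
Lemma derive_seq u x e l (c : R) : c != 0 -> is_derive x e u l ->
  (c / n.+1%:R)^-1 * (u (x + (c / n.+1%:R) *: e) - u x) @[n --> \oo] --> l.
Proof.
move=> c0 [du <-].
have := du => /cvgr_dnbhsP /(_ (fun n : nat => c / n.+1%:R)) H.
have H2 : (fun n : nat => (c / n.+1%:R)^-1 *: ((u \o shift x) ((c / n.+1%:R) *: e) - u x)) @ \oo --> 'D_e u x.
  apply: H; split; first by move=> n; rewrite mulf_neq0 // invr_neq0 // pnatr_eq0.
  by rewrite -(mulr0 c); apply: cvgMr; exact: cvg_harmonic.
by apply: cvg_trans H2; apply: near_eq_cvg; apply: nearW => n /=; rewrite (addrC _ x).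
Qed.

Section LipWeak.
Variables (A : set (R * R)) (i : 'I_2) (u w : R * R -> R).
Local Notation e := (unitv i : R * R).
Hypothesis oA : open A.
Hypothesis mu_ : mfun2 A u.
Hypothesis mw : mfun2 A w.
Hypothesis ubnd : forall K, compact K -> K `<=` A -> exists M : R, forall x, K x -> `|u x| <= M.
Hypothesis ulip : forall K, compact K -> K `<=` A -> exists r L : R, 0 < r /\
  forall x t, K x -> `|t| <= r -> A (x + t *: e) /\ `|u (x + t *: e) - u x| <= L * `|t|.
Hypothesis uder : {ae leb2, forall x, A x -> is_derive x e u (w x)}.

Lemma lip_w_bound K : compact K -> K `<=` A ->
  exists L : R, 0 <= L /\ {ae leb2, forall x, K x -> `|w x| <= L}.
Proof.
move=> cK KA; have [r [L [r0 H]]] := ulip cK KA.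
exists `|L|; split => //; apply: ae2S uder => x Hx Kx.
have := derive_seq (lt0r_neq0 r0) (Hx (KA _ Kx)) => C.
have C2 := cvg_norm C.
apply: (ler_cvg_to (C2 _) (@cvg_cst _ `|L| _ \oo _)).
apply: nearW => n /=.
have t0 : 0 < r / n.+1%:R by rewrite divr_gt0.
have tr : `|r / n.+1%:R| <= r.
  by rewrite (ger0_norm (ltW t0)) ler_divS.
have [_] := H _ _ Kx tr; rewrite (ger0_norm (ltW t0)) => h.
rewrite normrM normfV (ger0_norm (ltW t0)) ler_pdivrMl // [leRHS]mulrC.
by apply: (le_trans h); rewrite ler_wpM2r ?(ltW t0) // ler_norm.
Qed.

Lemma lip_u_loc : loc_integrable A u.
Proof.
move=> K cK KA; have [M HM] := ubnd cK KA.
apply: measurable_bounded_integrable; first exact: compact_measurable2.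
- exact: compact_leb2_fin.
- exact: (measurable_funS (open_measurable2 oA) KA).
- exists M; split; [exact: num_real|] => y My x Kx.
  by apply: le_trans (HM _ Kx) _; exact: ltW.
Qed.

Lemma lip_w_loc : loc_integrable A w.
Proof.
move=> K cK KA; have [L [L0 HL]] := lip_w_bound cK KA.
have mK := compact_measurable2 cK.
have mwK : mfun2 K w by exact: (measurable_funS (open_measurable2 oA) KA).
apply/integrableP; split; first exact/measurable_EFinP.
apply: (@le_lt_trans _ _ (\int[leb2]_(x in K) (cst L%:E) x)%E).
  apply: ae_ge0_le_integral => //.
  - by apply: measurableT_comp => //; exact/measurable_EFinP.
rewrite integral_cst //; apply: lte_mul_pinfty => //; exact: compact_leb2_fin.
Qed.

(** Discrete integration by parts: a translation moves the difference quotient from [phi] to [u],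
    and the local Lipschitz bound along [e] dominates the passage to the limit. Functions of class
    [C^1], finite element functions and extensions by zero are all instances. *)
Lemma lip_weak_partial : weak_partial A i u w.
Proof.
split; [exact: lip_u_loc|exact: lip_w_loc|] => phi tphi.
have [CK cS SA] := tphi; set K := closure _ in cS SA.
have [r [L [r0 Hr]]] := ulip cS SA.
pose K1 := thick K e r.
have cK1 : compact K1 by exact: thick_compact.
have K1A : K1 `<=` A.
  move=> _ [x Kx [t tr <-]]; have [] // := Hr x t Kx.
  by move: tr; rewrite /= in_itv /= ler_norml.
have KK1 : K `<=` K1 by apply: sub_thick; exact: ltW.
have [M HM] := ubnd cK1 K1A.
have cphi := test_cont tphi.
have tdphi := test_partial i tphi.
have [P [P0 HP]] := compact_bound cS (continuous_subspaceT cphi).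
have phi0 x : ~ K x -> phi x = 0 by exact: test_out.
have HPT x : `|phi x| <= P.
  by have [/HP //|/phi0 ->] := pselect (K x); rewrite normr0.
have [Q [Q0 HQ]] := compact_bound cS (continuous_subspaceT (test_cont tdphi)).
have dphi x : derivable phi x e by have [+ _] := CK 1%N => /(_ [::] isT i x I).
have dphi0 x : ~ K x -> partial i phi x = 0.
  move=> nx; apply: (@derive_out _ _ (~` K)) => //.
  by apply: closed_openC; exact: closed_closure.
have HQT x : `|partial i phi x| <= Q.
  by have [/HQ //|/dphi0 ->] := pselect (K x); rewrite normr0.
have Lphi x t : `|phi (x + t *: e) - phi x| <= Q * `|t|.
  by apply: line_lip => s _; [exact: dphi|exact: HQT].
pose U := (u : T2 -> R) \_ (A : set T2).
pose W := (w : T2 -> R) \_ (A : set T2).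
have mA : meas2 A := open_measurable2 oA.
have mU : measurable_fun setT U by apply/(measurable_restrictT _ mA).
have mW : measurable_fun setT W by apply/(measurable_restrictT _ mA).
have UE x : A x -> U x = u x by move=> Ax; rewrite /U patchE mem_set.
have WE x : A x -> W x = w x by move=> Ax; rewrite /W patchE mem_set.
pose t_ (n : nat) : R := r / n.+1%:R.
have t0 n : 0 < t_ n by rewrite /t_ divr_gt0.
have tr n : t_ n <= r.
  exact: ler_divS.
have K1t x t : `|t| <= r -> K (x + t *: e) -> K1 x.
  move=> tr' Kxt; exists (x + t *: e) => //; exists (- t).
    by rewrite /= in_itv /= -ler_norml normrN.
  by rewrite scaleNr addrK.
have mphi : measurable_fun setT (phi : T2 -> R) by exact: continuous_measurable2.
have mdphi : measurable_fun setT (partial i phi : T2 -> R).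
  by apply: continuous_measurable2; exact: test_cont tdphi.
have mtr h (f : T2 -> R) : measurable_fun setT f -> measurable_fun setT (fun x : T2 => f (x + h)).
  by move=> mf; exact: (measurableT_comp mf (measurable_trans h)).
(* [a_] carries the forward quotient of [phi], [b_] minus the backward quotient of [U]. Their
   integrals agree by translation, and both are dominated by a constant on the compact set [K1]. *)
pose a_ n x := U x * ((t_ n)^-1 * (phi (x + t_ n *: e) - phi x)).
pose b_ n x := - ((- t_ n)^-1 * (U (x + (- t_ n) *: e) - U x)) * phi x.
have ma n : measurable_fun setT (a_ n).
  apply: measurable_funM => //; apply: measurable_funM => //.
  by apply: measurable_funB => //; exact: mtr.
have mb n : measurable_fun setT (b_ n).
  apply: measurable_funM => //; apply: measurableT_comp => //; apply: measurable_funM => //.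
  by apply: measurable_funB => //; exact: mtr.
pose gg C (x : T2) : R := C * \1_K1 x.
have igg C : leb2.-integrable setT (EFin \o gg C).
  apply: (@integrable_bnd K1 `|C|) => //.
  - by apply: measurable_funM => //; apply: measurable_indic; exact: compact_measurable2.
  - by move=> x K1x; rewrite /gg indicE mem_set // mulr1.
  - by move=> x K1x; rewrite /gg indicE memNset // mulr0.
have Nzero n x : ~ K1 x -> phi (x + t_ n *: e) = 0.
  move=> nx; apply: phi0 => Kx; apply: nx; apply: K1t Kx.
  by rewrite ger0_norm ?tr // ltW.
have phi1 x : ~ K1 x -> phi x = 0 by move=> nx; apply: phi0 => /KK1.
have UM x : K1 x -> `|U x| <= `|M|.
  by move=> Kx; rewrite (UE _ (K1A _ Kx)); apply: le_trans (HM _ Kx) (ler_norm _).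
have ggE C x : K1 x -> gg C x = C by move=> Kx; rewrite /gg indicE mem_set // mulr1.
have gg0 C x : ~ K1 x -> gg C x = 0 by move=> Kx; rewrite /gg indicE memNset // mulr0.
have La : (\int[leb2]_x (a_ n x)%:E)%E @[n --> \oo] --> (\int[leb2]_x (U x * partial i phi x)%:E)%E.
  have H := @DCT2 _ setT a_ (fun x => U x * partial i phi x) (gg (`|M| * Q)).
  apply: (proj2 (H _ _ _ _ _ _)) => //.
  - exact: measurable_funM.
  - apply: aeW => x _; apply: cvgM; first exact: cvg_cst.
    apply: derive_seq; first exact: lt0r_neq0.
    exact: derivableP.
  - move=> n x _; have [Kx|Kx] := pselect (K1 x); last first.
      by rewrite gg0 // /a_ Nzero // phi1 // subr0 !mulr0 normr0.
    rewrite ggE // /a_ normrM ler_pM //; first exact: UM.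
    rewrite normrM normfV ler_pdivrMl ?normr_gt0 ?lt0r_neq0 // [leRHS]mulrC.
    exact: Lphi.
have Lb : (\int[leb2]_x (b_ n x)%:E)%E @[n --> \oo] --> (\int[leb2]_x (-1 * (W x * phi x))%:E)%E.
  have H := @DCT2 _ setT b_ (fun x => -1 * (W x * phi x)) (gg (`|L| * P)).
  apply: (proj2 (H _ _ _ _ _ _)) => //.
  - by apply: measurable_funM => //; exact: measurable_funM.
  - apply: ae2S uder => x Hx _; have [Kx|Kx] := pselect (K x); last first.
      rewrite phi0 // !mulr0 (_ : (fun n => _) = fun=> 0); first exact: cvg_cst.
      by apply/funext => n; rewrite /b_ phi0 // mulr0.
    rewrite mulrA mulN1r; apply: cvgM; last exact: cvg_cst.
    apply: cvgN; rewrite WE; last exact: SA.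
    have r1 : - r != 0 by rewrite oppr_eq0 lt0r_neq0.
    have := derive_seq r1 (Hx (SA _ Kx)); apply: cvg_trans; apply: near_eq_cvg; apply: nearW => n /=.
    have tn : `|- t_ n| <= r by rewrite normrN ger0_norm ?tr // ltW.
    have [Hn _] := Hr x (- t_ n) Kx tn.
    rewrite UE // ?UE //; last exact: SA.
    by rewrite /t_ mulNr.
  - move=> n x _; have [Kx|Kx] := pselect (K x); last first.
      rewrite /b_ phi0 // mulr0 normr0; have [K1x|K1x] := pselect (K1 x); first by rewrite ggE // mulr_ge0.
      by rewrite gg0.
    have tn : `|- t_ n| <= r by rewrite normrN ger0_norm ?tr // ltW.
    have [Hn Hb] := Hr x (- t_ n) Kx tn.
    rewrite ggE; last exact: KK1.
    rewrite /b_ normrM ler_pM //.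
    rewrite normrN normrM normfV ler_pdivrMl ?normr_gt0 ?oppr_eq0 ?lt0r_neq0 // [leRHS]mulrC.
    rewrite UE // UE; last exact: SA.
    by apply: le_trans Hb _; rewrite ler_wpM2r // ler_norm.
have AB n : (\int[leb2]_x (a_ n x)%:E = \int[leb2]_x (b_ n x)%:E)%E.
  pose F x := (t_ n)^-1 * U x * phi (x + t_ n *: e).
  pose G x := (t_ n)^-1 * U x * phi x.
  have mF : measurable_fun setT F by apply: measurable_funM => //; [exact: measurable_funM|exact: mtr].
  have mG : measurable_fun setT G by apply: measurable_funM => //; exact: measurable_funM.
  have ti : 0 <= (t_ n)^-1 by rewrite invr_ge0 ltW.
  have bnd x y : K1 x -> `|(t_ n)^-1 * U x * y| <= (t_ n)^-1 * `|M| * `|y|.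
    move=> Kx; rewrite !normrM (ger0_norm ti).
    by rewrite ler_wpM2r // ler_wpM2l // UM.
  have bnd2 x y : K1 x -> `|y| <= P -> `|(t_ n)^-1 * U x * y| <= (t_ n)^-1 * `|M| * P.
    move=> Kx yP; apply: le_trans (bnd _ _ Kx) _.
    by rewrite ler_wpM2l // mulr_ge0.
  have iF : leb2.-integrable setT (EFin \o F).
    apply: (@integrable_bnd K1 ((t_ n)^-1 * `|M| * P)) => // x Kx; first exact: bnd2.
    by rewrite /F Nzero // mulr0.
  have iG : leb2.-integrable setT (EFin \o G).
    apply: (@integrable_bnd K1 ((t_ n)^-1 * `|M| * P)) => // x Kx; first exact: bnd2.
    by rewrite /G phi1 // mulr0.
  have iF' : leb2.-integrable setT (EFin \o (fun x => F (x + (- t_ n) *: e))).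
    apply: (@integrable_bnd K ((t_ n)^-1 * `|M| * P)) => // [|x Kx|x Kx].
    - exact: mtr.
    - apply: bnd2; last exact: HPT.
      exists x => //; exists (- t_ n) => //.
      by rewrite /= in_itv /= lerNl opprK tr /= (le_trans (_ : _ <= 0)) ?oppr_le0 ?ltW.
    - by rewrite /F -addrA -scalerDl addNr scale0r addr0 phi0 // mulr0.
  transitivity (\int[leb2]_x (F x)%:E - \int[leb2]_x (G x)%:E)%E.
    rewrite -integralB_EFin //; apply: eq_integral => x _; rewrite -EFinB; congr (_%:E).
    by rewrite /a_ /F /G; ring.
  rewrite -(integral_trans ((- t_ n) *: e) mF) -integralB_EFin //.
  apply: eq_integral => x _; rewrite -EFinB; congr (_%:E).
  rewrite /b_ /F /G -addrA -scalerDl addNr scale0r addr0 invrN; ring.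
have /(cvg_unique (@ereal_hausdorff _) La) E : (\int[leb2]_x (a_ n x)%:E)%E @[n --> \oo] --> (\int[leb2]_x (-1 * (W x * phi x))%:E)%E.
  by rewrite (_ : (fun n => _) = fun n => (\int[leb2]_x (b_ n x)%:E)%E) //; apply/funext => n; exact: AB.
have iWphi : leb2.-integrable A (EFin \o (w \* phi)).
  exact: (integrable_test oA lip_w_loc tphi).
rewrite -mulN1r -RintegralZl //.
rewrite /Rintegral integral_mkcond [in RHS]integral_mkcond.
congr fine; transitivity (\int[leb2]_x (U x * partial i phi x)%:E)%E.
  apply: eq_integral => x _; rewrite /U !patchE; case: ifPn => // _.
  by rewrite mul0r.
rewrite E; apply: eq_integral => x _; rewrite /W !patchE; case: ifPn => // _.
by rewrite mul0r mulr0.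
Qed.

End LipWeak.

End WeakPartial.

Section Classical.
Context {R : realType}.
Local Notation T2 := (plane R).
Implicit Types (A K : set (R * R)) (u w phi : R * R -> R) (i : 'I_2).

Lemma near_line A K i : open A -> compact K -> K `<=` A ->
  exists2 r : R, 0 < r & forall x t, K x -> `|t| <= r -> A (x + t *: uv i).
Proof.
move=> oA cK KA; have [r r0 H] := compact_ball_sub oA cK KA.
exists (r / 2); first by rewrite divr_gt0.
move=> x t Kx tr; apply: (H x Kx); rewrite unitv_line.
have tr' : `|t| < r by apply: le_lt_trans tr _; rewrite ltr_pdivrMr // ltr_pMr // ltr1n.
by case: ifP => _; apply: ball2; rewrite /= ?subrr ?normr0 // opprD addrA subrr sub0r normrN.
Qed.

Lemma Ck1_weak_partial A i u : open A -> Ck 1 A u -> weak_partial A i u (partial i u).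
Proof.
move=> oA [C1 C2].
have mA := open_measurable2 oA.
have cu : {within A, continuous u} := C2 [::] isT.
have cd : {within A, continuous (partial i u)} := C2 [:: i] isT.
apply: lip_weak_partial => //.
- exact: within_continuous_measurable2.
- exact: within_continuous_measurable2.
- move=> K cK KA; have [M [_ HM]] := compact_bound cK (continuous_subspaceW KA cu).
  by exists M.
- move=> K cK KA; have [r r0 Hr] := near_line i oA cK KA.
  pose K1 := thick K (unitv i) r.
  have cK1 : compact K1 by exact: thick_compact.
  have K1A : K1 `<=` A.
    by move=> _ [x Kx [t tr <-]]; apply: Hr => //; move: tr; rewrite /= in_itv /= ler_norml.
  have [L [L0 HL]] := compact_bound cK1 (continuous_subspaceW K1A cd).
  exists r, L; split => // x t Kx tr; split; first exact: Hr.
  have K1s s : `|s| <= `|t| -> K1 (x + s *: unitv i).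
    move=> st; exists x => //; exists s => //.
    by rewrite /= in_itv /= -ler_norml (le_trans st).
  apply: line_lip => s st; first by apply: (C1 [::]) => //; exact/K1A/K1s.
  exact/HL/K1s.
- apply: aeW => x Ax; apply: derivableP; exact: (C1 [::]).
Qed.

End Classical.

(** * Lipschitz bounds across finitely many closed sets *)

Section SegmentCover.
Context {R : realType}.

Lemma closed_list (T : topologicalType) (Fs : seq (set T)) :
  (forall F, List.In F Fs -> closed F) -> closed [set x | exists2 F, List.In F Fs & F x].
Proof.
elim: Fs => [|F Fs IH] H.
  by rewrite (_ : [set x | _] = set0); [exact: closed0|apply/seteqP; split => x // [F []]].
rewrite (_ : [set x | _] = F `|` [set x | exists2 F, List.In F Fs & F x]).
  by apply: closedU; [apply: H; left|apply: IH => G GF; apply: H; right].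
apply/seteqP; split => x.
  by case=> G [<-|GF] Gx; [left|right; exists G].
by case=> [Fx|[G GF Gx]]; [exists F => //; left|exists G => //; right].
Qed.

Lemma closed_sup_mem (S : set R) : closed S -> S !=set0 -> has_ubound S -> S (sup S).
Proof.
move=> cS S0 uS; apply: cS => B /nbhs_ballP[e /= e0 eB].
have [x Sx xe] := sup_adherent e0 (conj S0 uS).
exists x; split => //; apply: eB; rewrite /ball /= ger0_norm.
  by rewrite ltrBlDr -ltrBlDl.
by rewrite subr_ge0; exact: ub_le_sup.
Qed.

Lemma closed_inf_mem (S : set R) : closed S -> S !=set0 -> has_lbound S -> S (inf S).
Proof.
move=> cS S0 lS; apply: cS => B /nbhs_ballP[e /= e0 eB].
have [x Sx xe] := inf_adherent e0 (conj S0 lS).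
exists x; split => //; apply: eB; rewrite /ball /= distrC ger0_norm.
  by rewrite ltrBlDl.
by rewrite subr_ge0; exact: ge_inf.
Qed.

(* Remove one closed set [F]: between the first and the last point of [F] the
   bound is the hypothesis, and the two remaining pieces are covered by the
   other sets, whose union is closed. *)
Lemma seg_lip (L : R) (f : R -> R) (Fs : seq (set R)) (a b : R) : a <= b ->
  (forall F, List.In F Fs -> closed F) ->
  (forall x, a <= x <= b -> exists2 F, List.In F Fs & F x) ->
  (forall F x y, List.In F Fs -> a <= x <= b -> a <= y <= b -> F x -> F y ->
     `|f x - f y| <= L * `|x - y|) ->
  `|f b - f a| <= L * (b - a).
Proof.
elim: Fs a b => [|F Fs IH] a b ab cF cov lip.
  by have [|F []] := cov a; rewrite ?lexx.
have cFs G : List.In G Fs -> closed G by move=> GF; apply: cF; right.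
have cU := closed_list cFs; set U := [set x | _] in cU.
have [[c0 [c0ab Fc0]]|nF] := pselect (exists c, a <= c <= b /\ F c); last first.
  apply: IH => //.
    by move=> x xab; have [G [<-|GF] Gx] := cov x xab; [case: nF; exists x|exists G].
  by move=> G x y GF; apply: lip; right.
pose S := [set c | a <= c <= b /\ F c].
have cS : closed S.
  rewrite (_ : S = `[a, b]%classic `&` F); last by apply/seteqP; split => x; rewrite /= in_itv.
  by apply: closedI; [exact: interval_closed|apply: cF; left].
have S0 : S !=set0 by exists c0.
have ubS : has_ubound S by exists b => x [/andP[]].
have lbS : has_lbound S by exists a => x [/andP[]].
have [/andP[at_ tb] Ft] : S (sup S) by exact: closed_sup_mem.
have [/andP[as_ sb] Fs_] : S (inf S) by exact: closed_inf_mem.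
set t := sup S in at_ tb Ft; set s := inf S in as_ sb Fs_.
have st : s <= t by apply: ge_inf => //; split => //; apply/andP.
have E1 : `|f s - f a| <= L * (s - a).
  have [sa|sa] := eqVneq s a; first by rewrite sa !subrr normr0 mulr0.
  have as' : a < s by rewrite lt_neqAle eq_sym sa.
  apply: IH => //; last first.
    move=> G x y GF /andP[h1 h2] /andP[h3 h4]; apply: lip; first by right.
      by rewrite h1 (le_trans h2).
    by rewrite h3 (le_trans h4).
  have Uo x : a <= x -> x < s -> U x.
    move=> ax xs; have [|G [GE|GF] Gx] := cov x; last by exists G.
      by rewrite ax (le_trans (ltW xs)).
    have : s <= x by apply: ge_inf => //; split; rewrite ?GE // ax (le_trans (ltW xs)).
    by rewrite leNgt xs.
  move=> x /andP[ax]; rewrite le_eqVlt => /orP[/eqP ->|xs]; last exact: Uo.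
  apply: cU => B /nbhs_ballP[e /= e0 eB].
  exists (Num.max a (s - e / 2)); split.
    apply: Uo; rewrite ?le_max ?lexx // gt_max as' /=.
    by rewrite ltrBlDr ltrDl divr_gt0.
  apply: eB; rewrite /ball /= ger0_norm.
    by rewrite ltrBlDr -ltrBlDl lt_max; apply/orP; right; rewrite ltrD2l ltrN2 ltr_pdivrMr // ltr_pMr // ltr1n.
  by rewrite subr_ge0 ge_max (ltW as') /= lerBlDr lerDl ltW // divr_gt0.
have E2 : `|f b - f t| <= L * (b - t).
  have [sa|sa] := eqVneq b t; first by rewrite sa !subrr normr0 mulr0.
  have tb' : t < b by rewrite lt_neqAle eq_sym sa.
  apply: IH => //; last first.
    move=> G x y GF /andP[h1 h2] /andP[h3 h4]; apply: lip; first by right.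
      by rewrite h2 (le_trans at_).
    by rewrite h4 (le_trans at_).
  have Uo x : t < x -> x <= b -> U x.
    move=> tx xb; have [|G [GE|GF] Gx] := cov x; last by exists G.
      by rewrite xb (le_trans _ (ltW tx)).
    have : x <= t by apply: ub_le_sup => //; split; rewrite ?GE // xb (le_trans _ (ltW tx)).
    by rewrite leNgt tx.
  move=> x /andP[]; rewrite le_eqVlt => /orP[/eqP <-|tx xb] => [xb|]; last exact: Uo.
  apply: cU => B /nbhs_ballP[e /= e0 eB].
  exists (Num.min b (t + e / 2)); split.
    apply: Uo; rewrite ?ge_min ?lexx // lt_min tb' /=.
    by rewrite ltrDl divr_gt0.
  apply: eB; rewrite /ball /= distrC ger0_norm.
    by rewrite ltrBlDl gt_min; apply/orP; right; rewrite ltrD2l ltr_pdivrMr // ltr_pMr // ltr1n.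
  by rewrite subr_ge0 le_min (ltW tb') /= lerDl ltW // divr_gt0.
have E3 : `|f t - f s| <= L * (t - s).
  rewrite -(ger0_norm (_ : 0 <= t - s)) ?subr_ge0 //.
  by apply: (lip F) => //; [left|apply/andP|apply/andP].
have -> : f b - f a = (f b - f t) + (f t - f s) + (f s - f a) by ring.
rewrite (le_trans (ler_normD _ _)) //.
have -> : L * (b - a) = (L * (b - t) + L * (t - s)) + L * (s - a) by ring.
rewrite lerD // (le_trans (ler_normD _ _)) // lerD //.
Qed.

(** Lets a Lipschitz bound along a line be checked piece by piece, for instance on the closed
    triangles and on the complement of the polygon, in whatever order the line meets them. *)
Lemma line_lip_cover (Cs : seq (set (R * R))) (f : R * R -> R) (x e : R * R) (t L : R) :
  (forall C, List.In C Cs -> closed C) ->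
  (forall s, `|s| <= `|t| -> exists2 C, List.In C Cs & C (x + s *: e)) ->
  (forall C y s, List.In C Cs -> C y -> C (y + s *: e) -> `|f (y + s *: e) - f y| <= L * `|s|) ->
  `|f (x + t *: e) - f x| <= L * `|t|.
Proof.
move=> cC cov lip.
pose ph s := x + s *: e.
have cph : continuous ph.
  by move=> s; apply: cvgD; [exact: cvg_cst|apply: cvgZr_tmp; exact: cvg_id].
pose Fs := List.map (fun C => ph @^-1` C) Cs.
have cFs F : List.In F Fs -> closed F.
  by move=> /List.in_map_iff[C [<- CC]]; apply: preimage_closed => //; exact: cC.
have covF s : `|s| <= `|t| -> exists2 F, List.In F Fs & F s.
  move=> /cov [C CC Cs_]; exists (ph @^-1` C) => //; exact: List.in_map.
have lipF F s s' : List.In F Fs -> F s -> F s' -> `|f (ph s) - f (ph s')| <= L * `|s - s'|.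
  move=> /List.in_map_iff[C [<- CC]] h1 h2.
  have := lip C (ph s') (s - s') CC h2; rewrite /ph -addrA -scalerDl subrKC; exact.
have x0 : f x = (f \o ph) 0 by rewrite /= /ph scale0r addr0.
rewrite x0 (_ : f (x + t *: e) = (f \o ph) t) //.
have [t0|t0] := leP 0 t.
  rewrite (ger0_norm t0) -[X in _ * X]subr0; apply: (seg_lip t0 cFs) => [s /andP[h1 h2]|F s s' FF _ _].
    by apply: covF; rewrite !ger0_norm.
  exact: lipF.
rewrite distrC (ltr0_norm t0) -[X in _ * X]sub0r; apply: (seg_lip (ltW t0) cFs) => [s /andP[h1 h2]|F s s' FF _ _].
  by apply: covF; rewrite ler0_norm // ltr0_norm // lerN2.
exact: lipF.
Qed.

End SegmentCover.

(** * Triangles and meshes *)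

Section Euclid.
Context {R : realType}.
Implicit Types (v w x y a b : R * R) (c : R).

Lemma dot_ge0 v : 0 <= dot v v.
Proof. by rewrite /dot -!expr2 addr_ge0 // sqr_ge0. Qed.

Lemma enorm_ge0 v : 0 <= enorm v.
Proof. exact: sqrtr_ge0. Qed.

Lemma enorm_sqr v : enorm v ^+ 2 = v.1 ^+ 2 + v.2 ^+ 2.
Proof. by rewrite /enorm sqr_sqrtr ?dot_ge0 // /dot -!expr2. Qed.

Lemma enorm0 : enorm (0 : R * R) = 0.
Proof. by rewrite /enorm /dot /= mul0r addr0 sqrtr0. Qed.

Lemma enorm_eq0 v : enorm v = 0 -> v = 0.
Proof.
move=> e; have := enorm_sqr v; rewrite e expr0n /= => /esym/eqP.
rewrite paddr_eq0 ?sqr_ge0 // !sqrf_eq0 => /andP[/eqP h1 /eqP h2].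
by case: v h1 h2 {e} => ? ? /= -> ->.
Qed.

Lemma enormZ c v : enorm (c *: v) = `|c| * enorm v.
Proof.
rewrite /enorm (_ : dot _ _ = c ^+ 2 * dot v v).
  by rewrite sqrtrM ?sqr_ge0 // sqrtr_sqr.
by rewrite /dot /= /GRing.scale /=; ring.
Qed.

Lemma enormN v : enorm (- v) = enorm v.
Proof. by rewrite -scaleN1r enormZ normrN1 mul1r. Qed.

Lemma enormB x y : enorm (x - y) = enorm (y - x).
Proof. by rewrite -enormN opprB. Qed.

Lemma ler_sqr_ge0 c d : 0 <= d -> c ^+ 2 <= d ^+ 2 -> c <= d.
Proof.
move=> d0; rewrite -(real_normK (num_real c)) => h.
by apply: le_trans (ler_norm c) _; rewrite -(@ler_pXn2r _ 2).
Qed.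

Lemma dot_le v w : `|dot v w| <= enorm v * enorm w.
Proof.
apply: ler_sqr_ge0; first by rewrite mulr_ge0 // enorm_ge0.
rewrite real_normK ?num_real // exprMn !enorm_sqr /dot.
rewrite -subr_ge0 (_ : _ - _ = (v.1 * w.2 - v.2 * w.1) ^+ 2) ?sqr_ge0 //; ring.
Qed.

Lemma cross_le v w : `|v.1 * w.2 - v.2 * w.1| <= enorm v * enorm w.
Proof.
have := dot_le v (w.2, - w.1); rewrite /dot /= mulrN.
suff -> : enorm (w.2, - w.1) = enorm w by [].
by rewrite /enorm /dot /=; congr Num.sqrt; ring.
Qed.

Lemma enormD v w : enorm (v + w) <= enorm v + enorm w.
Proof.
apply: ler_sqr_ge0; first by rewrite addr_ge0 // enorm_ge0.
rewrite sqrrD !enorm_sqr /=.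
have := dot_le v w; have := ler_norm (dot v w); rewrite /dot => h1 h2.
have h := le_trans h1 h2.
rewrite -subr_ge0 (_ : _ - _ = 2 * (enorm v * enorm w - (v.1 * w.1 + v.2 * w.2))); last by ring.
by rewrite mulr_ge0 // subr_ge0.
Qed.

Lemma enormD2 v w : enorm v <= enorm (v - w) + enorm w.
Proof. by rewrite -{1}(subrK w v) enormD. Qed.

Lemma coord1_le v : `|v.1| <= enorm v.
Proof. by apply: ler_sqr_ge0; rewrite ?enorm_ge0 // real_normK ?num_real // enorm_sqr lerDl sqr_ge0. Qed.

Lemma coord2_le v : `|v.2| <= enorm v.
Proof. by apply: ler_sqr_ge0; rewrite ?enorm_ge0 // real_normK ?num_real // enorm_sqr lerDr sqr_ge0. Qed.

Lemma coord_le (i : 'I_2) v : `|coord i v| <= enorm v.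
Proof. by rewrite /coord; case: ifP => _; [exact: coord1_le|exact: coord2_le]. Qed.

Lemma enorm_le v : enorm v <= `|v.1| + `|v.2|.
Proof.
apply: ler_sqr_ge0; first by rewrite addr_ge0.
rewrite enorm_sqr sqrrD !real_normK ?num_real // lerD2r lerDl.
by rewrite mulrn_wge0 // mulr_ge0.
Qed.

Lemma enorm_ball x y e : enorm (x - y) < e -> ball x e y.
Proof.
by move=> h; apply: ball2; apply: le_lt_trans h; [exact: (coord1_le (x - y))|exact: (coord2_le (x - y))].
Qed.

End Euclid.

Section Triangle.
Context {R : realType}.
Implicit Types (k : @triangle R) (x y : R * R).

Definition sd1 k : R * R := k 1 - k 0.
Definition sd2 k : R * R := k 2%:R - k 0.
(** Twice the signed area. By Cramer's rule, [br1] and [br2] below are the barycentric coordinates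
    belonging to [k 1] and [k 2]. *)
Definition dt k : R := (sd1 k).1 * (sd2 k).2 - (sd1 k).2 * (sd2 k).1.
Definition br1 k x : R := ((x.1 - (k 0).1) * (sd2 k).2 - (x.2 - (k 0).2) * (sd2 k).1) / dt k.
Definition br2 k x : R := ((sd1 k).1 * (x.2 - (k 0).2) - (sd1 k).2 * (x.1 - (k 0).1)) / dt k.
Definition closedt k : set (R * R) := [set x | [/\ 0 <= br1 k x, 0 <= br2 k x & br1 k x + br2 k x <= 1]].

Lemma I3_cases (i : 'I_3) : [\/ i = 0, i = 1 | i = 2%:R].
Proof.
case: i => -[|[|[|//]]] h; [constructor 1|constructor 2|constructor 3]; exact: val_inj.
Qed.

Lemma I3_sum (V : nmodType) (f : 'I_3 -> V) : \sum_i f i = f 0 + f 1 + f 2%:R.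
Proof.
rewrite !big_ord_recr big_ord0 /= add0r; congr (f _ + f _ + f _); exact: val_inj.
Qed.

Lemma brK k x : dt k != 0 -> aff2 (k 0) (sd1 k) (sd2 k) (br1 k x, br2 k x) = x.
Proof.
move=> d0; rewrite /aff2 /= /br1 /br2; case: x => x y /=.
set di := (dt k)^-1; congr pair.
  rewrite (_ : _ + _ + _ = (k 0).1 + (x - (k 0).1) * dt k * di); first by rewrite mulfK //; ring.
  by rewrite /dt /=; ring.
rewrite (_ : _ + _ + _ = (k 0).2 + (y - (k 0).2) * dt k * di); first by rewrite mulfK //; ring.
by rewrite /dt /=; ring.
Qed.

Lemma aff_ring1 (a1 a2 b1 b2 k1 k2 s t : R) :
  (k1 + s * a1 + t * b1 - k1) * b2 - (k2 + s * a2 + t * b2 - k2) * b1 = s * (a1 * b2 - a2 * b1).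
Proof. ring. Qed.

Lemma aff_ring2 (a1 a2 b1 b2 k1 k2 s t : R) :
  a1 * (k2 + s * a2 + t * b2 - k2) - a2 * (k1 + s * a1 + t * b1 - k1) = t * (a1 * b2 - a2 * b1).
Proof. ring. Qed.

Lemma affK1 k (s t : R) : dt k != 0 -> br1 k (aff2 (k 0) (sd1 k) (sd2 k) (s, t)) = s.
Proof. by move=> d0; apply: (canLR (mulfK d0)); exact: aff_ring1. Qed.

Lemma affK2 k (s t : R) : dt k != 0 -> br2 k (aff2 (k 0) (sd1 k) (sd2 k) (s, t)) = t.
Proof. by move=> d0; apply: (canLR (mulfK d0)); exact: aff_ring2. Qed.

Lemma br1_aff k x y (s t : R) : s + t = 1 -> br1 k (s *: x + t *: y) = s * br1 k x + t * br1 k y.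
Proof. move=> st; rewrite (_ : s = 1 - t); last by rewrite -st addrK.
rewrite /br1 /= /GRing.scale /=; ring. Qed.

Lemma br2_aff k x y (s t : R) : s + t = 1 -> br2 k (s *: x + t *: y) = s * br2 k x + t * br2 k y.
Proof. move=> st; rewrite (_ : s = 1 - t); last by rewrite -st addrK.
rewrite /br2 /= /GRing.scale /=; ring. Qed.

Lemma combE k x (c : 'I_3 -> R) : \sum_i c i = 1 -> x = \sum_i c i *: k i ->
  x = aff2 (k 0) (sd1 k) (sd2 k) (c 1, c 2%:R).
Proof.
rewrite !I3_sum => c1 ->; have -> : c 0 = 1 - c 1 - c 2%:R by rewrite -c1; ring.
by rewrite /aff2 /sd1 /sd2 /=; congr pair; rewrite /= /GRing.scale /=; ring.
Qed.

Lemma br_comb k x : dt k != 0 ->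
  x = (1 - br1 k x - br2 k x) *: k 0 + br1 k x *: k 1 + br2 k x *: k 2%:R.
Proof.
move=> d0; rewrite -{1}(brK x d0) /aff2 /sd1 /sd2 /=.
by congr pair; rewrite /= /GRing.scale /=; ring.
Qed.

Lemma opentE k : dt k != 0 ->
  opent k = [set x | [/\ 0 < br1 k x, 0 < br2 k x & br1 k x + br2 k x < 1]].
Proof.
move=> d0; apply/seteqP; split => x.
  case=> c [c0 c1 cx]; rewrite /= (combE c1 cx) affK1 // affK2 //; split => //.
  by move: c1 (c0 0); rewrite I3_sum; lra.
case=> h1 h2 h3.
exists (fun i => if i == 0 then 1 - br1 k x - br2 k x else if i == 1 then br1 k x else br2 k x).
split.
- by move=> i; have [-> /=|-> /=|-> /=] := I3_cases i => //; lra.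
- by rewrite I3_sum /=; ring.
- by rewrite I3_sum /= -br_comb.
Qed.

Lemma br1_cont k : continuous (br1 k).
Proof.
move=> x; apply: cvgMl; apply: cvgB; apply: cvgMl; apply: cvgB; try exact: cvg_cst.
  exact: cvg_fst.
exact: cvg_snd.
Qed.

Lemma br2_cont k : continuous (br2 k).
Proof.
move=> x; apply: cvgMl; apply: cvgB; apply: cvgMr; apply: cvgB; try exact: cvg_cst.
  exact: cvg_snd.
exact: cvg_fst.
Qed.

Lemma opent_open k : dt k != 0 -> open (opent k).
Proof.
move=> d0; rewrite opentE //.
rewrite (_ : [set x | _] = (br1 k @^-1` [set t | 0 < t]) `&` ((br2 k @^-1` [set t | 0 < t]) `&`
   ((br1 k \+ br2 k) @^-1` [set t | t < 1]))).
  apply: openI; first by apply: open_comp; [move=> x _; exact: br1_cont|exact: open_gt].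
  apply: openI; first by apply: open_comp; [move=> x _; exact: br2_cont|exact: open_gt].
  apply: open_comp; last exact: open_lt.
  by move=> x _; apply: cvgD; [exact: br1_cont|exact: br2_cont].
by apply/seteqP; split => x; [case=> ? ? ?|case=> ? [? ?]].
Qed.

Lemma preimage_closedT (f : R * R -> R) (D : set R) : closed D -> continuous f -> closed (f @^-1` D).
Proof. by move=> cD cf; apply: preimage_closed => // x _; exact: cf. Qed.

Lemma closedt_closed k : closed (closedt k).
Proof.
rewrite (_ : closedt k = (br1 k @^-1` [set t | 0 <= t]) `&` ((br2 k @^-1` [set t | 0 <= t]) `&`
   ((br1 k \+ br2 k) @^-1` [set t | t <= 1]))).
  apply: closedI; first by apply: preimage_closedT; [exact: closed_ge|exact: br1_cont].
  apply: closedI; first by apply: preimage_closedT; [exact: closed_ge|exact: br2_cont].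
  apply: preimage_closedT; first exact: closed_le.
  by move=> x; apply: cvgD; [exact: br1_cont|exact: br2_cont].
by apply/seteqP; split => x; [case=> ? ? ?|case=> ? [? ?]].
Qed.

Lemma opent_sub k : dt k != 0 -> opent k `<=` closedt k.
Proof. by move=> d0; rewrite opentE // => x [h1 h2 h3]; split; rewrite ltW. Qed.

Lemma br1_vertex k : dt k != 0 -> [/\ br1 k (k 0) = 0, br1 k (k 1) = 1 & br1 k (k 2%:R) = 0].
Proof.
by move=> d0; split; rewrite /br1; apply: (canLR (mulfK d0)); rewrite /dt /sd1 /sd2 /=; ring.
Qed.

Lemma br2_vertex k : dt k != 0 -> [/\ br2 k (k 0) = 0, br2 k (k 1) = 0 & br2 k (k 2%:R) = 1].
Proof.
by move=> d0; split; rewrite /br2; apply: (canLR (mulfK d0)); rewrite /dt /sd1 /sd2 /=; ring.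
Qed.

Lemma vertex_closedt k i : dt k != 0 -> closedt k (k i).
Proof.
move=> d0; have [h1 h2 h3] := br1_vertex d0; have [h4 h5 h6] := br2_vertex d0.
by have [->|->|->] := I3_cases i; split; rewrite ?h1 ?h2 ?h3 ?h4 ?h5 ?h6; lra.
Qed.

Definition centroid k : R * R := aff2 (k 0) (sd1 k) (sd2 k) (3^-1, 3^-1).

Lemma shrink_opent k x (e : R) : dt k != 0 -> closedt k x -> 0 < e -> e <= 1 ->
  opent k ((1 - e) *: x + e *: centroid k).
Proof.
move=> d0 [h1 h2 h3] e0 e1; rewrite opentE //=.
have E : 1 - e + e = 1 :> R by ring.
rewrite (br1_aff _ _ _ E) (br2_aff _ _ _ E) /centroid affK1 // affK2 //; split; nra.
Qed.

(** A small contraction towards the centroid brings any point of the closed triangle into the open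
    one. *)
Lemma closure_opent k : dt k != 0 -> closure (opent k) = closedt k.
Proof.
move=> d0; apply/seteqP; split.
  rewrite [X in _ `<=` X](closure_id _).1; last exact: closedt_closed.
  by apply: closure_subset; exact: opent_sub.
move=> x cx B /nbhs_ballP[r /= r0 rB].
pose M := enorm (x - centroid k).
have M0 : 0 <= M := enorm_ge0 _.
pose e := Num.min 1 (r / (M + 1) / 2).
have r1 : 0 < r / (M + 1) / 2 by rewrite divr_gt0 // divr_gt0 // ltr_pwDr.
have e0 : 0 < e by rewrite lt_min ltr01.
have e1 : e <= 1 by rewrite ge_min lexx.
exists ((1 - e) *: x + e *: centroid k); split; first exact: shrink_opent.
apply/rB/enorm_ball.
rewrite (_ : x - _ = e *: (x - centroid k)); last first.
  by apply: injective_projections; rewrite /= /GRing.scale /=; ring.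
rewrite enormZ (ger0_norm (ltW e0)).
have e2 : e <= r / (M + 1) / 2 by rewrite ge_min lexx orbT.
apply: (@le_lt_trans _ _ (r / (M + 1) / 2 * (M + 1))).
  by apply: ler_pM; rewrite ?(ltW e0) // ?enorm_ge0 // lerDl.
rewrite (_ : _ * _ = r / 2); last by field; rewrite gt_eqF // ltr_pwDr.
by rewrite ltr_pdivrMr // ltr_pMr // ltr1n.
Qed.

Lemma closedt_bounded k x y : dt k != 0 -> closedt k x -> closedt k y ->
  enorm (x - y) <= enorm (sd1 k) + enorm (sd2 k).
Proof.
move=> d0 [h1 h2 h3] [h4 h5 h6].
have -> : x - y = (br1 k x - br1 k y) *: sd1 k + (br2 k x - br2 k y) *: sd2 k.
  rewrite -{1}(brK x d0) -{1}(brK y d0) /aff2 /=.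
  by congr pair; rewrite /= /GRing.scale /=; ring.
rewrite (le_trans (enormD _ _)) // !enormZ lerD // ler_piMl ?enorm_ge0 // ler_norml.
  by apply/andP; split; lra.
by apply/andP; split; lra.
Qed.

Lemma diam_ub (A : set (R * R)) (M : R) x y : (forall x y, A x -> A y -> enorm (x - y) <= M) ->
  A x -> A y -> enorm (x - y) <= diam A.
Proof.
move=> AM Ax Ay; apply: ub_le_sup; last by exists x => //; exists y.
by exists M => _ [a Aa [b Ab <-]]; exact: AM.
Qed.

(** Contracting both points towards the centroid gives two points of the open triangle at distance
    [(1 - e) |x - y|]. If the claim failed, the [e] chosen below would put this distance halfway
    between the diameter and [|x - y|]. *)
Lemma diam_opent k x y : dt k != 0 -> closedt k x -> closedt k y -> enorm (x - y) <= diam (opent k).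
Proof.
move=> d0 cx cy.
have H e : 0 < e -> e <= 1 -> (1 - e) * enorm (x - y) <= diam (opent k).
  move=> e0 e1; have e2 : 0 <= 1 - e by rewrite subr_ge0.
  rewrite -{1}(ger0_norm e2) -enormZ.
  rewrite (_ : _ *: _ = ((1 - e) *: x + e *: centroid k) - ((1 - e) *: y + e *: centroid k)).
    apply: (@diam_ub _ (enorm (sd1 k) + enorm (sd2 k))); try exact: shrink_opent.
    by move=> a b /(opent_sub d0) ca /(opent_sub d0) cb; exact: closedt_bounded.
  by rewrite opprD addrACA subrr addr0 scalerBr.
rewrite leNgt; apply/negP => h.
have N0 : 0 < enorm (x - y).
  apply: le_lt_trans h; have := H 1 ltr01 (lexx _); rewrite subrr mul0r; exact.
pose e := (enorm (x - y) - diam (opent k)) / enorm (x - y) / 2.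
have D0 : 0 <= diam (opent k) by have := H 1 ltr01 (lexx _); rewrite subrr mul0r.
have e0 : 0 < e by rewrite divr_gt0 // divr_gt0 // subr_gt0.
have e1 : e <= 1.
  rewrite /e ler_pdivrMr // mul1r ler_pdivrMr //.
  lra.
have := H e e0 e1; rewrite leNgt; case/negP.
rewrite mulrBl mul1r (_ : e * _ = (enorm (x - y) - diam (opent k)) / 2); first lra.
by rewrite /e; field; rewrite gt_eqF.
Qed.

End Triangle.

(** * Shape regularity and common sides *)

Section Regular.
Context {R : realType}.
Implicit Types (k : @triangle R) (x y a b c d : R * R) (u v : R * R -> R) (T : set (@triangle R)).

(** A function with values in []0, 1[] cannot vary by 1 across a disc. If [2 r m > |dt k|], the two
    points at distance [|dt k| / (2 m) < r] from the centre along [n] would give a variation of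
    exactly 1. *)
Lemma disc_width k (r : R) x (n : R * R) (f : R * R -> R) (m : R) : 0 < r -> 0 <= m ->
  [set y | enorm (y - x) < r] `<=` opent k ->
  (forall y, opent k y -> 0 < f y < 1) ->
  enorm n = m -> 0 < m ->
  (forall t : R, f (x + t *: n) - f (x - t *: n) = 2 * t * (m ^+ 2) / dt k) ->
  dt k != 0 -> 2 * r * m <= `|dt k|.
Proof.
move=> r0 _ sub f01 nm m0 fE d0; rewrite leNgt; apply/negP => h.
have D0 : 0 < `|dt k| by rewrite normr_gt0.
pose rho := `|dt k| / (2 * m).
have rho_r : rho < r by rewrite /rho ltr_pdivrMr ?mulr_gt0 // mulrC mulrAC.
pose t := rho / m.
have t0 : 0 < t by rewrite divr_gt0 // divr_gt0 // mulr_gt0.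
have inD (s : R) : `|s| = t -> opent k (x + s *: n).
  move=> st; apply: sub => /=; rewrite addrC addKr enormZ nm st.
  by rewrite /t divfK // gt_eqF.
have i1 := f01 _ (inD t (ger0_norm (ltW t0))).
have := inD (- t); rewrite normrN (ger0_norm (ltW t0)) scaleNr => /(_ erefl)/f01 i2.
have := fE t.
have -> : 2 * t * m ^+ 2 / dt k = `|dt k| / dt k.
  by rewrite /t /rho; field; rewrite d0 gt_eqF.
move=> E; have : `|f (x + t *: n) - f (x - t *: n)| = 1.
  by rewrite E normrM normr_id normfV divff // normr_eq0.
move: i1 i2 => /andP[i1 i2] /andP[i3 i4] E1.
have : `|f (x + t *: n) - f (x - t *: n)| < 1 by rewrite ltr_norml; apply/andP; split; lra.
by rewrite E1 ltxx.
Qed.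

Lemma indiam_edge k (e : R * R) (f : R * R -> R) : dt k != 0 -> 0 < enorm e ->
  (forall y, opent k y -> 0 < f y < 1) ->
  (forall x (t : R), f (x + t *: (- e.2, e.1)) - f (x - t *: (- e.2, e.1)) = 2 * t * (enorm e ^+ 2) / dt k) ->
  indiam (opent k) * enorm e <= `|dt k|.
Proof.
move=> d0 e0 f01 fE.
rewrite -ler_pdivlMr //.
have E : enorm (- e.2, e.1) = enorm e by rewrite /enorm /dot /=; congr Num.sqrt; ring.
have H q : [set d : R | exists x r, [/\ 0 < r, d = 2 * r & [set y | enorm (y - x) < r] `<=` opent k]] q ->
    q <= `|dt k| / enorm e.
  case=> x [r [r0 -> sub]]; rewrite ler_pdivlMr //.
  exact: (@disc_width k r x (- e.2, e.1) f (enorm e) r0 (ltW e0) sub f01 E e0 (fE x) d0).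
rewrite /indiam; set S := [set d : R | _] in H *.
have [[q Sq]|S0] := pselect (S !=set0); first by apply: ge_sup => //; exists q.
have -> : S = set0 by apply/seteqP; split => // q Sq; apply: S0; exists q.
by rewrite sup0 divr_ge0 // ltW.
Qed.

Lemma dt_edges k : dt k != 0 -> 0 < enorm (sd1 k) /\ 0 < enorm (sd2 k).
Proof.
move=> d0; rewrite !lt0r !enorm_ge0 !andbT; split; apply: contra_neq d0 => /enorm_eq0 h;
by rewrite /dt h /= ?mul0r ?mulr0 subrr.
Qed.

(** With [a], [b] the two edges at [k 0] and [D] the diameter, the height bounds give [D |a|, D |b|
    <= sigma |dt| <= sigma |a| |b|]. Hence [D <= sigma |b|], and
    [D^2 <= sigma D |b| <= sigma^2 |dt|]. *)
Lemma regular_dt k sigma : dt k != 0 -> diam (opent k) <= sigma * indiam (opent k) ->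
  [/\ 0 < diam (opent k), 0 < sigma, enorm (sd1 k) <= diam (opent k),
      enorm (sd2 k) <= diam (opent k) & diam (opent k) ^+ 2 <= sigma ^+ 2 * `|dt k|].
Proof.
move=> d0 reg; have [a0 b0] := dt_edges d0.
have V i := vertex_closedt i d0.
have a1 : enorm (sd1 k) <= diam (opent k) by exact: diam_opent.
have b1 : enorm (sd2 k) <= diam (opent k) by exact: diam_opent.
set D := diam _ in reg a1 b1 *.
have D0 : 0 < D by exact: lt_le_trans a1.
have I1 : indiam (opent k) * enorm (sd1 k) <= `|dt k|.
  apply: (@indiam_edge _ _ (br2 k)) => // [y|x t].
    by rewrite opentE // => -[h1 h2 h3]; apply/andP; split; lra.
  by rewrite enorm_sqr /br2 /= /GRing.scale /=; ring.
have I2 : indiam (opent k) * enorm (sd2 k) <= `|dt k|.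
  apply: (@indiam_edge _ _ (fun y => 1 - br1 k y)) => // [y|x t].
    by rewrite opentE // => -[h1 h2 h3]; apply/andP; split; lra.
  by rewrite enorm_sqr /br1 /= /GRing.scale /=; ring.
have ind0 : 0 <= indiam (opent k).
  rewrite /indiam; set S := [set d : R | _].
  have [hS|nS] := pselect (has_sup S); last by rewrite sup_out.
  have [[q Sq] ubS] := hS.
  apply: (@le_trans _ _ q); last exact: ub_le_sup.
  by case: Sq => x [r [r0 -> _]]; rewrite mulr_ge0 // ltW.
have s0 : 0 < sigma.
  rewrite ltNge; apply/negP => s0; move: reg; rewrite leNgt; case/negP.
  by apply: le_lt_trans D0; rewrite mulr_le0_ge0.
have h1 : D * enorm (sd1 k) <= sigma * `|dt k|.
  by apply: le_trans (_ : sigma * indiam (opent k) * enorm (sd1 k) <= _); rewrite ?ler_wpM2r ?(ltW a0) // -mulrA ler_wpM2l // ltW.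
have h2 : D * enorm (sd2 k) <= sigma * `|dt k|.
  by apply: le_trans (_ : sigma * indiam (opent k) * enorm (sd2 k) <= _); rewrite ?ler_wpM2r ?(ltW b0) // -mulrA ler_wpM2l // ltW.
have h3 : `|dt k| <= enorm (sd1 k) * enorm (sd2 k) by exact: cross_le.
split => //.
have h4 : D <= sigma * enorm (sd2 k).
  rewrite -(ler_pM2r a0); apply: le_trans h1 _.
  by rewrite -mulrA ler_wpM2l ?(ltW s0) // mulrC.
rewrite !expr2; apply: le_trans (_ : D * (sigma * enorm (sd2 k)) <= _).
  by rewrite ler_wpM2l // ltW.
by rewrite mulrCA -mulrA ler_wpM2l // ltW.
Qed.

Lemma within_closure_eq (A : set (R * R)) u v : {within closure A, continuous u} ->
  continuous v -> (forall x, A x -> u x = v x) -> forall x, closure A x -> u x = v x.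
Proof.
move=> cu cv euv x cx; apply/eqP; rewrite -subr_eq0; apply/negPn/negP => n0.
pose e := `|u x - v x| / 2.
have e0 : 0 < e by rewrite divr_gt0 // normr_gt0.
have h1 : \forall y \near x, closure A y -> `|u x - u y| < e.
  by have /subspace_continuousP/(_ x cx)/cvgrPdist_lt/(_ e e0) := cu.
have /cvgrPdist_lt/(_ e e0) h2 := cv x.
have [y [Ay [By1 By2]]] := cx _ (filterI h1 h2).
have {}By1 := By1 (subset_closure Ay).
have : `|u x - v x| < e + e.
  rewrite (_ : u x - v x = (u x - u y) - (v x - v y)); last by rewrite (euv y Ay); ring.
  by apply: le_lt_trans (ler_normB _ _) _; rewrite ltrD.
by rewrite /e -splitr ltxx.
Qed.

Lemma paste_continuous (Cs : seq (set (R * R))) (C : set (R * R)) u :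
  (forall F, List.In F Cs -> closed F /\ {within F, continuous u}) ->
  (forall x, C x -> exists2 F, List.In F Cs & F x) -> {within C, continuous u}.
Proof.
move=> H cov; apply/subspace_continuousP => x Cx; apply/cvgrPdist_lt => e e0.
have : nbhs (x : R * R) [set y | forall F, List.In F Cs -> F y -> `|u x - u y| < e].
  elim: Cs H {cov} => [|F Cs IH] H; first by apply: filterS (@filterT _ (nbhs (x : R * R)) _) => y _ F [].
  have H1 : nbhs (x : R * R) [set y | F y -> `|u x - u y| < e].
    have [cF cu] : closed F /\ {within F, continuous u} by apply: H; left.
    have [Fx|nFx] := pselect (F x).
      by have /subspace_continuousP/(_ x Fx)/cvgrPdist_lt/(_ e e0) := cu.
    have : nbhs (x : R * R) (~` F) by apply: open_nbhs_nbhs; split => //; exact: closed_openC.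
    by apply: filterS => y nFy Fy; case: (nFy Fy).
  have H2 := IH (fun G GF => H G (or_intror GF)).
  by apply: filterS2 H1 H2 => y h1 h2 G [<-|GC]; [exact: h1|exact: h2].
by apply: filterS => y h Cy; have [F FC Fy] := cov y Cy; exact: (h F).
Qed.

(** Conformity describes a common side as a segment twice, so its endpoints have to be matched. With
    [t], [s] the parameters of [a], [b] on [[c, d]], and [p], [q] those of [c], [d] on [[a, b]], one
    gets [t + p (s - t) = 0] and [t + q (s - t) = 1], which inside [[0, 1]] forces
    [{t, s} = {0, 1}]. *)
Lemma seg_endpoints a b c d : segment a b = segment c d -> (a = c /\ b = d) \/ (a = d /\ b = c).
Proof.
move=> E.
have sE x y (t : R) : (1 - t) *: x + t *: y = x + t *: (y - x).
  by apply: injective_projections; rewrite /= /GRing.scale /=; ring.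
have ea x y : segment x y x.
  by exists 0; rewrite /= ?in_itv /= ?lexx ?ler01 // subr0 scale1r scale0r addr0.
have eb x y : segment x y y.
  by exists 1; rewrite /= ?in_itv /= ?lexx ?ler01 // subrr scale1r scale0r add0r.
have [cd|ncd] := pselect (c = d).
  have S x : segment c d x -> x = c.
    by rewrite cd => -[t _ <-]; rewrite sE subrr scaler0 addr0.
  by left; rewrite -cd; split; apply: S; rewrite -E.
have : segment c d a by rewrite -E.
case=> t /=; rewrite in_itv /= sE => /andP[t0 t1] at_.
have : segment c d b by rewrite -E.
case=> s /=; rewrite in_itv /= sE => /andP[s0 s1] bs.
have cdE (r : R) : r *: (d - c) = 0 -> r = 0.
  move/eqP; rewrite scaler_eq0 subr_eq0 => /orP[/eqP //|/eqP dc]; by case: ncd.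
have : segment a b c by rewrite E.
case=> p /=; rewrite in_itv /= sE => /andP[p0 p1] cp.
have : segment a b d by rewrite E.
case=> q /=; rewrite in_itv /= sE => /andP[q0 q1] dq.
have e1 : t + p * (s - t) = 0.
  apply: cdE; move: cp; rewrite -at_ -bs => cp.
  by apply: injective_projections; rewrite /= /GRing.scale /=; [move: (congr1 fst cp)|move: (congr1 snd cp)];
    rewrite /= /GRing.scale /=; lra.
have e2 : t + q * (s - t) = 1.
  suff : t + q * (s - t) - 1 = 0 by lra.
  apply: cdE; move: dq; rewrite -at_ -bs => dq.
  by apply: injective_projections; rewrite /= /GRing.scale /=; [move: (congr1 fst dq)|move: (congr1 snd dq)];
    rewrite /= /GRing.scale /=; lra.
have [t00|t00] := eqVneq t 0.
  left; rewrite -at_ -bs t00 scale0r addr0; split => //.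
  have -> : s = 1 by rewrite t00 in e1 e2; nra.
  by rewrite scale1r addrC subrK.
right.
have h : t * (1 - p) = 0 by nra.
have p1' : p = 1 by move: h => /eqP; rewrite mulf_eq0 (negbTE t00) /= subr_eq0 => /eqP.
have s00 : s = 0 by rewrite p1' in e1; lra.
have t11 : t = 1 by rewrite s00 in e2; nra.
by rewrite -at_ -bs t11 s00 scale0r scale1r addr0 addrC subrK.
Qed.

Lemma seg_val a b c d x u (t s : R) : segment a b = segment c d ->
  x = (1 - t) *: a + t *: b -> x = (1 - s) *: c + s *: d ->
  (1 - t) * u a + t * u b = (1 - s) * u c + s * u d.
Proof.
move=> /seg_endpoints E xa xc.
have Z (r : R) y z : r *: (y - z) = 0 -> r = 0 \/ y = z.
  by move/eqP; rewrite scaler_eq0 subr_eq0 => /orP[/eqP|/eqP]; [left|right].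
case: E xa xc => -[-> ->] -> E.
  have [ts|->] : t - s = 0 \/ d = c; last by ring.
    apply: Z; move: E => /eqP; rewrite -subr_eq0 => /eqP <-.
    by apply: injective_projections; rewrite /= /GRing.scale /=; ring.
  by rewrite (_ : t = s) //; lra.
have [ts|->] : 1 - t - s = 0 \/ d = c; last by ring.
  apply: Z; move: E => /eqP; rewrite -subr_eq0 => /eqP <-.
  by apply: injective_projections; rewrite /= /GRing.scale /=; ring.
by rewrite (_ : t = 1 - s); [ring|lra].
Qed.

End Regular.

Lemma finite_list (X : Type) (A : set X) : finite_set A -> exists s : seq X, forall x, A x <-> List.In x s.
Proof.
elim/Pchoice: X => X in A *.
move=> /finite_seqP [s ->]; exists s => x; rewrite /=; elim: s => //= y s IH.
rewrite inE; split => [/orP[/eqP ->|/IH]|[->|/IH ->]]; [by left|by right|by rewrite eqxx|by rewrite orbT].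
Qed.

Lemma List_In_map (X Y : Type) (f : X -> Y) (s : seq X) y :
  List.In y (map f s) <-> exists2 x, List.In x s & f x = y.
Proof.
elim: s => [|x s IH] /=; first by split => // -[].
split; first by move=> [<-|/IH[z zs <-]]; [exists x => //; left|exists z => //; right].
case=> z [<-|zs] E; first by left.
by right; apply/IH; exists z.
Qed.

(** * Affine interpolation on a triangulation *)

Section Mesh.
Context {R : realType}.
Implicit Types (k : @triangle R) (x y : R * R) (u v : R * R -> R) (T : set (@triangle R)).

Section Triangulation.
Variables (Omega : set (R * R)) (sigma h : R) (T : set (@triangle R)).
Hypothesis tr : triangulation Omega sigma h T.

Lemma tr_dt k : T k -> dt k != 0.
Proof. by move=> Tk; exact: (tr_nondegenerate tr Tk). Qed.

Definition union_closed : set (R * R) := [set x | exists2 k, T k & closedt k x].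

Lemma tr_list : exists s : seq (@triangle R), forall k, T k <-> List.In k s.
Proof. exact: finite_list (tr_finite tr). Qed.

Lemma union_closedE : \bigcup_(k in T) closure (opent k) = union_closed.
Proof.
apply/seteqP; split => x [k Tk].
  by rewrite (closure_opent (tr_dt Tk)) => ?; exists k.
by rewrite -(closure_opent (tr_dt Tk)) => ?; exists k.
Qed.

Lemma union_closed_closed : closed union_closed.
Proof.
have [s Hs] := tr_list.
have := @closed_list (R * R)%type (map (@closedt R) s).
rewrite (_ : [set x | _] = union_closed); first apply.
  by move=> F /List_In_map[k ks <-]; exact: closedt_closed.
apply/seteqP; split => x.
  by move=> [F /List_In_map[k ks <-] kx]; exists k => //; exact/Hs.
by move=> [k /Hs ks kx]; exists (closedt k) => //; apply/List_In_map; exists k.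
Qed.

Lemma polygon_open : open (polygon T).
Proof. exact: open_interior. Qed.

Lemma polygon_sub : polygon T `<=` union_closed.
Proof. by rewrite -union_closedE; exact: interior_subset. Qed.

Lemma closure_polygon_sub : closure (polygon T) `<=` union_closed.
Proof.
rewrite [X in _ `<=` X](closure_id _).1; last exact: union_closed_closed.
by apply: closure_subset; exact: polygon_sub.
Qed.

Lemma opent_polygon k : T k -> opent k `<=` polygon T.
Proof.
move=> Tk; rewrite -(open_subsetE _ (opent_open (tr_dt Tk))) => x kx.
by exists k => //; exact: subset_closure.
Qed.

Lemma closedt_polygon k : T k -> closedt k `<=` closure (polygon T).
Proof.
by move=> Tk; rewrite -(closure_opent (tr_dt Tk)); apply: closure_subset; exact: opent_polygon.
Qed.

(** The affine function, on the whole plane, with the values of [u] at the three vertices. *)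
Definition lin u k x : R := (1 - br1 k x - br2 k x) * u (k 0) + br1 k x * u (k 1) + br2 k x * u (k 2%:R).

Lemma lin_vertex u k i : dt k != 0 -> lin u k (k i) = u (k i).
Proof.
move=> d0; have [h1 h2 h3] := br1_vertex d0; have [h4 h5 h6] := br2_vertex d0.
by have [->|->|->] := I3_cases i; rewrite /lin ?h1 ?h2 ?h3 ?h4 ?h5 ?h6; ring.
Qed.

Lemma lin_aff u k x y (s t : R) : s + t = 1 ->
  lin u k (s *: x + t *: y) = s * lin u k x + t * lin u k y.
Proof.
move=> st; rewrite /lin br1_aff // br2_aff //.
by rewrite (_ : s = 1 - t); [ring|rewrite -st addrK].
Qed.

Lemma lin_cont u k : continuous (lin u k).
Proof.
move=> x; rewrite /lin; apply: cvgD; [apply: cvgD|]; apply: cvgMl.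
- apply: cvgB; last exact: br2_cont.
  by apply: cvgB; [exact: cvg_cst|exact: br1_cont].
- exact: br1_cont.
- exact: br2_cont.
Qed.

Lemma lin_affine u k : exists a b c : R, forall x, lin u k x = a + b * x.1 + c * x.2.
Proof.
exists (lin u k 0), (lin u k (1, 0) - lin u k 0), (lin u k (0, 1) - lin u k 0) => x.
by rewrite /lin /br1 /br2 /=; ring.
Qed.

Lemma lin_consistent u k k' x : T k -> T k' -> closedt k x -> closedt k' x -> lin u k x = lin u k' x.
Proof.
move=> Tk Tk' kx kx'; have [->//|kk'] := pselect (k = k').
have [_] := tr_conforming tr Tk Tk' kk'.
have d := tr_dt Tk; have d' := tr_dt Tk'.
rewrite (closure_opent d) (closure_opent d') => -[I0|[z [Iz [i zi] [i' zi']]]|[[i [j [_ S]]] [i' [j' [_ S']]]]].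
- by have : (closedt k `&` closedt k') x by []; rewrite I0.
- have : (closedt k `&` closedt k') x by [].
  by rewrite Iz => ->; rewrite {1}zi zi' !lin_vertex // -zi -zi'.
- have : (closedt k `&` closedt k') x by []; rewrite S => -[t _ xt].
  have : (closedt k `&` closedt k') x by []; rewrite S' => -[s _ xs].
  rewrite -{1}xt -xs !lin_aff ?subrK // !lin_vertex //.
  by apply: (@seg_val _ _ _ _ _ x) => //; rewrite -S S'.
Qed.

(** [interp] is a choice, so its properties wait for a witness. Gluing the affine pieces is
    consistent by conformity, and continuous because finitely many closed triangles cover the
    closure of the polygon. *)
Lemma interp_exists u : exists w, Sh T w /\ forall k x, T k -> closedt k x -> w x = lin u k x.
Proof.
pose w x := xget 0 [set y : R | exists2 k, T k & closedt k x /\ y = lin u k x].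
have wE k x : T k -> closedt k x -> w x = lin u k x.
  move=> Tk kx; rewrite /w; case: xgetP => [y _ [k' Tk' [kx' ->]]|]; first exact: lin_consistent.
  by move=> /(_ (lin u k x)); case; exists k.
exists w; split => //; split; last first.
  move=> k Tk; have [a [b [c E]]] := lin_affine u k; exists a, b, c => x kx.
  by rewrite (wE k) //; exact: (opent_sub (tr_dt Tk)).
have [s Hs] := tr_list.
apply: (@paste_continuous _ (map (@closedt R) s)).
  move=> F /List_In_map[k /Hs Tk <-]; split; first exact: closedt_closed.
  apply: (@subspace_eq_continuous _ _ _ (lin u k)); last exact/continuous_subspaceT/lin_cont.
  by move=> x; rewrite inE => kx; rewrite /from_subspace; apply/esym; exact: wE.
move=> x /closure_polygon_sub[k Tk kx]; exists (closedt k) => //.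
by apply/List_In_map; exists k => //; exact/Hs.
Qed.

(** Continuity carries the affine formula from the open triangle to the closed one, where an affine
    function is fixed by its vertex values. *)
Lemma Sh_closedt v k : Sh T v -> T k -> forall x, closedt k x -> v x = lin v k x.
Proof.
move=> [cv av] Tk; have d := tr_dt Tk; have [a [b [c E]]] := av k Tk.
pose g x := a + b * x.1 + c * x.2.
have cg : continuous g.
  move=> x; apply: cvgD; first apply: cvgD; first exact: cvg_cst.
    by apply: cvgMr; exact: cvg_fst.
  by apply: cvgMr; exact: cvg_snd.
have vg x : closedt k x -> v x = g x.
  rewrite -(closure_opent d); apply: within_closure_eq => //.
  apply: continuous_subspaceW cv; rewrite (closure_opent d); exact: closedt_polygon.
move=> x kx; rewrite (vg x kx) /lin !vg; try exact: vertex_closedt.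
by rewrite /g {1 2}(br_comb x d) /= /GRing.scale /=; ring.
Qed.

Lemma interpP u : Sh T (interp T u) /\ forall k x, T k -> closedt k x -> interp T u x = lin u k x.
Proof.
have [w [Sw Ew]] := interp_exists u.
have : [set w | Sh T w /\ forall k x, T k -> is_vertex k x -> w x = u x] (interp T u).
  apply: xgetPex; exists w; split => // k x Tk [i ->].
  by rewrite (Ew k) ?lin_vertex //; [exact: tr_dt|apply: vertex_closedt; exact: tr_dt].
move=> [S1 S2]; split => // k x Tk kx; rewrite (Sh_closedt S1 Tk kx) /lin.
by rewrite !(S2 k) //; [exists 2%:R|exists 1|exists 0].
Qed.

End Triangulation.
End Mesh.

(** * Piecewise constant gradients of finite element functions *)

Section PiecewiseAffine.
Context {R : realType}.
Local Notation T2 := (plane R).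

Lemma ae_list (X : Type) (s : seq X) (P : X -> T2 -> Prop) :
  (forall k, List.In k s -> {ae leb2, forall x : T2, P k x}) ->
  {ae leb2, forall x : T2, forall k, List.In k s -> P k x}.
Proof.
elim: s => [|k s IH] H; first by apply: aeW => x k [].
apply: ae2I (H k (or_introl erefl)) (IH (fun j js => H j (or_intror js))).
by move=> x h1 h2 j [<-|js]; [exact: h1|exact: h2].
Qed.

Lemma measurable_list (Cs : seq (set T2)) (f : T2 -> R) :
  (forall F, List.In F Cs -> measurable F /\ measurable_fun F f) ->
  measurable [set x | exists2 F, List.In F Cs & F x] /\
  measurable_fun [set x | exists2 F, List.In F Cs & F x] f.
Proof.
elim: Cs => [|F Cs IH] H.
  rewrite (_ : [set x | _] = set0); last by apply/seteqP; split => x // [F []].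
  by split => //; exact: measurable_fun_set0.
have [mF mf] : measurable F /\ measurable_fun F f by apply: H; left.
have [mC mfC] := IH (fun G GC => H G (or_intror GC)).
rewrite (_ : [set x | _] = F `|` [set x | exists2 F, List.In F Cs & F x]).
  by split; [exact: measurableU|apply/measurable_funU].
apply/seteqP; split => x.
  by case=> G [<-|GF] Gx; [left|right; exists G].
by case=> [Fx|[G GF Gx]]; [exists F => //; left|exists G => //; right].
Qed.

Lemma bound_list (X : Type) (s : seq X) (f : X -> R) : exists L : R, 0 <= L /\ forall k, List.In k s -> `|f k| <= L.
Proof.
elim: s => [|k s [L [L0 HL]]]; first by exists 0; split => // k [].
exists (L + `|f k|); split; first by rewrite addr_ge0.
move=> j [<-|js]; first by rewrite lerDr.
by apply: le_trans (HL _ js) _; rewrite lerDl.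
Qed.

Implicit Types (k : @triangle R) (x y : R * R) (u v : R * R -> R) (i : 'I_2) (A : set (R * R)).

Lemma negl_level (f : R * R -> R) (c : R) :
  (exists a b d, ((a != 0) || (b != 0)) /\ forall x, f x = a * x.1 + b * x.2 + d) ->
  {ae leb2, forall x : T2, f x <> c}.
Proof.
move=> [a [b [d [ab fE]]]].
exists [set x : T2 | a * x.1 + b * x.2 = c - d]; split.
- apply: closed_measurable2.
  rewrite (_ : [set x | _] = (fun x : R * R => a * x.1 + b * x.2) @^-1` [set c - d]) //.
  apply: preimage_closedT; first exact: closed_eq.
  by move=> x; apply: cvgD; apply: cvgMr; [exact: cvg_fst|exact: cvg_snd].
- exact: line_null.
- move=> x /= h; apply: contrapT => h2; apply: h => h3; apply: h2; rewrite -h3 fE; ring.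
Qed.

(** The boundary of a triangle lies on three lines. *)
Lemma br_ae k : dt k != 0 -> {ae leb2, forall x : T2, closedt k x -> opent k x}.
Proof.
move=> d0; have [a0 b0] := dt_edges d0.
have nz (e : R * R) : 0 < enorm e -> (e.1 != 0) || (e.2 != 0).
  move=> e0; rewrite -negb_and; apply/negP => /andP[/eqP h1 /eqP h2].
  by move: e0; rewrite (_ : e = 0) ?enorm0 ?ltxx //; case: e h1 h2 => ? ? /= -> ->.
have H1 : {ae leb2, forall x : T2, br1 k x <> 0}.
  apply: negl_level; exists ((sd2 k).2 / dt k), (- (sd2 k).1 / dt k), (((k 0).2 * (sd2 k).1 - (k 0).1 * (sd2 k).2) / dt k).
  split; last by move=> x; rewrite /br1; ring.
  by rewrite !mulf_eq0 oppr_eq0 invr_eq0 (negbTE d0) !orbF orbC nz.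
have H2 : {ae leb2, forall x : T2, br2 k x <> 0}.
  apply: negl_level; exists (- (sd1 k).2 / dt k), ((sd1 k).1 / dt k), (((sd1 k).2 * (k 0).1 - (sd1 k).1 * (k 0).2) / dt k).
  split; last by move=> x; rewrite /br2; ring.
  by rewrite !mulf_eq0 oppr_eq0 invr_eq0 (negbTE d0) !orbF orbC nz.
have H3 : {ae leb2, forall x : T2, br1 k x + br2 k x <> 1}.
  apply: negl_level; exists (((sd2 k).2 - (sd1 k).2) / dt k), (((sd1 k).1 - (sd2 k).1) / dt k),
    ((((k 0).2 * (sd2 k).1 - (k 0).1 * (sd2 k).2) + ((sd1 k).2 * (k 0).1 - (sd1 k).1 * (k 0).2)) / dt k).
  split; last by move=> x; rewrite /br1 /br2; ring.
  rewrite !mulf_eq0 invr_eq0 (negbTE d0) !orbF -negb_and; apply/negP => /andP[/eqP h1 /eqP h2].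
  case/eqP: d0; rewrite /dt (_ : (sd1 k).1 = (sd2 k).1); last by lra.
  by rewrite (_ : (sd1 k).2 = (sd2 k).2); [ring|lra].
have H12 := ae2I (fun x h1 h2 => conj h1 h2) H1 H2.
apply: ae2I H12 H3 => x [h1 h2] h3 [b1 b2 b3]; rewrite opentE //=; split.
- by rewrite lt_neqAle eq_sym b1 andbT; apply/eqP.
- by rewrite lt_neqAle eq_sym b2 andbT; apply/eqP.
- by rewrite lt_neqAle b3 andbT; apply/eqP.
Qed.

Definition pslope i v k : R := lin v k (unitv i) - lin v k 0.

Lemma lin_incr i v k x (t : R) : lin v k (x + t *: uv i) - lin v k x = t * pslope i v k.
Proof.
rewrite unitv_line /pslope /lin /br1 /br2 /unitv; case: ifP => _ /=; ring.
Qed.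

Lemma is_derive_near_affine v x i (m : R) : (\forall t \near (0 : R), v (x + t *: uv i) - v x = t * m) -> is_derive x (uv i) v m.
Proof.
move=> H.
have L : (fun h : R => h^-1 *: ((v \o shift x) (h *: uv i) - v x)) @ 0^' --> m.
  apply: cvg_trans (@cvg_cst _ m _ (0^') _); apply: near_eq_cvg.
  near=> t; have t0 : t != 0 by near: t; exact: nbhs_dnbhs_neq.
  rewrite /= (addrC _ x) (_ : v _ - v x = t * m); first by rewrite /GRing.scale /= mulKf.
  by near: t; exact: nbhs_dnbhs.
apply: DeriveDef; first by apply/cvg_ex; exists m.
exact/cvg_lim.
Unshelve. all: by end_near.
Qed.

Section Mesh.
Variables (Omega : set (R * R)) (sigma h : R) (T : set (@triangle R)).
Hypothesis tr : triangulation Omega sigma h T.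

Definition mesh_in : set (R * R) := [set x | exists2 k, T k & opent k x].

Lemma mesh_ae : {ae leb2, forall x : T2, union_closed T x -> mesh_in x}.
Proof.
have [s Hs] := tr_list tr.
have : {ae leb2, forall x : T2, forall k, List.In k s -> (closedt k x -> opent k x)}.
  by apply: ae_list => k /Hs Tk; apply: br_ae; exact: (tr_dt tr).
by apply: ae2S => x H [k Tk kx]; exists k => //; apply: H => //; exact/Hs.
Qed.

Lemma opent_inj k k' x : T k -> T k' -> opent k x -> opent k' x -> k = k'.
Proof.
move=> Tk Tk' kx kx'; apply: contrapT => kk'.
have [E _] := tr_conforming tr Tk Tk' kk'.
by have : (opent k `&` opent k') x by []; rewrite E.
Qed.

(** The default 0 is taken on a null subset of the polygon, and outside the polygon it is the
    derivative of the extension by zero. *)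
Definition pgrad i v x : R := xget 0 [set y : R | exists2 k, T k & opent k x /\ y = pslope i v k].

Lemma pgradE i v k x : T k -> opent k x -> pgrad i v x = pslope i v k.
Proof.
move=> Tk kx; rewrite /pgrad; case: xgetP => [y _ [k' Tk' [kx' ->]]|].
  by rewrite (opent_inj Tk Tk' kx kx').
by move=> /(_ (pslope i v k)); case; exists k.
Qed.

Lemma pgrad_out i v x : ~ mesh_in x -> pgrad i v x = 0.
Proof.
move=> nx; rewrite /pgrad; case: xgetP => // y _ [k Tk [kx _]].
by case: nx; exists k.
Qed.

Lemma mesh_in_polygon : mesh_in `<=` polygon T.
Proof. by move=> x [k Tk]; exact: (opent_polygon tr). Qed.

Lemma mesh_in_open : open mesh_in.
Proof.
rewrite (_ : mesh_in = \bigcup_(k in T) opent k).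
  by apply: bigcup_open => k Tk; apply: opent_open; exact: (tr_dt tr).
by apply/seteqP; split => x [k Tk kx]; exists k.
Qed.

Lemma measurable_pgrad i v (D : set T2) : measurable D -> measurable_fun D (pgrad i v : T2 -> R).
Proof.
move=> mD; apply: (@measurable_funS _ _ _ _ setT) => //.
have mM : meas2 mesh_in := open_measurable2 mesh_in_open.
rewrite -(setUv (mesh_in : set T2)); apply/measurable_funU => //; first exact: measurableC.
split; last first.
  apply: (@eq_measurable_fun _ _ _ _ _ (fun _ : T2 => (0 : R))) => // x; rewrite inE => nx.
  by rewrite pgrad_out.
have [s Hs] := tr_list tr.
have H F : List.In F (map (fun k => opent k : set T2) s) ->
    measurable F /\ measurable_fun F (pgrad i v : T2 -> R).
  move=> /List_In_map[k /Hs Tk <-]; split; first by apply: open_measurable2; apply: opent_open; exact: (tr_dt tr).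
  apply: (@eq_measurable_fun _ _ _ _ _ (fun _ : T2 => pslope i v k)) => // x; rewrite inE => kx.
  by rewrite (pgradE _ _ Tk kx).
have [mB] := measurable_list H; apply: measurable_funS => //.
by move=> x [k /Hs Tk kx]; exists (opent k) => //; apply/List_In_map; exists k.
Qed.

Lemma pslope_bound i v : exists L : R, 0 <= L /\ forall k, T k -> `|pslope i v k| <= L.
Proof.
have [s Hs] := tr_list tr; have [L [L0 HL]] := bound_list s (pslope i v).
by exists L; split => // k /Hs; exact: HL.
Qed.

Lemma pgrad_bound i v : exists L : R, 0 <= L /\ forall x, `|pgrad i v x| <= L.
Proof.
have [L [L0 HL]] := pslope_bound i v; exists L; split => // x.
have [[k Tk kx]|nx] := pselect (mesh_in x); first by rewrite (pgradE _ _ Tk kx) HL.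
by rewrite pgrad_out // normr0.
Qed.

Lemma Sh_incr i v k x (t : R) : Sh T v -> T k -> closedt k x -> closedt k (x + t *: uv i) ->
  v (x + t *: uv i) - v x = t * pslope i v k.
Proof. by move=> Sv Tk kx kxt; rewrite !(Sh_closedt tr Sv Tk) // lin_incr. Qed.

Lemma Sh_derive i v k x : Sh T v -> T k -> opent k x -> is_derive x (uv i) v (pslope i v k).
Proof.
move=> Sv Tk kx; apply: is_derive_near_affine.
have oP := opent_open (tr_dt tr Tk).
have cp : {for (0 : R), continuous (fun t : R => x + t *: uv i)}.
  by apply: cvgD; [exact: cvg_cst|apply: cvgZr_tmp; exact: cvg_id].
have : \forall t \near (0 : R), opent k (x + t *: uv i).
  by apply: cp; rewrite scale0r addr0; exact: open_nbhs_nbhs.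
apply: filterS => t kt; apply: Sh_incr => //; exact: (opent_sub (tr_dt tr Tk)).
Unshelve. all: by end_near.
Qed.

(** Along a line [v] is Lipschitz with the largest slope, by the cover by closed triangles, and off
    the edges it is differentiable. *)
Lemma Sh_weak_partial i v : Sh T v -> weak_partial (polygon T) i v (pgrad i v).
Proof.
move=> Sv; have oP := @polygon_open _ T; have mP := open_measurable2 oP.
have cv : {within polygon T, continuous v}.
  by case: Sv => cv _; apply: continuous_subspaceW cv; exact: subset_closure.
apply: lip_weak_partial => //.
- exact: within_continuous_measurable2.
- exact: measurable_pgrad.
- move=> K cK KP; have [M [_ HM]] := compact_bound cK (continuous_subspaceW KP cv).
  by exists M.
- move=> K cK KP; have [r r0 Hr] := near_line i oP cK KP.
  have [L [L0 HL]] := pslope_bound i v; exists r, L; split => // x t Kx tr'.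
  split; first exact: Hr.
  have [s Hs] := tr_list tr.
  apply: (@line_lip_cover _ (map (@closedt R) s)).
  + by move=> C /List_In_map[k ks <-]; exact: closedt_closed.
  + move=> q qt; have [k Tk kx] := polygon_sub tr (Hr x q Kx (le_trans qt tr')).
    by exists (closedt k) => //; apply/List_In_map; exists k => //; exact/Hs.
  + move=> C y q /List_In_map[k /Hs Tk <-] ky kyq.
    by rewrite (Sh_incr Sv Tk ky kyq) normrM mulrC ler_wpM2r // HL.
- apply: ae2S mesh_ae => x Hx Px; have [k Tk kx] := Hx (polygon_sub tr Px).
  by rewrite (pgradE _ _ Tk kx); exact: Sh_derive.
Qed.

End Mesh.
End PiecewiseAffine.

(** * Weak gradients: uniqueness and agreement with classical derivatives *)

Section WeakGradient.
Context {R : realType}.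
Local Notation T2 := (plane R).
Implicit Types (A B K : set (R * R)) (u v w phi : R * R -> R) (i j : 'I_2).

Lemma integral_out A B (f : T2 -> \bar R) : B `<=` A ->
  (forall x, A x -> ~ B x -> f x = 0%E) ->
  (\int[leb2]_(x in A) f x = \int[leb2]_(x in B) f x)%E.
Proof.
move=> BA f0; rewrite [LHS]integral_mkcond [RHS]integral_mkcond; congr (integral _ _ _).
apply/funext => x; rewrite !patchE; case: ifPn; case: ifPn => //.
- by move=> /negP; rewrite inE => nB; rewrite inE => Ax; rewrite f0.
- by rewrite inE => /BA Ax /negP; rewrite inE.
Qed.

Lemma Rintegral_out A B (f : T2 -> R) : B `<=` A ->
  (forall x, A x -> ~ B x -> f x = 0) ->
  \int[leb2]_(x in A) f x = \int[leb2]_(x in B) f x.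
Proof.
move=> BA f0; rewrite /Rintegral (@integral_out A B) // => x Ax nB.
by rewrite f0.
Qed.

Lemma test_zero A phi x : test_function A phi -> ~ A x -> phi x = 0.
Proof. by move=> [_ _ sA] nA; apply: test_out => /sA. Qed.

Lemma test_subset A B phi : A `<=` B -> test_function A phi -> test_function B phi.
Proof. by move=> AB [h1 h2 h3]; split => //; exact: subset_trans AB. Qed.

Lemma loc_integrable_subset A B u : B `<=` A -> loc_integrable A u -> loc_integrable B u.
Proof. by move=> BA H K cK KB; apply: H => //; exact: subset_trans BA. Qed.

Lemma weak_partial_subset A B i u w : B `<=` A -> weak_partial A i u w -> weak_partial B i u w.
Proof.
move=> BA [lu lw H]; split; [exact: loc_integrable_subset lu|exact: loc_integrable_subset lw|].
move=> phi tp; have := H _ (test_subset BA tp).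
rewrite (@Rintegral_out A B) // => [->|x _ nB]; last by rewrite (test_zero (test_partial i tp)) ?mulr0.
by rewrite (@Rintegral_out A B) // => x _ nB; rewrite (test_zero tp) ?mulr0.
Qed.

Lemma weak_partial_aeL A i u u' w : open A -> loc_integrable A u' ->
  {ae leb2, forall x, A x -> u x = u' x} -> weak_partial A i u w -> weak_partial A i u' w.
Proof.
move=> oA lu' E [lu lw H]; split => // phi tp; rewrite -(H _ tp) /Rintegral; congr fine.
have mA := open_measurable2 oA.
have mp : mfun2 A (partial i phi).
  by apply: continuous_measurable2; exact: test_cont (test_partial i tp).
apply: ae_eq_integral => //.
- by apply/measurable_EFinP; apply: measurable_funM => //; exact: loc_integrable_measurable.
- by apply/measurable_EFinP; apply: measurable_funM => //; exact: loc_integrable_measurable.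
- by apply: ae2S E => x Ex Ax; rewrite Ex.
Qed.

Lemma loc_integrableB A u v : open A -> loc_integrable A u -> loc_integrable A v ->
  loc_integrable A (u \- v).
Proof.
move=> oA lu lv K cK KA.
apply: (eq_integrable (compact_measurable2 cK) (fun x => ((u x)%:E - (v x)%:E)%E)) => //.
by apply: integrableB; [exact: compact_measurable2|exact: lu|exact: lv].
Qed.

Lemma weak_partialB A i u v w z : open A -> weak_partial A i u w -> weak_partial A i v z ->
  weak_partial A i (u \- v) (w \- z).
Proof.
move=> oA [lu lw H] [lv lz H']; split; [exact: loc_integrableB|exact: loc_integrableB|].
move=> phi tp; have tpi := test_partial i tp; have mA := open_measurable2 oA.
under eq_Rintegral do rewrite mulrBl.
rewrite RintegralB //; [|exact: integrable_test tpi|exact: integrable_test tpi].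
rewrite H // H' //.
under [in RHS]eq_Rintegral do rewrite mulrBl.
by rewrite RintegralB //; [ring|exact: integrable_test tp|exact: integrable_test tp].
Qed.

Lemma weak_grad_unique A u G G' : open A -> is_weak_grad A u G -> is_weak_grad A u G' ->
  {ae leb2, forall x, A x -> G x = G' x}.
Proof.
move=> oA H H'; have := weak_partial_unique oA (H 1) (H' 1).
apply: (ae2I _ (weak_partial_unique oA (H 0) (H' 0))) => x h1 h2 Ax.
by apply: injective_projections; [exact: h1|exact: h2].
Qed.

Lemma wgradP A u G : is_weak_grad A u G -> is_weak_grad A u (wgrad A u).
Proof. by move=> H; apply: (@xgetPex _ _ [set G | is_weak_grad A u G]); exists G. Qed.

Lemma wgrad_ae A u G : open A -> is_weak_grad A u G ->
  {ae leb2, forall x, A x -> wgrad A u x = G x}.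
Proof. by move=> oA H; apply: (weak_grad_unique oA _ H); exact: wgradP H. Qed.

Lemma measurable_wgrad A u G i : open A -> is_weak_grad A u G ->
  mfun2 A (coord i \o wgrad A u).
Proof. by move=> oA /wgradP /(_ i) [_ lw _]; exact: loc_integrable_measurable. Qed.

Definition cgrad u x : R * R := (partial 0 u x, partial 1 u x).

Lemma I2_cases i : i = 0 \/ i = 1.
Proof. by case: i => -[|[|//]] ?; [left|right]; apply: val_inj. Qed.

Lemma coord_cgrad i u : coord i \o cgrad u = partial i u.
Proof. by apply/funext => x; have [->|->] := I2_cases i. Qed.

Lemma CkS k A u : Ck k.+1 A u -> Ck k A u.
Proof. by move=> [h1 h2]; split => s ks; [apply: h1; exact: ltnW|apply: h2; exact: ltnW]. Qed.

Lemma Ck_partial k A u i : Ck k.+1 A u -> Ck k A (partial i u).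
Proof. by move=> [h1 h2]; split => s ks; rewrite partials_rcons; [apply: h1|apply: h2]; rewrite size_rcons. Qed.

Lemma Ck1_weak_grad A u : open A -> Ck 1 A u -> is_weak_grad A u (cgrad u).
Proof. by move=> oA C1 i; rewrite coord_cgrad; exact: Ck1_weak_partial. Qed.

(** [wgrad] is an unspecified representative, so the link with the classical gradient holds only
    almost everywhere, by restriction to [B] and uniqueness there. *)
Lemma wgrad_classical A B u G : open A -> open B -> B `<=` A -> Ck 1 B u -> is_weak_grad A u G ->
  {ae leb2, forall x, B x -> wgrad A u x = cgrad u x}.
Proof.
move=> oA oB BA C1 H; apply: (weak_grad_unique oB); last exact: Ck1_weak_grad.
by move=> i; apply: weak_partial_subset BA _; exact: (wgradP H).
Qed.

Lemma whess_classical A B u G D i j : open A -> open B -> B `<=` A -> Ck 2 B u ->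
  is_weak_grad A u G -> is_weak_hess A u D ->
  {ae leb2, forall x, B x -> D i j x = partial j (partial i u) x}.
Proof.
move=> oA oB BA C2 H HD.
have C1 := Ck_partial i C2.
have W := Ck1_weak_partial j oB C1.
apply: (weak_partial_unique oB _ W).
apply: (@weak_partial_aeL _ _ (coord i \o wgrad A u)) => //.
- by case: W.
- by apply: ae2S (wgrad_classical oA oB BA (CkS C2) H) => x E Bx; rewrite /= E // -coord_cgrad.
- exact: weak_partial_subset BA _.
Qed.

End WeakGradient.

Section RealIntegrable.
Context {R : realType} d (T : measurableType d) (m : {measure set T -> \bar R}).
Variables (D : set T) (f g : T -> R).
Hypothesis mD : measurable D.

Lemma integrable_subR : m.-integrable D (EFin \o f) -> m.-integrable D (EFin \o g) ->
  m.-integrable D (EFin \o (fun x => f x - g x)).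
Proof.
move=> fi gi; apply: (eq_integrable mD (fun x => ((f x)%:E - (g x)%:E)%E)) => //.
exact: integrableB.
Qed.

Lemma integrable_mulR (c : R) : m.-integrable D (EFin \o f) ->
  m.-integrable D (EFin \o (fun x => c * f x)).
Proof.
move=> fi; apply: (eq_integrable mD (fun x => (c%:E * (f x)%:E)%E)) => //.
exact: integrableZl.
Qed.

End RealIntegrable.

(** * Extension by zero as a limit of test functions *)

Section Convolution.
Context {R : realType}.
Local Notation T2 := (plane R).
Implicit Types (A B K : set (R * R)) (u v w phi : R * R -> R) (i j : 'I_2) (x y z : R * R).

Lemma integral_reflect x (F : T2 -> R) : measurable_fun setT F ->
  (\int[leb2]_z (F (x - z))%:E = \int[leb2]_z (F z)%:E)%E.
Proof.
move=> mF.
have E (z : T2) : aff2 x (-1, 0) (0, -1) z = (x - z : R * R).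
  by apply: injective_projections; rewrite /aff2 /=; ring.
have P (G : T2 -> \bar R) : measurable_fun setT G -> (forall z, 0 <= G z)%E ->
    (\int[leb2]_z (G (x - z)%R) = \int[leb2]_z (G z))%E.
  move=> mG G0; have := @affine_integral2 R x (-1, 0) (0, -1) G.
  have -> : ((-1, 0).1 * (0, -1).2 - (-1, 0).2 * (0, -1).1 : R) = 1.
    by rewrite /= mulrNN mulr1 mulr0 subr0.
  rewrite normr1 invr1 mul1e oner_eq0 => /(_ isT mG G0) <-.
  by apply: eq_integral => z _; rewrite E.
rewrite integralE [RHS]integralE; congr (_ - _)%E.
  transitivity (\int[leb2]_z ((EFin \o F)^\+ (x - z)%R))%E; first by apply: eq_integral => z _; rewrite ?funeposE ?funenegE.
  apply: P; last by move=> z; exact: funepos_ge0.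
  by apply: measurable_funepos; exact/measurable_EFinP.
transitivity (\int[leb2]_z ((EFin \o F)^\- (x - z)%R))%E; first by apply: eq_integral => z _; rewrite ?funeposE ?funenegE.
apply: P; last by move=> z; exact: funeneg_ge0.
by apply: measurable_funeneg; exact/measurable_EFinP.
Qed.

Lemma measurable_reflect x (F : T2 -> R) : measurable_fun setT F ->
  measurable_fun setT (fun z : T2 => F (x - z : R * R)).
Proof.
move=> mF; have := measurableT_comp mF (@measurable_aff2 R x (-1, 0) (0, -1)).
apply: eq_measurable_fun => z _ /=; congr F.
by apply: injective_projections; rewrite /aff2 /=; ring.
Qed.

Lemma is_derive_quad u x (e : R * R) (m C : R) :
  (forall t, `|u (x + t *: e) - u x - t * m| <= C * t ^+ 2) -> is_derive x e u m.
Proof.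
move=> H.
have L : (fun h : R => h^-1 *: ((u \o shift x) (h *: e) - u x)) @ 0^' --> m.
  apply/cvgrPdist_le => eps e0; near=> t; have t0 : t != 0 by near: t; exact: nbhs_dnbhs_neq.
  rewrite /= (addrC _ x) /GRing.scale /=.
  rewrite (_ : m - _ = - (t^-1 * (u (x + t *: e) - u x - t * m))); last by field.
  rewrite normrN normrM normfV ler_pdivrMl ?normr_gt0 //.
  apply: le_trans (H t) _; rewrite -[t ^+ 2]real_normK ?num_real // expr2 mulrCA ler_wpM2l //.
  apply: (@le_trans _ _ ((`|C| + 1) * `|t|)).
    by rewrite ler_wpM2r //; apply: le_trans (ler_norm _) _; rewrite lerDl.
  rewrite -ler_pdivlMl ?ltr_pwDr //.
  near: t; apply: dnbhs0_le; rewrite mulr_gt0 ?invr_gt0 ?ltr_pwDr //.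
apply: DeriveDef; first by apply/cvg_ex; exists m.
exact/cvg_lim.
Unshelve. all: by end_near.
Qed.

Lemma lip_plane u (L : R) : (forall i x (t : R), `|u (x + t *: uv i) - u x| <= L * `|t|) ->
  forall x y, `|u x - u y| <= L * (`|x.1 - y.1| + `|x.2 - y.2|).
Proof.
move=> H x y.
have h1 := H 0 y (x.1 - y.1); have h2 := H 1 (y + (x.1 - y.1) *: uv 0) (x.2 - y.2).
rewrite (_ : u x - u y = (u (y + (x.1 - y.1) *: uv 0 + (x.2 - y.2) *: uv 1) -
    u (y + (x.1 - y.1) *: uv 0)) + (u (y + (x.1 - y.1) *: uv 0) - u y)).
  by apply: le_trans (ler_normD _ _) _; rewrite mulrDr addrC lerD.
rewrite (_ : y + _ + _ = x); first by ring.
by apply: injective_projections; rewrite /unitv /= /GRing.scale /=; ring.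
Qed.

Lemma lip_plane_cont u (L : R) : (forall x y, `|u x - u y| <= L * (`|x.1 - y.1| + `|x.2 - y.2|)) ->
  continuous u.
Proof.
move=> H x; apply/cvgrPdist_le => eps e0.
have L1 : 0 < `|L| + 1 by rewrite ltr_pwDr.
pose d := eps / (2 * (`|L| + 1)).
have d0 : 0 < d by rewrite divr_gt0 ?mulr_gt0.
near=> y; apply: le_trans (H _ _) _.
have [h1 h2] : ball (x : R * R) d y by near: y; exact: (nbhsx_ballx (x : R * R) d d0).
have h1' : `|x.1 - y.1| <= d := ltW h1; have h2' : `|x.2 - y.2| <= d := ltW h2.
apply: (@le_trans _ _ ((`|L| + 1) * (`|x.1 - y.1| + `|x.2 - y.2|))).
  by rewrite ler_wpM2r ?addr_ge0 //; apply: le_trans (ler_norm _) _; rewrite lerDl.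
apply: (@le_trans _ _ ((`|L| + 1) * (d + d))).
  by rewrite ler_wpM2l ?(ltW L1) // lerD.
by rewrite /d le_eqVlt; apply/orP; left; apply/eqP; field; lra.
Unshelve. all: by end_near.
Qed.

Lemma is_derive_coord i x : is_derive x (uv i) (coord i) 1.
Proof.
apply: is_derive_near_affine; near=> t.
by rewrite mulr1; have [->|->] := I2_cases i; rewrite /coord /unitv /= /GRing.scale /=; ring.
Unshelve. all: by end_near.
Qed.

Section TestBounds.
Variables (A : set (R * R)) (phi : R * R -> R).
Hypothesis tp : test_function A phi.

Lemma test_bound : exists C : R, 0 <= C /\ forall x, `|phi x| <= C.
Proof.
have [_ cS _] := tp; have [C [C0 HC]] := compact_bound cS (continuous_subspaceT (test_cont tp)).
exists C; split => // x; have [Sx|nS] := pselect (closure [set x | phi x != 0] x); first exact: HC.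
by rewrite test_out // normr0.
Qed.

Lemma test_derivable i x : derivable phi x (unitv i : R * R).
Proof. by have [Ck _ _] := tp; have [H _] := Ck 1; exact: (H [::]). Qed.

End TestBounds.

Lemma test_lip A phi : test_function A phi -> exists C : R, 0 <= C /\
  forall i x (t : R), `|phi (x + t *: uv i) - phi x| <= C * `|t|.
Proof.
move=> tp; have [C [C0 H]] := test_bound (test_partial 0 tp).
have [C' [C0' H']] := test_bound (test_partial 1 tp).
exists (C + C'); split; first by rewrite addr_ge0.
move=> i x t; apply: line_lip => s _; first exact: (test_derivable tp).
by have [->|->] := I2_cases i; [apply: le_trans (H _) _; rewrite lerDl|apply: le_trans (H' _) _; rewrite lerDr].
Qed.

Lemma test_quad A phi i : test_function A phi -> exists C : R, 0 <= C /\
  forall x (t : R), `|phi (x + t *: uv i) - phi x - t * partial i phi x| <= C * t ^+ 2.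
Proof.
move=> tp; have [C [C0 H]] := test_lip (test_partial i tp).
exists C; split => // x t.
pose u y := phi y - partial i phi x * coord i y.
have du y : is_derive y (uv i) u (partial i phi y - partial i phi x).
  have d1 := derivableP (@test_derivable _ _ tp i y).
  have d2 := is_derive_coord i y.
  apply: (is_derive_eq (is_deriveB d1 (is_deriveZ (partial i phi x) d2))).
  by rewrite /partial /GRing.scale /= mulr1.
have := @line_lip _ u x (uv i) t (C * `|t|).
rewrite (_ : u _ - u _ = phi (x + t *: uv i) - phi x - t * partial i phi x); last first.
  rewrite /u; have -> : coord i (x + t *: uv i) = coord i x + t.
    by have [->|->] := I2_cases i; rewrite /coord /unitv /= /GRing.scale /=; ring.
  ring.
rewrite -mulrA -expr2 real_normK ?num_real //; apply => s st; first by case: (du (x + s *: uv i)).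
case: (du (x + s *: uv i)) => _ ->; apply: le_trans (H i x s) _.
by rewrite ler_wpM2l.
Qed.

Section Conv.
Variables (w : R * R -> R) (M : R) (K : set (R * R)).
Hypothesis mw : measurable_fun setT (w : T2 -> R).
Hypothesis cK : compact K.
Hypothesis wM : forall x, K x -> `|w x| <= M.
Hypothesis w0 : forall x, ~ K x -> w x = 0.

(** The smooth factor carries the argument [x - z], so that every derivative falls on it. *)
Definition convol phi x : R := \int[leb2]_z (w z * phi (x - z)).

Let W : R := \int[leb2]_z `|w z|.

Lemma conv_le (q : R * R -> R) (C : R) : measurable_fun setT (q : T2 -> R) -> (forall z, `|q z| <= C) ->
  leb2.-integrable setT (EFin \o (w \* q)) /\ `|\int[leb2]_z (w z * q z)| <= C * W.
Proof.
move=> mq qC.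
have C0 : 0 <= C := le_trans (normr_ge0 _) (qC 0).
have iw : leb2.-integrable setT (EFin \o (fun z : T2 => `|w z|)).
  apply: (@integrable_bnd _ K M _ cK); first exact: measurableT_comp.
    by move=> x /wM; rewrite normr_id.
  by move=> x /w0 ->; rewrite normr0.
have iq : leb2.-integrable setT (EFin \o (w \* q)).
  apply: (@integrable_bnd _ K (M * C) _ cK); first exact: measurable_funM.
    move=> x Kx; rewrite /= normrM; apply: ler_pM => //; exact: wM.
  by move=> x /w0; rewrite /= => ->; rewrite mul0r.
split => //; apply: le_trans (le_normr_Rintegral _ iq) _ => //.
rewrite -RintegralZl //; apply: le_Rintegral => //.
- exact: integrable_norm.
- exact: integrable_mulR.
- by move=> z _; rewrite normrM mulrC ler_wpM2r.
Qed.

Lemma measurable_shiftr phi x : continuous phi -> measurable_fun setT (fun z : T2 => phi (x - z : R * R)).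
Proof. by move=> cp; apply: measurable_reflect; exact: continuous_measurable2. Qed.

Lemma conv_lip A phi : test_function A phi -> exists L : R, forall i x (t : R),
  `|convol phi (x + t *: uv i) - convol phi x| <= L * `|t|.
Proof.
move=> tp; have [C [C0 H]] := test_lip tp; have [C1 [C10 H1]] := test_bound tp.
exists (C * W) => i x t.
have cp := test_cont tp.
have [i1 _] := conv_le (measurable_shiftr (x + t *: uv i) cp) (fun z => H1 _).
have [i2 _] := conv_le (measurable_shiftr x cp) (fun z => H1 _).
rewrite /convol -RintegralB //.
have := @conv_le (fun z => phi (x + t *: uv i - z) - phi (x - z)) (C * `|t|).
case.
- by apply: measurable_funB; exact: measurable_shiftr.
- by move=> z; rewrite addrAC; exact: H.
- move=> _; rewrite mulrAC; apply: le_trans; apply: eqle.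
  by congr (`|_|); apply: eq_Rintegral => z _ /=; rewrite mulrBr.
Qed.

Lemma conv_cont A phi : test_function A phi -> continuous (convol phi).
Proof. by move=> /conv_lip[L H]; apply: lip_plane_cont; exact: lip_plane H. Qed.

(** The Taylor remainder of [phi] is quadratic in [t] uniformly in the point, so it stays quadratic
    after integration against [w]. *)
Lemma is_derive_conv A phi i x : test_function A phi ->
  is_derive x (uv i) (convol phi) (convol (partial i phi) x).
Proof.
move=> tp; have [C [C0 H]] := test_quad i tp.
have [C1 [C10 H1]] := test_bound tp; have [C2 [C20 H2]] := test_bound (test_partial i tp).
apply: (@is_derive_quad _ _ _ _ (C * W)) => t.
have cp := test_cont tp; have cp' := test_cont (test_partial i tp).
have [i1 _] := conv_le (measurable_shiftr (x + t *: uv i) cp) (fun z => H1 _).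
have [i2 _] := conv_le (measurable_shiftr x cp) (fun z => H1 _).
have [i3 _] := conv_le (measurable_shiftr x cp') (fun z => H2 _).
have := @conv_le (fun z => phi (x + t *: uv i - z) - phi (x - z) - t * partial i phi (x - z)) (C * t ^+ 2).
case.
- apply: measurable_funB; first by apply: measurable_funB; exact: measurable_shiftr.
  by apply: measurable_funM => //; exact: measurable_shiftr.
- by move=> z; rewrite (addrAC x); exact: H.
- move=> _; rewrite mulrAC; apply: le_trans; apply: eqle; congr (`|_|).
  rewrite /convol -RintegralZl // -RintegralB // -RintegralB //; last 2 first.
  + exact: integrable_subR.
  + exact: integrable_mulR.
  by apply: eq_Rintegral => z _ /=; ring.
Qed.

Lemma partials_conv phi s : test_function setT phi -> partials s (convol phi) = convol (partials s phi).
Proof.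
(* The induction peels the last index because that one is the innermost derivative, the first to
   reach the convolution. *)
elim/last_ind: s phi => // s i IH phi tp.
rewrite -!partials_rcons -IH; last exact: test_partial.
by congr partials; apply/funext => x; case: (is_derive_conv i x tp).
Qed.

Lemma test_partials phi s : test_function setT phi -> test_function setT (partials s phi).
Proof. by elim: s => // i s IH /IH; exact: test_partial. Qed.

Lemma Ck_conv phi k : test_function setT phi -> Ck k setT (convol phi).
Proof.
move=> tp; split => s _.
  move=> i x _; rewrite partials_conv //.
  by case: (is_derive_conv i x (test_partials s tp)).
by rewrite partials_conv //; apply: continuous_subspaceT; exact: conv_cont (test_partials s tp).
Qed.

Lemma conv_swap phi x : continuous phi -> convol phi x = \int[leb2]_z (w (x - z) * phi z).
Proof.
move=> cp; rewrite /convol /Rintegral; congr fine.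
have mF : measurable_fun setT (fun z : T2 => w z * phi (x - z : R * R)).
  by apply: measurable_funM => //; exact: measurable_shiftr.
rewrite -(integral_reflect x mF); apply: eq_integral => z _; congr (_ * phi _)%:E.
by rewrite opprB addrC subrK.
Qed.

End Conv.
End Convolution.

(** * Modulars and the Luxemburg norm *)

Section Modular.
Context {R : realType}.
Local Notation T2 := (plane R).
Implicit Types (A B K : set (R * R)) (u v w phi p : R * R -> R).

Lemma measurable_powR2 d (T : measurableType d) (D : set T) (a r : T -> R) : measurable D ->
  measurable_fun D a -> measurable_fun D r -> measurable_fun D (fun x => a x `^ r x).
Proof.
move=> mD ma mr; rewrite /powR; apply: measurable_fun_if => //.
- exact: measurable_fun_eqr.
- apply: (measurable_funS mD); first by move=> x [].
  apply: (@eq_measurable_fun _ _ _ _ _ (fun x => if r x == 0 then (1 : R) else (0 : R))).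
    by move=> x _; case: ifP.
  by apply: measurable_fun_if => //; exact: measurable_fun_eqr.
- apply: (measurable_funS mD); first by move=> x [].
  apply: measurableT_comp; first exact: measurable_expR.
  by apply: measurable_funM => //; apply: measurableT_comp => //; exact: measurable_ln.
Qed.

(** The right-hand side is free of the exponent, so it can dominate an integrand whose exponent
    varies. *)
Lemma powR_itv (B r : R) : 0 <= B -> 1 <= r <= 2 -> B `^ r <= B + B ^+ 2.
Proof.
move=> B0 /andP[r1 r2].
have [B1|B1] := leP 1 B.
  apply: (@le_trans _ _ (B `^ 2)); first exact: ler_powR.
  by rewrite powR_mulrn // lerDr.
apply: (@le_trans _ _ B); last by rewrite lerDl sqr_ge0.
have [->|Bn0] := eqVneq B 0; first by rewrite powR0 //; apply: lt0r_neq0; exact: lt_le_trans r1.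
have B0' : 0 < B by rewrite lt_neqAle eq_sym Bn0.
rewrite -[leRHS](powRr1 B0); apply: ger_powR => //.
by rewrite B0' ltW.
Qed.

Lemma measurable_enorm d (T : measurableType d) (D : set T) (G : T -> R * R) :
  measurable_fun D (fst \o G) -> measurable_fun D (snd \o G) ->
  measurable_fun D (fun x => enorm (G x)).
Proof.
move=> m1 m2; rewrite /enorm /dot.
apply: (@measurableT_comp _ _ _ _ _ _ (@Num.sqrt R)).
  apply: continuous_measurable_fun; exact: sqrt_continuous.
by apply: measurable_funD; exact: measurable_funM.
Qed.

Section OnDomain.
Variables (A : set (R * R)) (p : R * R -> R).
Hypothesis mA : meas2 A.
Hypothesis Afin : (leb2 (A : set T2) < +oo)%E.
Hypothesis mp : mfun2 A p.
Hypothesis p12 : forall x, A x -> 1 <= p x <= 2.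

Lemma measurable_modular u : mfun2 A u ->
  measurable_fun (A : set T2) (fun x : T2 => `|u x| `^ p x).
Proof. by move=> m; apply: measurable_powR2 => //; exact: measurableT_comp. Qed.

Lemma modular_ae u v : mfun2 A u ->
  mfun2 A v ->
  {ae leb2, forall x : T2, A x -> u x = v x} -> modular A p u = modular A p v.
Proof.
move=> um vm E; apply: ae_eq_integral => //.
- by apply/measurable_EFinP; exact: measurable_modular.
- by apply/measurable_EFinP; exact: measurable_modular.
- by apply: ae2S E => x Ex Ax; rewrite Ex.
Qed.

Lemma integrable_bounded (C : R) (f : T2 -> R) : measurable_fun (A : set T2) f ->
  (forall x, A x -> `|f x| <= C) -> leb2.-integrable (A : set T2) (EFin \o f).
Proof.
move=> mf fC; apply: measurable_bounded_integrable => //.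
by exists C; split; [exact: num_real|move=> y Cy x Ax; apply: le_trans (fC _ Ax) _; exact: ltW].
Qed.

Lemma modular_le u (B : R) x : A x -> `|u x| <= B -> `|u x| `^ p x <= B + B ^+ 2.
Proof.
move=> Ax uB; have B0 := le_trans (normr_ge0 _) uB.
apply: le_trans (powR_itv (normr_ge0 _) (p12 Ax)) _.
by rewrite lerD // lerXn2r // nnegrE.
Qed.

Lemma modular_bounded u (B : R) : mfun2 A u ->
  (forall x, A x -> `|u x| <= B) -> Lp A p u.
Proof.
move=> um uB; split => //; rewrite /modular.
have : leb2.-integrable (A : set T2) (EFin \o (fun x => `|u x| `^ p x)).
  apply: (@integrable_bounded (B + B ^+ 2)); first exact: measurable_modular.
  by move=> x Ax; rewrite ger0_norm ?powR_ge0 // modular_le // uB.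
move=> /integrableP[_]; rewrite (_ : (\int[leb2]_(x in A) _)%E = (\int[leb2]_(x in A) (`|u x| `^ p x)%:E)%E) //.
by apply: eq_integral => x _ /=; rewrite ger0_norm ?powR_ge0.
Qed.

Lemma Lp_ae u v (B : R) : mfun2 A u -> mfun2 A v ->
  {ae leb2, forall x : T2, A x -> u x = v x} -> (forall x, A x -> `|v x| <= B) -> Lp A p u.
Proof.
move=> um vm E vB; split => //; rewrite (modular_ae um vm E).
by case: (modular_bounded vm vB).
Qed.

Lemma Lp_norm_ae u v : mfun2 A u ->
  mfun2 A v ->
  {ae leb2, forall x : T2, A x -> u x = v x} -> (Lp_norm A p u <= Lp_norm A p v)%E.
Proof.
move=> um vm E.
have H k : modular A p (fun x => (u x / k)%R) = modular A p (fun x => (v x / k)%R).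
  apply: modular_ae; first exact: measurable_funM.
    exact: measurable_funM.
  by apply: ae2S E => x Ex Ax; rewrite Ex.
apply: le_ereal_inf => z [k [k0 Hk] <-]; exists k; last by [].
by split; [exact: k0|rewrite H; exact: Hk].
Qed.

Lemma Lp_norm_le u (k : R) : 0 < k -> (modular A p (fun x => (u x / k)%R) <= 1)%E -> (Lp_norm A p u <= k%:E)%E.
Proof. by move=> k0 H; apply: ereal_inf_lbound; exists k. Qed.

(** Dominated convergence makes the modulars of [e n / k] tend to 0; once they are at most 1 the
    Luxemburg norm is at most [k]. *)
Lemma Lp_norm_cvg (e : nat -> R * R -> R) (B k : R) : 0 < k ->
  (forall n, mfun2 A (e n)) ->
  (forall n x, A x -> `|e n x| <= B) ->
  {ae leb2, forall x : T2, A x -> e n x @[n --> \oo] --> (0 : R)} ->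
  \forall n \near \oo, (Lp_norm A p (e n) <= k%:E)%E.
Proof.
move=> k0 me eB e0.
have [] := @DCT2 _ A (fun n x => `|e n x / k| `^ p x) (fun=> 0) (fun=> B / k + (B / k) ^+ 2) mA.
- move=> n; apply: measurable_modular; exact: measurable_funM.
- exact: measurable_cst.
- apply: ae2S e0 => x H Ax; have p1 : 1 <= p x by case/andP: (p12 Ax).
  apply: (@squeeze_cvgr _ _ _ _ (fun=> 0) (fun n => `|e n x / k| + `|e n x / k| ^+ 2)).
  + apply: nearW => n; rewrite powR_ge0 /=; apply: powR_itv => //; exact: p12.
  + exact: cvg_cst.
  + have H1 : `|e n x / k| @[n --> \oo] --> (0 : R).
      by rewrite -[X in _ --> X](@normr0 _ R) -(mul0r k^-1); apply: cvg_norm; apply: cvgMl; exact: H.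
    rewrite -[X in _ --> X]addr0; apply: cvgD => //.
    rewrite -[X in _ --> X](mulr0 (0 : R)); exact: (cvgM H1 H1).
- apply: (@integrable_bounded (`|B / k + (B / k) ^+ 2|)) => //.
- move=> n x Ax; rewrite ger0_norm ?powR_ge0 //.
  apply: (@modular_le (fun x => e n x / k)) => //.
  rewrite normrM normfV (gtr0_norm k0); apply: ler_pM; rewrite ?invr_ge0 ?(ltW k0) //; exact: eB.
move=> _; rewrite integral0 => H.
have /fine_cvgP[Hf Hc] : (\int[leb2]_(x in A) (`|e n x / k| `^ p x)%:E)%E @[n --> \oo] --> (0 : R)%:E by [].
near=> n; apply: Lp_norm_le => //.
have fn : (\int[leb2]_(x in A) (`|e n x / k| `^ p x)%:E)%E \is a fin_num by near: n.
rewrite /modular -(fineK fn) lee_fin.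
near: n; move/cvgrPdist_le: Hc => /(_ 1 ltr01); apply: filterS => n /=.
by rewrite sub0r normrN; apply: le_trans; exact: ler_norm.
Unshelve. all: by end_near.
Qed.

End OnDomain.
End Modular.

(** * Soft thresholding and mollifiers *)

Section Soft.
Context {R : realType}.
Local Notation T2 := (plane R).

(** It vanishes on [[-d, d]], so that [soft d v] is supported where [|v| >= d]; it is 1-Lipschitz,
    so Lipschitz constants survive; and it is a translation on each side of [[-d, d]], so increments
    away from 0 are exact. *)
Definition soft (d s : R) : R := if d < s then s - d else if s < - d then s + d else 0.

Lemma soft_lip (d s t : R) : 0 <= d -> `|soft d s - soft d t| <= `|s - t|.
Proof.
move=> d0; have n1 := ler_norm (s - t); have n2 := ler_norm (- (s - t)); rewrite normrN in n2.
rewrite ler_norml /soft; apply/andP; split;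
case: (ltP d s) => h1; case: (ltP d t) => h2; case: (ltP s (- d)) => h3; case: (ltP t (- d)) => h4 /=; lra.
Qed.

Lemma soft_dist (d s : R) : 0 <= d -> `|soft d s - s| <= d.
Proof.
move=> d0; rewrite ler_norml /soft; apply/andP; split;
case: (ltP d s) => h1; case: (ltP s (- d)) => h3 /=; lra.
Qed.

Lemma soft_small (d s : R) : `|s| <= d -> soft d s = 0.
Proof. by rewrite ler_norml /soft => /andP[h1 h2]; case: ltP => h3; [lra|]; case: ltP => h4 //; lra. Qed.

Lemma soft_norm (d s : R) : 0 <= d -> `|soft d s| <= `|s|.
Proof. by move=> d0; have := soft_lip s 0 d0; rewrite (soft_small (s := 0)) ?normr0 // !subr0. Qed.

Lemma soft_diff (d s t : R) : (d < s /\ d < t) \/ (s < - d /\ t < - d) -> 0 <= d ->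
  soft d s - soft d t = s - t.
Proof.
move=> H d0; rewrite /soft; case: (ltP d s) => h1; case: (ltP d t) => h2; case: (ltP s (- d)) => h3;
case: (ltP t (- d)) => h4 /=; case: H => -[]; lra.
Qed.

(** The product of two humps has positive integral because it is positive on an open square, which
    is not a null set; [c] is the inverse of that integral. *)
Lemma mollifier (e : R) : 0 < e -> exists (psi : R * R -> R) (c : R),
  [/\ test_function setT psi, 0 < c, forall x, 0 <= psi x,
      \int[leb2]_z (c * psi z) = 1 &
      forall z, psi z != 0 -> `|z.1| <= e /\ `|z.2| <= e].
Proof.
move=> e0.
pose f : R -> R := hump 1 (- e) e.
have f0 t : 0 <= f t by have /andP[] := hump_itv 1 (- e) e t.
have f1 t : f t <= 1 by have /andP[] := hump_itv 1 (- e) e t.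
have fsup t : f t != 0 -> `|t| <= e.
  move=> ft; rewrite ler_norml -!(rwP andP); have := hump_gt0 1 (- e) e t.
  by rewrite lt0r ft f0 => /esym/andP[/ltW -> /ltW ->].
pose psi := tensor f f.
have tp : test_function setT psi.
  by apply: (@test_tensor _ setT f f (- e) e (- e) e); [exact: hump_smooth|exact: hump_smooth|exact: hump_out|exact: hump_out|].
have psup z : psi z != 0 -> `|z.1| <= e /\ `|z.2| <= e.
  by rewrite /psi /tensor mulf_eq0 negb_or => /andP[/fsup ? /fsup ?].
have psi0 x : 0 <= psi x by rewrite mulr_ge0.
have cp := test_cont tp.
have ip : leb2.-integrable setT (EFin \o psi).
  have [K [cK KE]] : exists K : set (R * R), compact K /\ forall z, psi z != 0 -> K z.
    exists (`[- e, e] `*` `[- e, e]); split; first exact: compact_rect.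
    by move=> z /psup[]; rewrite !ler_norml /= !in_itv.
  apply: (@integrable_bnd _ K 1 _ cK); first exact: continuous_measurable2.
    by move=> x _; rewrite ger0_norm // /psi /tensor mulr_ile1.
  by move=> x nK; apply/eqP; apply: contrapT => /negP /KE.
have Ip : 0 < \int[leb2]_z psi z.
  rewrite lt0r Rintegral_ge0 // andbT; apply/negP => /eqP I0.
  have : (\int[leb2]_z (psi z)%:E = 0)%E.
    by rewrite -(fineK (integral_fune_fin_num measurableT ip)) -[fine _]/(\int[leb2]_z psi z) I0.
  have mp : measurable_fun setT (fun z : T2 => (psi z)%:E) by apply/measurable_EFinP; exact: continuous_measurable2.
  move=> H; have := (ae_eq_integral_abs leb2 measurableT mp).1.
  case; first by rewrite -[RHS]H; apply: eq_integral => z _; rewrite gee0_abs // lee_fin.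
  move=> N [mN N0 NE].
  pose Q : set T2 := `]- e, e[ `*` `]- e, e[.
  have : (leb2 Q <= leb2 N)%E.
    apply: le_measure; rewrite ?inE //; first exact: measurable_rect.
    move=> z [/= z1 z2]; apply: NE => /= /(_ I) [] /eqP; apply/negP.
    rewrite lt0r_neq0 // /psi /tensor mulr_gt0 // hump_gt0; [move: z1|move: z2]; by rewrite in_itv.
  rewrite N0 /Q leb2X //.
  rewrite !lebesgue_measure_itv /= !lte_fin gtrN // -EFinM lee_fin -expr2 real_exprn_even_le0 ?num_real //=.
  by rewrite opprK; lra.
exists psi, (\int[leb2]_z psi z)^-1; split => //; first by rewrite invr_gt0.
by rewrite RintegralZl // mulVf // lt0r_neq0.
Qed.

End Soft.

(** * The extension by zero of a finite element function *)

Section Density.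
Context {R : realType}.
Local Notation T2 := (plane R).
Implicit Types (A B K : set (R * R)) (u v w phi : R * R -> R) (i j : 'I_2) (x y z : R * R).

Lemma compact_bounded2 (K : set (R * R)) : bounded_set K -> closed K -> compact K.
Proof.
move=> bK cK; have [M HM] := bounded_leb2 bK.
apply: (@subclosed_compact _ _ (`[- M, M] `*` `[- M, M])) => //; first exact: compact_rect.
by move=> x /HM[]; rewrite /= !in_itv /= !ler_norml.
Qed.

Lemma ball2_small (x z : R * R) (r : R) : 0 < r -> `|z.1| <= r / 2 -> `|z.2| <= r / 2 -> ball x r (x + z : R * R).
Proof.
move=> r0 h1 h2; apply: ball2 => /=; rewrite opprD addrA subrr add0r normrN;
  by apply: le_lt_trans (_ : r / 2 < r); rewrite // ltr_pdivrMr // ltr_pMr // ltr1n.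
Qed.

(** Turns a bound on small increments into a bound on the derivative; this is how increments of the
    thresholded function control the derivatives of its mollification. *)
Lemma is_derive_dist u x (e : R * R) (l m eta t0 : R) : is_derive x e u l -> 0 < t0 ->
  (forall t, `|t| <= t0 -> `|u (x + t *: e) - u x - t * m| <= eta * `|t|) -> `|l - m| <= eta.
Proof.
move=> D t00 H; have C := derive_seq (lt0r_neq0 t00) D.
apply/ler_addgt0Pr => eps eps0; move/cvgrPdist_le: C => /(_ _ eps0) [n _ /(_ n (leqnn n)) /=].
set t := t0 / _ => h.
have t_ge0 : 0 < t by rewrite divr_gt0 // ltr0n.
have := H t; rewrite gtr0_norm // ler_divS // => /(_ isT) h2.
have -> : l - m = (l - t^-1 * (u (x + t *: e) - u x)) + t^-1 * (u (x + t *: e) - u x - t * m).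
  by field; exact: lt0r_neq0.
rewrite addrC; apply: le_trans (ler_normD _ _) _; rewrite lerD //.
by rewrite normrM normfV (gtr0_norm t_ge0) ler_pdivrMl //; apply: le_trans h2 _; rewrite mulrC.
Qed.

Section Ext.
Variables (Omega : set (R * R)) (sigma h : R) (T : set (@triangle R)).
Hypothesis tr : triangulation Omega sigma h T.
Hypothesis bO : bounded_set Omega.
Variable v : R * R -> R.
Hypothesis Sv : Sh0 T v.

Definition ext0 x : R := if x \in polygon T then v x else 0.

Lemma ext0_in x : polygon T x -> ext0 x = v x.
Proof. by rewrite /ext0 => /mem_set ->. Qed.

Lemma ext0_out x : ~ polygon T x -> ext0 x = 0.
Proof. by rewrite /ext0 => nx; case: ifPn => // /set_mem. Qed.

Lemma ext0_closedt k x : T k -> closedt k x -> ext0 x = v x.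
Proof.
move=> Tk kx; have [Px|nP] := pselect (polygon T x); first exact: ext0_in.
rewrite ext0_out //; case: Sv => _ -> //; split; first exact: (closedt_polygon tr Tk kx).
by move=> /interior_subset.
Qed.

(** The closed triangles and the complement of the polygon cover every line. On each of them the
    extension is affine or zero; the pieces agree where they meet since [v] vanishes on the
    boundary. *)
Lemma ext0_lip : exists L : R, 0 <= L /\ forall i x (t : R),
  `|ext0 (x + t *: uv i) - ext0 x| <= L * `|t|.
Proof.
have [L0 [L00 H0]] := pslope_bound tr 0 v; have [L1 [L10 H1]] := pslope_bound tr 1 v.
exists (L0 + L1); split; first by rewrite addr_ge0.
have HL i k : T k -> `|pslope i v k| <= L0 + L1.
  move=> Tk; have [->|->] := I2_cases i.
    by apply: le_trans (H0 k Tk) _; rewrite lerDl.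
  by apply: le_trans (H1 k Tk) _; rewrite lerDr.
move=> i x t; have [s Hs] := tr_list tr.
apply: (@line_lip_cover _ (~` polygon T :: map (@closedt R) s)).
- move=> C [<-|/List_In_map[k ks <-]]; last exact: closedt_closed.
  by apply: open_closedC; exact: polygon_open.
- move=> q _; have [Px|nP] := pselect (polygon T (x + q *: uv i)).
    have [k Tk kx] := polygon_sub tr Px.
    by exists (closedt k) => //; right; apply/List_In_map; exists k => //; exact/Hs.
  by exists (~` polygon T) => //; left.
- move=> C y q [<-|/List_In_map[k /Hs Tk <-]] Cy Cyq.
    by rewrite !ext0_out // subrr normr0 mulr_ge0 // addr_ge0.
  rewrite !(ext0_closedt Tk) // (Sh_incr tr _ Tk Cy Cyq); last by case: Sv.
  by rewrite normrM mulrC ler_wpM2r // HL.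
Qed.

Lemma ext0_cont : continuous ext0.
Proof. by have [L [_ H]] := ext0_lip; apply: lip_plane_cont; exact: lip_plane H. Qed.

Lemma ext0_slope i k x z : T k -> closedt k x -> closedt k z -> forall t : R, z = x + t *: uv i ->
  ext0 z - ext0 x = t * pslope i v k.
Proof.
move=> Tk kx kz t zE; rewrite !(ext0_closedt Tk) // zE (Sh_incr tr _ Tk kx) -?zE //; by case: Sv.
Qed.

Lemma ext0_derive i : {ae leb2, forall x : T2, is_derive (x : R * R) (uv i) ext0 (pgrad T i v x)}.
Proof.
apply: ae2S (mesh_ae tr) => x Hx; apply: is_derive_near_affine.
have lc : {for (0 : R), continuous (fun t : R => (x : R * R) + t *: uv i)}.
  by apply: cvgD; [exact: cvg_cst|apply: cvgZr_tmp; exact: cvg_id].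
have [Ux|nU] := pselect (union_closed T x).
  have [k Tk kx] := Hx Ux.
  have oP := opent_open (tr_dt tr Tk).
  have : \forall t \near (0 : R), opent k ((x : R * R) + t *: uv i).
    by apply: lc; rewrite scale0r addr0; exact: open_nbhs_nbhs.
  apply: filterS => t kt; rewrite (pgradE tr _ _ Tk kx); apply: ext0_slope => //; apply: (opent_sub (tr_dt tr Tk)) => //.
have oU : open (~` union_closed T) by rewrite openC; exact: union_closed_closed tr.
have : \forall t \near (0 : R), (~` union_closed T) ((x : R * R) + t *: uv i).
  by apply: lc; rewrite scale0r addr0; exact: open_nbhs_nbhs.
apply: filterS => t nt.
rewrite pgrad_out ?mulr0; last by move=> [k Tk kx]; apply: nU; exists k => //; exact: (opent_sub (tr_dt tr Tk)).
by rewrite !ext0_out ?subrr // => /(polygon_sub tr).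
Qed.

Lemma ext0_weak_partial A i : open A -> weak_partial A i ext0 (pgrad T i v).
Proof.
move=> oA; have mA := open_measurable2 oA; apply: lip_weak_partial => //.
- by apply: continuous_measurable2; exact: ext0_cont.
- exact: (measurable_pgrad tr).
- move=> K cK KA; have [M [_ HM]] := compact_bound cK (continuous_subspaceT ext0_cont).
  by exists M.
- move=> K cK KA; have [r r0 Hr] := near_line i oA cK KA.
  have [L [L0 HL]] := ext0_lip; exists r, L; split => // x t Kx tr'; split; first exact: Hr.
  exact: HL.
- by apply: ae2S (ext0_derive i) => x.
Qed.

Definition pgrad2 x : R * R := (pgrad T 0 v x, pgrad T 1 v x).

Lemma ext0_weak_grad A : open A -> is_weak_grad A ext0 pgrad2.
Proof.
move=> oA i; rewrite (_ : coord i \o pgrad2 = pgrad T i v); first exact: ext0_weak_partial.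
by apply/funext => x; have [->|->] := I2_cases i.
Qed.

End Ext.
End Density.

(** * Mollified soft thresholdings *)

Section Approximation.
Context {R : realType}.
Local Notation T2 := (plane R).
Implicit Types (A B K : set (R * R)) (u w phi : R * R -> R) (i j : 'I_2) (x y z : R * R).

Lemma average_le (rho g : R * R -> R) (eta : R) : measurable_fun setT (rho : T2 -> R) ->
  measurable_fun setT (g : T2 -> R) -> leb2.-integrable setT (EFin \o (rho : T2 -> R)) ->
  (forall z, 0 <= rho z) -> \int[leb2]_z rho z = 1 -> (forall z, rho z != 0 -> `|g z| <= eta) ->
  leb2.-integrable setT (EFin \o (fun z : T2 => g z * rho z)) /\ `|\int[leb2]_z (g z * rho z)| <= eta.
Proof.
move=> mr mg ir r0 r1 H.
have B z : `|g z * rho z| <= eta * rho z.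
  have [->|rz] := eqVneq (rho z) 0; first by rewrite !mulr0 normr0.
  by rewrite normrM (ger0_norm (r0 z)) ler_wpM2r // H.
have ie := integrable_mulR measurableT eta ir.
have ig : leb2.-integrable setT (EFin \o (fun z : T2 => g z * rho z)).
  apply: le_integrable ie => //; first by apply/measurable_EFinP; exact: measurable_funM.
  by move=> z _ /=; rewrite lee_fin; apply: le_trans (B z) _; exact: ler_norm.
split => //; apply: le_trans (le_normr_Rintegral _ ig) _ => //.
rewrite -[leRHS]mulr1 -r1 -RintegralZl //; apply: le_Rintegral => //.
exact: integrable_norm.
Qed.

Section Ext.
Variables (Omega : set (R * R)) (sigma h : R) (T : set (@triangle R)).
Hypothesis tr : triangulation Omega sigma h T.
Hypothesis bO : bounded_set Omega.
Hypothesis oO : open Omega.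
Variable v : R * R -> R.
Hypothesis Sv : Sh0 T v.
Local Notation vb := (ext0 T v).

Lemma level_compact (r : R) : 0 < r -> compact [set x | r <= `|vb x|] /\ [set x | r <= `|vb x|] `<=` polygon T.
Proof.
move=> r0; have sub : [set x | r <= `|vb x|] `<=` polygon T.
  move=> x /= rx; apply: contrapT => /(@ext0_out _ _ v) E.
  by move: rx; rewrite E normr0 leNgt r0.
split => //; apply: compact_bounded2.
  case: bO => M [Mr HM]; exists M; split => // M' /HM H x /sub /(tr_sub tr); exact: H.
rewrite (_ : [set _ | _] = (fun x => `|vb x|) @^-1` [set y | r <= y]) //.
apply: preimage_closedT; first exact: closed_ge.
by move=> x; apply: cvg_norm; exact: (ext0_cont tr Sv).
Qed.

(** The function is the mollification of the soft thresholding at level [r]. Its values and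
    derivatives are averages over shifts [z] of size at most [r], so any bound that is uniform in
    such shifts passes to it; this is the form of the last two clauses. *)
Lemma ext0_approx (r : R) : 0 < r -> exists phi, [/\ test_function (polygon T) phi,
   forall x (a eta : R), (forall z, `|z.1| <= r -> `|z.2| <= r -> `|vb (x - z) - a| <= eta) ->
     `|phi x - a| <= eta + r &
   forall i x (m eta t0 : R), 0 < t0 ->
     (forall z t, `|z.1| <= r -> `|z.2| <= r -> `|t| <= t0 ->
       `|soft r (vb (x - z + t *: uv i)) - soft r (vb (x - z)) - t * m| <= eta * `|t|) ->
     `|partial i phi x - m| <= eta].
Proof.
move=> r0; have [cK KP] := level_compact r0; set K := [set x | _] in cK KP.
have [e0 e00 He0] := compact_ball_sub (@polygon_open _ T) cK KP.
(* [e <= r] limits the shifts in the averages, and [e <= e0 / 2] keeps the support inside the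
   polygon. *)
pose e := Num.min r (e0 / 2).
have e_gt0 : 0 < e by rewrite lt_min r0 divr_gt0.
have e_r : e <= r by rewrite ge_min lexx.
have e_e0 : e <= e0 / 2 by rewrite ge_min lexx orbT.
have [psi [c [tpsi c0 psi0 Ipsi psup]]] := mollifier e_gt0.
have cpsi := test_cont tpsi.
have [M [M0 HM]] := compact_bound cK (continuous_subspaceT (ext0_cont tr Sv)).
have vbM x : `|vb x| <= M + r.
  have [rx|/ltW xr] := leP r `|vb x|; last by apply: le_trans xr _; rewrite lerDr.
  by apply: le_trans (HM x rx) _; rewrite lerDl (ltW r0).
pose vd x := soft r (vb x).
have vd0 x : ~ K x -> vd x = 0.
  by move=> nK; apply: soft_small; rewrite leNgt; apply/negP => /ltW.
have vdM x : `|vd x| <= M + r by apply: le_trans (soft_norm _ (ltW r0)) _.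
have cvd : continuous vd.
  have [L [L0 HL]] := ext0_lip tr Sv; apply: (@lip_plane_cont _ _ L); apply: lip_plane => i x t.
  by apply: le_trans (soft_lip _ _ (ltW r0)) _; exact: HL.
have mvd : measurable_fun setT (vd : T2 -> R) by exact: continuous_measurable2.
pose w x := c * vd x.
have mw : measurable_fun setT (w : T2 -> R) by exact: measurable_funM.
have wM x : K x -> `|w x| <= c * (M + r) by move=> _; rewrite normrM (gtr0_norm c0) ler_wpM2l // (ltW c0).
have w0 x : ~ K x -> w x = 0 by move=> /vd0 E; rewrite /w E mulr0.
pose rho z := c * psi z.
have mrho : measurable_fun setT (rho : T2 -> R) by apply: measurable_funM => //; exact: continuous_measurable2.
have rho0 z : 0 <= rho z by rewrite mulr_ge0 // ltW.
have rsup z : rho z != 0 -> `|z.1| <= e /\ `|z.2| <= e.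
  by rewrite mulf_eq0 negb_or => /andP[_]; exact: psup.
have irho : leb2.-integrable setT (EFin \o (rho : T2 -> R)).
  have [C [C0 HC]] := test_bound tpsi.
  apply: (@integrable_bnd _ (`[- e, e] `*` `[- e, e]) (c * C)) => //; first exact: compact_rect.
    by move=> x _; rewrite normrM (gtr0_norm c0) ler_wpM2l // (ltW c0).
  move=> x nx; apply/eqP; apply: contrapT => /negP /rsup[h1 h2]; apply: nx.
  by split; rewrite /= in_itv /= -ler_norml.
have mvdx x : measurable_fun setT (fun z : T2 => vd (x - z : R * R)) by exact: measurable_reflect.
pose phi := convol w psi.
have phiE x : phi x = \int[leb2]_z (vd (x - z) * rho z).
  rewrite /phi conv_swap //; apply: eq_Rintegral => z _; rewrite /w /rho; ring.
have ivd x := (average_le mrho (mvdx x) irho rho0 Ipsi (fun z _ => vdM _)).1.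
pose S := thick (thick K (uv 0) e) (uv 1) e.
have cS : compact S by do 2 apply: thick_compact.
have supS x : phi x != 0 -> S x.
  move=> px; apply: contrapT => nS; case/negP: px; apply/eqP; rewrite phiE.
  rewrite /Rintegral integral0_eq // => z _; congr EFin.
  have [->|/rsup[z1 z2]] := eqVneq (rho z) 0; first by rewrite mulr0.
  rewrite vd0 ?mul0r // => Kxz; apply: nS.
  exists (x - z + z.1 *: uv 0).
    by exists (x - z) => //; exists z.1 => //; rewrite /= in_itv /= -ler_norml.
  exists z.2; first by rewrite /= in_itv /= -ler_norml.
  by apply: injective_projections; rewrite /unitv /= /GRing.scale /=; ring.
have SP : S `<=` polygon T.
  move=> x [y [y0 Ky0 [t /=]]]; rewrite in_itv /= -ler_norml => te <- [s /=].
  rewrite in_itv /= -ler_norml => se <-; apply: (He0 _ Ky0); rewrite -addrA.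
  apply: ball2_small => //; rewrite /unitv /= /GRing.scale /= ?mulr1 ?mulr0 ?addr0 ?add0r; exact: le_trans e_e0.
have clS : closure [set x | phi x != 0] `<=` S.
  rewrite [X in _ `<=` X](closure_id _).1; last by apply: compact_closed => //; exact: norm_hausdorff.
  by apply: closure_subset => x; exact: supS.
exists phi; split.
- split; [|by apply: (@subclosed_compact _ _ S) => //; exact: closed_closure|exact: subset_trans SP].
  by move=> k; apply: (Ck_conv mw cK wM w0).
- move=> x a eta H.
  have mg : measurable_fun setT (fun z : T2 => vd (x - z : R * R) - a) by apply: measurable_funB.
  have bg z : rho z != 0 -> `|vd (x - z) - a| <= eta + r.
    move=> /rsup[z1 z2]; have := H z (le_trans z1 e_r) (le_trans z2 e_r).
    have := soft_dist (vb (x - z)) (ltW r0); rewrite /vd => h1 h2.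
    rewrite (_ : _ - a = (soft r (vb (x - z)) - vb (x - z)) + (vb (x - z) - a)); last by ring.
    by apply: le_trans (ler_normD _ _) _; rewrite addrC lerD.
  have [_] := average_le mrho mg irho rho0 Ipsi bg.
  under eq_Rintegral do rewrite mulrBl.
  rewrite RintegralB //; last exact: integrable_mulR.
  by rewrite RintegralZl // Ipsi mulr1 -phiE.
- move=> i x m eta t0 t00 H.
  have D := is_derive_conv mw cK wM w0 i x tpsi.
  have -> : partial i phi x = convol w (partial i psi) x by case: D.
  apply: (is_derive_dist D t00) => t tt0.
  have mg : measurable_fun setT (fun z : T2 => vd (x + t *: uv i - z : R * R) - vd (x - z : R * R) - t * m).
    by apply: measurable_funB => //; apply: measurable_funB.
  have bg z : rho z != 0 -> `|vd (x + t *: uv i - z) - vd (x - z) - t * m| <= eta * `|t|.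
    by move=> /rsup[z1 z2]; rewrite (addrAC x); apply: H => //; exact: le_trans e_r.
  have [_] := average_le mrho mg irho rho0 Ipsi bg.
  apply: le_trans; apply: eqle; congr (`|_|).
  rewrite -/phi !phiE -[X in _ - _ - X]mulr1 -Ipsi -RintegralZl // -RintegralB // -RintegralB //; last 2 first.
  + exact: integrable_subR.
  + exact: integrable_mulR.
  by apply: eq_Rintegral => z _ /=; rewrite /rho; ring.
Qed.

End Ext.
End Approximation.

(** * The extension has zero trace *)

Section ZeroTrace.
Context {R : realType}.
Local Notation T2 := (plane R).
Implicit Types (A B K : set (R * R)) (u w phi : R * R -> R) (i j : 'I_2) (x y z : R * R).

Section Ext.
Variables (Omega : set (R * R)) (sigma h : R) (T : set (@triangle R)).
Hypothesis tr : triangulation Omega sigma h T.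
Hypothesis bO : bounded_set Omega.
Hypothesis oO : open Omega.
Variable v : R * R -> R.
Hypothesis Sv : Sh0 T v.
Local Notation vb := (ext0 T v).

Lemma pslope_lin i k (a b c : R) : (forall x, lin v k x = a + b * x.1 + c * x.2) ->
  pslope i v k = if i == 0 then b else c.
Proof. by move=> E; rewrite /pslope !E /unitv; case: ifP => _ /=; ring. Qed.

(** The zero set of a nonconstant affine function is a null line. Soft thresholding preserves slopes
    only away from the value 0, and here it is shown that the remaining triangles are those where
    [v] vanishes identically. *)
Lemma nonzero_ae : {ae leb2, forall x : T2, forall k, T k -> opent k x ->
  vb x != 0 \/ (forall i, pslope i v k = 0) /\ (forall y, opent k y -> vb y = 0)}.
Proof.
have [s Hs] := tr_list tr.
have vE k y : T k -> opent k y -> vb y = lin v k y.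
  move=> Tk ky; have ky' := opent_sub (tr_dt tr Tk) ky.
  by rewrite (ext0_closedt tr Sv Tk) // (Sh_closedt tr _ Tk) //; case: Sv.
have : {ae leb2, forall x : T2, forall k, List.In k s -> opent k x ->
  vb x != 0 \/ (forall i, pslope i v k = 0) /\ (forall y, opent k y -> vb y = 0)}.
  apply: ae_list => k /Hs Tk; have [a [b [c E]]] := lin_affine v k.
  have S i := pslope_lin i E.
  have [/andP[/eqP b0 /eqP c0]|] := boolP ((b == 0) && (c == 0)).
    have [a0|a0] := eqVneq a 0; apply: aeW => x kx; [right|left].
      split => [i|y ky]; first by rewrite S b0 c0; case: ifP.
      by rewrite (vE k) // E a0 b0 c0 !mul0r !addr0.
    by rewrite (vE k) // E b0 c0 !mul0r !addr0.
  rewrite negb_and => bc.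
  have : {ae leb2, forall x : T2, lin v k x <> 0}.
    by apply: negl_level; exists b, c, a; split => // x; rewrite E; ring.
  by apply: ae2S => x nx kx; left; rewrite (vE k) //; apply/eqP.
by apply: ae2S => x H k /Hs; exact: H.
Qed.

(** Near almost every point the function is affine and either nonzero or identically zero, so for
    small [r] thresholding only shifts it by a constant. As a result the derivatives of the
    mollifications are eventually equal to [pgrad], not merely convergent. *)
Lemma soft_exact : {ae leb2, forall x : T2, forall i, exists2 r0 : R, 0 < r0 &
  forall (r : R) z t, 0 < r -> r <= r0 -> `|z.1| <= r -> `|z.2| <= r -> `|t| <= r0 ->
  soft r (vb ((x : R * R) - z + t *: uv i)) - soft r (vb ((x : R * R) - z)) = t * pgrad T i v x}.
Proof.
have W (x y z : R * R) i (t r0 q : R) : 0 < q -> r0 <= q / 4 -> `|z.1| <= r0 -> `|z.2| <= r0 -> `|t| <= r0 ->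
    ball x q (x - z + t *: uv i) /\ ball x q (x - z).
  move=> q0 rq z1 z2 t1; rewrite -addrA; split; apply: ball2_small => //=; rewrite ?normrN; try lra.
    apply: le_trans (ler_normD _ _) _; rewrite normrN normrM.
    have : `|(unitv i : R * R).1| <= 1 by rewrite /unitv; case: ifP => _ /=; rewrite ?normr1 ?normr0.
    move=> /(ler_wpM2l (normr_ge0 t)); lra.
  apply: le_trans (ler_normD _ _) _; rewrite normrN normrM.
  have : `|(unitv i : R * R).2| <= 1 by rewrite /unitv; case: ifP => _ /=; rewrite ?normr1 ?normr0.
  move=> /(ler_wpM2l (normr_ge0 t)); lra.
apply: (ae2I _ (mesh_ae tr) nonzero_ae) => x Hx Nx i.
have [Ux|nU] := pselect (union_closed T x); last first.
  have oU : open (~` union_closed T) by rewrite openC; exact: union_closed_closed tr.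
  have /nbhs_ballP[q /= q0 Hq] : nbhs (x : R * R) (~` union_closed T) by apply: open_nbhs_nbhs.
  exists (q / 4); first by rewrite divr_gt0.
  move=> r z t r0 rq z1 z2 t1.
  have [b1 b2] := W x x z i t (q / 4) q q0 (lexx _) (le_trans z1 rq) (le_trans z2 rq) t1.
  have V y : ball (x : R * R) q y -> vb y = 0 by move=> /Hq ny; apply: ext0_out => /(polygon_sub tr).
  rewrite !V // subrr pgrad_out ?mulr0 // => -[k Tk kx]; apply: nU; exists k => //.
  exact: (opent_sub (tr_dt tr Tk)).
have [k Tk kx] := Hx Ux.
have /nbhs_ballP[q /= q0 Hq] : nbhs (x : R * R) (opent k).
  by apply: open_nbhs_nbhs; split => //; exact: opent_open (tr_dt tr Tk).
rewrite (pgradE tr _ _ Tk kx).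
have [vx|[S0 V0]] := Nx k Tk kx; last first.
  exists (q / 4); first by rewrite divr_gt0.
  move=> r z t r0 rq z1 z2 t1.
  have [b1 b2] := W x x z i t (q / 4) q q0 (lexx _) (le_trans z1 rq) (le_trans z2 rq) t1.
  by rewrite !V0 ?subrr ?S0 ?mulr0 //; exact: Hq.
have : \forall y \near (x : R * R), `|vb x - vb y| <= `|vb x| / 2.
  have /cvgrPdist_le := @ext0_cont _ _ _ _ _ tr _ Sv (x : R * R); apply.
  by rewrite divr_gt0 // normr_gt0.
move=> /nbhs_ballP[q' /= q0' Hq'].
(* A shift by [-z] followed by [t] stays within half of the radii [q] and [q']; there the values
   keep the sign of [vb x] and exceed [|vb x| / 2] in modulus at least weakly, hence exceed the
   level [r <= |vb x| / 4]. *)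
pose r0 := Num.min (Num.min (q / 4) (q' / 4)) (`|vb x| / 4).
have [rq rq' rv] : [/\ r0 <= q / 4, r0 <= q' / 4 & r0 <= `|vb x| / 4].
  by split; rewrite !ge_min lexx ?orbT.
have vx0 : 0 < `|vb x| by rewrite normr_gt0.
exists r0; first by rewrite !lt_min !divr_gt0.
move=> r z t r_gt0 rr0 z1 z2 t1.
have [b1 b2] := W x x z i t r0 q q0 rq (le_trans z1 rr0) (le_trans z2 rr0) t1.
have [/Hq' c1 /Hq' c2] := W x x z i t r0 q' q0' rq' (le_trans z1 rr0) (le_trans z2 rr0) t1.
rewrite soft_diff; last exact: ltW.
  have d0 := tr_dt tr Tk.
  by apply: (ext0_slope tr Sv Tk) => //; apply: (opent_sub d0); exact: Hq.
move: c1 c2 vx0 rv; rewrite !ler_norml => /andP[c1 c2] /andP[c3 c4] vx0 rv.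
have [v0|v0] := leP 0 (vb x); [left|right].
  move: c1 c2 c3 c4 vx0 rv; rewrite (ger0_norm v0) => c1 c2 c3 c4 vx0 rv; split; lra.
move: c1 c2 c3 c4 vx0 rv; rewrite (ltr0_norm v0) => c1 c2 c3 c4 vx0 rv; split; lra.
Qed.

Lemma ext0_sequence : exists (phi : nat -> R * R -> R) (L : R), [/\ 0 <= L,
  forall n, test_function (polygon T) (phi n),
  forall n x, `|phi n x - vb x| <= L / n.+1%:R,
  forall n i x, `|partial i (phi n) x| <= L &
  {ae leb2, forall x : T2, forall i, \forall n \near \oo, partial i (phi n) x = pgrad T i v x}].
Proof.
have A n : {phi : R * R -> R | let r := n.+1%:R^-1 in [/\ test_function (polygon T) phi,
   forall x (a eta : R), (forall z, `|z.1| <= r -> `|z.2| <= r -> `|vb (x - z) - a| <= eta) ->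
     `|phi x - a| <= eta + r &
   forall i x (m eta t0 : R), 0 < t0 ->
     (forall z t, `|z.1| <= r -> `|z.2| <= r -> `|t| <= t0 ->
       `|soft r (vb (x - z + t *: uv i)) - soft r (vb (x - z)) - t * m| <= eta * `|t|) ->
     `|partial i phi x - m| <= eta]}.
  by apply: cid; apply: (ext0_approx tr bO Sv); rewrite invr_gt0 ltr0n.
have [L [L0 HL]] := ext0_lip tr Sv.
(* A shift by at most [r] in both coordinates changes [vb] by at most [2 L r], and thresholding adds
   [r]. *)
exists (fun n => sval (A n)), (L * 2 + 1); split.
- by rewrite addr_ge0 ?mulr_ge0.
- by move=> n; case: (svalP (A n)).
- move=> n x; case: (svalP (A n)) => _ H _.
  rewrite mulrDl mul1r; apply: H => z z1 z2.
  apply: le_trans (lip_plane HL _ _) _; rewrite -mulrA; apply: ler_wpM2l => //.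
  have -> : `|(x - z).1 - x.1| = `|z.1| by rewrite /= addrAC subrr sub0r normrN.
  have -> : `|(x - z).2 - x.2| = `|z.2| by rewrite /= addrAC subrr sub0r normrN.
  by rewrite mulr_natl mulr2n; apply: lerD.
- move=> n i x; case: (svalP (A n)) => _ _ H.
  have := H i x 0 L 1 ltr01; rewrite subr0 => Hi; apply: le_trans (Hi _) _; last by lra.
  move=> z t _ _ _; rewrite mulr0 subr0; apply: le_trans (soft_lip _ _ _) _; first by rewrite invr_ge0.
  exact: HL.
- apply: ae2S soft_exact => x H i; have [r0 r00 Hr] := H i.
  near=> n; case: (svalP (A n)) => _ _ /(_ i x (pgrad T i v x) 0 r0 r00) Hn.
  apply/eqP; rewrite -subr_eq0 -normr_le0; apply: Hn => z t z1 z2 t1.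
  have nr : (n.+1%:R : R)^-1 <= r0 by apply: ltW; near: n; exact: (near_infty_natSinv_lt (PosNum r00)).
  by rewrite Hr ?subrr ?normr0 ?mul0r // invr_gt0.
Unshelve. all: by end_near.
Qed.

(** Values converge uniformly and gradients are bounded and eventually exact almost everywhere, so
    both norms tend to 0 by dominated convergence. *)
Lemma ext0_W1p0 p : (leb2 (Omega : set T2) < +oo)%E -> mfun2 Omega p ->
  (forall x, Omega x -> 1 <= p x <= 2) -> W1p0 Omega p vb.
Proof.
move=> Ofin mp p12; have mO : meas2 Omega := open_measurable2 oO.
have [phi [L [L0 tphi phiL dphi dcvg]]] := ext0_sequence.
have Tphi n : test_function Omega (phi n) := test_subset (tr_sub tr) (tphi n).
pose G n x : R * R := pgrad2 T v x - cgrad (phi n) x.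
have WG n : is_weak_grad Omega (vb \- phi n) (G n).
  move=> i; have [Ckphi _ _] := Tphi n.
  have W1 : weak_partial Omega i (phi n) (partial i (phi n)).
    apply: Ck1_weak_partial => //; have [h1 h2] := Ckphi 1%N; split => s s1.
      by move=> j x _; exact: h1.
    exact: continuous_subspaceW (h2 s s1).
  have := weak_partialB oO (ext0_weak_partial tr Sv i oO) W1.
  congr weak_partial; apply/funext => x; have [->|->] := I2_cases i; by rewrite /G /pgrad2 /cgrad.
have [B0 [B00 HB0]] := pgrad_bound tr 0 v; have [B1 [B10 HB1]] := pgrad_bound tr 1 v.
pose B := (B0 + L) + (B1 + L).
have GB n x : enorm (G n x) <= B.
  apply: le_trans (enorm_le _) _; rewrite /G /pgrad2 /cgrad /=; apply: lerD.
    by apply: le_trans (ler_normB _ _) _; exact: lerD.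
  by apply: le_trans (ler_normB _ _) _; exact: lerD.
have mG n i : mfun2 Omega (coord i \o G n).
  by have [_ lw _] := WG n i; exact: loc_integrable_measurable lw.
have mE n : mfun2 Omega (vb \- phi n).
  by have [lu _ _] := WG n 0; exact: loc_integrable_measurable lu.
have EB n x : `|(vb \- phi n) x| <= L.
  rewrite /= distrC; apply: le_trans (phiL n x) _.
  by rewrite ler_pdivrMr ?ltr0n // ler_peMr // ler1n.
have wG n := wgrad_ae oO (WG n).
have W1pE n : W1p Omega p (vb \- phi n).
  split; [exact: (modular_bounded mO Ofin mp p12 (B := L))|by exists (G n)|move=> i].
  apply: (@Lp_ae _ _ _ mO Ofin mp p12 _ (coord i \o G n) B) => //.
  - exact: measurable_wgrad oO (WG n).
  - by apply: ae2S (wG n) => x E Ox; rewrite /= E.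
  - by move=> x _; apply: le_trans (coord_le _ _) _.
have N1 (k : R) : 0 < k -> \forall n \near \oo, (Lp_norm Omega p (vb \- phi n)%R <= k%:E)%E.
  move=> k0; apply: (@Lp_norm_cvg _ _ _ mO Ofin mp p12 (fun n => vb \- phi n) L) => //.
  apply: aeW => x _; apply/cvgr0Pnorm_le => e e0.
  have L1 : 0 < L + 1 by rewrite ltr_pwDr.
  have eL : 0 < e / (L + 1) by rewrite divr_gt0.
  near=> n; rewrite distrC.
  apply: le_trans (phiL n x) _.
  have : (n.+1%:R : R)^-1 <= e / (L + 1) by apply: ltW; near: n; exact: (near_infty_natSinv_lt (PosNum eL)).
  move=> /(ler_wpM2l L0) /le_trans; apply.
  by rewrite mulrCA ler_piMr ?(ltW e0) // ler_pdivrMr // mul1r lerDl.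
have N2 (k : R) : 0 < k -> \forall n \near \oo, (Lp_norm Omega p (fun x => enorm (wgrad Omega (vb \- phi n)%R x)) <= k%:E)%E.
  move=> k0.
  have mEn n : measurable_fun (Omega : set T2) (fun x : T2 => enorm (G n x)).
    by apply: measurable_enorm; [exact: (mG n 0)|exact: (mG n 1)].
  have : \forall n \near \oo, (Lp_norm Omega p (fun x => enorm (G n x)) <= k%:E)%E.
    apply: (@Lp_norm_cvg _ _ _ mO Ofin mp p12 (fun n x => enorm (G n x)) B) => //.
      by move=> n x _; rewrite ger0_norm ?enorm_ge0.
    apply: ae2S dcvg => x H _; have H0 := H 0; have H1 := H 1; apply: cvg_near_cst.
    near=> n.
    have E0 : partial 0 (phi n) x = pgrad T 0 v x by near: n.
    have E1 : partial 1 (phi n) x = pgrad T 1 v x by near: n.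
    by rewrite /G /pgrad2 /cgrad E0 E1 subrr enorm0.
  apply: filterS => n; apply: le_trans; apply: (Lp_norm_ae mO mp) => //.
    by apply: measurable_enorm; [exact: (measurable_wgrad 0 oO (WG n))|exact: (measurable_wgrad 1 oO (WG n))].
  by apply: ae2S (wG n) => x E Ox; rewrite E.
split.
  split; [|by exists (pgrad2 T v); exact: (ext0_weak_grad tr Sv oO)|].
    have [C [C0 HC]] := test_bound (tphi 0%N).
    apply: (modular_bounded mO Ofin mp p12 (B := C + L)).
      by apply: continuous_measurable2; exact: (ext0_cont tr Sv).
    move=> x _; rewrite (_ : vb x = phi 0%N x - (phi 0%N x - vb x)); last by ring.
    apply: le_trans (ler_normB _ _) _; apply: lerD => //.
    by have := phiL 0%N x; rewrite divr1.
  move=> i; apply: (@Lp_ae _ _ _ mO Ofin mp p12 _ (pgrad T i v) (B0 + B1)).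
  - exact: measurable_wgrad oO (ext0_weak_grad tr Sv oO).
  - exact: (measurable_pgrad tr).
  - apply: ae2S (wgrad_ae oO (ext0_weak_grad tr Sv oO)) => x E Ox; rewrite /= E //.
    by have [->|->] := I2_cases i.
  - move=> x _; have [->|->] := I2_cases i.
      by apply: le_trans (HB0 x) _; rewrite lerDl.
    by apply: le_trans (HB1 x) _; rewrite lerDr.
(* Two terms at most [eps / 3] leave room for the strict inequality. *)
move=> eps eps0; have e3 : 0 < eps / 3 by rewrite divr_gt0.
have [n [h1 h2]] := filter_ex (filterI (N1 _ e3) (N2 _ e3)).
exists (phi n); split => //.
rewrite /W1p_norm; apply: le_lt_trans (leeD h1 h2) _; rewrite -EFinD lte_fin; lra.
Unshelve. all: by end_near.
Qed.

End Ext.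
End ZeroTrace.

(** * Integral inequalities *)

Section Gagliardo.
Context {R : realType}.
Local Notation mR := (measurableTypeR R).
Local Notation T2 := (plane R).
Local Notation mu := (@lebesgue_measure R).
Implicit Types (A B K : set (R * R)) (u w phi : R * R -> R) (i j : 'I_2) (x y z : R * R).

Lemma ftc_abs_lt (f f' : R -> R) (a b s t : R) :
  (forall r, a <= r <= b -> is_derive r (1 : R) f (f' r)) -> {within `[a, b], continuous f'} ->
  a <= s -> s < t -> t <= b ->
  (`|f t - f s|%:E <= \int[mu]_(r in `[a, b]) `|f' r|%:E)%E.
Proof.
move=> df cf' as_ st tb.
have sub : `[s, t] `<=` `[a, b] by move=> r /=; rewrite !in_itv /= => /andP[h1 h2]; rewrite (le_trans as_ h1) (le_trans h2 tb).
have cst : {within `[s, t], continuous f'} by exact: continuous_subspaceW sub cf'.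
have dat r : s <= r <= t -> is_derive r (1 : R) f (f' r).
  by move=> /andP[sr rt]; apply: df; rewrite (le_trans as_ sr) (le_trans rt tb).
have cat r : s <= r <= t -> {for r, continuous f}.
  by move=> /dat[d _]; apply: differentiable_continuous; exact/derivable1_diffP.
have E : (\int[mu]_(r in `[s, t]) (f' r)%:E = (f t)%:E - (f s)%:E)%E.
  apply: continuous_FTC2 => //.
    split.
    - by move=> r; rewrite in_itv /= => /andP[/ltW h1 /ltW h2]; case: (dat r _); rewrite ?h1.
    - by apply: cvg_at_right_filter; apply: cat; rewrite lexx ltW.
    - by apply: cvg_at_left_filter; apply: cat; rewrite lexx ltW.
  by move=> r; rewrite in_itv /= => /andP[/ltW h1 /ltW h2]; rewrite derive1E; case: (dat r _); rewrite ?h1.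
have mf' : measurable_fun (`[a, b] : set mR) (fun r : mR => (`|f' r|%:E)%E).
  apply/measurable_EFinP; apply: measurableT_comp => //.
  by apply: subspace_continuous_measurable_fun => //.
have mf's : measurable_fun (`[s, t] : set mR) (fun r : mR => (f' r)%:E).
  by apply/measurable_EFinP; apply: subspace_continuous_measurable_fun => //.
have -> : (`|f t - f s|%:E = `|\int[mu]_(r in `[s, t]) (f' r)%:E|)%E by rewrite E.
apply: le_trans (le_abse_integral _ _ _) _ => //.
apply: ge0_subset_integral => //.
Qed.

Lemma ftc_abs (f f' : R -> R) (a b s t : R) :
  (forall r, a <= r <= b -> is_derive r (1 : R) f (f' r)) -> {within `[a, b], continuous f'} ->
  a <= s <= b -> a <= t <= b ->
  (`|f t - f s|%:E <= \int[mu]_(r in `[a, b]) `|f' r|%:E)%E.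
Proof.
move=> df cf' /andP[as_ sb] /andP[at_ tb].
have [st|ts|->] := ltgtP s t; first exact: ftc_abs_lt st _.
  by rewrite distrC; exact: ftc_abs_lt ts _.
by rewrite subrr normr0; apply: integral_ge0 => r _; rewrite lee_fin.
Qed.

Lemma is_derive_line u x i (t : R) : derivable u (x + t *: uv i) (uv i) ->
  is_derive t (1 : R) (fun s => u (x + s *: uv i)) (partial i u (x + t *: uv i)).
Proof.
move=> d; apply: DeriveDef; first exact/derivable_line.
by rewrite /partial derive_line.
Qed.

Lemma line_cont x (e : R * R) : continuous (fun t : R => x + t *: e).
Proof. by move=> t; apply: cvgD; [exact: cvg_cst|apply: cvgZr_tmp; exact: cvg_id]. Qed.

Lemma test_line_bound phi i x : test_function setT phi ->
  (`|phi x|%:E <= \int[mu]_s `|partial i phi (x + (s - coord i x) *: uv i)|%:E)%E.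
Proof.
move=> tp; have [_ cS _] := tp.
have [M HM] := bounded_leb2 (compact_bounded cS).
(* The point with coordinate [a] lies outside the support, where [phi] vanishes, and [[a, b]]
   contains the coordinate of [x]. *)
pose a := - `|M| - 1 - `|coord i x|; pose b := `|coord i x| + `|M|.
have cb := ler_norm (coord i x); have cb' := ler_norm (- coord i x); rewrite normrN in cb'.
have Mb := normr_ge0 M; have Mc := normr_ge0 (coord i x).
pose f s := phi (x + (s - coord i x) *: uv i).
have fE : f = (fun s => phi ((x - coord i x *: uv i) + s *: uv i)).
  by apply/funext => s; rewrite /f scalerBl (addrC (s *: _)) addrA.
pose f' s := partial i phi (x + (s - coord i x) *: uv i).
have f'E : f' = (fun s => partial i phi ((x - coord i x *: uv i) + s *: uv i)).
  by apply/funext => s; rewrite /f' scalerBl (addrC (s *: _)) addrA.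
have cf' : continuous f'.
  rewrite f'E => s; apply: continuous_comp; first exact: line_cont.
  exact: test_cont (test_partial i tp) _.
have fa : f a = 0.
  apply: test_out => /HM[]; rewrite /f.
  have E : coord i (x + (a - coord i x) *: uv i) = a.
    by have [->|->] := I2_cases i; rewrite /coord /unitv /= /GRing.scale /=; ring.
  have : `|coord i (x + (a - coord i x) *: uv i)| > M.
    have := ler_norm (- a); rewrite normrN E /a; have := ler_norm M; lra.
  by have [->|->] := I2_cases i; rewrite /coord /= => h1 h2 h3; move: h1; rewrite ltNge ?h2 ?h3.
have fx : f (coord i x) = phi x by rewrite /f subrr scale0r addr0.
have -> : `|phi x| = `|f (coord i x) - f a| by rewrite fa subr0 fx.
apply: (@le_trans _ _ (\int[mu]_(r in `[a, b]) `|f' r|%:E)%E).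
  apply: ftc_abs; [move=> r _|exact: continuous_subspaceT|rewrite /a /b; apply/andP; split; lra|rewrite /a /b; apply/andP; split; lra].
  by rewrite fE f'E; apply: is_derive_line; exact: test_derivable tp _ _.
apply: ge0_subset_integral => //.
by apply/measurable_EFinP; apply: measurableT_comp => //; exact: continuous_measurable_fun.
Qed.

(** The two-dimensional Gagliardo-Nirenberg inequality: [|phi|] at [z] is bounded by the line
    integrals of its derivatives through [z] in either direction. The product of the two bounds
    separates the variables, and Tonelli's theorem factors its integral. *)
Lemma gn_test phi : test_function setT phi ->
  (\int[leb2]_z (phi z ^+ 2)%:E <=
   (\int[leb2]_z `|partial 0 phi z|%:E) * (\int[leb2]_z `|partial 1 phi z|%:E))%E.
Proof.
move=> tp.
pose D i (z : T2) := (`|partial i phi z|%:E)%E.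
have D0 i z : (0 <= D i z)%E by rewrite lee_fin.
have mD i : measurable_fun setT (D i).
  by apply/measurable_EFinP; apply: measurableT_comp => //; apply: continuous_measurable2; exact: test_cont (test_partial i tp).
pose A (y : mR) := fubini_G mu (D 0) y; pose B (x : mR) := fubini_F mu (D 1) x.
have mA : measurable_fun setT A by exact: measurable_fun_fubini_tonelli_G.
have mB : measurable_fun setT B by exact: measurable_fun_fubini_tonelli_F.
have A0 (y : mR) : (0 <= A y)%E by apply: integral_ge0 => s _; exact: D0.
have B0 (y : mR) : (0 <= B y)%E by apply: integral_ge0 => s _; exact: D0.
have pt (z : T2) : ((phi z ^+ 2)%:E <= B z.1 * A z.2)%E.
  rewrite -real_normK ?num_real // expr2 EFinM; apply: lee_pmul; rewrite ?lee_fin //.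
    apply: le_trans (test_line_bound 1 z tp) _; apply: eqle.
    apply: eq_integral => s _; rewrite /D; congr (`|partial 1 phi _|%:E)%E.
    by apply: injective_projections; rewrite /coord /unitv /= /GRing.scale /=; ring.
  apply: le_trans (test_line_bound 0 z tp) _; apply: eqle.
  apply: eq_integral => s _; rewrite /D; congr (`|partial 0 phi _|%:E)%E.
  by apply: injective_projections; rewrite /coord /unitv /= /GRing.scale /=; ring.
have mBA : measurable_fun setT (fun z : T2 => (B z.1 * A z.2)%E).
  apply: emeasurable_funM; [exact: (measurableT_comp mB)|exact: (measurableT_comp mA)].
apply: (@le_trans _ _ (\int[leb2]_z (B z.1 * A z.2))%E).
  apply: ge0_le_integral => //.
  - by move=> z _; rewrite lee_fin sqr_ge0.
  - by apply/measurable_EFinP; apply: measurable_funX; apply: continuous_measurable2; exact: test_cont tp.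
have BA0 (z : T2) : (0 <= B z.1 * A z.2)%E := mule_ge0 (B0 z.1) (A0 z.2).
have E : (\int[leb2]_z (B z.1 * A z.2) = \int[mu]_x fubini_F mu (fun z : T2 => (B z.1 * A z.2)%E) x)%E.
  exact: fubini_tonelli1.
have E0 : (\int[leb2]_z `|partial 0 phi z|%:E = \int[mu]_y A y)%E by apply: (fubini_tonelli2 (D 0)).
have E1 : (\int[leb2]_z `|partial 1 phi z|%:E = \int[mu]_x B x)%E by apply: (fubini_tonelli1 (D 1)).
have IA : (0 <= \int[mu]_y A y)%E := integral_ge0 _ (fun (y : mR) _ => A0 y).
rewrite E E0 E1 -(ge0_integralZl mu measurableT mB (fun (x : mR) _ => B0 x) IA).
apply: eqle; apply: eq_integral => x _.
exact: (etrans (ge0_integralZl mu measurableT mA (fun (y : mR) _ => A0 y) (B0 x)) (muleC _ _)).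
Qed.

Section Ext.
Variables (Omega : set (R * R)) (sigma h : R) (T : set (@triangle R)).
Hypothesis tr : triangulation Omega sigma h T.
Hypothesis bO : bounded_set Omega.
Hypothesis oO : open Omega.
Hypothesis Ofin : (leb2 (Omega : set T2) < +oo)%E.
Variable v : R * R -> R.
Hypothesis Sv : Sh0 T v.
Local Notation vb := (ext0 T v).

Lemma bounded_convergence (f_ : nat -> T2 -> R) (f : T2 -> R) (C : R) :
  (forall n, measurable_fun (Omega : set T2) (f_ n)) -> measurable_fun (Omega : set T2) f ->
  {ae leb2, forall x, Omega x -> f_ n x @[n --> \oo] --> f x} ->
  (forall n x, Omega x -> `|f_ n x| <= C) ->
  (\int[leb2]_(x in Omega) f_ n x) @[n --> \oo] --> \int[leb2]_(x in Omega) f x.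
Proof.
move=> mf_ mf cf bf; have mO : meas2 Omega := open_measurable2 oO.
have iC : leb2.-integrable (Omega : set T2) (EFin \o (fun=> C)).
  by apply: (integrable_bounded mO Ofin (C := `|C|)).
have [i1 c1] := DCT2 mO mf_ mf cf iC bf.
have : (\int[leb2]_(x in Omega) (f_ n x)%:E)%E @[n --> \oo] --> ((\int[leb2]_(x in Omega) f x)%:E)%E.
  by rewrite fineK //; exact: integrable_fin_num.
by move/fine_cvgP => [_].
Qed.

(** All three integrals are limits along the approximating test functions, by bounded convergence on
    [Omega]. *)
Lemma gn_ext0 :
  \int[leb2]_(z in Omega) (vb z ^+ 2) <=
   (\int[leb2]_(z in Omega) `|pgrad T 0 v z|) * (\int[leb2]_(z in Omega) `|pgrad T 1 v z|).
Proof.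
have mO : meas2 Omega := open_measurable2 oO.
have [phi [L [L0 tphi phiL dphi dcvg]]] := ext0_sequence tr bO Sv.
have Tphi n : test_function Omega (phi n) := test_subset (tr_sub tr) (tphi n).
have TT n : test_function setT (phi n) := test_subset (@subsetT _ _) (tphi n).
have [C [C0 HC]] := test_bound (tphi 0%N).
have vC x : `|vb x| <= C + L.
  rewrite (_ : vb x = phi 0%N x - (phi 0%N x - vb x)); last by ring.
  apply: le_trans (ler_normB _ _) _; apply: lerD => //.
  by have := phiL 0%N x; rewrite divr1.
have phiC n x : `|phi n x| <= C + L + L.
  rewrite (_ : phi n x = vb x + (phi n x - vb x)); last by ring.
  apply: le_trans (ler_normD _ _) _; apply: lerD => //; apply: le_trans (phiL n x) _.
  by rewrite ler_pdivrMr ?ltr0n // ler_peMr // ler1n.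
have mphi n : mfun2 Omega (phi n).
  by apply: continuous_measurable2; exact: test_cont (tphi n).
have mdphi i n : mfun2 Omega (partial i (phi n)).
  by apply: continuous_measurable2; exact: test_cont (test_partial i (tphi n)).
have c0 : (\int[leb2]_(x in Omega) (phi n x ^+ 2)) @[n --> \oo] --> \int[leb2]_(x in Omega) (vb x ^+ 2).
  apply: (@bounded_convergence _ _ ((C + L + L) ^+ 2)).
  - by move=> n; exact: measurable_funX.
  - by apply: measurable_funX; apply: continuous_measurable2; exact: (ext0_cont tr Sv).
  - apply: aeW => x _; rewrite expr2.
    have cx : phi n x @[n --> \oo] --> vb x.
      apply/cvgrPdist_le => e e0.
      have L1 : 0 < L + 1 by rewrite ltr_pwDr.
      have eL : 0 < e / (L + 1) by rewrite divr_gt0.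
      near=> n; rewrite distrC; apply: le_trans (phiL n x) _.
      have : (n.+1%:R : R)^-1 <= e / (L + 1) by apply: ltW; near: n; exact: (near_infty_natSinv_lt (PosNum eL)).
      move=> /(ler_wpM2l L0) /le_trans; apply.
      by rewrite mulrCA ler_piMr ?(ltW e0) // ler_pdivrMr // mul1r lerDl.
    exact: (cvgM cx cx).
  - move=> n x _; rewrite normrX; apply: lerXn2r; rewrite ?nnegrE ?addr_ge0 //; exact: phiC.
have ci i : (\int[leb2]_(x in Omega) `|partial i (phi n) x|) @[n --> \oo] --> \int[leb2]_(x in Omega) `|pgrad T i v x|.
  apply: (@bounded_convergence _ _ L).
  - by move=> n; exact: measurableT_comp.
  - by apply: measurableT_comp => //; exact: (measurable_pgrad tr).
  - apply: ae2S dcvg => x H _; have Hi := H i; apply: cvg_near_cst.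
    near=> n; have -> : partial i (phi n) x = pgrad T i v x by near: n.
    by [].
  - by move=> n x _; rewrite normr_id.
apply: (ler_cvg_to c0 (cvgM (ci 0) (ci 1))); apply: nearW => n.
have out (f : T2 -> R) (B : R) : measurable_fun (Omega : set T2) f -> (forall x, Omega x -> `|f x| <= B) ->
    (forall x, ~ Omega x -> f x = 0) -> (\int[leb2]_z (f z)%:E = (\int[leb2]_(z in Omega) f z)%:E)%E.
  move=> mf fB fout; rewrite fineK; last first.
    by apply: integrable_fin_num => //; exact: (integrable_bounded mO Ofin mf fB).
  by apply: integral_out => // x _ nx; rewrite fout.
have := gn_test (TT n).
rewrite (out _ ((C + L + L) ^+ 2)); last 3 first.
- exact: measurable_funX.
- by move=> x _; rewrite normrX; apply: lerXn2r; rewrite ?nnegrE ?addr_ge0 //; exact: phiC.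
- by move=> x nx; rewrite (test_zero (Tphi n) nx) expr0n.
rewrite (out _ L); last 3 first.
- exact: measurableT_comp.
- by move=> x _; rewrite normr_id.
- by move=> x nx; rewrite (test_zero (test_partial 0 (Tphi n)) nx) normr0.
rewrite (out _ L); last 3 first.
- exact: measurableT_comp.
- by move=> x _; rewrite normr_id.
- by move=> x nx; rewrite (test_zero (test_partial 1 (Tphi n)) nx) normr0.
by rewrite -EFinM lee_fin.
Unshelve. all: by end_near.
Qed.

End Ext.
End Gagliardo.

(** * Poincare and supremum inequalities on the unit square *)

Section Square.
Context {R : realType}.
Local Notation mR := (measurableTypeR R).
Local Notation T2 := (plane R).
Local Notation mu := (@lebesgue_measure R).

Definition itv01 : set mR := `[0, 1]%classic.

Lemma measurable_itv01 : measurable itv01.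
Proof. exact: measurable_itv. Qed.

Lemma lebesgue_itv01 : (mu itv01 = 1)%E.
Proof. by rewrite /itv01 lebesgue_measure_itv /= lte_fin ltr01 sube0. Qed.

Lemma integral_cst01 (c : \bar R) : (\int[mu]_(r in itv01) c = c)%E.
Proof.
transitivity (c * mu itv01)%E; last by rewrite lebesgue_itv01 mule1.
exact: integral_cst measurable_itv01 c.
Qed.

(** If [A] exceeded its integral over [[0, 1]] everywhere on that interval of measure 1, the
    difference would be positive with integral zero. *)
Lemma mean_point (A : mR -> \bar R) : measurable_fun setT A -> (forall s : mR, (0 <= A s)%E) ->
  exists s : mR, 0 <= s <= 1 /\ (A s <= \int[mu]_r A r)%E.
Proof.
move=> mA A0; pose D := itv01.
have mD : measurable D := measurable_itv01.
have D1 : (mu D = 1)%E := lebesgue_itv01.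
have DI : (\int[mu]_(r in D) A r <= \int[mu]_r A r)%E by apply: ge0_subset_integral.
suff [s Ds As] : exists2 s : mR, D s & (A s <= \int[mu]_(r in D) A r)%E.
  exists s; split; last exact: le_trans As DI.
  by move: Ds; rewrite /D /itv01 /= in_itv.
apply: contrapT => nex.
have {nex} H (s : mR) : D s -> (\int[mu]_(r in D) A r < A s)%E.
  by move=> Ds; rewrite ltNge; apply/negP => h; apply: nex; exists s.
set I := (\int[mu]_(r in D) A r)%E in H.
have I0 : (0 <= I)%E := integral_ge0 _ (fun (y : mR) _ => A0 y).
have If : I \is a fin_num.
  rewrite ge0_fin_numE //; apply: lt_le_trans (H 0 _) (leey _).
  by rewrite /D /itv01 /= in_itv /= lexx ler01.
have mAD : measurable_fun D A := measurable_funTS mA.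
have iA : mu.-integrable D A.
  apply/integrableP; split => //; rewrite (eq_integral A) -?ge0_fin_numE //.
  by move=> s _; rewrite gee0_abs.
have icst : mu.-integrable D (cst I).
  apply/integrableP; split; first exact: measurable_cst.
  rewrite (eq_integral (cst I)); last by move=> s _; rewrite /= gee0_abs.
  by rewrite integral_cst01 -ge0_fin_numE.
have E0 : (\int[mu]_(r in D) (A r - I) = 0)%E.
  by rewrite integralB // integral_cst01 -/I subee.
have mB : measurable_fun D (fun r : mR => (A r - I)%E) by apply: emeasurable_funB.
have := (ae_eq_integral_abs mu mD mB).1.
case.
  rewrite -[RHS]E0; apply: eq_integral => s; rewrite inE => Ds.
  by rewrite gee0_abs // sube_ge0 ?If ?orbT // ltW // H.
move=> N [mN N0 NE].
have : (mu D <= mu N)%E.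
  apply: le_measure; rewrite ?inE // => s Ds; apply: NE => /= /(_ Ds).
  by move=> E; have := H s Ds; rewrite -sube_gt0 E ltxx.
by rewrite D1 N0 leNgt lte_fin ltr01.
Qed.

(** [G] stands for a bound of the derivative of [f] along horizontal lines, read only through line
    integrals. These run over the whole line because [G] will be a bound extended by zero. *)
Definition horiz (f : R * R -> R) (G : T2 -> \bar R) : Prop := forall s s' t : R,
  0 <= s <= 1 -> 0 <= s' <= 1 -> 0 <= t <= 1 -> (`|f (s, t) - f (s', t)|%:E <= \int[mu]_r G (r, t))%E.

Definition vert (f : R * R -> R) (G : T2 -> \bar R) : Prop := forall s t t' : R,
  0 <= s <= 1 -> 0 <= t <= 1 -> 0 <= t' <= 1 -> (`|f (s, t) - f (s, t')|%:E <= \int[mu]_r G (s, r))%E.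

Definition usq : set (R * R) := [set z | 0 <= z.1 <= 1 /\ 0 <= z.2 <= 1].

Section Poincare.
Variables (Gs Gt : T2 -> \bar R).
Hypotheses (mGs : measurable_fun setT Gs) (mGt : measurable_fun setT Gt).
Hypotheses (Gs0 : forall z, (0 <= Gs z)%E) (Gt0 : forall z, (0 <= Gt z)%E).

Let B (t : mR) := fubini_G mu Gs t.
Let A (s : mR) := fubini_F mu Gt s.

Let mB : measurable_fun setT B. Proof. exact: measurable_fun_fubini_tonelli_G. Qed.
Let mA : measurable_fun setT A. Proof. exact: measurable_fun_fubini_tonelli_F. Qed.
Let B0 (t : mR) : (0 <= B t)%E. Proof. by apply: integral_ge0 => s _; exact: Gs0. Qed.
Let A0 (s : mR) : (0 <= A s)%E. Proof. by apply: integral_ge0 => t _; exact: Gt0. Qed.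
Let IB : (\int[mu]_t B t = \int[leb2]_z Gs z)%E.
Proof. by apply/esym; apply: (fubini_tonelli2 Gs). Qed.
Let IA : (\int[mu]_s A s = \int[leb2]_z Gt z)%E.
Proof. by apply/esym; apply: (fubini_tonelli1 Gt). Qed.

Let I := (\int[leb2]_z Gs z + \int[leb2]_z Gt z)%E.

(** Take [z0 = (s0, t0)] on lines where the integrals of [Gt] and [Gs] do not exceed their means.
    The two paths of axis-parallel segments from [(s, t)] to [z0] give one bound that depends on [s]
    only and one on [t] only; their product is integrated by Tonelli's theorem. As [z0] depends on
    the bounds alone, it serves both components of a vector field. *)
Lemma square_poincare : exists z0, usq z0 /\ forall f, mfun2 usq f ->
  horiz f Gs -> vert f Gt ->
  (\int[leb2]_(z in usq) ((f z - f z0) ^+ 2)%:E <= I * I)%E.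
Proof.
have [s0 [s01 As0]] := mean_point mA A0.
have [t0 [t01 Bt0]] := mean_point mB B0.
exists (s0, t0); split => // f mf hf vf.
have Is : (0 <= \int[leb2]_z Gs z)%E := integral_ge0 _ (fun z _ => Gs0 z).
have It : (0 <= \int[leb2]_z Gt z)%E := integral_ge0 _ (fun z _ => Gt0 z).
have pt z : usq z -> (((f z - f (s0, t0)) ^+ 2)%:E <= (A z.1 + \int[leb2]_z Gs z) * (B z.2 + \int[leb2]_z Gt z))%E.
  case: z => s t [/= s1 t1].
  have h1 : (`|f (s, t) - f (s0, t0)|%:E <= A s + \int[leb2]_z Gs z)%E.
    apply: (@le_trans _ _ (`|f (s, t) - f (s, t0)|%:E + `|f (s, t0) - f (s0, t0)|%:E)%E).
      by rewrite -EFinD lee_fin -[X in `|X|](subrKA (f (s, t0))) ler_normD.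
    apply: leeD; first exact: vf.
    rewrite -IB; apply: le_trans Bt0; exact: hf.
  have h2 : (`|f (s, t) - f (s0, t0)|%:E <= B t + \int[leb2]_z Gt z)%E.
    apply: (@le_trans _ _ (`|f (s, t) - f (s0, t)|%:E + `|f (s0, t) - f (s0, t0)|%:E)%E).
      by rewrite -EFinD lee_fin -[X in `|X|](subrKA (f (s0, t))) ler_normD.
    apply: leeD; first exact: hf.
    rewrite -IA; apply: le_trans As0; exact: vf.
  by rewrite -real_normK ?num_real // expr2 EFinM; apply: lee_pmul; rewrite ?lee_fin.
pose D := itv01.
have mD : measurable D := measurable_itv01.
have D1 : (mu D = 1)%E := lebesgue_itv01.
have QE : (usq : set T2) = D `*` D.
  by apply/seteqP; split => z; rewrite /usq /D /itv01 /= !in_itv.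
have mQ : meas2 usq by rewrite QE; exact: measurableX.
pose a (s : mR) := ((A s + \int[leb2]_z Gs z) * (\1_D s)%:E)%E.
pose b (t : mR) := ((B t + \int[leb2]_z Gt z) * (\1_D t)%:E)%E.
have a0 (s : mR) : (0 <= a s)%E by apply: mule_ge0; [exact: adde_ge0 (A0 s) Is|rewrite lee_fin].
have b0 (t : mR) : (0 <= b t)%E by apply: mule_ge0; [exact: adde_ge0 (B0 t) It|rewrite lee_fin].
have m1 : measurable_fun setT (fun s : mR => (\1_D s)%:E : \bar R) by apply/measurable_EFinP; exact: measurable_indic.
have ma : measurable_fun setT a by apply: emeasurable_funM => //; apply: emeasurable_funD.
have mb : measurable_fun setT b by apply: emeasurable_funM => //; apply: emeasurable_funD.
have half (C : mR -> \bar R) (c : \bar R) : measurable_fun setT C -> (forall s : mR, (0 <= C s)%E) -> (0 <= c)%E ->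
    (\int[mu]_s ((C s + c) * (\1_D s)%:E) <= \int[mu]_s C s + c)%E.
  move=> mC C0 c0.
  have -> : (\int[mu]_s ((C s + c) * (\1_D s)%:E) = \int[mu]_(s in D) (C s + c))%E.
    rewrite [RHS]integral_mkcond; apply: eq_integral => s _; rewrite patchE indicE.
    by case: ifPn => [_|_]; rewrite ?mule1 ?mule0.
  rewrite ge0_integralD //; last exact: measurable_funTS.
  rewrite integral_cst01; apply: leeD => //.
  by apply: ge0_subset_integral.
have Ia : (\int[mu]_s a s <= I)%E.
  by apply: le_trans (half A _ mA A0 Is) _; rewrite IA addeC.
have Ib : (\int[mu]_t b t <= I)%E.
  by apply: le_trans (half B _ mB B0 It) _; rewrite IB.
have mab : measurable_fun setT (fun z : T2 => (a z.1 * b z.2)%E).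
  by apply: emeasurable_funM; [exact: (measurableT_comp ma)|exact: (measurableT_comp mb)].
have ab0 (z : T2) : (0 <= a z.1 * b z.2)%E := mule_ge0 (a0 z.1) (b0 z.2).
apply: (@le_trans _ _ (\int[leb2]_z (a z.1 * b z.2))%E).
  rewrite integral_mkcond; apply: ge0_le_integral => //.
  - by move=> z _; apply: erestrict_ge0 => // y _; rewrite lee_fin sqr_ge0.
  - apply/(measurable_restrictT _ mQ)/measurable_EFinP; apply: measurable_funX.
    by apply: measurable_funB.
  - move=> z _; rewrite patchE; case: ifPn => [|_]; last exact: ab0.
    rewrite inE => Qz; apply: le_trans (pt z Qz) _.
    have [D1z D2z] : D z.1 /\ D z.2 by move: Qz; rewrite QE.
    by rewrite /a /b !indicE !mem_set // !mule1.
have E : (\int[leb2]_z (a z.1 * b z.2) = \int[mu]_x fubini_F mu (fun z : T2 => (a z.1 * b z.2)%E) x)%E.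
  exact: fubini_tonelli1.
have Ib0 : (0 <= \int[mu]_y b y)%E := integral_ge0 _ (fun (y : mR) _ => b0 y).
have -> : (\int[leb2]_z (a z.1 * b z.2) = (\int[mu]_y b y) * \int[mu]_x a x)%E.
  rewrite E -(ge0_integralZl mu measurableT ma (fun (x : mR) _ => a0 x) Ib0).
  apply: eq_integral => x _.
  exact: (etrans (ge0_integralZl mu measurableT mb (fun (y : mR) _ => b0 y) (a0 x)) (muleC _ _)).
have Ia0 : (0 <= \int[mu]_y a y)%E := integral_ge0 _ (fun (y : mR) _ => a0 y).
exact: (lee_pmul Ib0 Ia0 Ib Ia).
Qed.

(** The vertical step is taken on the good line [s0]. The horizontal one, at height [t], is compared
    with the good height [t0]: the change of [fs] between the two heights is paid by the mixed
    second derivative [Gst]. *)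
Lemma square_sup (Gst : T2 -> \bar R) : measurable_fun setT Gst -> (forall z, (0 <= Gst z)%E) ->
  exists z1, usq z1 /\ forall f fs : R * R -> R,
  (forall s s' t : R, 0 <= s <= 1 -> 0 <= s' <= 1 -> 0 <= t <= 1 ->
    (`|f (s, t) - f (s', t)|%:E <= \int[mu]_(r in itv01) `|fs (r, t)|%:E)%E) ->
  (forall t : R, 0 <= t <= 1 -> measurable_fun itv01 (fun r : mR => fs (r, t))) ->
  (forall z, usq z -> (`|fs z|%:E <= Gs z)%E) ->
  vert f Gt -> vert fs Gst ->
  forall z, usq z -> (`|f z - f z1|%:E <= I + \int[leb2]_z Gst z)%E.
Proof.
move=> mGst Gst0.
have [s0 [s01 As0]] := mean_point mA A0.
have [t0 [t01 Bt0]] := mean_point mB B0.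
exists (s0, t0); split => // f fs hf mfs fsG vf vfs [s t] [/= s1 t1].
pose C (r : mR) := fubini_F mu Gst r.
have mC : measurable_fun setT C by exact: measurable_fun_fubini_tonelli_F.
have C0 (r : mR) : (0 <= C r)%E by apply: integral_ge0 => y _; exact: Gst0.
have IC : (\int[mu]_r C r = \int[leb2]_z Gst z)%E by apply/esym; apply: (fubini_tonelli1 Gst).
pose D := itv01.
have mD : measurable D := measurable_itv01.
have Dr (r : mR) : D r -> 0 <= r <= 1 by rewrite /D /itv01 /= in_itv.
have mfsE (t' : R) : 0 <= t' <= 1 -> measurable_fun D (fun r : mR => (`|fs (r, t')|%:E)%E).
  by move=> h; apply/measurable_EFinP; apply: measurableT_comp => //; exact: mfs.
have mCD : measurable_fun D C := measurable_funTS mC.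
have mGl : measurable_fun setT (fun r : mR => Gs (r, t0)).
  by apply: (measurableT_comp mGs); exact: measurable_pair2.
apply: (@le_trans _ _ (`|f (s, t) - f (s0, t)|%:E + `|f (s0, t) - f (s0, t0)|%:E)%E).
  by rewrite -EFinD lee_fin -[X in `|X|](subrKA (f (s0, t))) ler_normD.
have h1 : (`|f (s0, t) - f (s0, t0)|%:E <= \int[leb2]_z Gt z)%E.
  rewrite -IA; apply: le_trans As0; exact: vf.
have h2 : (`|f (s, t) - f (s0, t)|%:E <= \int[leb2]_z Gs z + \int[leb2]_z Gst z)%E.
  apply: (@le_trans _ _ (\int[mu]_(r in D) (`|fs (r, t0)|%:E + C r))%E).
    apply: le_trans (hf _ _ _ s1 s01 t1) _; apply: ge0_le_integral => //.
    - exact: mfsE.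
    - by apply: emeasurable_funD => //; exact: mfsE.
    - move=> r /Dr r1; apply: (@le_trans _ _ (`|fs (r, t0)|%:E + `|fs (r, t) - fs (r, t0)|%:E)%E).
        by rewrite -EFinD lee_fin addrC -[X in `|X|](subrK (fs (r, t0))) ler_normD.
      by apply: leeD => //; exact: vfs.
  rewrite ge0_integralD //; last exact: mfsE.
  apply: leeD.
    apply: (@le_trans _ _ (\int[mu]_(r in D) Gs (r, t0))%E).
      apply: ge0_le_integral => //.
      - exact: mfsE.
      - exact: measurable_funTS.
      - by move=> r /Dr r1; apply: fsG.
    rewrite -IB; apply: le_trans Bt0; apply: ge0_subset_integral => //.
  by rewrite -IC; apply: ge0_subset_integral.
by rewrite /I addeAC; exact: leeD.
Qed.
End Poincare.
End Square.

(** * Directional derivatives and symmetry of second derivatives *)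

Section Directional.
Context {R : realType}.
Implicit Types (A B : set (R * R)) (u : R * R -> R) (i j : 'I_2) (x y v : R * R).

Lemma coord_line i x (t : R) : coord i (x + t *: uv i) = coord i x + t.
Proof. by have [->|->] := I2_cases i; rewrite /coord /unitv /= /GRing.scale /=; ring. Qed.

Lemma line_quad u x i (c eps t : R) :
  (forall s, `|s| <= `|t| -> derivable u (x + s *: uv i) (uv i)) ->
  (forall s, `|s| <= `|t| -> `|partial i u (x + s *: uv i) - c| <= eps) ->
  `|u (x + t *: uv i) - u x - t * c| <= eps * `|t|.
Proof.
move=> du Hu.
pose f y := u y - c * coord i y.
have df s : `|s| <= `|t| -> is_derive (x + s *: uv i) (uv i) f
    (partial i u (x + s *: uv i) - c).
  move=> st; have d1 := derivableP (du s st).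
  have d2 := is_derive_coord i (x + s *: uv i).
  apply: (is_derive_eq (is_deriveB d1 (is_deriveZ c d2))).
  by rewrite /partial /GRing.scale /= mulr1.
rewrite (_ : _ - t * c = f (x + t *: uv i) - f x); last first.
  by rewrite /f coord_line; ring.
apply: line_lip => s st; first by case: (df s st).
by case: (df s st) => _ ->; exact: Hu.
Qed.

Lemma is_derive_little u x v (m : R) :
  (forall eps : R, 0 < eps -> \forall t \near (0 : R), `|u (x + t *: v) - u x - t * m| <= eps * `|t|) ->
  is_derive x v u m.
Proof.
move=> H.
have L : (fun h : R => h^-1 *: ((u \o shift x) (h *: v) - u x)) @ 0^' --> m.
  apply/cvgrPdist_le => eps e0; near=> t; have t0 : t != 0 by near: t; exact: nbhs_dnbhs_neq.
  rewrite /= (addrC _ x) /GRing.scale /=.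
  rewrite (_ : m - _ = - (t^-1 * (u (x + t *: v) - u x - t * m))); last by field.
  rewrite normrN normrM normfV ler_pdivrMl ?normr_gt0 // [`|t| * _]mulrC.
  by near: t; apply: nbhs_dnbhs; exact: H.
apply: DeriveDef; first by apply/cvg_ex; exists m.
exact/cvg_lim.
Unshelve. all: by end_near.
Qed.

Lemma Ck_cont k A u x : open A -> Ck k A u -> A x -> forall s, (size s <= k)%N -> {for x, continuous (partials s u)}.
Proof.
move=> oA [_ H] Ax s sk; have := H s sk; rewrite continuous_open_subspace //; apply.
exact: mem_set.
Qed.

Lemma cont_ball (f : R * R -> R) x (eps : R) : {for x, continuous f} -> 0 < eps ->
  exists2 q : R, 0 < q & forall y, ball x q y -> `|f x - f y| <= eps.
Proof. by move=> /cvgrPdist_le /[apply] /nbhs_ballP[q /= q0 H]; exists q. Qed.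

Lemma cont_ball2 A (f g : R * R -> R) x (eps : R) : open A -> A x ->
  {for x, continuous f} -> {for x, continuous g} -> 0 < eps ->
  exists2 q : R, 0 < q & forall y, ball x q y -> [/\ A y, `|f x - f y| <= eps & `|g x - g y| <= eps].
Proof.
move=> oA Ax cf cg e0; have [q1 q10 H1] := cont_ball cf e0; have [q2 q20 H2] := cont_ball cg e0.
have /nbhs_ballP[q3 /= q30 H3] := oA _ Ax.
exists (Num.min q3 (Num.min q1 q2)); first by rewrite !lt_min q10 q20 q30.
move=> y xy; split; [apply: H3|apply: H1|apply: H2]; apply: le_ball xy; by rewrite !ge_min lexx ?orbT.
Qed.

Lemma unitv_small x v (q : R) : 0 < q -> exists2 r : R, 0 < r & forall t s1 s2, `|t| <= r ->
  `|s1| <= `|t * v.1| -> `|s2| <= `|t * v.2| -> ball x q (x + s1 *: uv 0 + s2 *: uv 1).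
Proof.
move=> q0; pose V := `|v.1| + `|v.2| + 1.
have V0 : 0 < V by rewrite ltr_wpDl // addr_ge0.
exists (q / (2 * V)); first by rewrite divr_gt0 ?mulr_gt0.
move=> t s1 s2 tr s1r s2r.
have tV : `|t| * V <= q / 2.
  by move: tr; rewrite ler_pdivlMr ?mulr_gt0 // => h; rewrite ler_pdivlMr // -mulrA (mulrC V).
have tv1 : `|t * v.1| <= q / 2.
  apply: le_trans tV; rewrite normrM ler_wpM2l // /V; have := normr_ge0 v.2; lra.
have tv2 : `|t * v.2| <= q / 2.
  apply: le_trans tV; rewrite normrM ler_wpM2l // /V; have := normr_ge0 v.1; lra.
rewrite -addrA; apply: ball2_small => //=; rewrite /GRing.scale /= ?mulr0 ?mulr1 ?addr0 ?add0r.
  exact: le_trans s1r tv1.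
exact: le_trans s2r tv2.
Qed.

Lemma C1_directional A u x v : open A -> Ck 1 A u -> A x ->
  is_derive x v u (v.1 * partial 0 u x + v.2 * partial 1 u x).
Proof.
move=> oA C1 Ax; apply: is_derive_little => eps eps0.
pose V := `|v.1| + `|v.2| + 1.
have V0 : 0 < V by rewrite ltr_wpDl // addr_ge0.
have eV : 0 < eps / V by rewrite divr_gt0.
have c0 := Ck_cont oA C1 Ax (s := [:: 0]) isT; have c1 := Ck_cont oA C1 Ax (s := [:: 1]) isT.
have [q q0 Hq] := cont_ball2 oA Ax c0 c1 eV.
have [r r0 Hr] := unitv_small x v q0.
near=> t; have tr : `|t| <= r.
  by near: t; apply/nbhs_ballP; exists r => //= s; rewrite /ball /= sub0r normrN => /ltW.
have du i y : A y -> derivable u y (uv i) by move=> Ay; case: C1 => h _; exact: (h [::]).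
pose y := x + (t * v.1) *: (unitv 0 : R * R).
have E : x + t *: v = y + (t * v.2) *: (unitv 1 : R * R).
  by apply: injective_projections; rewrite /y /unitv /= /GRing.scale /=; ring.
have Q1 : `|u y - u x - (t * v.1) * partial 0 u x| <= eps / V * `|t * v.1|.
  apply: line_quad => s st.
    apply: du; have := Hr t s 0 tr st; rewrite normr0 scale0r addr0 => /(_ (normr_ge0 _)) /Hq []; done.
  have := Hr t s 0 tr st; rewrite normr0 scale0r addr0 => /(_ (normr_ge0 _)) /Hq [_ h1 _].
  rewrite distrC; exact: h1.
have Q2 : `|u (y + (t * v.2) *: uv 1) - u y - (t * v.2) * partial 1 u x| <= eps / V * `|t * v.2|.
  apply: line_quad => s st.
    by have [Ay _ _] := Hq _ (Hr t (t * v.1) s tr (lexx _) st); exact: du.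
  have := Hr t (t * v.1) s tr (lexx _) st => /Hq [_ _ h2].
  rewrite distrC; exact: h2.
rewrite E (_ : _ - _ - _ = (u y - u x - (t * v.1) * partial 0 u x) +
  (u (y + (t * v.2) *: uv 1) - u y - (t * v.2) * partial 1 u x)); last by ring.
apply: le_trans (ler_normD _ _) _; apply: le_trans (lerD Q1 Q2) _.
rewrite -mulrDr !normrM -mulrDr mulrCA mulrC ler_wpM2r //.
rewrite mulrAC -[leRHS]mulr1 -mulrA ler_wpM2l ?(ltW eps0) // ler_pdivrMr // mul1r /V lerDl.
Unshelve. all: by end_near.
Qed.

(** The second difference [D i j] is symmetric in the two directions, and divided by [r^2] it is
    within [eps / 2] of either mixed derivative. *)
Lemma schwarz A u x : open A -> Ck 2 A u -> A x -> partial 1 (partial 0 u) x = partial 0 (partial 1 u) x.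
Proof.
move=> oA C2 Ax; apply/eqP; rewrite -subr_eq0 -normr_le0; apply/ler_addgt0Pr => eps eps0; rewrite add0r.
have e2 : 0 < eps / 2 by rewrite divr_gt0.
have c0 := Ck_cont oA C2 Ax (s := [:: 1; 0]) isT; have c1 := Ck_cont oA C2 Ax (s := [:: 0; 1]) isT.
set c := partial 1 _ x; set c' := partial 0 _ x.
have [q q0 Hq] := cont_ball2 oA Ax c0 c1 e2.
have [r r0 Hr] := unitv_small x (1, 1) q0; rewrite /= in Hr.
have B s1 s2 : `|s1| <= r -> `|s2| <= r -> ball x q (x + s1 *: uv 0 + s2 *: uv 1).
  move=> h1 h2; apply: (Hr r) => //; rewrite ?mulr1 (ger0_norm (ltW r0)) //.
have rA : `|r| = r by rewrite ger0_norm // ltW.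
pose D i j := u (x + r *: uv i + r *: uv j) - u (x + r *: uv i) -
  (u (x + r *: uv j) - u x).
have key i j a : (forall s t, `|s| <= r -> `|t| <= r ->
    let y := x + s *: uv i + t *: uv j in A y /\ `|a - partial j (partial i u) y| <= eps / 2) ->
    `|D i j - r * (r * a)| <= eps / 2 * r * r.
  move=> H; pose e := r *: uv j; pose f y := u (y + e) - u y.
  have du y : A y -> derivable u y (uv i) by move=> Ay; case: C2 => h _; exact: (h [::]).
  have df s : `|s| <= r -> is_derive (x + s *: uv i) (uv i) f
      (partial i u (x + s *: uv i + e) - partial i u (x + s *: uv i)).
    move=> sr; have [Ay' _] := H s r sr (eq_ind_r (fun z => z <= r) (lexx r) rA).
    have n0 : `|0 : R| <= r by rewrite normr0 ltW.
    have [] := H s 0 sr n0; rewrite scale0r addr0 => Ay _.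
    rewrite -/e in Ay'; set y := x + s *: _ in Ay Ay' *.
    apply: is_deriveB; last exact: derivableP (du _ Ay).
    have sh : (fun h : R => h^-1 *: (((fun y => u (y + e)) \o shift y) (h *: uv i) - u (y + e))) =
        (fun h : R => h^-1 *: ((u \o shift (y + e)) (h *: uv i) - u (y + e))).
      by apply/funext => h /=; rewrite (addrA _ y).
    by apply: DeriveDef; [rewrite /derivable sh; exact: du|rewrite /derive sh].
  have := @line_quad f x i (r * a) (eps / 2 * r) r.
  rewrite rA /f; apply => s sr; rewrite -/f; have [dfs dE] := df s sr; first exact: dfs.
  rewrite /partial dE -[X in _ <= _ * X]rA; apply: line_quad => t; rewrite rA => tr; have [Ay h] := H s t sr tr.
    by case: C2 => h' _; exact: (h' [:: i]).
  by rewrite distrC.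
have D1 : `|D 0 1 - r * (r * c)| <= eps / 2 * r * r.
  by apply: key => s t sr tr; have [Ay h _] := Hq _ (B s t sr tr); split; [exact: Ay|exact: h].
have D2 : `|D 0 1 - r * (r * c')| <= eps / 2 * r * r.
  rewrite (_ : D 0 1 = D 1 0); last by rewrite /D (addrAC x); ring.
  by apply: key => s t sr tr; rewrite addrAC; have [Ay _ h] := Hq _ (B t s tr sr); split; [exact: Ay|exact: h].
have r2 : 0 < r * r by rewrite mulr_gt0.
rewrite -(ler_pM2r r2) -[X in `|_| * X]gtr0_norm // -normrM.
rewrite (_ : _ * (r * r) = (D 0 1 - r * (r * c')) - (D 0 1 - r * (r * c))); last by ring.
apply: le_trans (ler_normB _ _) _; apply: le_trans (lerD D2 D1) _.
by rewrite -(mulrA (eps / 2)) -mulrDl -splitr.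
Qed.

End Directional.

(** * Transfer to parallelograms *)

Section Parallelogram.
Context {R : realType}.
Local Notation mR := (measurableTypeR R).
Local Notation T2 := (plane R).
Local Notation mu := (@lebesgue_measure R).
Implicit Types (B S : set (R * R)) (F : R * R -> R) (P a b x y v : R * R).

Definition det2 a b : R := a.1 * b.2 - a.2 * b.1.

Definition par P a b : set (R * R) := [set aff2 P a b z | z in usq].

Lemma aff2_cont P a b : continuous (aff2 P a b : R * R -> R * R).
Proof.
rewrite (_ : (aff2 P a b : R * R -> R * R) = fun z => P + z.1 *: a + z.2 *: b); last first.
  by apply/funext => z; rewrite aff2E.
move=> z; apply: cvgD; first apply: cvgD; first exact: cvg_cst.
  by apply: cvgZr_tmp; exact: cvg_fst.
by apply: cvgZr_tmp; exact: cvg_snd.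
Qed.

Lemma usq_compact : compact (@usq R).
Proof.
rewrite (_ : usq = `[0, 1] `*` `[0, 1]); first exact: compact_rect.
by apply/seteqP; split => z; rewrite /usq /= !in_itv.
Qed.

Lemma measurable_usq : measurable (@usq R : set T2).
Proof. exact: compact_measurable2 usq_compact. Qed.

Lemma par_compact P a b : compact (par P a b).
Proof.
apply: continuous_compact usq_compact; apply: continuous_subspaceT; exact: aff2_cont.
Qed.

Lemma measurable_par P a b : meas2 (par P a b).
Proof. by apply: compact_measurable2; exact: par_compact. Qed.

Lemma aff2_inj P a b : det2 a b != 0 -> injective (aff2 P a b).
Proof.
move=> d0 [s t] [s' t'] E.
have E1 : (s - s') * a.1 + (t - t') * b.1 = 0 by have := congr1 fst E; rewrite /aff2 /=; lra.
have E2 : (s - s') * a.2 + (t - t') * b.2 = 0 by have := congr1 snd E; rewrite /aff2 /=; lra.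
have h1 : (s - s') * det2 a b = 0.
  rewrite (_ : _ * _ = b.2 * ((s - s') * a.1 + (t - t') * b.1) - b.1 * ((s - s') * a.2 + (t - t') * b.2)); last by rewrite /det2; ring.
  by rewrite E1 E2 !mulr0 subrr.
have h2 : (t - t') * det2 a b = 0.
  rewrite (_ : _ * _ = a.1 * ((s - s') * a.2 + (t - t') * b.2) - a.2 * ((s - s') * a.1 + (t - t') * b.1)); last by rewrite /det2; ring.
  by rewrite E1 E2 !mulr0 subrr.
move: h1 h2 => /eqP; rewrite mulf_eq0 (negbTE d0) orbF subr_eq0 => /eqP -> /eqP.
by rewrite mulf_eq0 (negbTE d0) orbF subr_eq0 => /eqP ->.
Qed.

Lemma affine_integral_par P a b (psi : T2 -> \bar R) : det2 a b != 0 ->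
  measurable_fun (par P a b : set T2) psi -> (forall x, par P a b x -> (0 <= psi x)%E) ->
  (\int[leb2]_(z in usq) psi (aff2 P a b z) = `|det2 a b|^-1%:E * \int[leb2]_(x in par P a b) psi x)%E.
Proof.
move=> d0 mpsi psi0; have mp := measurable_par P a b.
pose H := (psi \_ (par P a b)) : T2 -> \bar R.
have mH : measurable_fun setT H by apply/(measurable_restrictT _ mp).
have H0 x : (0 <= H x)%E by apply: erestrict_ge0.
have := affine_integral2 P d0 mH H0.
have -> : (\int[leb2]_(x in par P a b) psi x = \int[leb2]_x H x)%E by rewrite integral_mkcond.
rewrite -/(det2 a b) => <-.
rewrite integral_mkcond; apply: eq_integral => z _; rewrite /H !patchE.
have -> : (aff2 P a b z \in par P a b) = (z \in usq).
  apply/idP/idP; rewrite !inE; last by move=> zq; exists z.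
  by move=> [y yq E]; rewrite -(aff2_inj d0 E).
by [].
Qed.

Lemma leb2_par P a b : det2 a b != 0 -> leb2 (par P a b : set T2) = `|det2 a b|%:E.
Proof.
move=> d0; have := @affine_integral_par P a b (fun=> 1%E) d0 (measurable_cst _) (fun _ _ => lee01).
have u1 : leb2 (usq : set T2) = 1%E.
  rewrite (_ : (usq : set T2) = itv01 `*` itv01).
    rewrite leb2X; [|exact: measurable_itv01|exact: measurable_itv01].
    by rewrite lebesgue_itv01 mule1.
  by apply/seteqP; split => z; rewrite /usq /itv01 /= !in_itv.
rewrite !integral_cst; [|exact: measurable_par|exact: measurable_usq].
rewrite !mul1e u1 => E; have n0 : `|det2 a b| != 0 by rewrite normr_eq0.
rewrite -[LHS]mul1e -[X in (X * _)%E](_ : (`|det2 a b|%:E * `|det2 a b|^-1%:E)%E = 1%E); last first.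
  by rewrite -EFinM mulfV.
by rewrite -muleA -E mule1.
Qed.

Definition dir_bound B F (DF : R * R -> R * R -> R) (g : R * R -> R) : Prop :=
  forall x, B x -> [/\ {for x, continuous F}, {for x, continuous g} &
  forall v, [/\ is_derive x v F (DF x v), `|DF x v| <= enorm v * g x & {for x, continuous (DF^~ v)}]].

Lemma ftc_line B F DF g x v : dir_bound B F DF g -> (forall r : R, 0 <= r <= 1 -> B (x + r *: v)) ->
  forall s s' : R, 0 <= s <= 1 -> 0 <= s' <= 1 ->
  (`|F (x + s *: v) - F (x + s' *: v)|%:E <= \int[mu]_(r in itv01) `|DF (x + r *: v) v|%:E)%E.
Proof.
move=> db HB s s' s1 s1'.
apply: (@ftc_abs _ (fun r => F (x + r *: v)) (fun r => DF (x + r *: v) v) 0 1) => //.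
  move=> r r1; have [_ _ /(_ v)[d _ _]] := db _ (HB r r1).
  apply: DeriveDef; first by apply/derivable_line; case: d.
  by rewrite -derive_line; case: d.
apply: continuous_in_subspaceT => r; rewrite inE /= in_itv /= => r1.
have [_ _ /(_ v)[_ _ c]] := db _ (HB r r1).
by apply: (@continuous_comp _ _ _ (fun r : R => x + r *: v) (DF^~ v)); [exact: line_cont|exact: c].
Qed.

Lemma line_cont_in B (g : R * R -> R) x v : (forall y, B y -> {for y, continuous g}) ->
  (forall r : R, 0 <= r <= 1 -> B (x + r *: v)) -> measurable_fun (@itv01 R) (fun r : mR => g (x + r *: v)).
Proof.
move=> cg HB; apply: subspace_continuous_measurable_fun; first exact: measurable_itv01.
apply: continuous_in_subspaceT => r; rewrite inE /itv01 /= in_itv /= => r1.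
by apply: (@continuous_comp _ _ _ (fun r : R => x + r *: v) g); [exact: line_cont|exact: cg _ (HB r r1)].
Qed.

Section OnPar.
Variables (B S : set (R * R)) (P a b : R * R).
Hypothesis mS : meas2 S.
Hypothesis SB : S `<=` B.
Hypothesis pS : par P a b `<=` S.
Hypothesis d0 : det2 a b != 0.

Definition cutoff (g : R * R -> R) (x : T2) : \bar R := ((fun x => (g x)%:E) \_ S) x.

Lemma measurable_cutoff (g : R * R -> R) : mfun2 S g -> measurable_fun setT (cutoff g).
Proof. by move=> mg; apply/(measurable_restrictT _ mS)/measurable_EFinP. Qed.

Lemma cutoff_ge0 (g : R * R -> R) x : (forall x, S x -> 0 <= g x) -> (0 <= cutoff g x)%E.
Proof. by move=> g0; rewrite /cutoff patchE; case: ifPn => // /set_mem /g0; rewrite lee_fin. Qed.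

(** With [c] the length of a side, a bound for the derivative along that side in the parameters of
    the parallelogram. It is cut off at [S], not at the parallelogram, so that later one integral
    over the whole triangle bounds it for each of three parallelograms. *)
Definition scut (c : R) (g : R * R -> R) (z : T2) : \bar R := (c%:E * cutoff g (aff2 P a b z))%E.

Lemma measurable_scut c (g : R * R -> R) : mfun2 S g -> measurable_fun setT (scut c g).
Proof.
move=> mg; apply: emeasurable_funM => //.
by apply: (measurableT_comp (measurable_cutoff mg)); exact: measurable_aff2.
Qed.

Lemma scut_ge0 c (g : R * R -> R) z : 0 <= c -> (forall x, S x -> 0 <= g x) -> (0 <= scut c g z)%E.
Proof. by move=> c0 g0; apply: mule_ge0; [rewrite lee_fin|exact: cutoff_ge0]. Qed.

Lemma integral_scut c (g : R * R -> R) (I : R) : 0 <= c -> mfun2 S g ->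
  (forall x, S x -> 0 <= g x) -> (\int[leb2]_(x in S) (g x)%:E <= I%:E)%E ->
  (\int[leb2]_z scut c g z <= (c * I / `|det2 a b|)%:E)%E.
Proof.
move=> c0 mg g0 HI.
have mc := measurable_cutoff mg.
have mca : measurable_fun setT (fun z : T2 => cutoff g (aff2 P a b z)).
  by apply: (measurableT_comp mc); exact: measurable_aff2.
have ca0 z : (0 <= cutoff g (aff2 P a b z))%E by exact: cutoff_ge0.
have c0' : (0 <= c%:E)%E by rewrite lee_fin.
rewrite /scut (ge0_integralZl leb2 measurableT mca (fun z _ => ca0 z) c0').
rewrite (affine_integral2 P d0 mc (fun x => cutoff_ge0 x g0)) -integral_mkcond.
rewrite -mulrA EFinM; apply: lee_pmul => //.
  by apply: mule_ge0; rewrite ?lee_fin ?invr_ge0 //; apply: integral_ge0 => x Sx; rewrite lee_fin g0.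
rewrite (mulrC I) EFinM; apply: lee_pmul => //; rewrite ?lee_fin ?invr_ge0 //.
by apply: integral_ge0 => x Sx; rewrite lee_fin g0.
Qed.

Lemma aff_in s t : 0 <= s <= 1 -> 0 <= t <= 1 -> S (aff2 P a b (s, t)).
Proof. by move=> s1 t1; apply: pS; exists (s, t). Qed.

Lemma affE1 s t : aff2 P a b (s, t) = (P + t *: b) + s *: a.
Proof. by rewrite aff2E addrAC. Qed.

Lemma affE2 s t : aff2 P a b (s, t) = (P + s *: a) + t *: b.
Proof. by rewrite aff2E. Qed.

Lemma scut_in c g z : usq z -> scut c g z = (c * g (aff2 P a b z))%:E.
Proof.
by case: z => s t [/= s1 t1]; rewrite /scut /cutoff patchE mem_set; [rewrite EFinM|exact: aff_in].
Qed.

Section Bound.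
Variables (F : R * R -> R) (DF : R * R -> R * R -> R) (g : R * R -> R).
Hypothesis db : dir_bound B F DF g.
Hypothesis g0 : forall x, S x -> 0 <= g x.
Hypothesis mg : mfun2 S g.

Lemma line_integral_le x v (c : R) (G : mR -> \bar R) : measurable_fun setT G -> (forall r : mR, (0 <= G r)%E) ->
  (forall r : R, 0 <= r <= 1 -> B (x + r *: v)) ->
  (forall r : R, 0 <= r <= 1 -> ((enorm v * g (x + r *: v))%:E <= G r)%E) ->
  (\int[mu]_(r in itv01) `|DF (x + r *: v) v|%:E <= \int[mu]_r G r)%E.
Proof.
move=> mG G0 HB HG.
have mD := @measurable_itv01 R.
have cD y : B y -> {for y, continuous (DF^~ v)} by move=> /db[_ _ /(_ v)[]].
have mDF : measurable_fun (@itv01 R) (fun r : mR => `|DF (x + r *: v) v|%:E).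
  by apply/measurable_EFinP; apply: measurableT_comp => //; exact: (line_cont_in cD HB).
apply: (@le_trans _ _ (\int[mu]_(r in itv01) G r)%E).
  apply: ge0_le_integral => //.
    exact: measurable_funTS.
  move=> r; rewrite /itv01 /= in_itv /= => r1; apply: le_trans (HG r r1).
  by have [_ _ /(_ v)[_ h _]] := db (HB r r1); rewrite lee_fin.
by apply: ge0_subset_integral.
Qed.

Lemma horiz_aff : horiz (fun z => F (aff2 P a b z)) (scut (enorm a) g).
Proof.
move=> s s' t s1 s1' t1; rewrite !affE1.
have HB (r : R) : 0 <= r <= 1 -> B (P + t *: b + r *: a) by move=> r1; rewrite -affE1; apply: SB; exact: aff_in.
apply: le_trans (ftc_line db HB s1 s1') _; apply: (line_integral_le 0) => //.
- by apply: (measurableT_comp (measurable_scut (enorm a) mg)); exact: measurable_pair2.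
- by move=> r; apply: scut_ge0 => //; exact: enorm_ge0.
- by move=> r r1; rewrite scut_in ?affE1.
Qed.

Lemma vert_aff : vert (fun z => F (aff2 P a b z)) (scut (enorm b) g).
Proof.
move=> s t t' s1 t1 t1'; rewrite !affE2.
have HB (r : R) : 0 <= r <= 1 -> B (P + s *: a + r *: b) by move=> r1; rewrite -affE2; apply: SB; exact: aff_in.
apply: le_trans (ftc_line db HB t1 t1') _; apply: (line_integral_le 0) => //.
- by apply: (measurableT_comp (measurable_scut (enorm b) mg)); exact: measurable_pair1.
- by move=> r; apply: scut_ge0 => //; exact: enorm_ge0.
- by move=> r r1; rewrite scut_in ?affE2.
Qed.

End Bound.

Lemma par_poincare (g : R * R -> R) (I : R) : (forall x, S x -> 0 <= g x) ->
  mfun2 S g -> (\int[leb2]_(x in S) (g x)%:E <= I%:E)%E ->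
  exists x0, par P a b x0 /\ forall F DF, dir_bound B F DF g ->
  (\int[leb2]_(x in par P a b) ((F x - F x0) ^+ 2)%:E <=
     (((enorm a + enorm b) * I) ^+ 2 / `|det2 a b|)%:E)%E.
Proof.
move=> g0 mg HI.
have I0 : 0 <= I by rewrite -lee_fin; apply: le_trans HI; apply: integral_ge0 => x Sx; rewrite lee_fin g0.
have a0 := enorm_ge0 a; have b0 := enorm_ge0 b.
have [z0 [z0q Hz0]] := square_poincare (measurable_scut (enorm a) mg) (measurable_scut (enorm b) mg)
  (fun z => scut_ge0 z a0 g0) (fun z => scut_ge0 z b0 g0).
exists (aff2 P a b z0); split; first by exists z0.
move=> F DF db.
have cF x : par P a b x -> {for x, continuous F} by move=> /pS /SB /db[].
have mF : mfun2 (par P a b) F.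
  apply: within_continuous_measurable2; first exact: measurable_par.
  by apply: continuous_in_subspaceT => x /set_mem; exact: cF.
have mFa : measurable_fun (usq : set T2) (fun z : T2 => F (aff2 P a b z)).
  apply: within_continuous_measurable2; first exact: measurable_usq.
  apply: continuous_in_subspaceT => z /set_mem zq; apply: continuous_comp; first exact: aff2_cont.
  by apply: cF; exists z.
have := Hz0 _ mFa (horiz_aff db g0 mg) (vert_aff db g0 mg).
rewrite (@affine_integral_par P a b (fun x => ((F x - F (aff2 P a b z0)) ^+ 2)%:E)) //; last 2 first.
- by apply/measurable_EFinP; apply: measurable_funX; apply: measurable_funB.
- by move=> x _; rewrite lee_fin sqr_ge0.
set Y := (\int[leb2]_(x in par P a b) _)%E => H.
have dp : 0 < `|det2 a b| by rewrite normr_gt0.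
have L : (\int[leb2]_z scut (enorm a) g z + \int[leb2]_z scut (enorm b) g z <= ((enorm a + enorm b) * I / `|det2 a b|)%:E)%E.
  rewrite mulrDl mulrDl EFinD; apply: leeD; exact: integral_scut.
have L0 : (0 <= \int[leb2]_z scut (enorm a) g z + \int[leb2]_z scut (enorm b) g z)%E.
  by apply: adde_ge0; apply: integral_ge0 => z _; exact: scut_ge0.
have H2 := le_trans H (lee_pmul L0 L0 L L).
have -> : Y = (`|det2 a b|%:E * (`|det2 a b|^-1%:E * Y))%E by rewrite muleA -EFinM mulfV ?mul1e // lt0r_neq0.
have dp' : (0 <= `|det2 a b|%:E)%E by rewrite lee_fin ltW.
apply: le_trans (lee_wpmul2l dp' H2) _.
rewrite -!EFinM lee_fin le_eqVlt; apply/orP; left; apply/eqP; field; exact: lt0r_neq0.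
Qed.

Lemma par_sup (g g2 : R * R -> R) (I I2 : R) : (forall x, S x -> 0 <= g x) -> (forall x, S x -> 0 <= g2 x) ->
  mfun2 S g -> mfun2 S g2 ->
  (\int[leb2]_(x in S) (g x)%:E <= I%:E)%E -> (\int[leb2]_(x in S) (g2 x)%:E <= I2%:E)%E ->
  exists x1, par P a b x1 /\ forall F DF D2, dir_bound B F DF g -> dir_bound B (DF^~ a) D2 g2 ->
  forall x, par P a b x -> `|F x - F x1| <= ((enorm a + enorm b) * I + enorm b * I2) / `|det2 a b|.
Proof.
move=> g0 g20 mg mg2 HI HI2.
have a0 := enorm_ge0 a; have b0 := enorm_ge0 b.
have [z1 [z1q Hz1]] := square_sup (measurable_scut (enorm a) mg) (measurable_scut (enorm b) mg)
  (fun z => scut_ge0 z a0 g0) (fun z => scut_ge0 z b0 g0) (measurable_scut (enorm b) mg2)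
  (fun z => scut_ge0 z b0 g20).
exists (aff2 P a b z1); split; first by exists z1.
move=> F DF D2 db db2 _ [z zq <-].
have HB (t r : R) : 0 <= t <= 1 -> 0 <= r <= 1 -> B (P + t *: b + r *: a).
  by move=> t1 r1; rewrite -affE1; apply: SB; exact: aff_in.
have := Hz1 (fun z => F (aff2 P a b z)) (fun z => DF (aff2 P a b z) a).
move=> /(_ _ _ _ (vert_aff db g0 mg) (vert_aff db2 g20 mg2) z zq) H.
rewrite -lee_fin; apply: le_trans (H _ _ _) _.
- move=> s s' t s1 s1' t1; rewrite !affE1.
  apply: le_trans (ftc_line db (fun r => HB t r t1) s1 s1') _.
  by apply: eqle; apply: eq_integral => r _; rewrite affE1.
- move=> t t1; apply: (@eq_measurable_fun _ _ _ _ _ (fun r : mR => DF (P + t *: b + r *: a) a)).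
    by move=> r _; rewrite affE1.
  apply: (@line_cont_in B (DF^~ a)); last by move=> r; exact: HB.
  by move=> y By; have [_ _ /(_ a)[]] := db y By.
- move=> w [/= w1 w2]; rewrite scut_in // lee_fin.
  have Bw : B (aff2 P a b w) by case: w w1 w2 => s t /= s1 t1; apply: SB; exact: aff_in.
  by have [_ _ /(_ a)[]] := db _ Bw.
- rewrite mulrDl mulrDl mulrDl !EFinD; apply: leeD; last exact: integral_scut.
  by apply: leeD; exact: integral_scut.
Qed.

End OnPar.
End Parallelogram.

(** * Calculus of integral bounds *)

Section IntegralBounds.
Context {R : realType}.
Local Notation T2 := (plane R).
Implicit Types (f g h : R * R -> R) (a b c m : R).

Lemma measurable_epow d (T : measurableType d) (D : set T) (a r : T -> R) : measurable D ->
  measurable_fun D a -> measurable_fun D r -> measurable_fun D (fun x => epow (a x) (r x)).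
Proof.
move=> mD ma mr; rewrite /epow.
have m1 : measurable_fun D (fun x => a x == 0) by exact: measurable_fun_eqr.
have m2 : measurable_fun D (fun x => r x < 0) by exact: measurable_fun_ltr.
apply: measurable_fun_if => //; first exact: measurable_and.
apply: (measurable_funS mD); first by move=> x [].
by apply/measurable_EFinP; exact: measurable_powR2.
Qed.

Lemma epow_ge0 a b : 0 <= a -> (0 <= epow a b)%E.
Proof. by move=> a0; rewrite /epow; case: ifP => // _; rewrite lee_fin powR_ge0. Qed.

Variable S : set (R * R).
Hypothesis mS : meas2 S.

Definition ible f a : Prop := (\int[leb2]_(x in S) (f x)%:E <= a%:E)%E.
Definition nnm f : Prop := mfun2 S f /\ forall x, S x -> 0 <= f x.

Lemma nnm_add f g : nnm f -> nnm g -> nnm (fun x => f x + g x).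
Proof. by move=> [m1 f0] [m2 g0]; split; [exact: measurable_funD|move=> x Sx; rewrite addr_ge0 ?f0 ?g0]. Qed.

Lemma nnm_scale f c : 0 <= c -> nnm f -> nnm (fun x => c * f x).
Proof. by move=> c0 [m1 f0]; split; [exact: measurable_funM|move=> x Sx; rewrite mulr_ge0 ?f0]. Qed.

Lemma nnm_cst c : 0 <= c -> nnm (fun=> c).
Proof. by move=> c0; split; [exact: measurable_cst|]. Qed.

Lemma nnm_integralD f g : nnm f -> nnm g ->
  (\int[leb2]_(x in S) (f x + g x)%:E = \int[leb2]_(x in S) (f x)%:E + \int[leb2]_(x in S) (g x)%:E)%E.
Proof.
move=> [m1 f0] [m2 g0].
have m1' : measurable_fun (S : set T2) (fun x : T2 => (f x)%:E) by exact/measurable_EFinP.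
have m2' : measurable_fun (S : set T2) (fun x : T2 => (g x)%:E) by exact/measurable_EFinP.
have f0' (x : T2) : S x -> (0 <= (f x)%:E)%E by move=> Sx; rewrite lee_fin f0.
have g0' (x : T2) : S x -> (0 <= (g x)%:E)%E by move=> Sx; rewrite lee_fin g0.
exact: (ge0_integralD leb2 mS f0' m1' g0' m2').
Qed.

Lemma nnm_integralZ f c : 0 <= c -> nnm f ->
  (\int[leb2]_(x in S) (c * f x)%:E = c%:E * \int[leb2]_(x in S) (f x)%:E)%E.
Proof.
move=> c0 [m1 f0].
have m1' : measurable_fun (S : set T2) (fun x : T2 => (f x)%:E) by exact/measurable_EFinP.
have f0' (x : T2) : S x -> (0 <= (f x)%:E)%E by move=> Sx; rewrite lee_fin f0.
have c0' : (0 <= c%:E)%E by rewrite lee_fin.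
exact: (ge0_integralZl leb2 mS m1' f0' c0').
Qed.

Lemma ible_add f g a b : nnm f -> nnm g -> ible f a -> ible g b -> ible (fun x => f x + g x) (a + b).
Proof.
move=> nf ng h1 h2; rewrite /ible nnm_integralD //.
by rewrite EFinD; exact: leeD.
Qed.

Lemma ible_scale f c a : 0 <= c -> nnm f -> ible f a -> ible (fun x => c * f x) (c * a).
Proof.
move=> c0 nf h1; rewrite /ible nnm_integralZ //.
by rewrite EFinM; apply: lee_wpmul2l; rewrite ?lee_fin.
Qed.

Lemma ible_le f g a : nnm f -> nnm g -> (forall x, S x -> f x <= g x) -> ible g a -> ible f a.
Proof.
move=> [m1 f0] [m2 g0] fg; apply: le_trans; apply: ge0_le_integral => //; exact/measurable_EFinP.
Qed.

Lemma ible_leE f (g : T2 -> \bar R) a : nnm f -> measurable_fun (S : set T2) g ->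
  (forall x, S x -> ((f x)%:E <= g x)%E) -> (\int[leb2]_(x in S) g x <= a%:E)%E -> ible f a.
Proof.
move=> [m1 f0] m2 fg; apply: le_trans; apply: ge0_le_integral => //.
- exact/measurable_EFinP.
Qed.

Lemma ible_trans f a b : ible f a -> a <= b -> ible f b.
Proof. by move=> h ab; apply: le_trans h _; rewrite lee_fin. Qed.

Lemma ible_ge0 f a : nnm f -> ible f a -> 0 <= a.
Proof.
by move=> [_ f0] h; rewrite -lee_fin; apply: le_trans h; apply: integral_ge0 => x Sx; rewrite lee_fin f0.
Qed.

Variable A : R.
Hypothesis SA : leb2 (S : set T2) = A%:E.

Lemma ible_cst c : ible (fun=> c) (c * A).
Proof. by rewrite /ible integral_cst // SA -EFinM. Qed.

Lemma ible_cst_le c a : ible (fun=> c) a -> c * A <= a.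
Proof. by rewrite /ible integral_cst // SA -EFinM lee_fin. Qed.

(* Jensen's inequality for a supporting line [l + c (. - m)] at the mean [m]. *)
Lemma ible_jensen g h (l c a m : R) : nnm g -> nnm h -> 0 <= l -> 0 <= c -> 0 <= m ->
  (\int[leb2]_(x in S) (g x)%:E)%E = (m * A)%:E ->
  (forall x, S x -> l + c * (g x - m) <= h x) -> ible h a -> l * A <= a.
Proof.
move=> ng nh l0 c0 m0 Eg H Hh.
have nl := nnm_cst l0; have ncg := nnm_scale c0 ng.
have ncm : nnm (fun=> c * m) by apply: nnm_cst; exact: mulr_ge0.
have E1 : (\int[leb2]_(x in S) (l + c * g x)%:E = (l * A + c * (m * A))%:E)%E.
  rewrite (nnm_integralD nl ncg) (nnm_integralZ c0 ng).
  by rewrite Eg integral_cst // SA -!EFinM -EFinD.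
have h2 : ible (fun x => h x + c * m) (a + c * m * A) by apply: ible_add => //; exact: ible_cst.
have : ible (fun x => l + c * g x) (a + c * m * A).
  apply: ible_le h2; [exact: nnm_add|exact: nnm_add|].
  by move=> x Sx; have := H x Sx; lra.
by rewrite /ible E1 lee_fin; lra.
Qed.

(** The Cauchy-Schwarz inequality, obtained as Jensen's inequality for the square: its tangent at
    the mean [m] is [m^2 + 2 m (g - m)]. *)
Lemma ible_sqr g a : 0 < A -> nnm g -> (\int[leb2]_(x in S) (g x)%:E < +oo)%E ->
  ible (fun x => g x ^+ 2) a -> exists I, [/\ 0 <= I, (\int[leb2]_(x in S) (g x)%:E)%E = I%:E & I ^+ 2 <= A * a].
Proof.
move=> A0 ng gfin Hg; have [mg g0] := ng.
have i0 : (0 <= \int[leb2]_(x in S) (g x)%:E)%E by apply: integral_ge0 => x Sx; rewrite lee_fin g0.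
have fn : (\int[leb2]_(x in S) (g x)%:E)%E \is a fin_num by rewrite ge0_fin_numE.
exists (fine (\int[leb2]_(x in S) (g x)%:E)%E); rewrite fineK //; set I := fine _.
have I0 : 0 <= I by rewrite fine_ge0.
split => //; pose m := I / A; have m0 : 0 <= m by rewrite divr_ge0 // ltW.
have := @ible_jensen g (fun x => g x ^+ 2) (m ^+ 2) (2 * m) a m ng.
move=> /(_ _ _ _ m0 _ _ Hg) h.
have : m ^+ 2 * A <= a.
  apply: h.
  - by split=> [|x Sx]; [exact: measurable_funX|exact: sqr_ge0].
  - exact: sqr_ge0.
  - by rewrite mulr_ge0.
  - by rewrite -(fineK fn) /m divfK // lt0r_neq0.
  - move=> x _; rewrite -subr_ge0 (_ : _ - _ = (g x - m) ^+ 2) ?sqr_ge0 //; ring.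
rewrite /m expr_div_n => h3; rewrite mulrC -ler_pdivrMr // (le_trans _ h3) //.
by apply: eqle; field; exact: lt0r_neq0.
Qed.

End IntegralBounds.

(** * Poincare and supremum inequalities on a triangle *)

Section TriangleEstimates.
Context {R : realType}.
Local Notation T2 := (plane R).
Implicit Types (k : @triangle R) (B S : set (R * R)) (F : R * R -> R) (p q r P a b x y v : R * R).

Lemma sq_split (s t c : R) : (t - c) ^+ 2 <= 2 * (s - t) ^+ 2 + 2 * (s - c) ^+ 2.
Proof. by rewrite -subr_ge0 (_ : _ - _ = ((s - t) + (s - c)) ^+ 2) ?sqr_ge0 //; ring. Qed.

Lemma sq_split2 (s t c : R) : (s - c) ^+ 2 <= 2 * (s - t) ^+ 2 + 2 * (t - c) ^+ 2.
Proof. by rewrite -subr_ge0 (_ : _ - _ = ((s - t) - (t - c)) ^+ 2) ?sqr_ge0 //; ring. Qed.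

(** The parallelogram at the corner [p] spanned by two half edges. The three of them cover the
    triangle, since at most one barycentric coordinate exceeds 1/2. *)
Definition cpar p q r : set (R * R) := par p (2^-1 *: (q - p)) (2^-1 *: (r - p)).

(** Two barycentric coordinates range over [[1/4, 1/2]], so the third is at most 1/2 and the set
    lies in all three corner parallelograms; it links their base points. *)
Definition medial k : set (R * R) :=
  par (k 0 + 4^-1 *: sd1 k + 4^-1 *: sd2 k) (4^-1 *: sd1 k) (4^-1 *: sd2 k).

Lemma br1_cpar k p q r z : br1 k (aff2 p (2^-1 *: (q - p)) (2^-1 *: (r - p)) z) =
  br1 k p + z.1 / 2 * (br1 k q - br1 k p) + z.2 / 2 * (br1 k r - br1 k p).
Proof. by rewrite /br1 /aff2 /= /GRing.scale /=; ring. Qed.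

Lemma br2_cpar k p q r z : br2 k (aff2 p (2^-1 *: (q - p)) (2^-1 *: (r - p)) z) =
  br2 k p + z.1 / 2 * (br2 k q - br2 k p) + z.2 / 2 * (br2 k r - br2 k p).
Proof. by rewrite /br2 /aff2 /= /GRing.scale /=; ring. Qed.

Lemma br_inj k x y : dt k != 0 -> br1 k x = br1 k y -> br2 k x = br2 k y -> x = y.
Proof. by move=> d0 e1 e2; rewrite -(brK x d0) -(brK y d0) e1 e2. Qed.

Lemma br_medial k z : dt k != 0 ->
  br1 k (aff2 (k 0 + 4^-1 *: sd1 k + 4^-1 *: sd2 k) (4^-1 *: sd1 k) (4^-1 *: sd2 k) z) = 4^-1 + z.1 / 4 /\
  br2 k (aff2 (k 0 + 4^-1 *: sd1 k + 4^-1 *: sd2 k) (4^-1 *: sd1 k) (4^-1 *: sd2 k) z) = 4^-1 + z.2 / 4.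
Proof.
move=> d0.
have -> : aff2 (k 0 + 4^-1 *: sd1 k + 4^-1 *: sd2 k) (4^-1 *: sd1 k) (4^-1 *: sd2 k) z =
  aff2 (k 0) (sd1 k) (sd2 k) (4^-1 + z.1 / 4, 4^-1 + z.2 / 4).
  by apply: injective_projections; rewrite /aff2 /= /GRing.scale /=; ring.
by rewrite affK1 // affK2.
Qed.

Section OneTriangle.
Variable k : @triangle R.
Hypothesis d0 : dt k != 0.

Local Notation Q0 := (cpar (k 0) (k 1) (k 2%:R)).
Local Notation Q1 := (cpar (k 1) (k 2%:R) (k 0)).
Local Notation Q2 := (cpar (k 2%:R) (k 0) (k 1)).

Lemma cpar_closedt : [/\ Q0 `<=` closedt k, Q1 `<=` closedt k & Q2 `<=` closedt k].
Proof.
have [h1 h2 h3] := br1_vertex d0; have [h4 h5 h6] := br2_vertex d0.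
by split=> x [[s t] [/= s1 t1] <-]; rewrite /closedt /= br1_cpar br2_cpar ?h1 ?h2 ?h3 ?h4 ?h5 ?h6 /=; split; lra.
Qed.

Lemma in_cpar x : let b0 := 1 - br1 k x - br2 k x in 0 <= b0 -> 0 <= br1 k x -> 0 <= br2 k x ->
  [/\ br1 k x <= 2^-1 -> br2 k x <= 2^-1 -> Q0 x, br2 k x <= 2^-1 -> b0 <= 2^-1 -> Q1 x &
      b0 <= 2^-1 -> br1 k x <= 2^-1 -> Q2 x].
Proof.
move=> b0 b00 b10 b20; rewrite {}/b0 in b00 *.
have [h1 h2 h3] := br1_vertex d0; have [h4 h5 h6] := br2_vertex d0.
split => c1 c2.
- exists (2 * br1 k x, 2 * br2 k x); first by split => /=; lra.
  by apply: (br_inj d0); rewrite ?br1_cpar ?br2_cpar ?h1 ?h2 ?h3 ?h4 ?h5 ?h6 /=; field.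
- exists (2 * br2 k x, 2 * (1 - br1 k x - br2 k x)); first by split => /=; lra.
  by apply: (br_inj d0); rewrite ?br1_cpar ?br2_cpar ?h1 ?h2 ?h3 ?h4 ?h5 ?h6 /=; field.
- exists (2 * (1 - br1 k x - br2 k x), 2 * br1 k x); first by split => /=; lra.
  by apply: (br_inj d0); rewrite ?br1_cpar ?br2_cpar ?h1 ?h2 ?h3 ?h4 ?h5 ?h6 /=; field.
Qed.

Lemma cpar_cover x : closedt k x -> [\/ Q0 x, Q1 x | Q2 x].
Proof.
move=> [b1 b2 b3]; have b0 : 0 <= 1 - br1 k x - br2 k x by lra.
have [H0 H1 H2] := in_cpar b0 b1 b2.
have [c1|c1] := leP (br1 k x) 2^-1; last by constructor 2; apply: H1; lra.
have [c2|c2] := leP (br2 k x) 2^-1; first by constructor 1; exact: H0.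
by constructor 3; apply: H2; lra.
Qed.

Lemma medial_cpar x : medial k x -> [/\ Q0 x, Q1 x & Q2 x].
Proof.
move=> [[s t] [/= s1 t1] <-]; set y := aff2 _ _ _ _.
have [e1 e2] := br_medial (s, t) d0; rewrite -/y /= in e1 e2.
have [] := @in_cpar y; rewrite ?e1 ?e2; try lra.
by move=> H0 H1 H2; split; [apply: H0|apply: H1|apply: H2]; lra.
Qed.

Lemma det2_cpar : [/\ `|det2 (2^-1 *: (k 1 - k 0)) (2^-1 *: (k 2%:R - k 0))| = `|dt k| / 4,
  `|det2 (2^-1 *: (k 2%:R - k 1)) (2^-1 *: (k 0 - k 1))| = `|dt k| / 4 &
  `|det2 (2^-1 *: (k 0 - k 2%:R)) (2^-1 *: (k 1 - k 2%:R))| = `|dt k| / 4].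
Proof.
have E : `|dt k| / 4 = `|dt k / 4| by rewrite normrM [`|4^-1|]ger0_norm.
by split; rewrite E; congr (`|_|); rewrite /det2 /dt /sd1 /sd2 /= /GRing.scale /=; field.
Qed.

Lemma leb2_medial : leb2 (medial k : set T2) = (`|dt k| / 16)%:E.
Proof.
have E : det2 (4^-1 *: sd1 k) (4^-1 *: sd2 k) = dt k / 16.
  by rewrite /det2 /dt /= /GRing.scale /=; field.
rewrite leb2_par E; last by rewrite mulf_neq0 // invr_eq0 pnatr_eq0.
by rewrite normrM [`|16^-1|]ger0_norm.
Qed.

Lemma closedt_compact : compact (closedt k).
Proof.
rewrite (_ : closedt k = Q0 `|` Q1 `|` Q2).
  by apply: compactU; [apply: compactU|]; exact: par_compact.
have [s0 s1 s2] := cpar_closedt.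
apply/seteqP; split => x; first by case/cpar_cover; [left; left|left; right|right].
by case=> [[]|]; [exact: s0|exact: s1|exact: s2].
Qed.

Lemma measurable_closedt : meas2 (closedt k).
Proof. by apply: closed_measurable2; exact: closedt_closed. Qed.

Variables (B : set (R * R)) (d : R).
Hypothesis kB : closedt k `<=` B.
Hypothesis kd : forall i j, enorm (k i - k j) <= d.

Lemma half_edge i j : enorm (2^-1 *: (k i - k j)) <= d / 2.
Proof. by rewrite enormZ [`|2^-1|]ger0_norm // mulrC ler_pM2r // kd. Qed.

Lemma integral_cover3 (f : T2 -> \bar R) : measurable_fun (closedt k : set T2) f ->
  (forall x, closedt k x -> (0 <= f x)%E) ->
  (\int[leb2]_(x in closedt k) f x <= \int[leb2]_(x in Q0) f x + \int[leb2]_(x in Q1) f x + \int[leb2]_(x in Q2) f x)%E.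
Proof.
move=> mf f0; have [s0 s1 s2] := cpar_closedt.
have mQ p q r : meas2 (cpar p q r) by exact: measurable_par.
have mk := measurable_closedt.
have mr (S : set (R * R)) : meas2 S -> S `<=` closedt k -> measurable_fun setT (f \_ S : T2 -> \bar R).
  by move=> mS sS; apply/(measurable_restrictT _ mS); exact: measurable_funS mk sS mf.
have r0 (S : set (R * R)) : S `<=` closedt k -> forall x, (0 <= (f \_ S) x)%E.
  by move=> sS x; apply: erestrict_ge0 => y /sS; exact: f0.
have eQ (S : set (R * R)) : (\int[leb2]_(x in S) f x = \int[leb2]_x (f \_ S) x)%E by rewrite integral_mkcond.
rewrite (eQ (closedt k)) (eQ Q0) (eQ Q1) (eQ Q2).
have := ge0_integralD leb2 measurableT (fun x _ => r0 Q0 s0 x) (mr Q0 (mQ _ _ _) s0) (fun x _ => r0 Q1 s1 x) (mr Q1 (mQ _ _ _) s1).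
move=> E1.
have m01 := emeasurable_funD (mr Q0 (mQ _ _ _) s0) (mr Q1 (mQ _ _ _) s1).
have r01 x : (0 <= (f \_ Q0) x + (f \_ Q1) x)%E by apply: adde_ge0; exact: r0.
have E2 := ge0_integralD leb2 measurableT (fun x _ => r01 x) m01 (fun x _ => r0 Q2 s2 x) (mr Q2 (mQ _ _ _) s2).
rewrite -E1 -E2; apply: ge0_le_integral => //.
- by move=> x _; exact: r0.
- exact: mr.
- by apply: emeasurable_funD => //; exact: mr.
- move=> x _; rewrite !patchE; case: ifPn => [/set_mem kx|nk].
    case: (cpar_cover kx) => Qx.
    + rewrite (mem_set Qx) -addeA leeDl //; apply: adde_ge0; case: ifPn => // _; exact: f0.
    + rewrite (mem_set Qx) addeAC leeDr //; apply: adde_ge0; case: ifPn => // _; exact: f0.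
    + rewrite (mem_set Qx) leeDr //; apply: adde_ge0; case: ifPn => // _; exact: f0.
  have n (S : set (R * R)) : S `<=` closedt k -> (x \in S) = false.
    by move=> sS; apply/negbTE; apply: contra nk => /set_mem /sS /mem_set.
  by rewrite !n // !adde0.
Qed.

(** Each corner parallelogram, of area [|dt| / 4], gives [Y = 4 (d I)^2 / |dt|] about its own base
    point. Comparison on the medial set, of area [|dt| / 16], shows that base values differ in
    square by at most [64 Y / |dt|], so moving to the common point [x0] costs [2 Y + 32 Y]. Three
    times [34 Y] is the constant 408. *)
Lemma tri_poincare (g : R * R -> R) (I : R) : (forall x, B x -> 0 <= g x) ->
  mfun2 (closedt k) g -> (\int[leb2]_(x in closedt k) (g x)%:E <= I%:E)%E ->
  exists x0, closedt k x0 /\ forall F DF, dir_bound B F DF g ->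
  (\int[leb2]_(x in closedt k) ((F x - F x0) ^+ 2)%:E <= (408 * (d * I) ^+ 2 / `|dt k|)%:E)%E.
Proof.
move=> g0 mg HI; have [s0 s1 s2] := cpar_closedt; have [D0 D1 D2] := det2_cpar.
have mk := measurable_closedt.
have gk x : closedt k x -> 0 <= g x by move=> /kB; exact: g0.
have dp : 0 < `|dt k| by rewrite normr_gt0.
have I0 : 0 <= I by rewrite -lee_fin; apply: le_trans HI; apply: integral_ge0 => x /gk; rewrite lee_fin.
have dd : 0 <= d := le_trans (enorm_ge0 _) (kd 0 0).
have nz (e : R) : `|e| = `|dt k| / 4 -> e != 0.
  by move=> E; rewrite -normr_eq0 E mulf_neq0 ?invr_eq0 ?pnatr_eq0 // normr_eq0.
pose Y := 4 * (d * I) ^+ 2 / `|dt k|.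
have Yb a b : enorm a <= d / 2 -> enorm b <= d / 2 -> `|det2 a b| = `|dt k| / 4 ->
    ((enorm a + enorm b) * I) ^+ 2 / `|det2 a b| <= Y.
  move=> a1 b1 ->; rewrite invf_div mulrA (mulrC _ 4) /Y ler_wpM2r ?invr_ge0 // ler_wpM2l // lerXn2r ?nnegrE ?mulr_ge0 ?addr_ge0 ?enorm_ge0 //.
  by rewrite ler_wpM2r //; lra.
have [x0 [q0 H0]] := par_poincare mk kB s0 (nz _ D0) gk mg HI.
have [x1 [q1 H1]] := par_poincare mk kB s1 (nz _ D1) gk mg HI.
have [x2 [q2 H2]] := par_poincare mk kB s2 (nz _ D2) gk mg HI.
exists x0; split; first exact: s0.
move=> F DF db.
have K0 : ible Q0 (fun x => (F x - F x0) ^+ 2) Y.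
  by apply: ible_trans (H0 _ _ db) _; apply: Yb D0; exact: half_edge.
have K1 : ible Q1 (fun x => (F x - F x1) ^+ 2) Y.
  by apply: ible_trans (H1 _ _ db) _; apply: Yb D1; exact: half_edge.
have K2 : ible Q2 (fun x => (F x - F x2) ^+ 2) Y.
  by apply: ible_trans (H2 _ _ db) _; apply: Yb D2; exact: half_edge.
have mF : mfun2 (closedt k) F.
  apply: within_continuous_measurable2 => //.
  by apply: continuous_in_subspaceT => x /set_mem /kB /db[].
have mQ p q r : meas2 (cpar p q r) by exact: measurable_par.
have mSq (S : set (R * R)) (c : R) : S `<=` closedt k -> nnm S (fun x => (F x - c) ^+ 2).
  move=> sS; split=> [|x _]; last exact: sqr_ge0.
  by apply: (measurable_funS mk sS); apply: measurable_funX; exact: measurable_funB.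
have two : 0 <= 2 :> R by [].
have mM : meas2 (medial k) by exact: measurable_par.
have sM : medial k `<=` Q0 by move=> x /medial_cpar[].
have shift Q y : medial k `<=` Q -> meas2 Q -> Q `<=` closedt k -> leb2 (Q : set T2) = (`|dt k| / 4)%:E ->
    ible Q (fun x => (F x - F y) ^+ 2) Y -> ible Q (fun x => (F x - F x0) ^+ 2) (34 * Y).
  move=> MQ mQ' sQ lQ hQ; have c0 := sqr_ge0 (F y - F x0).
  have on_medial Q' c : medial k `<=` Q' -> meas2 Q' -> Q' `<=` closedt k ->
      ible Q' (fun x => (F x - c) ^+ 2) Y -> ible (medial k) (fun x => 2 * (F x - c) ^+ 2) (2 * Y).
    move=> M' m' s' h'; apply: ible_scale => //; first exact: mSq (subset_trans M' s').
    apply: le_trans h'; apply: ge0_subset_integral => //; first by apply/measurable_EFinP; case: (mSq _ c s').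
    by move=> x _; rewrite lee_fin sqr_ge0.
  have nM c : nnm (medial k) (fun x => 2 * (F x - c) ^+ 2) by apply: nnm_scale => //; exact: mSq (subset_trans sM s0).
  have h := ible_add mM (nM _) (nM _) (on_medial _ _ MQ mQ' sQ hQ) (on_medial _ _ sM (mQ _ _ _) s0 K0).
  have := ible_cst_le mM leb2_medial (ible_le mM (nnm_cst _ c0) (nnm_add (nM _) (nM _)) (fun x _ => sq_split (F x) (F y) (F x0)) h).
  have n2 := nnm_scale two (mSq Q (F y) sQ); have nc := nnm_cst Q (mulr_ge0 two c0).
  have h' := ible_add mQ' n2 nc (ible_scale mQ' two (mSq Q _ sQ) hQ) (ible_cst mQ' lQ _).
  move=> E; apply: ible_trans (ible_le mQ' (mSq Q _ sQ) (nnm_add n2 nc) (fun x _ => sq_split2 (F x) (F y) (F x0)) h') _.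
  move: E; lra.
have L0 := leb2_par (k 0) (nz _ D0); have L1 := leb2_par (k 1) (nz _ D1); have L2 := leb2_par (k 2%:R) (nz _ D2).
rewrite D0 in L0; rewrite D1 in L1; rewrite D2 in L2.
have [mC nC] := mSq _ (F x0) (@subset_refl _ (closedt k)).
apply: le_trans (integral_cover3 _ _) _; [exact/measurable_EFinP|by move=> x kx; rewrite lee_fin nC|].
have F0 := shift _ _ sM (mQ _ _ _) s0 L0 K0.
have F1 := shift Q1 x1 (fun x Mx => let: And3 _ a _ := medial_cpar Mx in a) (mQ _ _ _) s1 L1 K1.
have F2 := shift Q2 x2 (fun x Mx => let: And3 _ _ a := medial_cpar Mx in a) (mQ _ _ _) s2 L2 K2.
apply: le_trans (leeD (leeD F0 F1) F2) _.
rewrite -!EFinD lee_fin /Y le_eqVlt; apply/orP; left; apply/eqP; ring.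
Qed.

(** A point of the medial set lies in all corner parallelograms, so every value of [F] is within
    [2 Y] of the value there and two values are within [4 Y], with [Y = 4 (d I + d I2) / |dt|]. *)
Lemma tri_sup (g g2 : R * R -> R) (I I2 : R) : (forall x, B x -> 0 <= g x) -> (forall x, B x -> 0 <= g2 x) ->
  mfun2 (closedt k) g -> mfun2 (closedt k) g2 ->
  (\int[leb2]_(x in closedt k) (g x)%:E <= I%:E)%E -> (\int[leb2]_(x in closedt k) (g2 x)%:E <= I2%:E)%E ->
  forall F DF, dir_bound B F DF g ->
  (forall i j, exists D2, dir_bound B (DF^~ (2^-1 *: (k i - k j))) D2 g2) ->
  forall x y, closedt k x -> closedt k y -> `|F x - F y| <= 16 * (d * I + d * I2) / `|dt k|.
Proof.
move=> g0 g20 mg mg2 HI HI2; have [s0 s1 s2] := cpar_closedt; have [D0 D1 D2] := det2_cpar.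
have mk := measurable_closedt.
have gk x : closedt k x -> 0 <= g x by move=> /kB; exact: g0.
have g2k x : closedt k x -> 0 <= g2 x by move=> /kB; exact: g20.
have dp : 0 < `|dt k| by rewrite normr_gt0.
have I0 : 0 <= I by rewrite -lee_fin; apply: le_trans HI; apply: integral_ge0 => x /gk; rewrite lee_fin.
have I20 : 0 <= I2 by rewrite -lee_fin; apply: le_trans HI2; apply: integral_ge0 => x /g2k; rewrite lee_fin.
have dd : 0 <= d := le_trans (enorm_ge0 _) (kd 0 0).
have nz (e : R) : `|e| = `|dt k| / 4 -> e != 0.
  by move=> E; rewrite -normr_eq0 E mulf_neq0 ?invr_eq0 ?pnatr_eq0 // normr_eq0.
pose Y := 4 * (d * I + d * I2) / `|dt k|.
have Yb a b : enorm a <= d / 2 -> enorm b <= d / 2 -> `|det2 a b| = `|dt k| / 4 ->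
    ((enorm a + enorm b) * I + enorm b * I2) / `|det2 a b| <= Y.
  move=> a1 b1 ->; rewrite invf_div mulrA (mulrC _ 4) /Y ler_wpM2r ?invr_ge0 // ler_wpM2l //.
  apply: lerD; apply: ler_wpM2r => //; lra.
have [x0 [q0 H0]] := par_sup mk kB s0 (nz _ D0) gk g2k mg mg2 HI HI2.
have [x1 [q1 H1]] := par_sup mk kB s1 (nz _ D1) gk g2k mg mg2 HI HI2.
have [x2 [q2 H2]] := par_sup mk kB s2 (nz _ D2) gk g2k mg mg2 HI HI2.
move=> F DF db db2.
have M : medial k (aff2 (k 0 + 4^-1 *: sd1 k + 4^-1 *: sd2 k) (4^-1 *: sd1 k) (4^-1 *: sd2 k) (0, 0)).
  by exists (0, 0) => //; split => /=; rewrite lexx ler01.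
have [c0 c1 c2] := medial_cpar M; set c := aff2 _ _ _ _ in c0 c1 c2.
have near x : closedt k x -> `|F x - F c| <= 2 * Y.
  have tri A z : `|F z - A| <= Y -> `|F c - A| <= Y -> `|F z - F c| <= 2 * Y.
    move=> h1 h2; rewrite (_ : _ - _ = (F z - A) - (F c - A)); last by ring.
    by apply: le_trans (ler_normB _ _) _; lra.
  move=> /cpar_cover[] Qx.
  - have [E2 db2'] := db2 1 0; have {}H0 z Qz := le_trans (H0 _ _ _ db db2' z Qz) (Yb _ _ (half_edge _ _) (half_edge _ _) D0).
    by apply: (tri (F x0)); exact: H0.
  - have [E2 db2'] := db2 2%:R 1; have {}H1 z Qz := le_trans (H1 _ _ _ db db2' z Qz) (Yb _ _ (half_edge _ _) (half_edge _ _) D1).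
    by apply: (tri (F x1)); exact: H1.
  - have [E2 db2'] := db2 0 2%:R; have {}H2 z Qz := le_trans (H2 _ _ _ db db2' z Qz) (Yb _ _ (half_edge _ _) (half_edge _ _) D2).
    by apply: (tri (F x2)); exact: H2.
move=> x y /near hx /near hy; rewrite (_ : F x - F y = (F x - F c) - (F y - F c)); last by ring.
apply: le_trans (ler_normB _ _) _; apply: le_trans (lerD hx hy) _.
by rewrite /Y le_eqVlt; apply/orP; left; apply/eqP; ring.
Qed.

End OneTriangle.
End TriangleEstimates.

(** * Power-type vector fields *)

Section Powers.
Context {R : realType}.
Implicit Types (a b c d m r s t x y z p q P C : R).

Lemma powR_bernoulli r t : 0 <= r -> 0 <= t <= 1 -> r `^ t <= t * r + (1 - t).
Proof.
move=> r0 /andP[t0 t1].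
have [->|tn0] := eqVneq t 0; first by rewrite powRr0 mul0r add0r subr0.
have [->|tn1] := eqVneq t 1; first by rewrite powRr1 // mul1r subrr addr0.
have t0' : 0 < t by rewrite lt_neqAle eq_sym tn0.
have t1' : 0 < 1 - t by rewrite subr_gt0 lt_neqAle tn1.
have := @conjugate_powR _ (r `^ t) 1 t^-1 (1 - t)^-1 (powR_ge0 _ _) ler01.
rewrite !invr_gt0 t0' t1' !invrK addrC subrK => /(_ isT isT erefl).
by rewrite mulr1 -powRrM divff // powRr1 // powR1 mul1r mulrC.
Qed.

Lemma powR_anti x y p : 0 < x -> x <= y -> p <= 0 -> y `^ p <= x `^ p.
Proof.
move=> x0 xy p0; have y0 := lt_le_trans x0 xy.
rewrite -(opprK p) (powRN y) (powRN x) lef_pV2 ?posrE ?powR_gt0 //.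
by apply: ge0_ler_powR; rewrite ?nnegrE ?oppr_ge0 // ltW.
Qed.

Lemma powR_scale x y C P : 0 < x -> 0 < y -> y <= C * x -> 1 <= C -> 1 <= P <= 2 ->
  x `^ (P - 2) <= C * y `^ (P - 2).
Proof.
move=> x0 y0 yx C1 /andP[P1 P2]; have C0 := lt_le_trans ltr01 C1.
have h : (C * x) `^ (P - 2) <= y `^ (P - 2) by apply: powR_anti => //; lra.
have : C^-1 * x `^ (P - 2) <= y `^ (P - 2).
  apply: le_trans h; rewrite powRM ?(ltW C0) ?(ltW x0) //.
  rewrite ler_wpM2r ?powR_ge0 // -powR_inv1 ?(ltW C0) //.
  by apply: ler_powR => //; lra.
by rewrite ler_pdivrMl.
Qed.

Lemma powR_split x p q : 0 < x -> x `^ (p + q) = x `^ p * x `^ q.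
Proof. by move=> x0; rewrite powRD // (gt_eqF x0) implybT. Qed.

Lemma powR_sq x p : 0 < x -> x `^ p = x `^ (p - 2) * x ^+ 2.
Proof. by move=> x0; rewrite -powR_mulrn ?(ltW x0) // -powR_split // subrK. Qed.

(** The shifted power function of quasi-norm estimates; with [a] of the size of one vector and [r]
    the distance to another it is equivalent to the squared distance of their images under [V]. *)
Definition phi a P r := (a + r) `^ (P - 2) * r ^+ 2.

Lemma phi_ge0 a P r : 0 <= phi a P r.
Proof. by rewrite mulr_ge0 ?powR_ge0 ?sqr_ge0. Qed.

(* By Bernoulli, (a + g)^(2-P) lies below its tangent at g = m, and
   (z g - m M^(P-2))^2 >= 0 with z = (a + g)^(P-2), M = a + m. *)
Lemma phi_support a P m : 0 <= a -> 0 <= m -> 1 <= P <= 2 ->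
  exists c, 0 <= c /\ forall g, 0 <= g -> phi a P m + c * (g - m) <= phi a P g.
Proof.
move=> a0 m0 /andP[P1 P2].
have [M0|Mn0] := eqVneq (a + m) 0.
  exists 0; split => // g g0; rewrite mul0r addr0.
  have -> : m = 0 by lra.
  by rewrite {1}/phi expr0n mulr0 phi_ge0.
have M0 : 0 < a + m by rewrite lt_neqAle eq_sym Mn0 addr_ge0.
set M := a + m in Mn0 M0; set Mq := M `^ (P - 2).
have Mq0 : 0 < Mq by exact: powR_gt0.
pose q := 2 - P; have [q0 q1] : 0 <= q /\ q <= 1 by rewrite /q; split; lra.
have mM : m / M <= 1 by rewrite ler_pdivrMr // mul1r /M; lra.
have mM0 : 0 <= m / M by rewrite divr_ge0 // ltW.
have qm : q * (m / M) <= 1 by rewrite mulr_ile1.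
exists (Mq * m * (2 - q * (m / M))); split.
  by rewrite mulr_ge0 ?mulr_ge0 ?(ltW Mq0) //; lra.
move=> g g0; rewrite {1}/phi -/M -/Mq.
have [y0|yn0] := eqVneq (a + g) 0.
  have -> : g = 0 by lra.
  rewrite {1}/phi expr0n mulr0 sub0r.
  rewrite (_ : _ + _ = - (Mq * m ^+ 2 * (1 - q * (m / M)))); last by ring.
  by rewrite oppr_le0 mulr_ge0 ?mulr_ge0 ?sqr_ge0 ?(ltW Mq0) // subr_ge0.
have y0 : 0 < a + g by rewrite lt_neqAle eq_sym yn0 addr_ge0.
set y := a + g in yn0 y0; rewrite /phi -/y; set z := y `^ (P - 2).
have z0 : 0 < z by exact: powR_gt0.
have zV : z^-1 <= Mq^-1 * (q * (y / M) + (1 - q)).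
  have := @powR_bernoulli (y / M) q; rewrite q0 q1 divr_ge0 ?(ltW y0) ?(ltW M0) // => /(_ isT isT).
  rewrite powRM ?(ltW y0) ?invr_ge0 ?(ltW M0) // -(powR_inv1 (ltW M0)) -powRrM mulN1r /q opprB -/Mq.
  have -> : y `^ (2 - P) = z^-1 by rewrite /z -powRN opprB.
  by rewrite powR_inv1 ?(ltW M0) // -ler_pdivlMr // mulrC.
have E : Mq * m ^+ 2 + Mq * m * (2 - q * (m / M)) * (g - m) = 2 * g * m * Mq - m ^+ 2 * Mq ^+ 2 * (Mq^-1 * (q * (y / M) + (1 - q))).
  have -> : y / M = 1 + (g - m) / M by rewrite /y /M; field; rewrite -/M.
  by field; rewrite ?Mn0 lt0r_neq0.
rewrite E.
have h : m ^+ 2 * Mq ^+ 2 * z^-1 <= m ^+ 2 * Mq ^+ 2 * (Mq^-1 * (q * (y / M) + (1 - q))).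
  by rewrite ler_wpM2l // mulr_ge0 ?sqr_ge0.
have : 0 <= z^-1 * (g * z - m * Mq) ^+ 2 by rewrite mulr_ge0 ?sqr_ge0 // invr_ge0 ltW.
rewrite (_ : z^-1 * _ = z * g ^+ 2 - 2 * g * m * Mq + m ^+ 2 * Mq ^+ 2 * z^-1); last first.
  by field; exact: lt0r_neq0.
lra.
Qed.

Lemma phi_mono a P r s : 0 <= a -> 0 <= r -> r <= s -> 1 <= P <= 2 -> phi a P r <= phi a P s.
Proof.
move=> a0 r0 rs P12; have [c [c0 H]] := phi_support a0 r0 P12.
apply: le_trans (H s (le_trans r0 rs)); rewrite lerDl mulr_ge0 // subr_ge0 //.
Qed.

Lemma phi_scale a P C r : 0 <= a -> 0 <= r -> 1 <= C -> P <= 2 -> phi a P (C * r) <= C ^+ 2 * phi a P r.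
Proof.
move=> a0 r0 C1 P2; have C0 : 0 <= C := le_trans ler01 C1.
rewrite /phi exprMn mulrCA ler_wpM2l ?sqr_ge0 //.
have [E|n0] := eqVneq (a + r) 0.
  have -> : r = 0 by lra.
  by rewrite expr0n !mulr0.
rewrite ler_wpM2r ?sqr_ge0 //; apply: powR_anti; last by lra.
  by rewrite lt_neqAle eq_sym n0 addr_ge0.
by rewrite lerD2l ler_peMl.
Qed.

Lemma phi_add a P r s : 0 <= a -> 0 <= r -> 0 <= s -> 1 <= P <= 2 ->
  phi a P (r + s) <= 4 * phi a P r + 4 * phi a P s.
Proof.
move=> a0 r0 s0 P12; have P2 : P <= 2 by case/andP: P12.
have S z : 0 <= z -> phi a P (2 * z) <= 4 * phi a P z.
  by move=> z0; apply: le_trans (phi_scale a0 z0 _ P2) _; rewrite ?ler1n // ler_wpM2r ?phi_ge0 //; lra.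
have pr := phi_ge0 a P r; have ps := phi_ge0 a P s.
have [rs|sr] := leP r s.
  apply: le_trans (_ : phi a P (2 * s) <= _); first by apply: phi_mono => //; lra.
  by apply: le_trans (S s s0) _; lra.
apply: le_trans (_ : phi a P (2 * r) <= _); first by apply: phi_mono => //; lra.
by apply: le_trans (S r r0) _; lra.
Qed.

(** Leads from weighted squares back to powers: if [z <= x] the last term suffices, otherwise
    [z^(p-2) <= x^(p-2)] because [p <= 2]. *)
Lemma powR_young x z p : 0 < x -> 0 <= z -> 0 < p <= 2 -> z `^ p <= x `^ (p - 2) * z ^+ 2 + x `^ p.
Proof.
move=> x0 z0 /andP[p0 p2]; have [zx|xz] := leP z x.
  apply: le_trans (_ : x `^ p <= _); last by rewrite lerDr mulr_ge0 ?powR_ge0 ?sqr_ge0.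
  by apply: ge0_ler_powR; rewrite ?nnegrE // ltW.
have z0' := lt_trans x0 xz.
rewrite powR_sq // -[leLHS]addr0 lerD ?powR_ge0 // ler_wpM2r ?sqr_ge0 //.
by apply: powR_anti => //; [exact: ltW|lra].
Qed.

Lemma powR_drop t b p : 0 <= t -> 0 <= b -> 0 < p <= 2 -> (t + b) `^ (p - 2) * b ^+ 2 <= b `^ p.
Proof.
move=> t0 b0 /andP[p0 p2]; have [->|bn0] := eqVneq b 0; first by rewrite expr0n mulr0 powR_ge0.
have b0' : 0 < b by rewrite lt_neqAle eq_sym bn0.
rewrite (powR_sq p b0') ler_wpM2r ?sqr_ge0 //; apply: powR_anti => //; lra.
Qed.

Lemma powR_drop_ge t b p : 0 <= t -> 0 <= b -> 1 <= p <= 2 ->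
  b `^ p <= 2 * ((t + b) `^ (p - 2) * b ^+ 2) + t `^ p.
Proof.
move=> t0 b0 p12; have /andP[p1 p2] := p12.
have X0 : 0 <= (t + b) `^ (p - 2) * b ^+ 2 by rewrite mulr_ge0 ?powR_ge0 ?sqr_ge0.
have [bt|tb] := leP b t.
  apply: le_trans (_ : t `^ p <= _); last by lra.
  by apply: ge0_ler_powR; rewrite ?nnegrE //; lra.
have b0' := le_lt_trans t0 tb.
apply: le_trans (_ : 2 * ((t + b) `^ (p - 2) * b ^+ 2) <= _); last by rewrite lerDl powR_ge0.
rewrite (powR_sq p b0') mulrA ler_wpM2r ?sqr_ge0 //; apply: powR_scale => //; lra.
Qed.

Lemma powR_add_le s t p : 0 <= s -> 0 <= t -> 0 <= p <= 2 -> (s + t) `^ p <= 4 * (s `^ p + t `^ p).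
Proof.
move=> s0 t0 /andP[p0 p2].
have S z : 0 <= z -> (2 * z) `^ p <= 4 * z `^ p.
  move=> z0; rewrite powRM // ler_wpM2r ?powR_ge0 //.
  apply: le_trans (_ : 2 `^ 2 <= _); first by apply: ler_powR => //; rewrite ler1n.
  by rewrite powR_mulrn // -natrX.
have ps := powR_ge0 s p; have pt := powR_ge0 t p.
have mono z z' : 0 <= z -> z <= z' -> z `^ p <= z' `^ p.
  by move=> h1 h2; apply: ge0_ler_powR; rewrite ?nnegrE // (le_trans h1).
have [st|ts] := leP s t.
  apply: le_trans (_ : (2 * t) `^ p <= _); first by apply: mono; lra.
  by apply: le_trans (S t t0) _; lra.
apply: le_trans (_ : (2 * s) `^ p <= _); first by apply: mono; lra.
by apply: le_trans (S s s0) _; lra.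
Qed.

Lemma powR_le1D t p q : 0 <= t -> 0 <= p <= q -> t `^ p <= 1 + t `^ q.
Proof.
move=> t0 /andP[p0 pq]; have [t1|t1] := leP t 1.
  apply: le_trans (_ : 1 <= _); last by rewrite lerDl powR_ge0.
  by rewrite -(powRr0 t); have [->|tn0] := eqVneq t 0;
    [rewrite powRr0; have [->|pn0] := eqVneq p 0; [rewrite powRr0|rewrite powR0]|
     apply: ger_powR; rewrite ?lt_neqAle ?(eq_sym 0) ?tn0 ?t0 ?t1].
apply: le_trans (_ : t `^ q <= _); last by rewrite lerDr.
by apply: ler_powR => //; exact: ltW.
Qed.

End Powers.

(** * Regularised power fields *)

Section Vectors.
Context {R : realType}.
Implicit Types (xi eta zeta : R * R) (de s P : R).

Definition nrm de xi : R := Num.sqrt (de ^+ 2 + dot xi xi).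

(** With [de = 0] and [s = 2 - p] this is the flux of the [p]-Laplacian, zero at [xi = 0]; with
    [de > 0] and [s = (2 - P) / 2] it is the field [V]. *)
Definition powvec de s xi : R * R := nrm de xi `^ (- s) *: xi.

Lemma nrm_ge0 de xi : 0 <= nrm de xi. Proof. exact: sqrtr_ge0. Qed.

Lemma nrm_sqr de xi : nrm de xi ^+ 2 = de ^+ 2 + enorm xi ^+ 2.
Proof.
rewrite /nrm sqr_sqrtr; last by rewrite addr_ge0 ?sqr_ge0 ?dot_ge0.
by rewrite enorm_sqr /dot !expr2.
Qed.

Lemma enorm_nrm de xi : enorm xi <= nrm de xi.
Proof. by apply: ler_sqr_ge0; rewrite ?nrm_ge0 // nrm_sqr lerDr sqr_ge0. Qed.

Lemma nrm_de de xi : 0 <= de -> de <= nrm de xi.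
Proof. by move=> d0; apply: ler_sqr_ge0; rewrite ?nrm_ge0 // nrm_sqr lerDl sqr_ge0. Qed.

Lemma nrm_le de xi : 0 <= de -> nrm de xi <= de + enorm xi.
Proof.
move=> d0; have x0 := enorm_ge0 xi; apply: ler_sqr_ge0; first by rewrite addr_ge0.
by rewrite nrm_sqr; nra.
Qed.

Lemma nrm0 xi : nrm 0 xi = enorm xi.
Proof. by rewrite /nrm expr0n add0r. Qed.

Lemma dotB_sqr xi eta : enorm (xi - eta) ^+ 2 = enorm xi ^+ 2 - 2 * dot xi eta + enorm eta ^+ 2.
Proof. by rewrite !enorm_sqr /dot /=; ring. Qed.

(** The Cauchy-Schwarz inequality for [(de, xi)] and [(de, eta)] in three dimensions. *)
Lemma nrm_dot de xi eta : de ^+ 2 + dot xi eta <= nrm de xi * nrm de eta.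
Proof.
apply: ler_sqr_ge0; first by rewrite mulr_ge0 ?nrm_ge0.
rewrite exprMn !nrm_sqr !enorm_sqr /dot -subr_ge0.
rewrite (_ : _ - _ = de ^+ 2 * ((xi.1 - eta.1) ^+ 2 + (xi.2 - eta.2) ^+ 2) + (xi.1 * eta.2 - xi.2 * eta.1) ^+ 2); last by ring.
by apply: addr_ge0; [apply: mulr_ge0; [exact: sqr_ge0|by apply: addr_ge0; exact: sqr_ge0]|exact: sqr_ge0].
Qed.

Lemma nrm_lip de xi eta : nrm de xi - nrm de eta <= enorm (xi - eta).
Proof.
have n0 := nrm_ge0 de eta; have e0 := enorm_ge0 (xi - eta).
have [h|h] := leP (nrm de xi) (nrm de eta); first by lra.
apply: ler_sqr_ge0 => //; rewrite dotB_sqr.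
have := nrm_dot de xi eta; have := nrm_sqr de xi; have := nrm_sqr de eta; nra.
Qed.

(* Bernoulli applied to (y/x)^(1-s). *)
Lemma powR_diff (s x y : R) : 0 < y -> y <= x -> 0 <= s <= 1 ->
  (y `^ (- s) - x `^ (- s)) * y <= s * x `^ (- s) * (x - y).
Proof.
move=> y0 yx /andP[s0 s1]; have x0 := lt_le_trans y0 yx.
have B : (y / x) `^ (1 - s) <= (1 - s) * (y / x) + (1 - (1 - s)).
  by apply: powR_bernoulli; rewrite ?divr_ge0 ?(ltW y0) ?(ltW x0) //; apply/andP; split; lra.
have E : y `^ (- s) * y = x `^ (- s) * x * (y / x) `^ (1 - s).
  rewrite powRM ?(ltW y0) ?invr_ge0 ?(ltW x0) // -(powR_inv1 (ltW x0)) -powRrM mulN1r opprB.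
  rewrite (powR_split 1 (- s) y0) powRr1 ?(ltW y0) // (powR_split s (-1) x0) powR_inv1 ?(ltW x0) //.
  rewrite (powRN x); field; rewrite lt0r_neq0 //= lt0r_neq0 // powR_gt0 //.
rewrite mulrBl E.
have A0 : 0 <= x `^ (- s) * x by rewrite mulr_ge0 ?powR_ge0 // ltW.
apply: le_trans (lerB (ler_wpM2l A0 B) (lexx _)) _.
apply: eqle; field; exact: lt0r_neq0.
Qed.

(** With [x >= y] the two regularised norms, [A = x^-s] and [B = y^-s], the difference is
    [A (xi - eta) - (B - A) eta], and [powR_diff] bounds [(B - A) y] by
    [s A (x - y) <= s A |xi - eta|]. So the second term takes away at most the fraction [s] of the
    first. *)
Lemma powvec_mono_le de s xi eta : 0 <= de -> 0 <= s <= 1 -> nrm de eta <= nrm de xi ->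
  (1 - s) * nrm de xi `^ (- s) * enorm (xi - eta) ^+ 2 <= dot (powvec de s xi - powvec de s eta) (xi - eta) /\
  enorm (powvec de s xi - powvec de s eta) <= 2 * nrm de xi `^ (- s) * enorm (xi - eta).
Proof.
move=> d0 s01 yx; have /andP[s0 s1] := s01.
set x := nrm de xi in yx *; set y := nrm de eta in yx *.
have y0 : 0 <= y := nrm_ge0 _ _; have e0 := enorm_ge0 (xi - eta).
set A := x `^ (- s); have A0 : 0 <= A := powR_ge0 _ _.
set B := y `^ (- s).
have L : x - y <= enorm (xi - eta) := nrm_lip de xi eta.
have E1 : dot (powvec de s xi - powvec de s eta) (xi - eta) = A * enorm (xi - eta) ^+ 2 - (B - A) * dot eta (xi - eta).
  by rewrite /powvec -/x -/y -/A -/B enorm_sqr /dot /= /GRing.scale /=; ring.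
have E2 : powvec de s xi - powvec de s eta = A *: (xi - eta) - (B - A) *: eta.
  by apply: injective_projections; rewrite /powvec -/x -/y -/A -/B /= /GRing.scale /=; ring.
have D : dot eta (xi - eta) <= y * (x - y).
  have := nrm_dot de eta xi; have := nrm_sqr de eta; rewrite -/x -/y enorm_sqr /dot /=; nra.
have ye : enorm eta <= y := enorm_nrm de eta.
have [yz|yn] := eqVneq y 0.
  have eta0 : eta = 0 by apply: enorm_eq0; apply: le_anti; rewrite enorm_ge0 -yz ye.
  rewrite E1 E2 eta0 subr0 scaler0 subr0 /dot /= !mul0r addr0 mulr0 subr0 enormZ (ger0_norm A0); split.
    by rewrite -mulrA; apply: ler_piMl; [rewrite mulr_ge0 ?sqr_ge0|rewrite lerBlDr lerDl].
  by rewrite -mulrA ler_peMl ?mulr_ge0 ?enorm_ge0 // ler1n.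
have y0' : 0 < y by rewrite lt_neqAle eq_sym yn.
have BA : 0 <= B - A by rewrite subr_ge0; apply: powR_anti => //; lra.
have K : (B - A) * y <= s * A * (x - y) := powR_diff y0' yx s01.
have xy0 : 0 <= x - y by lra.
have sA : 0 <= s * A by rewrite mulr_ge0.
rewrite E1; split.
  have h1 : (B - A) * dot eta (xi - eta) <= s * A * enorm (xi - eta) ^+ 2.
    apply: le_trans (ler_wpM2l BA D) _; rewrite mulrA.
    apply: le_trans (ler_wpM2r xy0 K) _; rewrite -(mulrA (s * A)) -expr2.
    by apply: ler_wpM2l => //; apply: lerXn2r; rewrite ?nnegrE.
  have : (1 - s) * A * enorm (xi - eta) ^+ 2 = A * enorm (xi - eta) ^+ 2 - s * A * enorm (xi - eta) ^+ 2 by ring.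
  by move=> ->; rewrite lerB.
rewrite E2; apply: le_trans (enormD _ _) _; rewrite enormN !enormZ (ger0_norm A0) (ger0_norm BA).
have h2 : (B - A) * enorm eta <= A * enorm (xi - eta).
  apply: le_trans (ler_wpM2l BA ye) _; apply: le_trans K _.
  apply: le_trans (_ : A * (x - y) <= _); last by rewrite ler_wpM2l.
  by rewrite ler_wpM2r // ler_piMl.
by rewrite -mulrA mulr_natl mulr2n lerD2l.
Qed.

Lemma powvec_mono de s xi eta : 0 <= de -> 0 <= s <= 1 ->
  let x := Num.max (nrm de xi) (nrm de eta) in
  (1 - s) * x `^ (- s) * enorm (xi - eta) ^+ 2 <= dot (powvec de s xi - powvec de s eta) (xi - eta) /\
  enorm (powvec de s xi - powvec de s eta) <= 2 * x `^ (- s) * enorm (xi - eta).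
Proof.
move=> d0 s01 x; rewrite /x; have [h|h] := leP (nrm de eta) (nrm de xi).
  by apply: powvec_mono_le.
have [h1 h2] := powvec_mono_le d0 s01 (ltW h).
rewrite enormB [enorm (powvec _ _ xi - _)]enormB; split => //.
by move: h1; rewrite /dot /=; lra.
Qed.

Section VFun.
Variables (de P : R).
Hypotheses (de0 : 0 < de) (P12 : 1 <= P <= 2).

Let V xi := powvec de ((2 - P) / 2) xi.

Let s01 : 0 <= (2 - P) / 2 <= 1.
Proof. by case/andP: P12 => h1 h2; apply/andP; split; lra. Qed.

Let sqE (x : R) : 0 < x -> (x `^ (- ((2 - P) / 2))) ^+ 2 = x `^ (P - 2).
Proof. by move=> x0; rewrite expr2 -powR_split //; congr powR; lra. Qed.

(** Here [1 - s = P / 2 >= 1/2], and the larger regularised norm [x] satisfies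
    [x <= de + |eta| + |xi - eta| <= 4 x], so the monotonicity and Lipschitz bounds of [powvec] turn
    into bounds by [phi]. *)
Lemma Vfun_bounds xi eta :
  phi (de + enorm eta) P (enorm (xi - eta)) <= 4 * enorm (V xi - V eta) ^+ 2 /\
  enorm (V xi - V eta) ^+ 2 <= 16 * phi (de + enorm eta) P (enorm (xi - eta)).
Proof.
have /andP[P1 P2] := P12.
have [h1 h2] := powvec_mono xi eta (ltW de0) s01.
set x := Num.max _ _ in h1 h2; rewrite -/(V xi) -/(V eta) in h1 h2.
set b := enorm (xi - eta) in h1 h2 *; have b0 : 0 <= b := enorm_ge0 _.
have e0 := enorm_ge0 eta; have x0' := enorm_ge0 xi.
have xd : de <= x by rewrite le_max nrm_de // ltW.
have x0 : 0 < x := lt_le_trans de0 xd.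
have ab0 : 0 < de + enorm eta + b by rewrite -addrA ltr_pwDl // addr_ge0.
have xab : x <= de + enorm eta + b.
  rewrite ge_max; apply/andP; split; last by apply: le_trans (nrm_le _ (ltW de0)) _; lra.
  by apply: le_trans (nrm_le _ (ltW de0)) _; have := enormD2 xi eta; rewrite -/b; lra.
have abx : de + enorm eta + b <= 4 * x.
  have g1 : enorm xi <= x by rewrite le_max enorm_nrm.
  have g2 : enorm eta <= x by rewrite le_max enorm_nrm orbT.
  have : b <= enorm xi + enorm eta by rewrite -(enormN eta) /b enormD.
  lra.
set A := x `^ _ in h1 h2; have A0 : 0 <= A := powR_ge0 _ _.
have A2 : A ^+ 2 = x `^ (P - 2) := sqE x0.
set D := enorm (V xi - V eta) in h2 *; have D0 : 0 <= D := enorm_ge0 _.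
split.
  have DL : A * b <= 2 * D.
    have [bz|bn] := eqVneq b 0; first by rewrite bz mulr0 mulr_ge0.
    have b0' : 0 < b by rewrite lt_neqAle eq_sym bn.
    have CS : dot (V xi - V eta) (xi - eta) <= D * b by apply: le_trans (ler_norm _) (dot_le _ _).
    have : (1 - (2 - P) / 2) * A * b * b <= D * b by rewrite -mulrA -expr2; exact: le_trans h1 CS.
    rewrite ler_pM2r // => h3.
    have : 2^-1 * (A * b) <= (1 - (2 - P) / 2) * (A * b) by rewrite ler_wpM2r ?mulr_ge0 //; lra.
    by rewrite !mulrA in h3 *; lra.
  apply: le_trans (_ : A ^+ 2 * b ^+ 2 <= _).
    rewrite A2 /phi ler_wpM2r ?sqr_ge0 //; apply: powR_anti => //; lra.
  rewrite -exprMn (_ : 4 * D ^+ 2 = (2 * D) ^+ 2); last by ring.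
  by rewrite lerXn2r // nnegrE mulr_ge0.
apply: le_trans (_ : (2 * A * b) ^+ 2 <= _); first by rewrite lerXn2r // nnegrE !mulr_ge0.
rewrite !exprMn A2 /phi mulrA ler_wpM2r ?sqr_ge0 //.
have := powR_scale x0 ab0 abx _ P12; rewrite ler1n => /(_ isT) h3.
have -> : 2 ^+ 2 = 4 :> R by ring.
by apply: le_trans (ler_wpM2l (ler0n _ 4) h3) _; rewrite mulrA -natrM.
Qed.

End VFun.

End Vectors.

(** * Pointwise comparison of exponents *)

Section Pointwise.
Context {R : realType}.
Implicit Types (xi eta zeta G : R * R) (de P p La Cf : R).

(** If [|G| + |G - eta| <= de], the left side is at most [de^p <= de]. Otherwise that sum lies
    between [de] and [3 La]: the exponent [p - 2] becomes [P - 2] at the price [Cf], and the sum is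
    comparable to [de + |eta| + |G - eta|]. *)
Lemma X_le_V de P p La Cf G eta : 0 < de -> de <= 1 -> 1 <= P -> P <= p -> p <= 2 -> 1 <= Cf ->
  1 <= La -> (3 * La) `^ (p - P) <= Cf -> enorm G <= La -> enorm eta <= La ->
  (enorm G + enorm (G - eta)) `^ (p - 2) * enorm (G - eta) ^+ 2 <=
  12 * Cf * enorm (powvec de ((2 - P) / 2) G - powvec de ((2 - P) / 2) eta) ^+ 2 + de.
Proof.
move=> de0 de1 P1 Pp p2 Cf1 La1 HLa GL eL.
set t := enorm G in GL *; set b := enorm (G - eta).
have t0 : 0 <= t := enorm_ge0 _; have b0 : 0 <= b := enorm_ge0 _; have e0 := enorm_ge0 eta.
have P12 : 1 <= P <= 2 by rewrite P1 (le_trans Pp p2).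
have p02 : 0 < p <= 2 by rewrite p2 (lt_le_trans ltr01 (le_trans P1 Pp)).
have Cf0 : 0 <= Cf := le_trans ler01 Cf1.
have [h1 _] := Vfun_bounds de0 P12 G eta; rewrite -/b in h1.
set D := enorm (_ - _) ^+ 2 in h1 *; have D0 : 0 <= D by rewrite sqr_ge0.
have CD0 : 0 <= 12 * Cf * D by apply: mulr_ge0 => //; exact: mulr_ge0.
have [rd|dr] := leP (t + b) de.
  apply: le_trans (powR_drop t0 b0 p02) _.
  apply: le_trans (_ : de <= _); last by rewrite lerDr.
  apply: le_trans (_ : de `^ p <= _).
    apply: ge0_ler_powR; rewrite ?nnegrE //; [by case/andP: p02 => /ltW|exact: ltW|by apply: le_trans rd; rewrite lerDr].
  by rewrite -[leRHS]powRr1 ?(ltW de0) //; apply: ger_powR; [rewrite de0|exact: le_trans Pp].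
have r0 : 0 < t + b := lt_trans de0 dr.
have be : b <= t + enorm eta by rewrite -(enormN eta) /b /t enormD.
have et : enorm eta <= t + b.
  by rewrite (_ : eta = G - (G - eta)) ?(le_trans (enormD _ _)) ?enormN //; rewrite opprB addrC subrK.
have aux : (t + b) `^ (p - 2) <= 3 * Cf * (de + enorm eta + b) `^ (P - 2).
  rewrite (_ : p - 2 = (p - P) + (P - 2)); last by ring.
  rewrite powR_split // (mulrC 3) -mulrA; apply: ler_pM; rewrite ?powR_ge0 //.
    apply: le_trans HLa; apply: ge0_ler_powR; rewrite ?nnegrE ?(ltW r0) ?subr_ge0 ?mulr_ge0 //.
      exact: le_trans La1.
    by move: GL eL be; lra.
  apply: powR_scale => //; first by rewrite -addrA ltr_pwDl // addr_ge0.
    by move: et dr t0; lra.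
  by rewrite ler1n.
apply: le_trans (_ : 12 * Cf * D <= _); last by rewrite lerDl ltW.
apply: le_trans (_ : 3 * Cf * phi (de + enorm eta) P b <= _).
  by rewrite /phi mulrA ler_wpM2r ?sqr_ge0.
rewrite (_ : 12 * Cf * D = 3 * Cf * (4 * D)); last by ring.
by rewrite ler_wpM2l ?mulr_ge0.
Qed.

Lemma X_le_tail p G eta : 1 <= p <= 2 -> enorm eta <= enorm G ->
  (enorm G + enorm (G - eta)) `^ (p - 2) * enorm (G - eta) ^+ 2 <= 4 * enorm G `^ p.
Proof.
move=> p12 et; have /andP[p1 p2] := p12; have t0 := enorm_ge0 G; have b0 := enorm_ge0 (G - eta).
have p0 : 0 < p by exact: lt_le_trans p1.
apply: le_trans (powR_drop t0 b0 _) _; first by rewrite p0.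
apply: le_trans (_ : (2 * enorm G) `^ p <= _).
  apply: ge0_ler_powR; rewrite ?nnegrE ?mulr_ge0 ?(ltW p0) //.
  by apply: le_trans (enormD _ _) _; rewrite enormN mulr_natl mulr2n lerD2l.
rewrite powRM // ler_wpM2r ?powR_ge0 //.
apply: le_trans (_ : 2 `^ 2 <= _); first by apply: ler_powR => //; rewrite ler1n.
by rewrite powR_mulrn // -natrX.
Qed.

(** Moves the weight from [xi0] to [G]: monotonicity if [s <= |G - xi0|], and otherwise
    [nrm de G <= de + |xi0| + s]. *)
Lemma phi_dH de P (s : R) xi0 G : 0 < de -> 1 <= P <= 2 -> 0 <= s ->
  phi (de + enorm xi0) P s <= phi (de + enorm xi0) P (enorm (G - xi0)) + nrm de G `^ (P - 2) * s ^+ 2.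
Proof.
move=> de0 P12 s0; have a0 : 0 <= de + enorm xi0 by rewrite addr_ge0 ?(ltW de0) ?enorm_ge0.
have n0 : 0 < nrm de G by apply: lt_le_trans de0 (nrm_de _ (ltW de0)).
have [h|h] := leP s (enorm (G - xi0)).
  apply: le_trans (phi_mono a0 s0 h P12) _; rewrite lerDl mulr_ge0 ?powR_ge0 ?sqr_ge0 //.
apply: le_trans (_ : nrm de G `^ (P - 2) * s ^+ 2 <= _); last by rewrite lerDr phi_ge0.
rewrite /phi ler_wpM2r ?sqr_ge0 //; apply: powR_anti => //.
  apply: le_trans (nrm_le _ (ltW de0)) _; rewrite -addrA lerD2l.
  apply: le_trans (enormD2 G xi0) _; rewrite [leLHS]addrC lerD2l; exact: ltW.
by rewrite subr_le0; case/andP: P12.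
Qed.

(** [nrm^(P-2) = nrm^(P-p) nrm^(p-2)], where the first factor is at most [de^(P-p)] and the second
    at most [|G|^(p-2)]. Where [G = 0] and [p < 2] the right side is infinite unless [H = 0]. *)
Lemma Kde_le de P p Cf G (H : R) : 0 < de -> P <= p -> p <= 2 -> 0 <= Cf -> de `^ (P - p) <= Cf ->
  ((nrm de G `^ (P - 2) * H ^+ 2)%:E <= Cf%:E * (epow (enorm G) (p - 2) * (H ^+ 2)%:E))%E.
Proof.
move=> de0 Pp p2 Cf0 HC; have t0 := enorm_ge0 G.
have n0 : 0 < nrm de G by apply: lt_le_trans de0 (nrm_de _ (ltW de0)).
have nP : nrm de G `^ (P - p) <= Cf.
  by apply: le_trans HC; apply: powR_anti => //; [exact: nrm_de (ltW de0)|lra].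
rewrite /epow; case: ifPn => [/andP[_ pl]|].
  have [->|Hn] := eqVneq H 0; first by rewrite expr0n mulr0 mule0 mule0.
  have H2 : 0 < H ^+ 2 by rewrite exprn_even_gt0.
  rewrite gt0_mulye ?lte_fin //.
  have [C0|Cn] := eqVneq Cf 0.
    have : 0 < de `^ (P - p) by exact: powR_gt0.
    by rewrite C0 in HC; rewrite ltNge HC.
  by rewrite gt0_muley ?leey // lte_fin lt_neqAle eq_sym Cn.
rewrite negb_and => h; rewrite -!EFinM lee_fin mulrA ler_wpM2r ?sqr_ge0 //.
rewrite (_ : P - 2 = (P - p) + (p - 2)); last by ring.
rewrite powR_split //; apply: ler_pM; rewrite ?powR_ge0 //.
have [tz|tn] := eqVneq (enorm G) 0.
  have pE : p = 2 by move: h; rewrite tz eqxx /= -leNgt => h2; lra.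
  by rewrite pE subrr !powRr0.
by apply: powR_anti; [rewrite lt_neqAle eq_sym tn|exact: enorm_nrm|lra].
Qed.

Section Galerkin.
Variables (p kap : R) (G eta zeta : R * R).
Hypotheses (p12 : 1 <= p <= 2) (kap0 : 0 < kap) (kp : kap <= p - 1).
Local Notation t := (enorm G).
Local Notation b := (enorm (G - eta)).
Local Notation y := (enorm (G - zeta)).
Let x := Num.max t (enorm zeta).

Let x0 : 0 <= x. Proof. by rewrite le_max enorm_ge0. Qed.
Let tx : t <= x. Proof. by rewrite le_max lexx. Qed.
Let yx : y <= 2 * x.
Proof.
apply: le_trans (enormD _ _) _; rewrite enormN mulr_natl mulr2n lerD //.
by rewrite le_max lexx orbT.
Qed.

(** If [t + b <= 4 x] the weights are comparable and Young's inequality gives [8 / kap]. Otherwise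
    [x] is small against [b]: [y <= 2 x], [x^(p-1) <= (t + b)^(p-1)] and [t + b <= 3/2 b] give the
    constant 6. *)
Lemma galerkin_young : 2 * x `^ (p - 2) * y * b <=
  kap / 2 * (x `^ (p - 2) * y ^+ 2) + (8 / kap + 6) * ((t + b) `^ (p - 2) * b ^+ 2).
Proof.
have /andP[p1 p2] := p12; have t0 := enorm_ge0 G; have b0 := enorm_ge0 (G - eta); have y0 := enorm_ge0 (G - zeta).
set A := x `^ (p - 2); set Z := (t + b) `^ (p - 2).
have A0 : 0 <= A := powR_ge0 _ _; have Z0 : 0 <= Z := powR_ge0 _ _.
have b20 := sqr_ge0 b; have y20 := sqr_ge0 y.
have k0 : 0 <= 8 / kap by rewrite divr_ge0 // ltW.
have Ay : 0 <= A * y ^+ 2 by rewrite mulr_ge0.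
have Zb : 0 <= Z * b ^+ 2 by rewrite mulr_ge0.
have [->|xn] := eqVneq b 0.
  by rewrite mulr0 expr0n !mulr0 addr0 mulr_ge0 // divr_ge0 // ltW.
have b0' : 0 < b by rewrite lt_neqAle eq_sym xn.
have tb : 0 < t + b by rewrite ltr_wpDl.
have [h|h] := leP (t + b) (4 * x).
  have xp : 0 < x by rewrite -(pmulr_rgt0 _ (ltr0n R 4)); exact: lt_le_trans h.
  have AZ : A <= 4 * Z by apply: powR_scale => //; rewrite ler1n.
  have h1 : 2 * A * y * b <= kap / 2 * (A * y ^+ 2) + 2 / kap * (A * b ^+ 2).
    rewrite -subr_ge0 (_ : _ - _ = A * (kap / 2) * (y - 2 / kap * b) ^+ 2); last by field; exact: lt0r_neq0.
    by apply: mulr_ge0; [apply: mulr_ge0 => //; rewrite divr_ge0 // ltW|exact: sqr_ge0].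
  apply: le_trans h1 _; rewrite lerD2l.
  apply: le_trans (_ : 2 / kap * (4 * Z * b ^+ 2) <= _).
    by rewrite ler_wpM2l ?divr_ge0 ?(ltW kap0) // ler_wpM2r.
  rewrite (_ : 2 / kap * (4 * Z * b ^+ 2) = 8 / kap * (Z * b ^+ 2)); last by ring.
  by apply: ler_wpM2r => //; rewrite lerDl.
have hx : x <= t + b by move: h x0; lra.
have Ax : A * x <= Z * (t + b).
  have [->|xn0] := eqVneq x 0; first by rewrite mulr0 mulr_ge0 // ltW.
  have xp : 0 < x by rewrite lt_neqAle eq_sym xn0.
  have E (z : R) : 0 < z -> z `^ (p - 2) * z = z `^ (p - 1).
    by move=> z0; rewrite -{2}(powRr1 (ltW z0)) -powR_split //; congr powR; ring.
  rewrite /A /Z !E //; apply: ge0_ler_powR; rewrite ?nnegrE ?subr_ge0 // ltW //.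
have t3 : t + b <= 3 / 2 * b by move: h tx b0; lra.
apply: le_trans (_ : 6 * (Z * b ^+ 2) <= _); last first.
  rewrite (mulrDl (8 / kap)) addrA -[leLHS]add0r lerD2r; apply: addr_ge0; apply: mulr_ge0 => //.
  by rewrite divr_ge0 // ltW.
apply: le_trans (_ : 4 * (A * x) * b <= _).
  rewrite (_ : 2 * A * y * b = 2 * A * b * y); last by ring.
  rewrite (_ : 4 * (A * x) * b = 2 * A * b * (2 * x)); last by ring.
  by rewrite ler_wpM2l // !mulr_ge0.
apply: le_trans (_ : 4 * (Z * (t + b)) * b <= _).
  by rewrite ler_wpM2r // ler_wpM2l.
apply: le_trans (_ : 4 * (Z * (3 / 2 * b)) * b <= _).
  by rewrite ler_wpM2r // ler_wpM2l // ler_wpM2l.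
by apply: eqle; field.
Qed.

(** Bounds the power of the discrete gradient by that of [grad u] and the error density itself; if
    [y > t] then [x <= 2 y]. *)
Lemma max_powR_le : x `^ p <= 4 * t `^ p + 4 * (x `^ (p - 2) * y ^+ 2).
Proof.
have /andP[p1 p2] := p12; have t0 := enorm_ge0 G; have y0 := enorm_ge0 (G - zeta).
have Y0 : 0 <= x `^ (p - 2) * y ^+ 2 by rewrite mulr_ge0 ?powR_ge0 ?sqr_ge0.
have T0 : 0 <= t `^ p := powR_ge0 _ _.
have p0 : 0 <= p by exact: le_trans p1.
have xty : x <= t + y.
  rewrite ge_max lerDl y0 /=; apply: le_trans (enormD2 zeta G) _.
  by rewrite addrC lerD2l enormB.
have [yt|ty] := leP y t.
  apply: le_trans (_ : (2 * t) `^ p <= _).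
    by apply: ge0_ler_powR; rewrite ?nnegrE ?mulr_ge0 //; move: xty yt; lra.
  rewrite powRM //; apply: le_trans (_ : 4 * t `^ p <= _); last by move: Y0 T0; lra.
  rewrite ler_wpM2r //; apply: le_trans (_ : 2 `^ 2 <= _); first by apply: ler_powR => //; rewrite ler1n.
  by rewrite powR_mulrn // -natrX.
have yp : 0 < y := le_lt_trans t0 ty.
have xp : 0 < x by move: yx yp; lra.
apply: le_trans (_ : 4 * (x `^ (p - 2) * y ^+ 2) <= _); last by rewrite lerDr mulr_ge0.
rewrite (powR_sq p xp) [leRHS]mulrCA (_ : 4 * y ^+ 2 = (2 * y) ^+ 2); last by ring.
apply: ler_wpM2l; first exact: powR_ge0.
by apply: lerXn2r; rewrite ?nnegrE ?mulr_ge0 //; move: xty ty; lra.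
Qed.

Lemma diff_powR_le (k : R) : 0 < k -> (y / k) `^ p <= (x `^ (p - 2) * y ^+ 2) / k ^+ 2 + x `^ p.
Proof.
move=> k0; have /andP[p1 p2] := p12; have y0 := enorm_ge0 (G - zeta).
have p0 : 0 < p by exact: lt_le_trans p1.
have [xz|xn] := eqVneq x 0.
  have yz : y = 0 by apply: le_anti; rewrite y0 andbT; move: yx; rewrite xz mulr0.
  by rewrite yz mul0r powR0 ?lt0r_neq0 // expr0n mulr0 mul0r add0r powR_ge0.
have xp : 0 < x by rewrite lt_neqAle eq_sym xn.
apply: le_trans (powR_young xp (_ : 0 <= y / k) _) _.
- by rewrite divr_ge0 // ltW.
- by rewrite p0.
by rewrite expr_div_n mulrA.
Qed.

End Galerkin.
End Pointwise.

(** * Differential inequalities for functions of the gradient *)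

Section DirectionalCalculus.
Context {R : realType}.
Implicit Types (B : set (R * R)) (F H u : R * R -> R) (DF DH : R * R -> R * R -> R) (x v xi : R * R).

Lemma ball_cont (f : R * R -> R) x : (forall eps : R, 0 < eps -> exists2 q : R, 0 < q &
  forall y, ball x q y -> `|f x - f y| <= eps) -> {for x, continuous f}.
Proof.
move=> H; apply/cvgrPdist_le => eps e0; have [q q0 h] := H eps e0.
by near=> y; apply: h; near: y; exact: (nbhsx_ballx (x : R * R) q q0).
Unshelve. all: by end_near.
Qed.

Lemma is_derive1_cont (f : R -> R) (r l : R) : is_derive r (1 : R) f l -> {for r, continuous f}.
Proof. by case=> d _; apply: differentiable_continuous; exact/derivable1_diffP. Qed.

Lemma lin2_le (a b p q e : R) : `|a| <= e -> `|b| <= e -> `|a * p + b * q| <= e * (`|p| + `|q|).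
Proof.
move=> ae be; apply: le_trans (ler_normD _ _) _; rewrite !normrM mulrDr.
by apply: lerD; exact: ler_wpM2r.
Qed.

Lemma norm3 (a b c : R) : `|a * b * c| = `|a| * `|b| * `|c|.
Proof. by rewrite !normrM. Qed.

Lemma norm4 (a b c d : R) : `|a * (b * c * d)| = `|a| * (`|b| * `|c| * `|d|).
Proof. by rewrite !normrM. Qed.

Lemma dbl_sum (p q : R) : 2 * (p + q) = 0 + ((p + p) + (q + q)).
Proof. by ring. Qed.

Lemma lin_aux (p q r s : R) : p + q * 0 + (r + s * 0 + 0) = p + r.
Proof. by ring. Qed.

Lemma enorm_dist (a b : R * R) : `|enorm a - enorm b| <= enorm (a - b).
Proof.
have h1 := enormD2 a b; have h2 := enormD2 b a; rewrite [enorm (b - a)]enormB in h2.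
by rewrite ler_norml lerBlDr h1 andbT lerNl opprB lerBlDr.
Qed.

Lemma hess_aux (p q r : R) : 0 <= p -> 0 <= r -> p + q + (q + r) <= 2 * (p + q + r).
Proof. lra. Qed.

Definition dirC1 B F DF : Prop := forall x, B x -> {for x, continuous F} /\
  forall v, is_derive x v F (DF x v) /\ {for x, continuous (DF^~ v)}.

Lemma dirC1D B F DF H DH : dirC1 B F DF -> dirC1 B H DH ->
  dirC1 B (fun x => F x + H x) (fun x v => DF x v + DH x v).
Proof.
move=> f h x Bx; have [cf df] := f x Bx; have [ch dh] := h x Bx.
split=> [|v]; first exact: cvgD.
have [d1 c1] := df v; have [d2 c2] := dh v; split; [exact: is_deriveD|exact: cvgD].
Qed.

Lemma dirC1M B F DF H DH : dirC1 B F DF -> dirC1 B H DH ->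
  dirC1 B (fun x => F x * H x) (fun x v => F x * DH x v + H x * DF x v).
Proof.
move=> f h x Bx; have [cf df] := f x Bx; have [ch dh] := h x Bx.
split=> [|v]; first exact: cvgM.
have [d1 c1] := df v; have [d2 c2] := dh v; split; first exact: is_deriveM.
by apply: cvgD; exact: cvgM.
Qed.

Lemma dirC1_cst B (c : R) : dirC1 B (fun=> c) (fun _ _ => 0).
Proof. by move=> x _; split=> [|v]; [exact: cvg_cst|split; [exact: is_derive_cst|exact: cvg_cst]]. Qed.

(** Restriction to the line through [x] in direction [v] reduces this to the one-variable chain
    rule. *)
Lemma dirC1_comp B F DF (psi dpsi : R -> R) : dirC1 B F DF ->
  (forall x, B x -> is_derive (F x) (1 : R) psi (dpsi (F x)) /\ {for F x, continuous dpsi}) ->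
  dirC1 B (fun x => psi (F x)) (fun x v => dpsi (F x) * DF x v).
Proof.
move=> f h x Bx; have [cf df] := f x Bx; have [dp cdp] := h x Bx.
have cp : {for F x, continuous psi}.
  exact: is_derive1_cont dp.
split=> [|v]; first exact: (@continuous_comp _ _ _ F psi).
have [d1 c1] := df v; split; last by apply: cvgM => //; exact: (@continuous_comp _ _ _ F dpsi).
have d0 : is_derive (0 : R) (1 : R) (fun s => F (x + s *: v)) (DF x v).
  by apply: DeriveDef; [apply/derivable_line0; case: d1|rewrite -derive_line0; case: d1].
have dc : is_derive (0 : R) (1 : R) (psi \o (fun s => F (x + s *: v))) (dpsi (F x) * DF x v).
  have dp' : is_derive ((fun s => F (x + s *: v)) 0) (1 : R) psi (dpsi (F x)) by rewrite /= scale0r addr0.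
  have := @is_derive1_comp _ psi (fun s => F (x + s *: v)) 0 _ _ dp' d0.
  by [].
by apply: DeriveDef; [apply/derivable_line0; case: dc|rewrite derive_line0; case: dc].
Qed.

Lemma dirC1_Ck1 B u : open B -> Ck 1 B u -> dirC1 B u (fun x v => dot (cgrad u x) v).
Proof.
move=> oB C1 x Bx; split=> [|v]; first exact: (Ck_cont oB C1 Bx (s := [::])).
split; last first.
  apply: cvgD; apply: cvgMl; [exact: (Ck_cont oB C1 Bx (s := [:: 0]))|exact: (Ck_cont oB C1 Bx (s := [:: 1]))].
apply: (is_derive_eq (C1_directional v oB C1 Bx)).
by rewrite /dot /cgrad /=; ring.
Qed.

Lemma dirC1_powR B F DF (th : R) : dirC1 B F DF -> (forall x, B x -> 0 < F x) ->
  dirC1 B (fun x => F x `^ th) (fun x v => th * F x `^ (th - 1) * DF x v).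
Proof.
move=> f F0; apply: (@dirC1_comp B F DF (fun r => r `^ th) (fun r => th * r `^ (th - 1)) f) => x Bx.
split; first exact: is_derive1_powR (F0 x Bx).
by apply: cvgMr; exact: is_derive1_cont (is_derive1_powR (th - 1) (F0 x Bx)).
Qed.

Lemma dirC1_bound B F DF g : dirC1 B F DF -> (forall x, B x -> {for x, continuous g}) ->
  (forall x v, B x -> `|DF x v| <= enorm v * g x) -> dir_bound B F DF g.
Proof.
move=> f cg H x Bx; have [cf df] := f x Bx; split => //; first exact: cg.
by move=> v; have [d c] := df v; split => //; exact: H.
Qed.

Section Smooth.
Variables (B : set (R * R)) (u : R * R -> R).
Hypotheses (oB : open B) (C2 : Ck 2 B u).

Definition chess i j : R * R -> R := partial j (partial i u).
Definition Hc : R * R -> R := hess_sum chess.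
Local Notation G := (cgrad u).

Lemma Hc_ge0 x : 0 <= Hc x.
Proof. by rewrite /Hc /hess_sum !addr_ge0. Qed.

Lemma Hc_cont x : B x -> {for x, continuous Hc}.
Proof.
move=> Bx; apply: cvgD; first apply: cvgD; apply: cvg_norm.
- exact: (Ck_cont oB C2 Bx (s := [:: 0; 0])).
- exact: (Ck_cont oB C2 Bx (s := [:: 1; 0])).
- exact: (Ck_cont oB C2 Bx (s := [:: 1; 1])).
Qed.

Let DG i x v := dot (cgrad (partial i u) x) v.

Lemma dirC1_G i : dirC1 B (partial i u) (DG i).
Proof. by apply: dirC1_Ck1 => //; exact: Ck_partial. Qed.

(** [Hc] contains only one of the mixed derivatives; symmetry supplies the other. *)
Lemma DG_sum x v : B x -> `|DG 0 x v| + `|DG 1 x v| <= 2 * Hc x * enorm v.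
Proof.
move=> Bx; have c1 := coord1_le v; have c2 := coord2_le v.
have S : chess 1 0 x = chess 0 1 x by apply/esym; exact: schwarz oB C2 Bx.
rewrite /DG /dot /cgrad /= -![partial _ (partial _ u) x]/(chess _ _ x) S.
have n00 := normr_ge0 (chess 0 0 x); have n01 := normr_ge0 (chess 0 1 x); have n11 := normr_ge0 (chess 1 1 x).
have e0 := enorm_ge0 v.
have A a b : `|a * v.1 + b * v.2| <= (`|a| + `|b|) * enorm v.
  by rewrite (mulrC a) (mulrC b) [leRHS]mulrC; exact: lin2_le.
apply: le_trans (lerD (A (chess 0 0 x) (chess 0 1 x)) (A (chess 0 1 x) (chess 1 1 x))) _; rewrite -mulrDl.
exact: (ler_wpM2r e0 (hess_aux `|chess 0 1 x| n00 n11)).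
Qed.

Lemma DG_le i x v : B x -> `|DG i x v| <= 2 * Hc x * enorm v.
Proof.
move=> Bx; apply: le_trans (DG_sum v Bx).
by have [->|->] := I2_cases i; [rewrite lerDl|rewrite lerDr].
Qed.

(** The square of [nrm de (grad u)] as a polynomial in the derivatives. Powers of [nrm] are
    differentiated as powers of this expression, positive for [de > 0], which keeps the square root
    out of the chain rule. *)
Definition nsq (de : R) x : R := de ^+ 2 + (partial 0 u x * partial 0 u x + partial 1 u x * partial 1 u x).

Lemma nsqE de x : nsq de x = nrm de (G x) ^+ 2.
Proof. by rewrite nrm_sqr enorm_sqr /nsq /cgrad /= -!expr2. Qed.

Lemma nrm_powR de x (s : R) : 0 < de -> nrm de (G x) `^ s = nsq de x `^ (s / 2).
Proof.
move=> d0; rewrite nsqE -powR_mulrn ?nrm_ge0 // -powRrM; congr powR.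
by field.
Qed.

Lemma nsq_gt0 de x : 0 < de -> 0 < nsq de x.
Proof. by move=> d0; rewrite nsqE exprn_gt0 // (lt_le_trans d0) // nrm_de // ltW. Qed.

Let DN x v := 2 * (partial 0 u x * DG 0 x v + partial 1 u x * DG 1 x v).

Lemma dirC1_nsq de : dirC1 B (nsq de) DN.
Proof.
have D := dirC1D (@dirC1_cst B (de ^+ 2)) (dirC1D (dirC1M (dirC1_G 0) (dirC1_G 0)) (dirC1M (dirC1_G 1) (dirC1_G 1))).
rewrite (_ : DN = fun x v => 0 + ((partial 0 u x * DG 0 x v + partial 0 u x * DG 0 x v) +
  (partial 1 u x * DG 1 x v + partial 1 u x * DG 1 x v))); first exact: D.
by apply/funext => x; apply/funext => v; exact: dbl_sum.
Qed.

Lemma DN_le x v : B x -> `|DN x v| <= 4 * enorm (G x) * Hc x * enorm v.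
Proof.
move=> Bx; have e0 := enorm_ge0 (G x).
have c1 := coord1_le (G x); have c2 := coord2_le (G x); rewrite /cgrad /= in c1 c2.
rewrite /DN normrM (ger0_norm (ler0n _ 2)).
rewrite (_ : 4 * _ * _ * _ = 2 * (enorm (G x) * (2 * Hc x * enorm v))); last by ring.
apply: ler_wpM2l; first exact: ler0n.
by apply: le_trans (lin2_le _ _ c1 c2) _; apply: ler_wpM2l => //; exact: DG_sum.
Qed.

Lemma enormG_nsq de x : 0 <= de -> enorm (G x) ^+ 2 <= nsq de x.
Proof. by move=> d0; rewrite nsqE nrm_sqr lerDr sqr_ge0. Qed.

Lemma powR_cont (F : R * R -> R) x (th : R) : {for x, continuous F} -> 0 < F x ->
  {for x, continuous (fun y => F y `^ th)}.
Proof.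
move=> cF F0; apply: (@continuous_comp _ _ _ F (fun r : R => r `^ th)) => //.
exact: is_derive1_cont (is_derive1_powR th F0).
Qed.

Lemma nsq_cont de x : B x -> {for x, continuous (nsq de)}.
Proof. by move=> Bx; have [] := dirC1_nsq de Bx. Qed.

Lemma nrm_pow_cont de (s : R) x : 0 < de -> B x -> {for x, continuous (fun y => nrm de (G y) `^ s)}.
Proof.
move=> d0 Bx; rewrite (_ : (fun y => _) = fun y => nsq de y `^ (s / 2)).
  by apply: powR_cont; [exact: nsq_cont|exact: nsq_gt0].
by apply/funext => y; exact: nrm_powR.
Qed.

(** Each of the two terms of the product rule contributes at most 2: in the second, [|s| / 2 <= 1/4]
    meets the factor 4 of [DN_le], and [|grad u|^2 <= nsq] restores the lost power. *)
Lemma dir_bound_V de (s : R) i : 0 < de -> 0 <= s <= 2^-1 ->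
  exists DV, dir_bound B (fun x => coord i (powvec de s (G x))) DV
    (fun x => 4 * (nrm de (G x) `^ (- s) * Hc x)).
Proof.
move=> d0 /andP[s0 s1].
have N0 x : B x -> 0 < nsq de x by move=> _; exact: nsq_gt0.
pose th := - s / 2.
have D := dirC1M (dirC1_powR th (dirC1_nsq de) N0) (dirC1_G i).
exists (fun x v => nsq de x `^ th * DG i x v + partial i u x * (th * nsq de x `^ (th - 1) * DN x v)).
have -> : (fun x => coord i (powvec de s (G x))) = (fun x => nsq de x `^ th * partial i u x).
  apply/funext => x; rewrite /powvec nrm_powR // -/th.
  by have [->|->] := I2_cases i.
apply: dirC1_bound => //.
  move=> x Bx; apply: cvgMr; apply: cvgM; [exact: nrm_pow_cont|exact: Hc_cont].
move=> x v Bx; rewrite nrm_powR // -/th.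
have n0 := N0 x Bx; set N := nsq de x in n0 *.
have h0 := Hc_ge0 x; have e0 := enorm_ge0 (G x); have v0 := enorm_ge0 v.
apply: le_trans (ler_normD _ _) _.
have p0 : 0 <= N `^ th := powR_ge0 _ _.
have A1 : `|N `^ th * DG i x v| <= 2 * (N `^ th * Hc x * enorm v).
  rewrite normrM (ger0_norm p0) (_ : 2 * _ = N `^ th * (2 * Hc x * enorm v)); last by ring.
  by rewrite ler_wpM2l // DG_le.
have A2 : `|partial i u x * (th * N `^ (th - 1) * DN x v)| <= 2 * (N `^ th * Hc x * enorm v).
  have gi : `|partial i u x| <= enorm (G x) by rewrite -[partial i u]coord_cgrad; exact: coord_le.
  have t1 : `|th| <= 4^-1 by rewrite /th mulNr normrN ger0_norm ?divr_ge0 //; move: s1; lra.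
  rewrite norm4 (ger0_norm (powR_ge0 _ _)).
  apply: le_trans (_ : enorm (G x) * (4^-1 * N `^ (th - 1) * (4 * enorm (G x) * Hc x * enorm v)) <= _).
    apply: ler_pM => //; first by rewrite !mulr_ge0 ?powR_ge0.
    apply: ler_pM => //; [by rewrite mulr_ge0 ?powR_ge0|by rewrite ler_wpM2r ?powR_ge0|exact: DN_le].
  have E : N `^ th = N `^ (th - 1) * N by rewrite -{3}(powRr1 (ltW n0)) -powR_split // subrK.
  rewrite (_ : enorm (G x) * _ = N `^ (th - 1) * (enorm (G x) ^+ 2) * (Hc x * enorm v)); last by field.
  apply: le_trans (_ : N `^ th * (Hc x * enorm v) <= _).
    rewrite E ler_wpM2r ?mulr_ge0 // ler_wpM2l ?powR_ge0 //; exact: enormG_nsq (ltW d0).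
  by rewrite mulrA ler_peMl ?ler1n // !mulr_ge0.
apply: le_trans (lerD A1 A2) _; apply: eqle; ring.
Qed.

(** The chain rule yields the factor [2 ga], hence 3. *)
Lemma dir_bound_norm (ga : R) : 0 <= ga <= 3 / 2 ->
  exists D, dir_bound B (fun x => nrm 1 (G x) `^ ga) D (fun x => 3 * (nrm 1 (G x) `^ (ga - 1) * Hc x)).
Proof.
move=> /andP[g0 g1].
have N0 x : B x -> 0 < nsq 1 x by move=> _; exact: nsq_gt0.
pose th := ga / 2.
have D := dirC1_powR th (dirC1_nsq 1) N0.
exists (fun x v => th * nsq 1 x `^ (th - 1) * DN x v).
have -> : (fun x => nrm 1 (G x) `^ ga) = (fun x => nsq 1 x `^ th).
  by apply/funext => x; rewrite nrm_powR.
apply: dirC1_bound => //.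
  move=> x Bx; apply: cvgMr; apply: cvgM; [exact: nrm_pow_cont|exact: Hc_cont].
move=> x v Bx; have n0 := N0 x Bx.
have h0 := Hc_ge0 x; have e0 := enorm_ge0 (G x); have v0 := enorm_ge0 v.
have nn : 0 < nrm 1 (G x) by apply: lt_le_trans ltr01 (nrm_de _ ler01).
have E : nsq 1 x `^ (th - 1) = nrm 1 (G x) `^ (ga - 2).
  by rewrite nrm_powR //; congr powR; rewrite /th; field.
have E2 : nrm 1 (G x) `^ (ga - 1) = nrm 1 (G x) `^ (ga - 2) * nrm 1 (G x).
  by rewrite -{3}(powRr1 (ltW nn)) -powR_split //; congr powR; ring.
have th0 : 0 <= th by rewrite divr_ge0.
rewrite norm3 (ger0_norm (powR_ge0 _ _)) (ger0_norm th0) E E2.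
apply: le_trans (_ : th * nrm 1 (G x) `^ (ga - 2) * (4 * nrm 1 (G x) * Hc x * enorm v) <= _).
  rewrite ler_wpM2l ?mulr_ge0 ?powR_ge0 //; apply: le_trans (DN_le v Bx) _.
  by rewrite ler_wpM2r // ler_wpM2r // ler_wpM2l // enorm_nrm.
rewrite (_ : th * _ * _ = (4 * th) * (nrm 1 (G x) `^ (ga - 2) * nrm 1 (G x) * Hc x * enorm v)); last by ring.
rewrite (_ : enorm v * _ = 3 * (nrm 1 (G x) `^ (ga - 2) * nrm 1 (G x) * Hc x * enorm v)); last by ring.
apply: ler_wpM2r; last by rewrite /th; move: g1; lra.
by rewrite !mulr_ge0 ?powR_ge0 // ltW.
Qed.

(** The two inputs of the supremum inequality for [u] minus an affine function: the gradient of the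
    error, and the change of its derivative along a half edge [a], where [2 H] meets
    [|a| <= d / 2]. *)
Lemma dir_bound_err (b : R * R) (c : R) :
  dir_bound B (fun x => u x - (c + dot b x)) (fun x v => dot (G x - b) v) (fun x => enorm (G x - b)) /\
  forall (a : R * R) (d : R), enorm a <= d / 2 ->
    exists D2, dir_bound B (fun x => dot (G x - b) a) D2 (fun x => d * Hc x).
Proof.
have coordC1 i : dirC1 B (coord i) (fun _ v => coord i v).
  move=> x _; split.
    by have [->|->] := I2_cases i; [exact: cvg_fst|exact: cvg_snd].
  move=> v; split; last exact: cvg_cst.
  apply: (@is_derive_quad _ _ _ _ _ 0) => t; rewrite mul0r.
  have -> : coord i (x + t *: v) - coord i x - t * coord i v = 0.
    by have [->|->] := I2_cases i; rewrite /coord /= /GRing.scale /=; ring.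
  by rewrite normr0.
split.
  have lin := dirC1D (@dirC1_cst B (- c)) (dirC1D (dirC1M (@dirC1_cst B (- b.1)) (coordC1 0)) (dirC1M (@dirC1_cst B (- b.2)) (coordC1 1))).
  have D := dirC1D (dirC1_Ck1 oB (CkS C2)) lin.
  have -> : (fun x => u x - (c + dot b x)) = (fun x => u x + (- c + (- b.1 * coord 0 x + - b.2 * coord 1 x))).
    by apply/funext => x; rewrite /dot /coord /=; ring.
  rewrite (_ : (fun x v => dot (G x - b) v) = (fun x v => dot (G x) v + (0 + (- b.1 * coord 0 v + coord 0 x * 0 + (- b.2 * coord 1 v + coord 1 x * 0))))); last first.
    by apply/funext => x; apply/funext => v; rewrite /dot /coord /=; ring.
  apply: dirC1_bound => //.
    move=> x Bx; have c0 := Ck_cont oB C2 Bx (s := [:: 0]) isT; have c1 := Ck_cont oB C2 Bx (s := [:: 1]) isT.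
    apply: ball_cont => eps e0; have e2 : 0 < eps / 2 by rewrite divr_gt0.
    have [q q0 Hq] := cont_ball2 oB Bx c0 c1 e2.
    exists q => // y /Hq[_ h0 h1].
    apply: le_trans (_ : enorm (G x - G y) <= _).
      have E : G x - b - (G y - b) = G x - G y by rewrite opprB addrA subrK.
      by rewrite -E; exact: enorm_dist.
    have := lerD h0 h1; rewrite -(splitr eps); apply: le_trans; exact: enorm_le (G x - G y).
  move=> x v Bx; rewrite (_ : _ + _ = dot (G x - b) v).
    by apply: le_trans (dot_le _ _) _; rewrite mulrC.
  by rewrite /dot /coord /=; ring.
move=> a d ad.
have D := dirC1D (dirC1M (@dirC1_cst B a.1) (dirC1_G 0)) (dirC1D (dirC1M (@dirC1_cst B a.2) (dirC1_G 1)) (@dirC1_cst B (- dot b a))).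
exists (fun x v => a.1 * DG 0 x v + partial 0 u x * 0 + (a.2 * DG 1 x v + partial 1 u x * 0 + 0)).
have -> : (fun x => dot (G x - b) a) = (fun x => a.1 * partial 0 u x + (a.2 * partial 1 u x + - dot b a)).
  by apply/funext => x; rewrite /dot /cgrad /=; ring.
apply: dirC1_bound => //; first by move=> x Bx; apply: cvgMr; exact: Hc_cont.
move=> x v Bx; rewrite lin_aux.
have a1 := coord1_le a; have a2 := coord2_le a.
apply: le_trans (lin2_le _ _ (le_trans a1 ad) (le_trans a2 ad)) _.
have d0 : 0 <= d / 2 := le_trans (enorm_ge0 _) ad.
apply: le_trans (ler_wpM2l d0 (DG_sum v Bx)) _.
by apply: eqle; field.
Qed.

End Smooth.
End DirectionalCalculus.

(** * The interpolation error on a triangle *)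

Section LocalEstimate.
Context {R : realType}.
Local Notation T2 := (plane R).
Implicit Types (F g : R * R -> R) (b x y v xi : R * R) (a I m : R).

Variables (B : set (R * R)) (u : R * R -> R) (k : @triangle R) (d Sg : R).
Hypotheses (oB : open B) (C2 : Ck 2 B u) (d0 : dt k != 0) (kB : closedt k `<=` B).
Hypotheses (dpos : 0 < d) (kd : forall i j, enorm (k i - k j) <= d) (Sg1 : 1 <= Sg) (HS : d ^+ 2 <= Sg * `|dt k|).

Local Notation C := (closedt k).
Local Notation G := (cgrad u).
Local Notation H := (Hc u).
Local Notation A := (fine (leb2 (closedt k : set T2))).

Let mC : meas2 C. Proof. exact: measurable_closedt. Qed.
Let dtp : 0 < `|dt k|. Proof. by rewrite normr_gt0. Qed.
Let Sg0 : 0 < Sg. Proof. exact: lt_le_trans Sg1. Qed.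

(** The area [A] enters only through [|dt| / 16 <= A <= |dt|]: three parallelograms of area
    [|dt| / 4] cover the triangle, and the medial one lies inside. *)
Lemma leb2_closedt_le : (leb2 (C : set T2) <= `|dt k|%:E)%E.
Proof.
have [D0 D1 D2] := det2_cpar k.
have nz (e : R) : `|e| = `|dt k| / 4 -> e != 0.
  by move=> E; rewrite -normr_eq0 E mulf_neq0 ?invr_eq0 ?pnatr_eq0 // normr_eq0.
have := @integral_cover3 _ k d0 (fun=> 1%E) (measurable_cst _) (fun _ _ => lee01).
have L (X : set (R * R)) : meas2 X -> (\int[leb2]_(x in X) (1%E : \bar R) = leb2 (X : set T2))%E.
  by move=> mX; rewrite integral_cst // -[RHS]mul1e.
have L' p q r := L (cpar p q r) (measurable_par _ _ _).
rewrite (L C mC) !L' => h; apply: (le_trans h).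
rewrite /cpar !leb2_par ?D0 ?D1 ?D2; try exact: nz.
by rewrite -!EFinD lee_fin; move: dtp; lra.
Qed.

Lemma leb2_closedtE : leb2 (C : set T2) = A%:E.
Proof. by rewrite fineK // ge0_fin_numE //; apply: le_lt_trans leb2_closedt_le _; rewrite ltry. Qed.

Lemma area_le : A <= `|dt k|.
Proof. by rewrite -lee_fin -leb2_closedtE; exact: leb2_closedt_le. Qed.

Lemma area_ge : `|dt k| / 16 <= A.
Proof.
rewrite -lee_fin -leb2_closedtE -(leb2_medial d0); apply: le_measure; rewrite ?inE //.
- exact: measurable_par.
- have [s0 _ _] := cpar_closedt d0.
  by move=> x /(medial_cpar d0)[q0 _ _]; exact: s0.
Qed.

Lemma area_gt0 : 0 < A.
Proof. by apply: lt_le_trans area_ge; rewrite divr_gt0. Qed.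

Let A0 := area_gt0.

Lemma cont_measurable F : (forall x, B x -> {for x, continuous F}) -> mfun2 C F.
Proof.
move=> cF; apply: within_continuous_measurable2 => //.
by apply: continuous_in_subspaceT => x; rewrite inE => /kB; exact: cF.
Qed.

Lemma cont_ible F : (forall x, B x -> {for x, continuous F}) -> (forall x, B x -> 0 <= F x) ->
  nnm C F /\ exists a, ible C F a.
Proof.
move=> cF F0; have nF : nnm C F by split; [exact: cont_measurable|move=> x /kB; exact: F0].
split=> //; have [M HM] : exists M : R, forall x, C x -> F x <= M.
  have : compact (F @` C).
    apply: continuous_compact; last exact: closedt_compact.
    by apply: continuous_in_subspaceT => x; rewrite inE => /kB; exact: cF.
  move=> /compact_bounded[M [_ HM]]; exists (M + 1) => x Cx.
  by apply: le_trans (ler_norm _) _; apply: HM; [rewrite ltrDl|exists x].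
have HM' x : C x -> F x <= `|M| by move=> /HM h; apply: le_trans h (ler_norm _).
by exists (`|M| * A); exact: (ible_le mC nF (nnm_cst C (normr_ge0 M)) HM' (ible_cst mC leb2_closedtE `|M|)).
Qed.

Lemma ible_mean F a : nnm C F -> ible C F a ->
  exists m, [/\ 0 <= m, (\int[leb2]_(x in C) (F x)%:E)%E = (m * A)%:E & m * A <= a].
Proof.
move=> nF Fa; have [_ F0] := nF.
have i0 : (0 <= \int[leb2]_(x in C) (F x)%:E)%E by apply: integral_ge0 => x /F0; rewrite lee_fin.
have ifin : (\int[leb2]_(x in C) (F x)%:E)%E \is a fin_num by rewrite ge0_fin_numE // (le_lt_trans Fa) ?ltry.
exists (fine (\int[leb2]_(x in C) (F x)%:E)%E / A); rewrite divfK ?lt0r_neq0 // fineK //; split => //.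
  by rewrite divr_ge0 ?fine_ge0 // ltW.
by rewrite -lee_fin fineK.
Qed.

Lemma ible_one_sqr F a : nnm C F -> ible C (fun x => F x ^+ 2) a -> ible C F (A + a).
Proof.
move=> nF Fa; have [mF _] := nF.
have n2 : nnm C (fun x => F x ^+ 2) by split=> [|x Cx]; [exact: measurable_funX|exact: sqr_ge0].
have n1 : nnm C (fun=> 1 : R) by exact: nnm_cst.
apply: ible_le (nF) (nnm_add n1 n2) _ _ => //.
  by move=> x _; have := sqr_ge0 (F x - 1); have := sqr_ge0 (F x); rewrite !expr2; lra.
apply: ible_add => //.
by have := ible_cst mC leb2_closedtE 1; rewrite mul1r.
Qed.

(** The constant of [tri_poincare]. *)
Definition cpo : R := 408.

Lemma cpo_ge0 : 0 <= cpo. Proof. exact: ler0n. Qed.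

Lemma tri_poincare_sqr g a : (forall x, B x -> 0 <= g x) -> mfun2 C g ->
  ible C (fun x => g x ^+ 2) a ->
  exists x0, C x0 /\ forall F DF, dir_bound B F DF g -> ible C (fun x => (F x - F x0) ^+ 2) (cpo * d ^+ 2 * a).
Proof.
move=> g0 mg ga; have ng : nnm C g by split=> // x /kB; exact: g0.
have gfin : (\int[leb2]_(x in C) (g x)%:E < +oo)%E.
  by apply: le_lt_trans (ible_one_sqr ng ga) _; rewrite ltry.
have [I [I0 EI HI]] := ible_sqr mC leb2_closedtE A0 ng gfin ga.
have hI : (\int[leb2]_(x in C) (g x)%:E <= I%:E)%E by rewrite EI.
have [x0 [Cx0 Hx0]] := tri_poincare d0 kB kd g0 mg hI.
exists x0; split=> // F DF FD; apply: ible_trans (Hx0 F DF FD) _.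
have a0 : 0 <= a.
  apply: (ible_ge0 _ ga); split=> [|x Cx]; [exact: measurable_funX|exact: sqr_ge0].
rewrite ler_pdivrMr // (_ : cpo * d ^+ 2 * a * _ = cpo * d ^+ 2 * (`|dt k| * a)); last by ring.
rewrite (_ : 408 * (d * I) ^+ 2 = cpo * d ^+ 2 * I ^+ 2); last by rewrite /cpo; ring.
apply: ler_wpM2l; first exact: mulr_ge0 cpo_ge0 (sqr_ge0 _).
by apply: (le_trans HI); apply: ler_wpM2r => //; exact: area_le.
Qed.

Definition slope : R * R := (pslope 0 u k, pslope 1 u k).

Lemma lin_slope x y : lin u k x - lin u k y = dot slope (x - y).
Proof. by rewrite /dot /slope /pslope /lin /br1 /br2 /unitv /=; ring. Qed.

(** The bound is in terms of the mean [m], because Jensen's inequality will control a convex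
    function of [m] by its integral. *)
Lemma err_mean b m : 0 <= m -> (\int[leb2]_(x in C) (enorm (G x - b) + d * H x)%:E)%E = (m * A)%:E ->
  forall c x y, C x -> C y -> `|(u x - (c + dot b x)) - (u y - (c + dot b y))| <= 16 * d * m.
Proof.
move=> m0 Em c x y Cx Cy.
have [db1 db2] := dir_bound_err oB C2 b c.
have cH x' : B x' -> {for x', continuous H} by exact: (Hc_cont oB C2).
have cg x' : B x' -> {for x', continuous (fun z => enorm (G z - b))} by move=> Bx; have [] := db1 x' Bx.
have cdH x' : B x' -> {for x', continuous (fun z => d * H z)} by move=> Bx; apply: cvgM; [exact: cvg_cst|exact: cH].
have g0 x' : B x' -> 0 <= enorm (G x' - b) by rewrite enorm_ge0.
have dH0 x' : B x' -> 0 <= d * H x' by move=> _; rewrite mulr_ge0 ?Hc_ge0 // ltW.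
have [n1 [a1 i1]] := cont_ible cg g0; have [n2 [a2 i2]] := cont_ible cdH dH0.
have [m1 [m10 E1 _]] := ible_mean n1 i1; have [m2 [m20 E2 _]] := ible_mean n2 i2.
have := Em; rewrite (nnm_integralD mC n1 n2) E1 E2 -EFinD => -[Em'].
have h1 : (\int[leb2]_(x in C) (enorm (G x - b))%:E <= (m1 * A)%:E)%E by rewrite E1.
have h2 : (\int[leb2]_(x in C) (d * H x)%:E <= (m2 * A)%:E)%E by rewrite E2.
apply: le_trans (tri_sup d0 kB kd g0 dH0 (proj1 n1) (proj1 n2) h1 h2 db1 _ Cx Cy) _.
  move=> i j; apply: db2; rewrite enormZ ger0_norm // mulrC ler_wpM2r ?invr_ge0 //.
rewrite ler_pdivrMr // (_ : 16 * _ = 16 * d * m * A).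
  apply: ler_wpM2l area_le; apply: mulr_ge0 m0; exact: mulr_ge0 (ler0n _ _) (ltW dpos).
by rewrite -(mulrA _ m A) -Em'; ring.
Qed.

(** Cramer's rule recovers [z] from its products with two edges. *)
Lemma vec_bound z (q : R) : 0 <= q -> `|dot z (sd1 k)| <= q -> `|dot z (sd2 k)| <= q ->
  enorm z <= 4 * q * d / `|dt k|.
Proof.
move=> q0 h1 h2.
have e1 : `|(sd1 k).1| <= d /\ `|(sd1 k).2| <= d.
  by split; [apply: le_trans (coord1_le _) (kd 1 0)|apply: le_trans (coord2_le _) (kd 1 0)].
have e2 : `|(sd2 k).1| <= d /\ `|(sd2 k).2| <= d.
  by split; [apply: le_trans (coord1_le _) (kd 2%:R 0)|apply: le_trans (coord2_le _) (kd 2%:R 0)].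
have P (s t : R) (r w : R) : `|s| <= q -> `|t| <= q -> `|r| <= d -> `|w| <= d -> `|s * r - t * w| <= 2 * (q * d).
  move=> hs ht hr hw; apply: le_trans (ler_normB _ _) _; rewrite !normrM mulr_natl mulr2n.
  by apply: lerD; apply: ler_pM.
have z1 : `|z.1| <= 2 * (q * d) / `|dt k|.
  rewrite ler_pdivlMr // -normrM (_ : z.1 * dt k = dot z (sd1 k) * (sd2 k).2 - dot z (sd2 k) * (sd1 k).2).
    by apply: P => //; [case: e2|case: e1].
  by rewrite /dot /dt; ring.
have z2 : `|z.2| <= 2 * (q * d) / `|dt k|.
  rewrite ler_pdivlMr // -normrM (_ : z.2 * dt k = dot z (sd2 k) * (sd1 k).1 - dot z (sd1 k) * (sd2 k).1).
    by apply: P => //; [case: e1|case: e2].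
  by rewrite /dot /dt; ring.
apply: le_trans (_ : `|z.1| + `|z.2| <= _).
  apply: ler_sqr_ge0; first by rewrite addr_ge0.
  rewrite enorm_sqr -[X in X + _]real_normK ?num_real // -[X in _ + X]real_normK ?num_real //.
  rewrite sqrrD lerD2r lerDl mulrn_wge0 // mulr_ge0 //.
by apply: le_trans (lerD z1 z2) _; rewrite -mulrDl ler_wpM2r ?invr_ge0 //; apply: eqle; ring.
Qed.

(** The interpolant agrees with [u] at the vertices, so the product of [slope - b] with an edge is
    an increment of [u] minus an affine function of slope [b]. Shape regularity turns
    [64 m d^2 / |dt|] into [64 Sg m]. *)
Lemma slope_mean b m : 0 <= m -> (\int[leb2]_(x in C) (enorm (G x - b) + d * H x)%:E)%E = (m * A)%:E ->
  enorm (slope - b) <= 64 * Sg * m.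
Proof.
move=> m0 Em; have HE := err_mean m0 Em 0.
have v i : C (k i) by exact: vertex_closedt.
have hv i : `|dot (slope - b) (k i - k 0)| <= 16 * d * m.
  have := HE (k i) (k 0) (v i) (v 0); congr (`| _ | <= _).
  have := lin_slope (k i) (k 0); rewrite !lin_vertex // => E.
  rewrite (_ : _ - _ = (u (k i) - u (k 0)) - dot b (k i - k 0)); last by rewrite /dot /=; ring.
  by rewrite E /dot /=; ring.
have q0 : 0 <= 16 * d * m by rewrite !mulr_ge0 // ltW.
apply: le_trans (vec_bound q0 (hv 1) (hv 2%:R)) _.
rewrite ler_pdivrMr // (_ : 4 * _ * d = 64 * m * d ^+ 2); last by ring.
rewrite (_ : 64 * Sg * m * `|dt k| = 64 * m * (Sg * `|dt k|)); last by ring.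
by apply: ler_wpM2l HS; exact: mulr_ge0.
Qed.

End LocalEstimate.

(** This lemma and the next few are the elementary arithmetic of later estimates, with variables in
    place of powers and norms. *)
Lemma mix_aux (R : realFieldType) (z1 z2 z3 z4 : R) : z1 <= 4 * z3 -> z2 <= z1 + z4 -> 4 * z1 + 4 * z2 <= 32 * z3 + 4 * z4.
Proof. lra. Qed.

Lemma err_aux (R : realFieldType) (a b e z t : R) : forall (x y : R), a <= 1 + x -> b <= 1 + y ->
  x <= 2 * z + t -> y <= e + 4 * (1 + t) -> 4 * (a + b) <= 24 + (20 * t + (8 * z + 4 * e)).
Proof. move=> x y; lra. Qed.

Lemma half_le (R : realFieldType) (r s t : R) : t <= r -> 2 * s <= t -> 0 <= s -> r ^+ 2 <= 4 * (r - s) ^+ 2.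
Proof.
move=> h1 h2 h3; rewrite (_ : 4 * _ = (2 * (r - s)) ^+ 2); last by ring.
by apply: lerXn2r; rewrite ?nnegrE; lra.
Qed.

Lemma sum_aux (R : realFieldType) (f0 f t w : R) : f <= 4 * (1 + t) -> f0 - f <= 1 + w -> f0 <= 5 + (4 * t + w).
Proof. lra. Qed.

Lemma tail_aux (R : realFieldType) (q t r e : R) : 0 <= q -> t <= r * q -> r <= 4 * e -> 4 * t <= 16 * q * e.
Proof.
move=> q0 h1 h2; have h3 := ler_wpM2r q0 h2.
by rewrite (_ : 16 * q * e = 4 * (4 * e * q)); [apply: ler_wpM2l => //; exact: le_trans h3|ring].
Qed.

Lemma prod_le_sq (R : realFieldType) (z w : R) : 3 * (z * w) <= 2 * z ^+ 2 + 2 * w ^+ 2.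
Proof. by have := sqr_ge0 (z - w); have := sqr_ge0 z; have := sqr_ge0 w; rewrite !expr2; lra. Qed.

Lemma sub_le_sq (R : realFieldType) (z w : R) : w - z <= 1 + (z - w) ^+ 2.
Proof. by have := sqr_ge0 (z - w + 1); have := sqr_ge0 (z - w); rewrite !expr2; lra. Qed.

Lemma conv3 (R : realFieldType) (s t a b c U : R) : 0 <= s -> 0 <= t -> s + t <= 1 ->
  `|a| <= U -> `|b| <= U -> `|c| <= U -> `|(1 - s - t) * a + s * b + t * c| <= U.
Proof.
move=> s0 t0 st aU bU cU; have r0 : 0 <= 1 - s - t by lra.
apply: le_trans (ler_normD _ _) _; apply: le_trans (lerD (ler_normD _ _) (lexx _)) _.
rewrite !normrM (ger0_norm s0) (ger0_norm t0) (ger0_norm r0).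
have := ler_wpM2l r0 aU; have := ler_wpM2l s0 bU; have := ler_wpM2l t0 cU; lra.
Qed.

Lemma enorm_sq_split (R : realType) (a b c : R * R) :
  enorm (a - b) ^+ 2 <= 2 * enorm (a - c) ^+ 2 + 2 * enorm (b - c) ^+ 2.
Proof.
rewrite !enorm_sqr /= -subr_ge0.
rewrite (_ : _ - _ = (a.1 + b.1 - 2 * c.1) ^+ 2 + (a.2 + b.2 - 2 * c.2) ^+ 2); last by ring.
by rewrite addr_ge0 // sqr_ge0.
Qed.

Lemma powR_half_sqr (R : realType) (x a : R) : (x `^ (a / 2)) ^+ 2 = x `^ a.
Proof. by rewrite -powR_mulrn ?powR_ge0 // -powRrM divfK. Qed.

(** * Estimates on a closed triangle with a frozen exponent *)

Section VariableEstimate.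
Context {R : realType}.
Local Notation T2 := (plane R).
Implicit Types (F g q : R * R -> R) (b x y v xi : R * R) (a I m : R).

Variables (B : set (R * R)) (u p : R * R -> R) (k : @triangle R) (d Sg : R).
Hypotheses (oB : open B) (C2 : Ck 2 B u) (d0 : dt k != 0) (kB : closedt k `<=` B).
Hypotheses (dpos : 0 < d) (kd : forall i j, enorm (k i - k j) <= d) (Sg1 : 1 <= Sg) (HS : d ^+ 2 <= Sg * `|dt k|).

Local Notation C := (closedt k).
Local Notation G := (cgrad u).
Local Notation H := (Hc u).
Local Notation A := (fine (leb2 (closedt k : set T2))).
Local Notation eta := (slope u k).

Variables (p1 P de La Cf Jt : R).
Hypotheses (mp : mfun2 C p).
Hypotheses (hp : forall x, C x -> P <= p x <= 2) (hp1 : 1 < p1) (hP : p1 <= P).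
Hypotheses (de0 : 0 < de) (de1 : de <= 1) (ded : de <= d ^+ 2) (Cf1 : 1 <= Cf) (La1 : 1 <= La).
Hypotheses (hde : forall x, C x -> de `^ (P - p x) <= Cf) (hLa : forall x, C x -> (3 * La) `^ (p x - P) <= Cf).
Hypotheses (HA : A <= Jt) (Ht : ible C (fun x => enorm (G x) `^ p x) Jt).
Hypothesis HK : (\int[leb2]_(x in C) (epow (enorm (G x)) (p x - 2) * ((H x) ^+ 2)%:E) <= Jt%:E)%E.

Let mC : meas2 C. Proof. exact: measurable_closedt. Qed.
Let Sg0 : 0 < Sg. Proof. exact: lt_le_trans Sg1. Qed.
Let Cf0 : 0 <= Cf. Proof. exact: le_trans Cf1. Qed.
Let k0C : C (k 0). Proof. exact: vertex_closedt. Qed.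
Let P1 : 1 <= P. Proof. by apply: le_trans hP; exact: ltW. Qed.
Let P2 : P <= 2. Proof. by have /andP[] := hp k0C; exact: le_trans. Qed.
Let P12 : 1 <= P <= 2. Proof. by rewrite P1. Qed.
Let p12 x : C x -> 1 <= p x <= 2.
Proof. by move=> /hp/andP[h1 ->]; rewrite andbT; exact: le_trans h1. Qed.
Let A0 : 0 < A. Proof. exact: area_gt0. Qed.
Let Jt0 : 0 <= Jt. Proof. exact: le_trans (ltW A0) HA. Qed.
Let EA := leb2_closedtE d0.

Let cG b x : B x -> {for x, continuous (fun z => enorm (G z - b))}.
Proof. by move=> Bx; have [h _] := dir_bound_err oB C2 b 0; have [] := h x Bx. Qed.

Let ct x : B x -> {for x, continuous (fun z => enorm (G z))}.
Proof. by move=> Bx; have := cG (b := 0) Bx; rewrite (_ : (fun z => enorm (G z - 0)) = fun z => enorm (G z)) //; apply/funext => z; rewrite subr0. Qed.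

Let cH x : B x -> {for x, continuous H}. Proof. exact: (Hc_cont oB C2). Qed.

Let mG b : mfun2 C (fun z => enorm (G z - b)).
Proof. exact: (cont_measurable kB (F := fun z => enorm (G z - b)) (cG (b := b))). Qed.

Let mt : mfun2 C (fun z => enorm (G z)).
Proof. exact: (cont_measurable kB ct). Qed.

Let mH : mfun2 C H.
Proof. exact: (cont_measurable kB cH). Qed.

Let mn de' : 0 < de' -> mfun2 C (fun z => nrm de' (G z)).
Proof.
move=> d'; apply: (cont_measurable kB (F := fun z => nrm de' (G z))) => x Bx.
have := nrm_pow_cont oB C2 (s := 1) d' Bx; rewrite (_ : (fun y => _) = fun z => nrm de' (G z)) //.
by apply/funext => z; rewrite powRr1 // nrm_ge0.
Qed.

Let mH2 : mfun2 C (fun z => H z ^+ 2).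
Proof. exact: measurable_funX. Qed.

(** Used twice: with [q = P] and the small regularisation [de], at the price [Cf], and with [q = p]
    and regularisation 1, at no price. *)
Lemma ible_Kd de' Cf' q : 0 < de' -> 0 <= Cf' -> mfun2 C q ->
  (forall x, C x -> q x <= p x) -> (forall x, C x -> de' `^ (q x - p x) <= Cf') ->
  nnm C (fun x => nrm de' (G x) `^ (q x - 2) * H x ^+ 2) /\
  ible C (fun x => nrm de' (G x) `^ (q x - 2) * H x ^+ 2) (Cf' * Jt).
Proof.
move=> d' C' mq qp hq; have nK : nnm C (fun x => nrm de' (G x) `^ (q x - 2) * H x ^+ 2).
  split=> [|x Cx]; last by rewrite mulr_ge0 ?powR_ge0 ?sqr_ge0.
  apply: (measurable_funM _ mH2).
  by apply: (measurable_powR2 mC (mn d')); exact: measurable_funB.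
split=> //.
have mK : measurable_fun (C : set T2) (fun x : T2 => (epow (enorm (G x)) (p x - 2) * ((H x) ^+ 2)%:E)%E).
  by apply: emeasurable_funM; [apply: measurable_epow => //; exact: measurable_funB|exact/measurable_EFinP].
apply: (ible_leE mC (g := fun x : T2 => (Cf'%:E * (epow (enorm (G x)) (p x - 2) * ((H x) ^+ 2)%:E))%E) nK).
- exact: emeasurable_funM.
- by move=> x Cx; apply: Kde_le => //; [exact: qp|case/andP: (hp Cx)|exact: hq].
have K0 (x : T2) : C x -> (0 <= epow (enorm (G x)) (p x - 2) * ((H x) ^+ 2)%:E)%E.
  by move=> _; apply: mule_ge0; [exact: epow_ge0 (enorm_ge0 _)|rewrite lee_fin sqr_ge0].
have C'' : (0 <= Cf'%:E)%E by rewrite lee_fin.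
rewrite (ge0_integralZl leb2 mC mK K0 C'') EFinM.
exact: lee_wpmul2l.
Qed.

Local Notation V := (powvec de ((2 - P) / 2)).
Local Notation Kd := (fun x => nrm de (G x) `^ (P - 2) * H x ^+ 2).

Let nKd : nnm C Kd /\ ible C Kd (Cf * Jt).
Proof.
by apply: (@ible_Kd de Cf (fun=> P)) => // x /hp/andP[].
Qed.

Let nV b : nnm C (fun x => enorm (V (G x) - b) ^+ 2).
Proof.
split=> [|x _]; last exact: sqr_ge0.
have s01 : 0 <= (2 - P) / 2 <= 2^-1 by apply/andP; split; move: P1 P2; lra.
have m i : mfun2 C (fun x => coord i (V (G x))).
  have [DV DB] := dir_bound_V oB C2 i de0 s01.
  by apply: (cont_measurable kB (F := fun x => coord i (V (G x)))) => x Bx; have [] := DB x Bx.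
rewrite (_ : (fun x => enorm _ ^+ 2) = fun x : T2 => (coord 0 (V (G x)) - b.1) ^+ 2 + (coord 1 (V (G x)) - b.2) ^+ 2); last first.
  by apply/funext => x; rewrite enorm_sqr.
by apply: measurable_funD; apply: measurable_funX; apply: measurable_funB.
Qed.

Definition cV1 : R := 32 * cpo.

Let cV1_ge0 : 0 <= cV1. Proof. exact: mulr_ge0 (ler0n _ _) cpo_ge0. Qed.

(** The square of the derivative bound is 16 times the weight [Kd]; both components of [V] share the
    base point [x0], and their two bounds add up to [32 cpo]. *)
Lemma V_poincare : exists x0, C x0 /\
  ible C (fun x => enorm (V (G x) - V (G x0)) ^+ 2) (cV1 * (Cf * (d ^+ 2 * Jt))).
Proof.
have s01 : 0 <= (2 - P) / 2 <= 2^-1 by apply/andP; split; move: P1 P2; lra.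
have [nK iK] := nKd.
pose g x := 4 * (nrm de (G x) `^ (- ((2 - P) / 2)) * H x).
have g0 x : B x -> 0 <= g x by move=> _; rewrite /g !mulr_ge0 ?powR_ge0 ?Hc_ge0.
have mg : mfun2 C g.
  apply: measurable_funM => //; apply: measurable_funM => //.
  by apply: measurable_powR2 => //; exact: mn.
have g2 x : g x ^+ 2 = 16 * (nrm de (G x) `^ (P - 2) * H x ^+ 2).
  have E : (nrm de (G x) `^ (- ((2 - P) / 2))) ^+ 2 = nrm de (G x) `^ (P - 2).
    by rewrite -powR_mulrn ?powR_ge0 // -powRrM; congr (_ `^ _); field.
  by rewrite /g 2!exprMn E; ring.
have ig : ible C (fun x => g x ^+ 2) (16 * (Cf * Jt)).
  by rewrite (_ : (fun x => _) = fun x => 16 * Kd x); [exact: ible_scale|apply/funext].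
have [x0 [Cx0 Hx]] := tri_poincare_sqr d0 kB kd g0 mg ig.
exists x0; split => //.
have [D1 /Hx i1] := dir_bound_V oB C2 0 de0 s01; have [D2 /Hx i2] := dir_bound_V oB C2 1 de0 s01.
have n i : nnm C (fun x => (coord i (V (G x)) - coord i (V (G x0))) ^+ 2).
  split=> [|x _]; last exact: sqr_ge0.
  have [DV DB] := dir_bound_V oB C2 i de0 s01.
  apply: measurable_funX; apply: measurable_funB => //.
  by apply: (cont_measurable kB (F := fun x => coord i (V (G x)))) => x Bx; have [] := DB x Bx.
have := ible_add mC (n 0) (n 1) i1 i2.
rewrite (_ : (fun x => _ + _) = fun x => enorm (V (G x) - V (G x0)) ^+ 2); last first.
  by apply/funext => x; rewrite enorm_sqr.
by congr (ible C _ _); rewrite /cV1; ring.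
Qed.

Definition cV2 : R := 2 * cV1 + 32 * (64 * Sg) ^+ 2 * (32 * cV1 + 4).

(** Replaces the value at [x0] by the slope [eta] of the interpolant. With [m] the mean of
    [|grad u - xi| + d H], the distance from [eta] to [xi] is at most [64 Sg m], and Jensen's
    inequality for [phi] bounds [phi a P m] by the quantities of [V_poincare]; [phi a P m] in turn
    controls [|V eta - V xi|^2]. *)
Lemma V_slope : ible C (fun x => enorm (V (G x) - V eta) ^+ 2) (cV2 * (Cf * (d ^+ 2 * Jt))).
Proof.
have [x0 [Cx0 i0]] := V_poincare; have [nK iK] := nKd.
set D1 := cV1 * _ in i0; set xi := G x0 in i0.
have D0 : 0 <= Cf * (d ^+ 2 * Jt) by rewrite mulr_ge0 // mulr_ge0 // sqr_ge0.
set a := de + enorm xi; have a0 : 0 <= a by rewrite addr_ge0 ?enorm_ge0 // ltW.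
pose gg x := enorm (G x - xi) + d * H x.
have ngg : nnm C gg /\ exists a, ible C gg a.
  apply: (cont_ible d0 kB) => x Bx; last by rewrite addr_ge0 ?enorm_ge0 // mulr_ge0 ?Hc_ge0 // ltW.
  by apply: cvgD; [exact: cG|apply: cvgM; [exact: cvg_cst|exact: cH]].
have [ng [a' ia]] := ngg.
have [m [m0 Em _]] := ible_mean d0 ng ia.
have hs := slope_mean oB C2 d0 kB dpos kd HS m0 Em.
have [c [c0 Hc]] := phi_support a0 m0 P12.
have L : phi a P m * A <= 32 * D1 + 4 * (d ^+ 2 * (Cf * Jt)).
  have nV1 := nnm_scale (ler0n R 32) (nV (V xi)).
  have nK2 := nnm_scale (ler0n R 4) (nnm_scale (sqr_ge0 d) nK).
  apply: (@ible_jensen _ _ mC _ EA gg (fun x => 32 * enorm (V (G x) - V xi) ^+ 2 + 4 * (d ^+ 2 * Kd x)) _ c _ m) => //.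
  - exact: nnm_add.
  - exact: phi_ge0.
  - move=> x Cx; have dH0 : 0 <= d * H x by rewrite mulr_ge0 ?Hc_ge0 // ltW.
    have [h1 _] := Vfun_bounds de0 P12 (G x) xi.
    have h2 := phi_dH xi (G x) de0 P12 dH0; rewrite -/a in h1 h2.
    apply: le_trans (Hc _ _) _; first by rewrite addr_ge0 // enorm_ge0.
    apply: le_trans (phi_add a0 (enorm_ge0 _) dH0 P12) _.
    rewrite (_ : d ^+ 2 * _ = nrm de (G x) `^ (P - 2) * (d * H x) ^+ 2); last by ring.
    exact: mix_aux h1 h2.
  - apply: (ible_add mC nV1 nK2).
      exact: (ible_scale mC (ler0n R 32) (nV _) i0).
    exact: (ible_scale mC (ler0n R 4) (nnm_scale (sqr_ge0 d) nK) (ible_scale mC (sqr_ge0 d) nK iK)).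
have S1 : 1 <= 64 * Sg.
  by apply: le_trans Sg1 _; rewrite ler_peMl // ?(ltW Sg0) // ler1n.
have hV : enorm (V eta - V xi) ^+ 2 <= 16 * (64 * Sg) ^+ 2 * phi a P m.
  have [_ h2] := Vfun_bounds de0 P12 eta xi; apply: le_trans h2 _; rewrite -/a -mulrA.
  apply: ler_wpM2l => //; apply: le_trans (phi_scale a0 m0 S1 P2).
  by apply: phi_mono => //; exact: enorm_ge0.
have nc : nnm C (fun=> 2 * (16 * (64 * Sg) ^+ 2 * phi a P m)).
  apply: nnm_cst; apply: mulr_ge0 => //; apply: mulr_ge0; last exact: phi_ge0.
  by apply: mulr_ge0 => //; exact: sqr_ge0.
have n2 := nnm_scale (ler0n R 2) (nV (V xi)).
have i2 := ible_add mC n2 nc (ible_scale mC (ler0n R 2) (nV _) i0) (ible_cst mC EA _).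
apply: ible_trans (ible_le mC (nV _) (nnm_add n2 nc) _ i2) _.
  move=> x Cx; set z1 := V (G x); set z2 := V eta; set z3 := V xi in hV *.
  have h1 := enorm_sq_split z1 z2 z3.
  by apply: le_trans h1 _; rewrite lerD2l ler_wpM2l.
rewrite /cV2 (_ : 2 * (16 * (64 * Sg) ^+ 2 * phi a P m) * A = 32 * (64 * Sg) ^+ 2 * (phi a P m * A)); last by ring.
rewrite [leRHS]mulrDl; apply: lerD; first by rewrite /D1 mulrA.
rewrite -[leRHS]mulrA; apply: ler_wpM2l; first by rewrite mulr_ge0 // sqr_ge0.
apply: le_trans L _; apply: eqle; rewrite /D1; ring.
Qed.

Let nt : nnm C (fun x => enorm (G x) `^ p x).
Proof. by split=> [|x _]; [exact: measurable_powR2|exact: powR_ge0]. Qed.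

Let n1 : nnm C (fun=> 1 : R). Proof. exact: nnm_cst. Qed.

Let i1 : ible C (fun=> 1 : R) Jt.
Proof. by apply: ible_trans (ible_cst mC EA 1) _; rewrite mul1r. Qed.

Lemma nrm1_powR x (q : R) : 1 <= q -> q <= 2 -> nrm 1 (G x) `^ q <= 4 * (1 + enorm (G x) `^ q).
Proof.
move=> q1 q2; have q0 := le_trans ler01 q1.
apply: le_trans (_ : (1 + enorm (G x)) `^ q <= _).
  apply: ge0_ler_powR; rewrite ?nnegrE ?nrm_ge0 ?addr_ge0 ?enorm_ge0 //.
  exact: nrm_le.
apply: le_trans (powR_add_le ler01 (enorm_ge0 _) _) _; first by rewrite q0.
by rewrite powR1.
Qed.

Let K1 := ible_Kd ltr01 ler01 mp (fun x _ => lexx (p x)).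

Let nK1 : nnm C (fun x => nrm 1 (G x) `^ (p x - 2) * H x ^+ 2) /\
  ible C (fun x => nrm 1 (G x) `^ (p x - 2) * H x ^+ 2) Jt.
Proof.
by have [] := K1; first (by move=> x _; rewrite powR1); rewrite mul1r.
Qed.

Let ga : R := (1 + p1) / 2.
Let ex1 x : C x -> p x - (1 + p1) <= - (p1 - 1).
Proof. by move=> /hp/andP[_]; lra. Qed.
Let ex2 : - (p1 - 1) <= 0. Proof. by rewrite oppr_le0 subr_ge0 ltW. Qed.
Let ga1 : 1 <= ga. Proof. by rewrite /ga; move: hp1; lra. Qed.
Local Notation f := (fun x => nrm 1 (G x) `^ ga).

Definition cT1 : R := 64 * cpo * Sg.
Let cT1_ge0 : 0 <= cT1. Proof. exact: mulr_ge0 (mulr_ge0 (ler0n _ _) cpo_ge0) (ltW Sg0). Qed.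

(* The power [ga] with [2 ga = 1 + p1] makes [f^2] integrable against [K] and still
   leaves the gain [La^(-(p1-1))] where [|grad u|] exceeds [La]. *)
Lemma norm_poincare : exists x0, C x0 /\ nnm C (fun x => (f x - f x0) ^+ 2) /\
  ible C (fun x => (f x - f x0) ^+ 2) (cT1 * Jt ^+ 2) /\
  `|dt k| * f x0 <= 16 * (9 * Jt + cT1 * Jt ^+ 2).
Proof.
have g01 : 0 <= ga <= 3 / 2 by apply/andP; split; rewrite /ga; move: hp1 hP P2; lra.
have [nK iK] := nK1.
pose g x := 3 * (nrm 1 (G x) `^ (ga - 1) * H x).
have g0 x : B x -> 0 <= g x by move=> _; rewrite /g !mulr_ge0 ?powR_ge0 ?Hc_ge0.
have m1 := mn ltr01.
have mg : mfun2 C g.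
  apply: measurable_funM => //; apply: (measurable_funM _ mH).
  exact: measurable_powR2.
have n1p x : 1 <= nrm 1 (G x) by exact: nrm_de.
have n0p x : 0 < nrm 1 (G x) by exact: lt_le_trans (n1p x).
have gle x : C x -> g x <= 2 * (nrm 1 (G x) `^ (p x - 2) * H x ^+ 2) + (4 + 2 * enorm (G x) `^ p x).
  move=> Cx; have /andP[px1 px2] := p12 Cx; have /andP[Pp _] := hp Cx.
  set z := nrm 1 (G x) `^ ((p x - 2) / 2) * H x.
  (* [g / 3] splits into [z], whose square is the integrable weighted Hessian, and [w], whose square
     has exponent [1 + p1 - p <= 1] and is controlled by the modular. *)
  set w := nrm 1 (G x) `^ ((1 + p1 - p x) / 2).
  have gE : g x = 3 * (z * w).
    rewrite /g /z /w mulrAC -powR_split //; congr (3 * (_ `^ _ * _)).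
    by rewrite /ga; field.
  have zE : z ^+ 2 = nrm 1 (G x) `^ (p x - 2) * H x ^+ 2.
    by rewrite /z exprMn powR_half_sqr.
  have wE : w ^+ 2 <= 2 + enorm (G x) `^ p x.
    rewrite /w powR_half_sqr.
    apply: le_trans (_ : nrm 1 (G x) `^ 1 <= _).
      by apply: ler_powR => //; move: hP Pp; lra.
    rewrite powRr1 ?nrm_ge0 //; apply: le_trans (nrm_le _ ler01) _.
    rewrite -[2]/(1 + 1) -addrA lerD2l -[leLHS]powRr1 ?enorm_ge0 //.
    by apply: powR_le1D; rewrite ?enorm_ge0 //= ler01.
  rewrite gE -zE; apply: le_trans (_ : 2 * z ^+ 2 + 2 * w ^+ 2 <= _).
    exact: prod_le_sq.
  by rewrite lerD2l; move: wE; lra.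
have n4 : nnm C (fun=> 4 : R) by exact: nnm_cst.
have ng2 := nnm_add (nnm_scale (ler0n R 2) nK) (nnm_add n4 (nnm_scale (ler0n R 2) nt)).
have ig2 := ible_add mC (nnm_scale (ler0n R 2) nK) (nnm_add n4 (nnm_scale (ler0n R 2) nt)) (ible_scale mC (ler0n R 2) nK iK)
  (ible_add mC n4 (nnm_scale (ler0n R 2) nt) (ible_cst mC EA 4) (ible_scale mC (ler0n R 2) nt Ht)).
have ng : nnm C g by split=> // x /kB; exact: g0.
have ig : ible C g (6 * Jt + 2 * Jt).
  by apply: ible_trans (ible_le mC ng ng2 gle ig2) _; move: HA; lra.
have {}ig : (\int[leb2]_(x in C) (g x)%:E <= (8 * Jt)%:E)%E.
  by apply: le_trans ig _; rewrite lee_fin; lra.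
have [x0 [Cx0 Hx]] := tri_poincare d0 kB kd g0 mg ig.
exists x0; split=> //.
have [DF /Hx i2] := dir_bound_norm oB C2 g01.
have nf : nnm C f by split=> [|x _]; [exact: measurable_powR2|exact: powR_ge0].
have nf2 : nnm C (fun x => (f x - f x0) ^+ 2).
  by split=> [|x _]; [apply: measurable_funX; apply: measurable_funB => //; case: nf|exact: sqr_ge0].
have {}i2 : ible C (fun x => (f x - f x0) ^+ 2) (cT1 * Jt ^+ 2).
  apply: ible_trans i2 _; rewrite ler_pdivrMr ?normr_gt0 //.
  rewrite (_ : cT1 * Jt ^+ 2 * _ = cpo * (64 * Jt ^+ 2) * (Sg * `|dt k|)); last by rewrite /cT1; ring.
  rewrite (_ : 408 * _ = cpo * (64 * Jt ^+ 2) * d ^+ 2); last by rewrite /cpo; ring.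
  by apply: ler_wpM2l HS; apply: mulr_ge0; [exact: cpo_ge0|rewrite mulr_ge0 // sqr_ge0].
split=> //; split=> //.
have f00 : 0 <= f x0 := powR_ge0 _ _.
have n5 : nnm C (fun=> 5 : R) by exact: nnm_cst.
have nf3 := nnm_add n5 (nnm_add (nnm_scale (ler0n R 4) nt) nf2).
have if3 := ible_add mC n5 (nnm_add (nnm_scale (ler0n R 4) nt) nf2) (ible_cst mC EA 5)
  (ible_add mC (nnm_scale (ler0n R 4) nt) nf2 (ible_scale mC (ler0n R 4) nt Ht) i2).
(* The base value is bounded by averaging [f x0 <= f x + 1 + (f x - f x0)^2] over the triangle. *)
have if0 : ible C (fun=> f x0) (9 * Jt + cT1 * Jt ^+ 2).
  apply: ible_trans (ible_le mC (nnm_cst C f00) nf3 _ if3) _; last by move: HA; lra.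
  move=> x Cx; have /andP[px1 px2] := p12 Cx; have /andP[Pp _] := hp Cx.
  have h1 : f x <= 4 * (1 + enorm (G x) `^ p x).
    apply: le_trans (nrm1_powR x px1 px2); apply: ler_powR => //.
    by rewrite /ga; move: hp1 hP Pp; lra.
  have h2 := sub_le_sq (f x) (f x0).
  exact: sum_aux h1 h2.
have h := ible_cst_le mC EA if0.
have a16 := area_ge d0.
have h2 : f x0 * (`|dt k| / 16) <= f x0 * A by exact: ler_wpM2l.
by have h3 := le_trans h2 h; move: h3; lra.
Qed.

Local Notation X := (fun x => (enorm (G x) + enorm (G x - eta)) `^ (p x - 2) * enorm (G x - eta) ^+ 2).

Let nX : nnm C X.
Proof.
split=> [|x _]; last exact: mulr_ge0 (powR_ge0 _ _) (sqr_ge0 _).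
apply: measurable_funM; last exact: measurable_funX.
by apply: measurable_powR2 => //; [exact: measurable_funD|exact: measurable_funB].
Qed.

Variable U : R.
Hypotheses (HU : forall x, C x -> `|u x| <= U) (U0 : 0 <= U).
(** The three requirements on [La]: it exceeds the slope of the interpolant, its negative power
    gains [d^2] in the tail, and (next line) it is at least twice the base value [f x0]. *)
Hypotheses (LaU : 8 * U * Sg <= La * d) (Lad : La `^ (- (p1 - 1)) <= d ^+ 2).
Hypothesis Laf : 32 * (9 * Jt + cT1 * Jt ^+ 2) * Sg <= La * d ^+ 2.

Let etaLa : enorm eta <= La.
Proof.
have v i : C (k i) by exact: vertex_closedt.
have hv i : `|dot eta (k i - k 0)| <= 2 * U.
  rewrite -lin_slope !lin_vertex //; apply: le_trans (ler_normB _ _) _.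
  by rewrite mulr_natl mulr2n; apply: lerD; exact: HU.
have U20 : 0 <= 2 * U by rewrite mulr_ge0.
apply: le_trans (vec_bound d0 kd U20 (hv 1) (hv 2%:R)) _.
have dtp : 0 < `|dt k| by rewrite normr_gt0.
rewrite ler_pdivrMr // -(ler_pM2l Sg0).
apply: le_trans (_ : La * d ^+ 2 <= _); last first.
  rewrite (_ : Sg * _ = La * (Sg * `|dt k|)); last by ring.
  by apply: ler_wpM2l => //; exact: le_trans ler01 La1.
rewrite (_ : Sg * _ = 8 * U * Sg * d); last by ring.
rewrite (_ : La * d ^+ 2 = La * d * d); last by ring.
by apply: ler_wpM2r => //; exact: ltW.
Qed.

Definition cX : R := 12 * Cf ^+ 2 * cV2 + 1 + 16 * cT1 * Jt.

(** Where [|grad u| <= La] the exponent is frozen. Where [|grad u| > La], put [w = nrm 1 (grad u)]: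
    then [w^p = f^2 w^(p - 1 - p1) <= f^2 La^(-(p1 - 1)) <= d^2 f^2], using [p <= 2]. Moreover
    [f >= w >= La >= 2 f x0] gives [f^2 <= 4 (f - f x0)^2], which [norm_poincare] integrates. *)
Lemma ible_X : ible C X (cX * (d ^+ 2 * Jt)).
Proof.
have [x0 [Cx0 [nf [jf f0]]]] := norm_poincare.
have iV := V_slope.
have La0 : 0 < La := lt_le_trans ltr01 La1.
have f2 : 2 * f x0 <= La.
  have dtp : 0 < `|dt k| by rewrite normr_gt0.
  have h1 : 2 * (`|dt k| * f x0) * Sg <= La * (Sg * `|dt k|).
    apply: le_trans (_ : La * d ^+ 2 <= _); last by apply: ler_wpM2l => //; exact: ltW.
    apply: le_trans Laf; rewrite ler_wpM2r ?(ltW Sg0) //.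
    by move: f0; lra.
  rewrite -(ler_pM2r (mulr_gt0 Sg0 dtp)); apply: le_trans h1.
  by apply: eqle; ring.
have c12 : 0 <= 12 * Cf by rewrite mulr_ge0.
have d2 : 0 <= d ^+ 2 := sqr_ge0 d.
have c16 : 0 <= 16 * d ^+ 2 by rewrite mulr_ge0.
have nd : nnm C (fun=> de) by apply: nnm_cst; exact: ltW.
have nV' := nnm_scale c12 (nV (V eta)); have nf' := nnm_scale c16 nf.
have n' := nnm_add nV' (nnm_add nd nf').
have i' := ible_add mC nV' (nnm_add nd nf') (ible_scale mC c12 (nV _) iV)
  (ible_add mC nd nf' (ible_cst mC EA de) (ible_scale mC c16 nf jf)).
apply: ible_trans (ible_le mC nX n' _ i') _.
  move=> x Cx; have /andP[Pp p2] := hp Cx; have px12 := p12 Cx.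
  have V0 : 0 <= 12 * Cf * enorm (V (G x) - V eta) ^+ 2 by rewrite mulr_ge0 // sqr_ge0.
  have F0 : 0 <= 16 * d ^+ 2 * (f x - f x0) ^+ 2 by rewrite mulr_ge0 // sqr_ge0.
  have [tL|Lt] := leP (enorm (G x)) La.
    apply: le_trans (X_le_V de0 de1 P1 Pp p2 Cf1 La1 (hLa Cx) tL etaLa) _.
    by rewrite addrA lerDl.
  apply: le_trans (X_le_tail px12 (le_trans etaLa (ltW Lt))) _.
  apply: le_trans (_ : 16 * d ^+ 2 * (f x - f x0) ^+ 2 <= _); last first.
    by rewrite addrA lerDr addr_ge0 // ltW.
  set w := nrm 1 (G x); have tw : enorm (G x) <= w by exact: enorm_nrm.
  have Lw : La <= w by apply: le_trans tw; exact: ltW.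
  have w0 : 0 < w := lt_le_trans La0 Lw.
  have w1 : 1 <= w := le_trans La1 Lw.
  have fw : La <= f x.
    apply: le_trans Lw _; rewrite -[leLHS]powRr1 ?(ltW w0) //; exact: ler_powR.
  have f4 : f x ^+ 2 <= 4 * (f x - f x0) ^+ 2.
    have fx0 : 0 <= f x0 := powR_ge0 _ _.
    exact: half_le fw f2 fx0.
  apply: (tail_aux d2 _ f4).
  apply: le_trans (_ : w `^ p x <= _).
    apply: ge0_ler_powR; rewrite ?nnegrE ?enorm_ge0 ?(ltW w0) //.
    by apply: le_trans (ltW ltr01) _; case/andP: px12.
  rewrite (_ : p x = (1 + p1) + (p x - (1 + p1))); last by ring.
  rewrite powR_split // /ga powR_half_sqr; apply: ler_wpM2l; first exact: powR_ge0.
  apply: le_trans Lad; apply: le_trans (_ : w `^ (- (p1 - 1)) <= _).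
    by apply: ler_powR => //; exact: ex1.
  exact: powR_anti ex2.
have h1 : de * A <= d ^+ 2 * Jt by apply: ler_pM => //; exact: ltW.
rewrite /cX; apply: le_trans (_ : 12 * Cf * (cV2 * (Cf * (d ^+ 2 * Jt))) + (d ^+ 2 * Jt + 16 * d ^+ 2 * (cT1 * Jt ^+ 2)) <= _).
  by rewrite lerD2l lerD2r.
by apply: eqle; ring.
Qed.

(** After division by [d] a bound of order [Jt] is enough. The supremum of the quotient [r] is at
    most [16 m], with [m] the mean of [|grad u - eta| + d H], and Jensen's inequality bounds [m^P].
    The exponent [P] becomes [p] trivially if [r <= 1], and at the price [Cf] otherwise, since
    [r <= La]. *)
Lemma ible_err : ible C (fun x => (`|u x - lin u k x| / d) `^ p x)
  ((1 + 256 * Cf * (44 + (8 * cX + 4) * d ^+ 2)) * Jt).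
Proof.
have [nK iK] := nK1; have iX := ible_X.
pose gg x := enorm (G x - eta) + d * H x.
have ngg : nnm C gg /\ exists a, ible C gg a.
  apply: (cont_ible d0 kB) => x Bx; last by rewrite addr_ge0 ?enorm_ge0 // mulr_ge0 ?Hc_ge0 // ltW.
  by apply: cvgD; [exact: cG|apply: cvgM; [exact: cvg_cst|exact: cH]].
have [ng [a' ia]] := ngg.
have [m [m0 Em _]] := ible_mean d0 ng ia.
pose c := lin u k 0.
have linE x : lin u k x = c + dot eta x.
  have := lin_slope u k x 0; rewrite subr0 => h; rewrite -h /c addrC subrK //.
have e16 x : C x -> `|u x - lin u k x| <= 16 * d * m.
  move=> Cx; have := err_mean oB C2 d0 kB dpos kd m0 Em c Cx k0C.
  by rewrite -!linE lin_vertex // subrr subr0.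
have eU x : C x -> `|u x - lin u k x| <= 2 * U.
  move=> Cx; apply: le_trans (ler_normB _ _) _; rewrite mulr_natl mulr2n; apply: lerD; first exact: HU.
  have [b1 b2 b3] := Cx; have v i : C (k i) by exact: vertex_closedt.
  have U3 i : `|u (k i)| <= U by apply: HU.
  exact: conv3.
have [cc [c0 Hc]] := phi_support (lexx 0) m0 P12.
have d2 : 0 <= d ^+ 2 := sqr_ge0 d.
have n24 : nnm C (fun=> 24 : R) by exact: nnm_cst.
have na := nnm_scale (ler0n R 20) nt; have nb := nnm_scale (ler0n R 8) nX.
have nc := nnm_scale (ler0n R 4) (nnm_scale d2 nK).
have ic := ible_scale mC (ler0n R 4) (nnm_scale d2 nK) (ible_scale mC d2 nK iK).
have nh := nnm_add n24 (nnm_add na (nnm_add nb nc)).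
have ih := ible_add mC n24 (nnm_add na (nnm_add nb nc)) (ible_cst mC EA 24)
  (ible_add mC na (nnm_add nb nc) (ible_scale mC (ler0n R 20) nt Ht)
  (ible_add mC nb nc (ible_scale mC (ler0n R 8) nX iX) ic)).
have L := ible_jensen mC EA ng nh (phi_ge0 0 P m) c0 m0 Em _ ih.
have {}L : phi 0 P m * A <= (44 + (8 * cX + 4) * d ^+ 2) * Jt.
  apply: le_trans (L _) _; last first.
    rewrite (_ : (44 + _) * Jt = 24 * Jt + (20 * Jt + (8 * (cX * (d ^+ 2 * Jt)) + 4 * (d ^+ 2 * Jt)))); last by ring.
    by rewrite lerD2r ler_wpM2l.
  move=> x Cx; have /andP[Pp p2] := hp Cx; have px12 := p12 Cx; have /andP[px1 _] := px12.
  have b0 := enorm_ge0 (G x - eta); have t0 := enorm_ge0 (G x).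
  have dH0 : 0 <= d * H x by rewrite mulr_ge0 ?Hc_ge0 // ltW.
  have P0 : 0 <= P := le_trans ler01 P1.
  have g0 : 0 <= gg x by rewrite addr_ge0.
  apply: le_trans (Hc _ g0) _.
  apply: le_trans (_ : gg x `^ P <= _).
    rewrite /phi add0r; have [->|gn] := eqVneq (gg x) 0; first by rewrite expr0n mulr0 powR_ge0.
    by rewrite (powR_sq P) // lt_neqAle eq_sym gn.
  apply: le_trans (powR_add_le b0 dH0 _) _; first by rewrite P0.
  have h1 : enorm (G x - eta) `^ P <= 1 + enorm (G x - eta) `^ p x by apply: powR_le1D => //; rewrite P0.
  have h2 : (d * H x) `^ P <= 1 + (d * H x) `^ p x by apply: powR_le1D => //; rewrite P0.
  have h3 := powR_drop_ge t0 b0 px12.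
  have h4 : (d * H x) `^ p x <= d ^+ 2 * (nrm 1 (G x) `^ (p x - 2) * H x ^+ 2) + 4 * (1 + enorm (G x) `^ p x).
    apply: le_trans (_ : nrm 1 (G x) `^ (p x - 2) * (d * H x) ^+ 2 + nrm 1 (G x) `^ p x <= _).
      apply: powR_young => //; first by apply: lt_le_trans ltr01 (nrm_de _ ler01).
      by rewrite p2 andbT; exact: lt_le_trans px1.
    by apply: lerD; [apply: eqle; ring|exact: nrm1_powR].
  exact: err_aux h1 h2 h3 h4.
have ne : nnm C (fun x => (`|u x - lin u k x| / d) `^ p x).
  split=> [|x _]; last exact: powR_ge0.
  apply: measurable_powR2 => //; apply: measurable_funM => //.
  apply: measurableT_comp => //; apply: measurable_funB.
    by apply: (cont_measurable kB (F := u)) => x Bx; exact: (Ck_cont oB C2 Bx (s := [::])).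
  by apply: (cont_measurable kB (F := lin u k)) => x _; exact: lin_cont.
have q0 : 0 <= 256 * Cf * phi 0 P m by exact: mulr_ge0 (mulr_ge0 (ler0n _ _) Cf0) (phi_ge0 _ _ _).
have nq : nnm C (fun=> 1 + 256 * Cf * phi 0 P m) by apply: nnm_cst; rewrite addr_ge0.
apply: ible_trans (ible_le mC ne nq _ (ible_cst mC EA _)) _; last first.
  rewrite mulrDl mul1r [leRHS]mulrDl mul1r; apply: lerD => //.
  by rewrite -mulrA -[leRHS]mulrA; apply: ler_wpM2l L; exact: mulr_ge0 (ler0n _ _) Cf0.
move=> x Cx; have /andP[Pp p2] := hp Cx.
set r := _ / d; have r0 : 0 <= r by rewrite divr_ge0 // ltW.
have r16 : r <= 16 * m by rewrite ler_pdivrMr // mulrAC; exact: e16.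
have rL : r <= La.
  rewrite ler_pdivrMr //; apply: le_trans (eU x Cx) _; apply: le_trans LaU.
  by apply: le_trans (_ : 8 * U * 1 <= _); [move: U0; lra|rewrite ler_wpM2l // mulr_ge0].
have phr : phi 0 P r <= 256 * phi 0 P m.
  apply: le_trans (phi_mono (lexx 0) r0 r16 P12) _.
  apply: le_trans (phi_scale (lexx 0) m0 _ P2) _; first by rewrite ler1n.
  by rewrite -natrX.
have [r1|r1] := leP r 1.
  apply: le_trans (_ : 1 <= _); last by rewrite lerDl.
  apply: le_trans (_ : 1 `^ p x <= _); last by rewrite powR1.
  apply: ge0_ler_powR; rewrite ?nnegrE //.
  exact: le_trans (le_trans ler01 P1) Pp.
apply: le_trans (_ : Cf * phi 0 P r <= _).
  have rp := lt_trans ltr01 r1.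
  rewrite /phi add0r -powR_sq // (_ : p x = (p x - P) + P); last by ring.
  rewrite powR_split //; apply: ler_wpM2r; first exact: powR_ge0.
  apply: le_trans (hLa Cx).
  apply: ge0_ler_powR; rewrite ?nnegrE ?subr_ge0 ?mulr_ge0 ?(le_trans ler01 La1) //.
    by rewrite invr_ge0 ltW.
  by apply: (le_trans rL); rewrite ler_peMl ?(le_trans ler01 La1) // ler1n.
apply: le_trans (ler_wpM2l Cf0 phr) _; rewrite mulrCA mulrA lerDr //.
Qed.

End VariableEstimate.

(** * Shrunk triangles and limits *)

Section ShrunkTriangle.
Context {R : realType}.
Local Notation T2 := (plane R).
Implicit Types (k : @triangle R) (x : R * R) (e : R).

Lemma limn_einf_le (a : (\bar R)^nat) (c : \bar R) : (forall n, (a n <= c)%E) -> (limn_einf a <= c)%E.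
Proof.
move=> ac; rewrite limn_einf_lim; apply: lime_le; first exact: is_cvg_einfs.
apply: nearW => n; apply: le_trans (ac n); apply: ereal_inf_lbound.
by exists n => /=.
Qed.

Lemma fatou_le (D : set (R * R)) (F : nat -> T2 -> \bar R) (f : T2 -> \bar R) (c : \bar R) : meas2 D ->
  (forall n, measurable_fun (D : set T2) (F n)) -> measurable_fun (D : set T2) f ->
  (forall n x, D x -> (0 <= F n x)%E) -> (forall x, D x -> (0 <= f x)%E) ->
  (forall x, D x -> f x = 0%E \/ F n x @[n --> \oo] --> f x) ->
  (forall n, (\int[leb2]_(x in D) F n x <= c)%E) -> (\int[leb2]_(x in D) f x <= c)%E.
Proof.
move=> mD mF mf F0 f0 FF Fc.
apply: le_trans (limn_einf_le Fc); apply: le_trans (fatou leb2 mD mF F0).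
apply: ge0_le_integral => //.
  apply: (emeasurable_fun_cvg (fun n => fun x => einfs (F^~ x) n)).
    by move=> n; exact: measurable_fun_einfs.
  by move=> x _; rewrite limn_einf_lim; exact: is_cvg_einfs.
move=> x Dx; have [->|/cvg_limn_einf_sup[-> _] //] := FF x Dx.
rewrite limn_einf_lim; apply: lime_ge; first exact: is_cvg_einfs.
apply: nearW => n.
by apply: le_ereal_inf_tmp => _ [m _ <-]; exact: F0.
Qed.

Definition shr e k : @triangle R := fun i => (1 - e) *: k i + e *: centroid k.

Lemma dt_shr e k : dt (shr e k) = (1 - e) ^+ 2 * dt k.
Proof. by rewrite /dt /shr /sd1 /sd2 /=; rewrite /GRing.scale /=; ring. Qed.

Lemma br1_shr e k x : dt k != 0 -> e != 1 -> br1 (shr e k) x = (br1 k x - e / 3) / (1 - e).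
Proof.
move=> d0 e1; have e1' : 1 - e != 0 by rewrite subr_eq0 eq_sym.
rewrite /br1 dt_shr /shr /sd1 /sd2 /centroid aff2E /= /GRing.scale /=.
move: d0; rewrite /dt /sd1 /sd2 /= => d0; field.
by rewrite e1' d0.
Qed.

Lemma br2_shr e k x : dt k != 0 -> e != 1 -> br2 (shr e k) x = (br2 k x - e / 3) / (1 - e).
Proof.
move=> d0 e1; have e1' : 1 - e != 0 by rewrite subr_eq0 eq_sym.
rewrite /br2 dt_shr /shr /sd1 /sd2 /centroid aff2E /= /GRing.scale /=.
move: d0; rewrite /dt /sd1 /sd2 /= => d0; field.
by rewrite e1' d0.
Qed.

Lemma closedt_shr e k : dt k != 0 -> 0 < e < 1 -> closedt (shr e k) `<=` opent k.
Proof.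
move=> d0 /andP[e0 e1] x; have en : e != 1 by rewrite lt_eqF.
have e1' : 0 < 1 - e by rewrite subr_gt0.
rewrite opentE // /closedt /= br1_shr // br2_shr // -mulrDl.
rewrite !pmulr_lge0 ?invr_gt0 // ler_pdivrMr // => -[h1 h2 h3].
by split; move: h1 h2 h3; lra.
Qed.

Lemma enorm_shr e k i j : 0 <= e <= 1 -> enorm (shr e k i - shr e k j) <= enorm (k i - k j).
Proof.
move=> /andP[e0 e1]; rewrite /shr (_ : _ - _ = (1 - e) *: (k i - k j)).
  rewrite enormZ ger0_norm ?subr_ge0 // ler_piMl ?enorm_ge0 // lerBlDr lerDl //.
by rewrite opprD addrACA subrr addr0 scalerBr.
Qed.

(** Starting at 1/2 keeps the determinants of the shrunk triangles above a quarter of the original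
    one. *)
Definition en (n : nat) : R := n.+2%:R^-1.

Lemma en01 n : 0 < en n < 1.
Proof. by rewrite /en invr_gt0 ltr0Sn /= invf_lt1 ?ltr0Sn // ltr1n. Qed.

Lemma en_half n : en n <= 2^-1.
Proof. by rewrite /en lef_pV2 ?posrE ?ltr0Sn // ler_nat. Qed.

Lemma en_cvg : en n @[n --> \oo] --> (0 : R).
Proof.
apply/cvgrPdist_lt => e e0; have := near_infty_natSinv_lt (PosNum e0); apply: filterS => n /=.
rewrite sub0r normrN ger0_norm ?invr_ge0 //; apply: le_lt_trans.
by rewrite lef_pV2 ?posrE ?ltr0Sn // ler_nat.
Qed.

Lemma shr_cvg k i : shr (en n) k i @[n --> \oo] --> (k i : R * R).
Proof.
rewrite [X in _ --> X](_ : _ = (1 - 0) *: k i + 0 *: centroid k); last by rewrite subr0 scale1r scale0r addr0.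
apply: cvgD; apply: cvgZr_tmp; last exact: en_cvg.
by apply: cvgB; [exact: cvg_cst|exact: en_cvg].
Qed.

Section Limits.
Variables (Om : set (R * R)) (u : R * R -> R) (k : @triangle R).
Hypotheses (cu : {within closure Om, continuous u}) (d0 : dt k != 0) (kO : opent k `<=` Om).

Let vO i : closure Om (k i).
Proof.
apply: (closureS kO); rewrite closure_opent //; exact: vertex_closedt.
Qed.

Let vn n i : closure Om (shr (en n) k i).
Proof.
apply: subset_closure; apply: kO; apply: (closedt_shr d0 (en01 n)); apply: vertex_closedt.
by rewrite dt_shr mulf_neq0 // expf_neq0 // subr_eq0 eq_sym; have /andP[_ /lt_eqF->] := en01 n.
Qed.

Lemma u_shr_cvg i : u (shr (en n) k i) @[n --> \oo] --> (u (k i) : R).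
Proof.
apply/cvgrPdist_lt => e e0.
have /subspace_continuousP/(_ _ (@vO i))/cvgrPdist_lt/(_ e e0) h := cu.
have {}h : \forall n \near \oo, closure Om (shr (en n) k i) -> `|u (k i) - u (shr (en n) k i)| < e.
  exact: (shr_cvg h).
by apply: filterS h => n; apply; exact: vn.
Qed.

Lemma lin_shr_cvg x : lin u (shr (en n) k) x @[n --> \oo] --> (lin u k x : R).
Proof.
have e1 n : en n != 1 by have /andP[_ /lt_eqF->] := en01 n.
have E0 (b : R) : b = (b - 0 / 3) / (1 - 0) by rewrite mul0r !subr0 divr1.
have cb (b : R) : (b - en n / 3) / (1 - en n) @[n --> \oo] --> b.
  rewrite [X in _ --> X]E0; apply: cvgM.
    by apply: cvgB; [exact: cvg_cst|apply: cvgM; [exact: en_cvg|exact: cvg_cst]].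
  apply: cvgV; first by rewrite subr0 oner_neq0.
  by apply: cvgB; [exact: cvg_cst|exact: en_cvg].
rewrite /lin (_ : (fun n => _) = fun n => (1 - (br1 k x - en n / 3) / (1 - en n) - (br2 k x - en n / 3) / (1 - en n)) * u (shr (en n) k 0) +
  (br1 k x - en n / 3) / (1 - en n) * u (shr (en n) k 1) + (br2 k x - en n / 3) / (1 - en n) * u (shr (en n) k 2%:R)); last first.
  by apply/funext => n; rewrite br1_shr // br2_shr.
apply: cvgD; [apply: cvgD|]; apply: cvgM; try exact: u_shr_cvg; try exact: cb.
by apply: cvgB; [apply: cvgB; [exact: cvg_cst|exact: cb]|exact: cb].
Qed.

Lemma slope_shr_cvg b : enorm (b - slope u (shr (en n) k)) @[n --> \oo] --> (enorm (b - slope u k) : R).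
Proof.
have c i : pslope i u (shr (en n) k) @[n --> \oo] --> (pslope i u k : R).
  by rewrite /pslope; apply: cvgB; exact: lin_shr_cvg.
rewrite /enorm /dot /slope /=; apply: continuous_cvg; first exact: sqrt_continuous.
by apply: cvgD; apply: cvgM; apply: cvgB; try exact: cvg_cst; exact: c.
Qed.

Lemma mem_shr x : opent k x -> \forall n \near \oo, closedt (shr (en n) k) x.
Proof.
rewrite {1}opentE // => -[b1 b2 b3].
pose m := Num.min (br1 k x) (Num.min (br2 k x) (1 - br1 k x - br2 k x)).
have m0 : 0 < m by rewrite !lt_min b1 b2 /=; move: b3; lra.
have : \forall n \near \oo, en n < m.
  have := en_cvg => /cvgrPdist_lt/(_ m m0); apply: filterS => n.
  rewrite sub0r normrN; apply: le_lt_trans; exact: ler_norm.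
apply: filterS => n; rewrite !lt_min => /and3P[h1 h2 h3].
have /andP[e0 e1] := en01 n; have en1 : en n != 1 by rewrite lt_eqF.
have e1' : 0 < 1 - en n by rewrite subr_gt0.
rewrite /closedt /= br1_shr // br2_shr // -mulrDl !pmulr_lge0 ?invr_gt0 // ler_pdivrMr //.
by split; move: h1 h2 h3 e0; lra.
Qed.

End Limits.
End ShrunkTriangle.

(** * Cut-off scales and logarithmic oscillation *)

Section Scales.
Context {R : realType}.
Variables (D0 Clog p1 M : R) (N : nat).
Hypotheses (D1 : 1 <= D0) (C0 : 0 <= Clog) (p11 : 1 < p1) (M1 : 1 <= M) (N2 : (2 <= N)%N) (Np : 2 <= N%:R * (p1 - 1)).

(** [small] and [large] are the cut-offs [de] and [La] for a triangle of diameter [d], [osc] bounds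
    the excess of the exponent over its frozen value, and [cost] is the resulting factor [Cf],
    uniform in [d]. Dividing by [D0] makes the base at most 1. *)
Definition small d : R := (d / D0) ^+ 2.
Definition large d : R := M * (d / D0)^-1 ^+ N.
Definition osc d : R := 2 * (Clog / ln (expR 1 + d^-1)).
Definition cost : R := 3 * M * expR (N.+2%:R * (2 * Clog * (1 + ln D0))).

Let D00 : 0 < D0. Proof. exact: lt_le_trans D1. Qed.
Let M0 : 0 < M. Proof. exact: lt_le_trans M1. Qed.

Lemma log_ge1 (d : R) : 0 < d -> 1 <= ln (expR 1 + d^-1).
Proof.
by move=> d0; rewrite -{1}(expRK 1) ler_ln ?posrE ?addr_gt0 ?expR_gt0 ?invr_gt0 // lerDl invr_ge0 ltW.
Qed.

Let lD0 : 0 <= ln D0. Proof. exact: ln_ge0. Qed.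

Let cost3 : 3 * M <= cost.
Proof.
rewrite /cost ler_peMr ?mulr_ge0 ?(ltW M0) // -[leLHS]expR0 ler_expR mulr_ge0 // mulr_ge0 //.
  by rewrite mulr_ge0.
by rewrite addr_ge0.
Qed.

Lemma cost_ge1 : 1 <= cost.
Proof. by apply: le_trans cost3; move: M1; lra. Qed.

Section OneD.
Variable d : R.
Hypotheses (d0 : 0 < d) (dD : d <= D0).
Let q : R := d / D0.
Let q0 : 0 < q. Proof. by rewrite divr_gt0. Qed.
Let q1 : q <= 1. Proof. by rewrite ler_pdivrMr // mul1r. Qed.
Let qd : q <= d. Proof. by rewrite ler_pdivrMr // ler_peMr // ltW. Qed.
Let qi : 1 <= q^-1. Proof. by rewrite invf_ge1. Qed.

Lemma small_bounds : [/\ 0 < small d, small d <= 1 & small d <= d ^+ 2].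
Proof.
rewrite /small -/q; split; first by rewrite exprn_gt0.
- by rewrite exprn_ile1 // ltW.
- by apply: lerXn2r; rewrite ?nnegrE // ltW.
Qed.

Let lq : q ^- 2 <= (q^-1) ^+ N.
Proof. by rewrite -exprVn; apply: ler_weXn2l. Qed.

(** [N >= 2] lets [large d] absorb the factor [d^2], and [N (p1 - 1) >= 2] gives the decay. *)
Lemma large_bounds : [/\ 1 <= large d, M <= large d * d ^+ 2, M <= large d * d & large d `^ (- (p1 - 1)) <= d ^+ 2].
Proof.
have L0 : 1 <= (q^-1) ^+ N by rewrite exprn_ege1.
have H (z : R) : q ^+ 2 <= z -> M <= large d * z.
  move=> qz; rewrite /large -/q -mulrA ler_peMr ?(ltW M0) //.
  apply: le_trans (ler_pM _ _ lq qz); rewrite ?sqr_ge0 ?invr_ge0 ?sqr_ge0 //.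
  by rewrite mulVf // expf_neq0 // lt0r_neq0.
have qq : q ^+ 2 <= d ^+ 2 by apply: lerXn2r; rewrite ?nnegrE // ltW.
split.
- by rewrite /large -/q; apply: le_trans M1 _; rewrite ler_peMr // ltW.
- exact: H.
- by apply: H; apply: le_trans qd; rewrite expr2 ler_piMl // ltW.
- apply: le_trans qq; rewrite powRN -[leRHS]invrK lef_pV2 ?posrE ?invr_gt0 ?exprn_gt0 //; last first.
    by rewrite powR_gt0 // /large mulr_gt0 // exprn_gt0 // invr_gt0.
  apply: le_trans (_ : ((q^-1) ^+ N) `^ (p1 - 1) <= _).
    have qi0 : 0 <= q^-1 by exact: le_trans qi.
    by rewrite -exprVn -(powR_mulrn N qi0) -powRrM -(powR_mulrn 2 qi0); exact: ler_powR.
  apply: ge0_ler_powR; rewrite ?nnegrE ?subr_ge0 ?(ltW p11) //.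
  - exact: le_trans L0.
  - by rewrite /large mulr_ge0 ?(ltW M0) // (le_trans _ L0).
  - by rewrite /large -/q ler_peMl // (le_trans _ L0).
Qed.

(** Here log-Hoelder continuity pays: [ln (D0 / d) <= (1 + ln D0) ln (e + 1/d)], so [r ln (D0 / d)]
    is at most [2 Clog (1 + ln D0)] and fixed powers of [D0 / d], raised to [r], are bounded.
    [r <= 1] handles the factor [3 M]. *)
Lemma osc_bounds r : 0 <= r -> r <= osc d -> r <= 1 ->
  small d `^ (- r) <= cost /\ (3 * large d) `^ r <= cost.
Proof.
move=> r0 rd r1; pose l := - ln q.
have l0 : 0 <= l by rewrite oppr_ge0 ln_le0.
have w1 := log_ge1 d0; set w := ln (expR 1 + d^-1) in w1.
have w0 : 0 < w := lt_le_trans ltr01 w1.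
have lw : l <= (1 + ln D0) * w.
  rewrite /l /q ln_div ?posrE // opprB mulrDl mul1r addrC.
  apply: lerD; last by rewrite ler_peMr.
  rewrite -lnV ?posrE // /w ler_ln ?posrE ?invr_gt0 ?addr_gt0 ?expR_gt0 ?invr_gt0 //.
  by rewrite lerDr ltW ?expR_gt0.
have rl : r * l <= 2 * Clog * (1 + ln D0).
  apply: le_trans (ler_pM r0 l0 rd lw) _; rewrite /osc -/w.
  by apply: eqle; field; exact: lt0r_neq0.
set Q := 2 * _ * _ in rl; have Q0 : 0 <= Q by rewrite /Q mulr_ge0 ?addr_ge0 // mulr_ge0.
have E (z : R) (x : R) : 0 < z -> z `^ x = expR (x * ln z) by move=> z0; rewrite /powR gt_eqF.
have eN (m : nat) : (m <= N.+2)%N -> expR (r * (m%:R * l)) <= expR (N.+2%:R * Q).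
  move=> mN; rewrite ler_expR mulrCA; apply: ler_pM => //; first exact: mulr_ge0.
  by rewrite ler_nat.
have M31 : 1 <= 3 * M by move: M1; lra.
split.
- rewrite E ?exprn_gt0 // /small -/q lnXn // -[_ *+ 2]mulr_natl mulNr -mulrN -mulrN -/l.
  apply: le_trans (eN 2 _) _; first by rewrite !ltnS.
  by rewrite /cost ler_peMl // expR_ge0.
- rewrite /large mulrA powRM ?mulr_ge0 ?(ltW M0) ?exprn_ge0 ?invr_ge0 ?(ltW q0) //.
  rewrite /cost; apply: ler_pM; rewrite ?powR_ge0 //.
    by rewrite -[leRHS]powRr1 ?mulr_ge0 ?(ltW M0) //; apply: ler_powR.
  rewrite E ?exprn_gt0 ?invr_gt0 // -/q lnXn ?invr_gt0 // lnV ?posrE // -/l -[l *+ N]mulr_natl.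
  by apply: eN; rewrite -addn2 leq_addr.
Qed.

End OneD.
End Scales.

(** * The estimates on an open triangle *)

Section OpenTriangle.
Context {R : realType}.
Local Notation T2 := (plane R).
Implicit Types (x y : R * R).

Definition quasi (r : R) (xi eta : R * R) : R :=
  (enorm xi + enorm (xi - eta)) `^ (r - 2) * enorm (xi - eta) ^+ 2.

(** Its integral bounds the area, the modular of the gradient and the weighted Hessian integral
    together, and it is additive over triangles. *)
Definition weight (p : R * R -> R) (G : R * R -> R * R) (H : R * R -> R) x : \bar R :=
  ((1 + enorm (G x) `^ p x)%:E + epow (enorm (G x)) (p x - 2) * ((H x) ^+ 2)%:E)%E.

Lemma weight_ge0 p G H x : (0 <= weight p G H x)%E.
Proof.
apply: adde_ge0; first by rewrite lee_fin addr_ge0 // powR_ge0.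
by apply: mule_ge0; [exact: epow_ge0 (enorm_ge0 _)|rewrite lee_fin sqr_ge0].
Qed.

Lemma measurable_weight (D : set (R * R)) p G H : meas2 D ->
  mfun2 D p -> mfun2 D (fun x => enorm (G x)) ->
  mfun2 D H -> measurable_fun (D : set T2) (weight p G H : T2 -> \bar R).
Proof.
move=> mD mp mG mH; apply: emeasurable_funD.
  by apply/measurable_EFinP; apply: measurable_funD => //; exact: measurable_powR2.
apply: emeasurable_funM; last by apply/measurable_EFinP; exact: measurable_funX.
by apply: measurable_epow => //; exact: measurable_funB.
Qed.

Lemma osc_log (Clog d e : R) : 0 <= Clog -> 0 < e -> e <= d -> Clog / ln (expR 1 + e^-1) <= osc Clog d / 2.
Proof.
move=> C0 e0 ed; have d0 := lt_le_trans e0 ed.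
rewrite /osc (mulrC 2) mulfK ?pnatr_eq0 // ler_wpM2l // lef_pV2 ?posrE.
- by rewrite ler_ln ?posrE ?addr_gt0 ?expR_gt0 ?invr_gt0 // lerD2l lef_pV2.
- exact: lt_le_trans ltr01 (log_ge1 e0).
- exact: lt_le_trans ltr01 (log_ge1 d0).
Qed.

Lemma cX_ge0 (Sg Cf Jt : R) : 0 <= Sg -> 0 <= Jt -> 0 <= cX Sg Cf Jt.
Proof.
move=> Sg0 Jt0; have cT0 : 0 <= cT1 Sg by exact: mulr_ge0 (mulr_ge0 (ler0n _ _) (cpo_ge0)) Sg0.
have cV0 : 0 <= @cV1 R by exact: mulr_ge0 (ler0n _ _) cpo_ge0.
have h1 : 0 <= cV2 Sg.
  rewrite /cV2; apply: addr_ge0; first exact: mulr_ge0 (ler0n _ _) cV0.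
  apply: mulr_ge0; first exact: mulr_ge0 (ler0n _ _) (sqr_ge0 _).
  by apply: addr_ge0; [exact: mulr_ge0 (ler0n _ _) cV0|exact: ler0n].
apply: addr_ge0; last exact: mulr_ge0 (mulr_ge0 (ler0n _ _) cT0) Jt0.
by apply: addr_ge0 => //; apply: mulr_ge0 h1; exact: mulr_ge0 (ler0n _ _) (sqr_ge0 _).
Qed.

Variables (Omega : set (R * R)) (p u : R * R -> R) (p1 Clog U D0 Sg J M : R) (N : nat).
Hypotheses (mO : meas2 Omega) (mp : mfun2 Omega p).
Hypotheses (hp : forall x, Omega x -> p1 <= p x <= 2) (p11 : 1 < p1).
Hypotheses (lh : forall x y, Omega x -> Omega y -> `|p x - p y| <= Clog / ln (expR 1 + (enorm (x - y))^-1)).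
Hypotheses (cu : {within closure Omega, continuous u}) (HU : forall x, closure Omega x -> `|u x| <= U) (U0 : 0 <= U).
Hypotheses (D1 : 1 <= D0) (C0 : 0 <= Clog) (Sg1 : 1 <= Sg) (J0 : 0 <= J).
Hypotheses (M1 : 1 <= M) (N2 : (2 <= N)%N) (Np : 2 <= N%:R * (p1 - 1)).
Hypotheses (MU : 8 * U * Sg <= M) (MJ : 32 * (9 * J + cT1 Sg * J ^+ 2) * Sg <= M).

Variable k : @triangle R.
Local Notation B := (opent k).
Local Notation d := (diam (opent k)).
Local Notation G := (cgrad u).
Local Notation W := (weight p G (Hc u)).
Local Notation Cf := (cost D0 Clog M N).
Hypotheses (d0 : dt k != 0) (kO : B `<=` Omega) (C2 : Ck 2 B u) (dpos : 0 < d) (dD : d <= D0).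
(** The factor 4 pays for the smaller determinants of the shrunk triangles. *)
Hypothesis HSk : 4 * d ^+ 2 <= Sg * `|dt k|.
Variable Jt : R.
Hypotheses (HW : (\int[leb2]_(x in B) W x = Jt%:E)%E) (JtJ : Jt <= J).

Let oB : open B. Proof. exact: opent_open. Qed.
Let mB : meas2 B. Proof. exact: open_measurable2. Qed.

Let C2cont (F : R * R -> R) : (forall x, B x -> {for x, continuous F}) -> mfun2 B F.
Proof. exact: open_continuous_measurable2. Qed.

Let mG b : mfun2 B (fun z => enorm (G z - b)).
Proof. by apply: C2cont => x Bx; have [h _] := dir_bound_err oB C2 b 0; have [] := h x Bx. Qed.

Let mt : mfun2 B (fun z => enorm (G z)).
Proof. by have := mG 0; rewrite (_ : (fun z => enorm (G z - 0)) = fun z => enorm (G z)) //; apply/funext => z; rewrite subr0. Qed.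

Let mH : mfun2 B (Hc u).
Proof. exact: C2cont (Hc_cont oB C2). Qed.

Let mpB : mfun2 B p.
Proof. exact: measurable_funS mO kO mp. Qed.

Let mW : measurable_fun (B : set T2) (W : T2 -> \bar R).
Proof. exact: measurable_weight. Qed.

Let Jt0 : 0 <= Jt.
Proof. by rewrite -lee_fin -HW; apply: integral_ge0 => x _; exact: weight_ge0. Qed.

Let sub_le (S : set (R * R)) (f : T2 -> \bar R) : meas2 S -> S `<=` B -> measurable_fun (S : set T2) f ->
  (forall x, S x -> (0 <= f x)%E) -> (forall x, S x -> (f x <= W x)%E) -> (\int[leb2]_(x in S) f x <= Jt%:E)%E.
Proof.
move=> mS SB mf f0 fW; rewrite -HW.
apply: le_trans (ge0_subset_integral leb2 mS mB mW (fun x _ => weight_ge0 p G (Hc u) x) SB).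
by apply: ge0_le_integral => //; exact: measurable_funS mB SB mW.
Qed.

Let c := centroid k.
Let Bc : B c.
Proof.
have := @shrink_opent _ k (k 0) 1 d0 (vertex_closedt 0 d0) ltr01 (lexx 1).
by rewrite subrr scale0r add0r scale1r.
Qed.

(** A lower bound of [p] on the triangle, built from the value at the centroid; [p] exceeds it by at
    most [osc Clog d], and [P >= p1] keeps it away from 1. *)
Let P := Num.max p1 (p c - osc Clog d / 2).

Let p_osc x y : B x -> B y -> p x - p y <= osc Clog d / 2.
Proof.
move=> Bx By; apply: le_trans (ler_norm _) _.
have [E|ne] := eqVneq (enorm (x - y)) 0.
  have /eqP : x - y = 0 by exact: enorm_eq0.
  rewrite subr_eq0 => /eqP ->; rewrite subrr normr0 divr_ge0 // /osc mulr_ge0 // divr_ge0 //.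
  by apply: le_trans ler01 (log_ge1 dpos).
have e0 : 0 < enorm (x - y) by rewrite lt_neqAle eq_sym ne enorm_ge0.
apply: le_trans (lh (kO Bx) (kO By)) _; apply: osc_log => //.
by apply: diam_opent => //; exact: opent_sub.
Qed.

Let P_le x : B x -> P <= p x.
Proof.
by move=> Bx; rewrite ge_max; have /andP[-> _] := hp (kO Bx); rewrite lerBlDr addrC -lerBlDr p_osc.
Qed.

Let P_osc x : B x -> p x - P <= osc Clog d.
Proof.
move=> Bx; have h1 := p_osc Bx Bc.
have h2 : p c - osc Clog d / 2 <= P by rewrite le_max lexx orbT.
by move: h1 h2; lra.
Qed.

Let P_one x : B x -> p x - P <= 1.
Proof.
move=> Bx; have /andP[_ h1] := hp (kO Bx).
have h2 : p1 <= P by rewrite le_max lexx.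
by move: h1 h2 p11; lra.
Qed.

Let kn n := shr (en n) k.

Let dtn n : `|dt k| / 4 <= `|dt (kn n)| /\ dt (kn n) != 0.
Proof.
have /andP[e0 e1] := @en01 R n; have eh := @en_half R n.
have h : 2^-1 <= 1 - @en R n by rewrite lerBrDl -lerBrDr (_ : 1 - 2^-1 = 2^-1 :> R) //; field.
rewrite dt_shr; split; last by rewrite mulf_neq0 // expf_neq0 // lt0r_neq0 // subr_gt0.
rewrite normrM normrX mulrC ger0_norm ?subr_ge0 ?(ltW e1) //; apply: ler_wpM2r => //.
apply: le_trans (_ : (2^-1) ^+ 2 <= _); first by rewrite exprVn -natrX.
by apply: lerXn2r; rewrite ?nnegrE ?subr_ge0 ?(ltW e1).
Qed.

Let CB n : closedt (kn n) `<=` B. Proof. exact: closedt_shr (en01 n). Qed.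

Local Notation cE := (1 + 256 * Cf * (44 + (8 * cX Sg Cf J + 4) * D0 ^+ 2)).

Let main n :
  ible (closedt (kn n)) (fun x => quasi (p x) (G x) (slope u (kn n))) (cX Sg Cf J * (d ^+ 2 * Jt)) /\
  ible (closedt (kn n)) (fun x => (`|u x - lin u (kn n) x| / d) `^ p x) (cE * Jt).
Proof.
have [dn1 dn0] := dtn n.
have mC : measurable (closedt (kn n) : set T2) by exact: measurable_closedt.
have kd i j : enorm (kn n i - kn n j) <= d.
  apply: le_trans (enorm_shr _ _ _ _) _; last by apply: diam_opent => //; exact: vertex_closedt.
  by have /andP[/ltW-> /ltW->] := @en01 R n.
have HS : d ^+ 2 <= Sg * `|dt (kn n)|.
  apply: le_trans (_ : Sg * (`|dt k| / 4) <= _); first by rewrite mulrA ler_pdivlMr // mulrC.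
  by apply: ler_wpM2l => //; exact: le_trans Sg1.
have mpC : measurable_fun (closedt (kn n) : set T2) (p : T2 -> R) by exact: measurable_funS mB (@CB n) mpB.
have hpC x : closedt (kn n) x -> P <= p x <= 2.
  by move=> /CB Bx; rewrite P_le //; have /andP[_ ->] := hp (kO Bx).
have P1P : p1 <= P by rewrite le_max lexx.
have [s1 s2 s3] := small_bounds D1 dpos dD.
have [l1 l2 l3 l4] := large_bounds D1 p11 M1 N2 Np dpos dD.
have Cf1 := cost_ge1 N D1 C0 M1.
have px x : closedt (kn n) x -> 0 <= p x - P by move=> /hpC/andP[h _]; rewrite subr_ge0.
have ob x (Cx : closedt (kn n) x) := osc_bounds N D1 C0 M1 dpos dD (px x Cx) (P_osc (CB Cx)) (P_one (CB Cx)).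
have hde x : closedt (kn n) x -> small D0 d `^ (P - p x) <= Cf.
  by move=> Cx; have [h _] := ob x Cx; rewrite opprB in h.
have hLa x : closedt (kn n) x -> (3 * large D0 M N d) `^ (p x - P) <= Cf.
  by move=> Cx; have [_ h] := ob x Cx.
have K0 x : (0 <= epow (enorm (G x)) (p x - 2) * ((Hc u x) ^+ 2)%:E)%E.
  by apply: mule_ge0; [exact: epow_ge0 (enorm_ge0 _)|rewrite lee_fin sqr_ge0].
have HA : fine (leb2 (closedt (kn n) : set T2)) <= Jt.
  rewrite -lee_fin -leb2_closedtE // -[leLHS]mul1e -integral_cst //.
  apply: (sub_le mC (@CB n)); [exact: measurable_cst|by move=> x _; rewrite lee01|move=> x _].
  rewrite /weight -[leLHS]adde0; apply: leeD => //.
  by rewrite lee_fin lerDl powR_ge0.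
have Ht : ible (closedt (kn n)) (fun x => enorm (G x) `^ p x) Jt.
  apply: (sub_le mC (@CB n)).
  - by apply/measurable_EFinP; apply: (measurable_funS mB (@CB n)); exact: measurable_powR2.
  - by move=> x _; rewrite lee_fin powR_ge0.
  - by move=> x _; rewrite /weight -[leLHS]adde0; apply: leeD => //; rewrite lee_fin lerDr.
have HK : (\int[leb2]_(x in closedt (kn n)) (epow (enorm (G x)) (p x - 2) * ((Hc u x) ^+ 2)%:E) <= Jt%:E)%E.
  apply: (sub_le mC (@CB n)) => //.
  - apply: (measurable_funS mB (@CB n)); apply: emeasurable_funM; last by apply/measurable_EFinP; exact: measurable_funX.
    by apply: measurable_epow => //; exact: measurable_funB.
  - by move=> x _; rewrite /weight -[leLHS]add0e; apply: leeD => //; rewrite lee_fin addr_ge0 // powR_ge0.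
have HUn x : closedt (kn n) x -> `|u x| <= U by move=> /CB/kO/subset_closure; exact: HU.
have LaU : 8 * U * Sg <= large D0 M N d * d by exact: le_trans MU l3.
have cT0 : 0 <= cT1 Sg.
  by apply: mulr_ge0; [exact: mulr_ge0 (ler0n _ _) (cpo_ge0)|exact: le_trans Sg1].
have Laf : 32 * (9 * Jt + cT1 Sg * Jt ^+ 2) * Sg <= large D0 M N d * d ^+ 2.
  apply: le_trans l2; apply: le_trans MJ; apply: ler_wpM2r; first exact: le_trans Sg1.
  apply: ler_wpM2l; first exact: ler0n.
  by apply: lerD; apply: ler_wpM2l => //; apply: lerXn2r; rewrite ?nnegrE.
have cXJ : cX Sg Cf Jt <= cX Sg Cf J.
  rewrite /cX lerD2l; apply: ler_wpM2l JtJ; exact: mulr_ge0 (ler0n _ _) cT0.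
have cX0 : 0 <= cX Sg Cf Jt by apply: cX_ge0 => //; exact: le_trans Sg1.
have d2J : 0 <= d ^+ 2 * Jt by exact: mulr_ge0 (sqr_ge0 _) Jt0.
split.
  apply: ible_trans (ible_X oB C2 dn0 (@CB n) dpos kd Sg1 HS mpC hpC p11 P1P s1 s2 s3 Cf1 l1 hde hLa HA Ht HK HUn U0 LaU l4 Laf) _.
  exact: ler_wpM2r.
apply: ible_trans (ible_err oB C2 dn0 (@CB n) dpos kd Sg1 HS mpC hpC p11 P1P s1 s2 s3 Cf1 l1 hde hLa HA Ht HK HUn U0 LaU l4 Laf) _.
apply: ler_wpM2r => //; rewrite lerD2l; apply: ler_wpM2l; first exact: mulr_ge0 (ler0n _ _) (le_trans ler01 Cf1).
rewrite lerD2l; apply: ler_pM.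
- by apply: addr_ge0; [exact: mulr_ge0 (ler0n _ _) cX0|exact: ler0n].
- exact: sqr_ge0.
- by rewrite lerD2r; apply: ler_wpM2l cXJ; exact: ler0n.
- by apply: lerXn2r; rewrite ?nnegrE ?(ltW dpos) ?(le_trans ler01 D1).
Qed.

Let limit (Fn : nat -> R * R -> R) (F : R * R -> R) (a : R) :
  (forall n, mfun2 B (Fn n)) -> mfun2 B F ->
  (forall n x, 0 <= Fn n x) -> (forall x, 0 <= F x) ->
  (forall x, B x -> F x = 0 \/ Fn n x @[n --> \oo] --> F x) ->
  (forall n, ible (closedt (kn n)) (Fn n) a) -> ible B F a.
Proof.
move=> mFn mF Fn0 F0 cF iF.
apply: (@fatou_le _ B (fun n => (fun x => (Fn n x)%:E) \_ (closedt (kn n))) (fun x => (F x)%:E) a%:E mB).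
- move=> n; apply/measurable_restrict => //; first by have [_ dn] := dtn n; exact: measurable_closedt.
  apply: (measurable_funS mB); first by move=> x [].
  exact/measurable_EFinP.
- exact/measurable_EFinP.
- by move=> n x _; rewrite /patch; case: ifP => // _; rewrite lee_fin.
- by move=> x _; rewrite lee_fin.
- move=> x Bx; have [->|cx] := cF x Bx; [by left|right].
  have E : \forall n \near \oo, (Fn n x)%:E = ((fun x => (Fn n x)%:E) \_ (closedt (kn n))) x.
    by have := mem_shr d0 Bx; apply: filterS => n Cx; rewrite /patch mem_set.
  by apply: cvg_trans (near_eq_cvg E) _; apply: cvg_EFin; [exact: nearW|exact: cx].
- by move=> n; rewrite -integral_mkcondr setIidr; [exact: iF|exact: CB].
Qed.

Let powR_seq (a : nat -> R) (l r : R) : 0 < l -> a n @[n --> \oo] --> l -> a n `^ r @[n --> \oo] --> l `^ r.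
Proof.
move=> l0 al; apply: (@continuous_cvg _ _ _ _ _ a (fun z => z `^ r)) => //.
exact: is_derive1_cont (is_derive1_powR r l0).
Qed.

(** The slopes of the interpolants on the shrunk triangles converge, by continuity of [u] up to the
    boundary. Where [grad u] equals the limit slope the density is 0; elsewhere its base is positive
    and it converges. *)
Lemma triangle_quasi : ible B (fun x => quasi (p x) (G x) (slope u k)) (cX Sg Cf J * (d ^+ 2 * Jt)).
Proof.
have mq b : mfun2 B (fun x => quasi (p x) (G x) b).
  apply: measurable_funM; last by apply: measurable_funX.
  by apply: measurable_powR2 => //; [exact: measurable_funD|exact: measurable_funB].
have q0 (r : R) xi eta : 0 <= quasi r xi eta by rewrite mulr_ge0 ?powR_ge0 ?sqr_ge0.
apply: (@limit (fun n x => quasi (p x) (G x) (slope u (kn n)))) => // [x Bx|n]; last by have [] := main n.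
have [b0|bn] := eqVneq (enorm (G x - slope u k)) 0; [left|right].
  by rewrite /quasi b0 expr0n mulr0.
have bp : 0 < enorm (G x - slope u k) by rewrite lt_neqAle eq_sym bn enorm_ge0.
have cb := @slope_shr_cvg _ _ _ _ cu d0 kO (G x).
apply: cvgM; last by apply: cvgM.
apply: powR_seq; first by rewrite ltr_wpDl // enorm_ge0.
by apply: cvgD; [exact: cvg_cst|].
Qed.

Lemma triangle_err : ible B (fun x => (`|u x - lin u k x| / d) `^ p x) (cE * Jt).
Proof.
have mu : mfun2 B u.
  by apply: C2cont => x Bx; exact: (Ck_cont oB C2 Bx (s := [::])).
have me k' : mfun2 B (fun x => (`|u x - lin u k' x| / d) `^ p x).
  apply: measurable_powR2 => //; apply: measurable_funM => //; apply: measurableT_comp => //.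
  by apply: measurable_funB => //; apply: C2cont => x _; exact: lin_cont.
apply: (@limit (fun n x => (`|u x - lin u (kn n) x| / d) `^ p x)) => // [n x|x|x Bx|n]; try exact: powR_ge0; last by have [] := main n.
have cl := @lin_shr_cvg _ _ _ _ cu d0 kO x.
have ce : `|u x - lin u (kn n) x| / d @[n --> \oo] --> `|u x - lin u k x| / d.
  by apply: cvgM; [apply: cvg_norm; apply: cvgB; [exact: cvg_cst|]|exact: cvg_cst].
have [b0|bn] := eqVneq (`|u x - lin u k x| / d) 0; [left|right].
  rewrite b0 powR0 // lt0r_neq0 //; have /andP[h _] := hp (kO Bx).
  exact: lt_le_trans (lt_trans ltr01 p11) h.
apply: powR_seq => //; rewrite lt_neqAle eq_sym bn divr_ge0 // ltW //.
Qed.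

End OpenTriangle.

(** * The error on the mesh *)

Section MeshIntegrals.
Context {R : realType}.
Local Notation T2 := (plane R).
Implicit Types (x y : R * R) (A B : set (R * R)).

Lemma integral_ae_sub A B (f g : T2 -> \bar R) : meas2 A -> meas2 B -> B `<=` A ->
  measurable_fun (A : set T2) f -> measurable_fun (B : set T2) g ->
  {ae leb2, forall x : T2, A x -> (B x -> f x = g x) /\ (~ B x -> f x = 0%E)} ->
  (\int[leb2]_(x in A) f x = \int[leb2]_(x in B) g x)%E.
Proof.
move=> mA mB BA mf mg H.
have AB : A `&` B = B by exact: setIidr.
rewrite -[X in (\int[_]_(x in X) g x)%E]AB integral_mkcondr; apply: ae_eq_integral => //.
  by apply/measurable_restrict => //; rewrite AB.
apply: filterS H => x H Ax; have [h1 h2] := H Ax; rewrite /patch; case: ifPn => xB; first by apply: h1; rewrite -inE.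
by apply: h2 => Bx; move: xB; rewrite mem_set.
Qed.

Lemma ae_and (P Q : T2 -> Prop) : {ae leb2, forall x, P x} -> {ae leb2, forall x, Q x} -> {ae leb2, forall x, P x /\ Q x}.
Proof. by apply: filterS2 => x Px Qx; split. Qed.

Variables (Omega : set (R * R)) (sigma h : R) (T : set (@triangle R)).
Hypothesis tr : triangulation Omega sigma h T.
Local Notation S := (mesh_in T).

Let oS : open S. Proof. exact: mesh_in_open tr. Qed.

Lemma measurable_mesh : meas2 S.
Proof. exact: open_measurable2. Qed.

(** Both sides are additive over the disjoint open triangles, so a bound linear in the integral of
    [W] sums up with the same constant. *)
Lemma mesh_integral_le (F W : T2 -> \bar R) (c : R) : 0 <= c ->
  measurable_fun (S : set T2) F -> measurable_fun (S : set T2) W ->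
  (forall x, S x -> (0 <= F x)%E) -> (forall x, S x -> (0 <= W x)%E) ->
  (forall k, T k -> (\int[leb2]_(x in opent k) F x <= c%:E * \int[leb2]_(x in opent k) W x)%E) ->
  (\int[leb2]_(x in S) F x <= c%:E * \int[leb2]_(x in S) W x)%E.
Proof.
move=> c0 mF mW F0 W0 H; have [s Hs] := tr_list tr.
pose Ms (l : seq triangle) : set (R * R) := [set x | exists2 k, List.In k l & opent k x].
have oM l : (forall k, List.In k l -> T k) -> open (Ms l).
  move=> lT; rewrite (_ : Ms l = \bigcup_(k in [set k | List.In k l]) opent k).
    by apply: bigcup_open => k /lT Tk; apply: opent_open; exact: (tr_dt tr).
  by apply/seteqP; split => x [k lk kx]; exists k.
have MS l : (forall k, List.In k l -> T k) -> Ms l `<=` S by move=> lT x [k /lT Tk kx]; exists k.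
have -> : S = Ms s by apply/seteqP; split => x [k /Hs sk kx]; exists k.
have : forall l, (forall k, List.In k l -> T k) -> (\int[leb2]_(x in Ms l) F x <= c%:E * \int[leb2]_(x in Ms l) W x)%E; last first.
  by apply=> k /Hs.
elim=> [_|k l IH lT].
  rewrite (_ : Ms [::] = set0); first by rewrite !integral_set0 mule0.
  by apply/seteqP; split => x // [].
have lT' k' : List.In k' l -> T k' by move=> lk; apply: lT; right.
have Tk : T k by apply: lT; left.
have {}IH := IH lT'.
(* The list may repeat a triangle: a repeated one adds nothing to the union, a new one is disjoint
   from it. *)
have [kl|nkl] := pselect (List.In k l).
  rewrite (_ : Ms (k :: l) = Ms l) //; apply/seteqP; split => x [k' /= lk kx]; last by exists k' => //; right.
  by case: lk => [E|lk]; [exists k => //; rewrite E|exists k'].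
have E : Ms (k :: l) = opent k `|` Ms l.
  apply/seteqP; split => x; first by move=> [k' [<-|lk] kx]; [left|right; exists k'].
  by move=> [kx|[k' lk kx]]; [exists k => //; left|exists k' => //; right].
have mk : meas2 (opent k) by apply: open_measurable2; apply: opent_open; exact: (tr_dt tr).
have ml : meas2 (Ms l) by apply: open_measurable2; exact: oM.
have dis : [disjoint opent k & Ms l].
  apply/disj_setPS => x [kx [k' lk k'x]]; apply: nkl.
  by rewrite (opent_inj tr Tk (lT' _ lk) kx k'x).
have sub : opent k `|` Ms l `<=` S by rewrite -E; exact: MS.
have mF' := measurable_funS measurable_mesh sub mF; have mW' := measurable_funS measurable_mesh sub mW.
have F0' x (Ux : (opent k `|` Ms l) x) := F0 x (sub x Ux).
have W0' x (Ux : (opent k `|` Ms l) x) := W0 x (sub x Ux).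
rewrite E (ge0_integral_setU leb2 mk ml mF' F0' dis) (ge0_integral_setU leb2 mk ml mW' W0' dis).
rewrite ge0_muleDr.
- by apply: leeD IH; exact: H.
- by apply: integral_ge0 => x kx; apply: W0'; left.
- by apply: integral_ge0 => x kx; apply: W0'; right.
Qed.

Section Data.
Variables (p u : R * R -> R) (Gu : R * R -> R * R) (D : 'I_2 -> 'I_2 -> R * R -> R).
Hypotheses (oO : open Omega) (mp : mfun2 Omega p).
Hypotheses (wG : is_weak_grad Omega u Gu) (wD : is_weak_hess Omega u D).
Hypothesis C2 : forall k, T k -> Ck 2 (opent k) u.

Let SO : S `<=` Omega. Proof. by move=> x /(mesh_in_polygon tr); exact: tr_sub tr x. Qed.
Let mO : meas2 Omega. Proof. exact: open_measurable2. Qed.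
Let mS := measurable_mesh.

(** The data are given through distributional derivatives and the local estimates through classical
    ones; almost everywhere on the open triangles the two coincide. *)
Lemma mesh_classical : {ae leb2, forall x : T2, S x ->
  wgrad Omega u x = cgrad u x /\ forall i j, D i j x = chess u i j x}.
Proof.
have [s Hs] := tr_list tr.
have H k : T k -> {ae leb2, forall x : T2, opent k x -> wgrad Omega u x = cgrad u x /\ forall i j, D i j x = chess u i j x}.
  move=> Tk; have ok : open (opent k) by apply: opent_open; exact: (tr_dt tr).
  have kO : opent k `<=` Omega by move=> x kx; apply: SO; exists k.
  have h0 : {ae leb2, forall x : T2, opent k x -> wgrad Omega u x = cgrad u x} := wgrad_classical oO ok kO (CkS (C2 Tk)) wG.
  have hh i j : {ae leb2, forall x : T2, opent k x -> D i j x = chess u i j x} := whess_classical i j oO ok kO (C2 Tk) wG wD.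
  apply: ae2S (ae_and h0 (ae_and (ae_and (hh 0 0) (hh 0 1)) (ae_and (hh 1 0) (hh 1 1)))) => x [a [[b1 b2] [b3 b4]]] kx.
  split; first exact: a.
  by move=> i j; have [->|->] := I2_cases i; have [->|->] := I2_cases j; [exact: b1|exact: b2|exact: b3|exact: b4].
have : {ae leb2, forall x : T2, forall k, List.In k s -> opent k x -> wgrad Omega u x = cgrad u x /\ forall i j, D i j x = chess u i j x}.
  by apply: ae_list => k /Hs; exact: H.
by apply: filterS => x Hx [k /Hs sk kx]; exact: (Hx k sk kx).
Qed.

Lemma mesh_cont (F : R * R -> R) : (forall k x, T k -> opent k x -> {for x, continuous F}) -> mfun2 S F.
Proof. by move=> cF; apply: open_continuous_measurable2 => // x [k Tk kx]; exact: cF kx. Qed.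

Lemma measurable_Hc : mfun2 S (Hc u).
Proof.
apply: mesh_cont => k x Tk kx.
by apply: (Hc_cont (opent_open (tr_dt tr Tk)) (C2 Tk)).
Qed.

Lemma measurable_cgrad i : mfun2 S (partial i u).
Proof.
apply: mesh_cont => k x Tk kx.
exact: (Ck_cont (opent_open (tr_dt tr Tk)) (C2 Tk) kx (s := [:: i])).
Qed.

Lemma measurable_cenorm (b : R * R -> R * R) : mfun2 S (fun x => (b x).1) ->
  mfun2 S (fun x => (b x).2) ->
  mfun2 S (fun x => enorm (cgrad u x - b x)).
Proof.
move=> m1 m2; apply: measurable_enorm; apply: measurable_funB => //.
- exact: (measurable_cgrad 0).
- exact: (measurable_cgrad 1).
Qed.

Let mpS : mfun2 S p. Proof. exact: measurable_funS mO SO mp. Qed.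

Lemma measurable_ct : mfun2 S (fun x => enorm (cgrad u x)).
Proof.
have := @measurable_cenorm (fun=> 0) (measurable_cst _) (measurable_cst _).
by rewrite (_ : (fun x => enorm (cgrad u x - 0)) = fun x => enorm (cgrad u x)) //; apply/funext => z; rewrite subr0.
Qed.

Lemma measurable_cweight : measurable_fun (S : set T2) (weight p (cgrad u) (Hc u) : T2 -> \bar R).
Proof. exact: (measurable_weight mS mpS measurable_ct measurable_Hc). Qed.

Lemma mesh_weight : (\int[leb2]_(x in S) weight p (cgrad u) (Hc u) x <=
  \int[leb2]_(x in Omega) weight p (wgrad Omega u) (hess_sum D) x)%E.
Proof.
have mD i j : mfun2 Omega (D i j).
  by have [_ l _] := wD i j; exact: loc_integrable_measurable oO l.
have mW : measurable_fun (Omega : set T2) (weight p (wgrad Omega u) (hess_sum D) : T2 -> \bar R).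
  apply: measurable_weight => //.
    by apply: measurable_enorm; [exact: (measurable_wgrad 0 oO wG)|exact: (measurable_wgrad 1 oO wG)].
  by apply: measurable_funD; [apply: measurable_funD|]; apply: measurableT_comp.
apply: le_trans (ge0_subset_integral leb2 mS mO mW (fun x _ => weight_ge0 _ _ _ x) SO).
apply: eqle; apply: ae_eq_integral => //.
- exact: measurable_cweight.
- exact: measurable_funS mO SO mW.
- apply: filterS mesh_classical => x H Sx; have [e1 e2] := H Sx.
  by rewrite /weight e1 /hess_sum !e2.
Qed.

End Data.
End MeshIntegrals.

Lemma galerkin_aux (R : realFieldType) (k Y l d Q m c X : R) : k * Y <= l -> l <= d - Q -> d <= m ->
  m <= k / 2 * Y + c * X -> k / 2 * Y <= c * X - Q.
Proof. by move=> h1 h2 h3 h4; have := le_trans h1 h2; rewrite (_ : k * Y = k / 2 * Y + k / 2 * Y); [lra|field]. Qed.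

Lemma mix_aux2 (R : realFieldType) (s t b X : R) : s <= 4 * (t + b) -> b <= 2 * X + t -> s <= 8 * t + 8 * X.
Proof. lra. Qed.

Lemma dotBl (R : realType) (a b c : R * R) : dot (a - b) c = dot a c - dot b c.
Proof. by rewrite /dot /=; ring. Qed.

Lemma dotBr (R : realType) (a b c : R * R) : dot a (b - c) = dot a b - dot a c.
Proof. by rewrite /dot /=; ring. Qed.

Lemma dotZl (R : realType) (r : R) (a c : R * R) : dot (r *: a) c = r * dot a c.
Proof. by rewrite /dot /= /GRing.scale /=; ring. Qed.

(** * The Galerkin error *)

Section Galerkin.
Context {R : realType}.
Local Notation T2 := (plane R).
Implicit Types (x y : R * R) (A B : set (R * R)).

Variables (Omega : set (R * R)) (sigma h : R) (T : set (@triangle R)).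
Hypotheses (tr : triangulation Omega sigma h T) (oO : open Omega) (bO : bounded_set Omega).
Hypothesis Ofin : (leb2 (Omega : set T2) < +oo)%E.
Local Notation S := (mesh_in T).
Local Notation poly := (polygon T).

Variables (p f g u uh : R * R -> R) (p1 : R) (D : 'I_2 -> 'I_2 -> R * R -> R) (Gu : R * R -> R * R).
Hypotheses (mp : mfun2 Omega p).
Hypotheses (hp : forall x, Omega x -> p1 <= p x <= 2) (p11 : 1 < p1).
Hypotheses (wG : is_weak_grad Omega u Gu) (wD : is_weak_hess Omega u D).
Hypothesis C2 : forall k, T k -> Ck 2 (opent k) u.
Hypotheses (ws : weak_solution Omega p f g u) (fs : fe_solution T p f u uh).

Let SP : S `<=` poly. Proof. exact: mesh_in_polygon tr. Qed.
Let PO : poly `<=` Omega. Proof. exact: tr_sub tr. Qed.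
Let SO : S `<=` Omega. Proof. by move=> x /SP/PO. Qed.
Let mO : meas2 Omega. Proof. exact: open_measurable2. Qed.
Let oP : open poly. Proof. exact: polygon_open. Qed.
Let mP : meas2 poly. Proof. exact: open_measurable2. Qed.
Let mS : meas2 S := measurable_mesh tr.
Let p12 x : Omega x -> 1 <= p x <= 2.
Proof. by move=> /hp/andP[h1 ->]; rewrite andbT; apply: le_trans h1; exact: ltW. Qed.
Let mpS : mfun2 S p. Proof. exact: measurable_funS mO SO mp. Qed.

Let pi := interp T u.
Let v := uh \- pi.

Let Suh : Sh T uh. Proof. by have [[]] := fs. Qed.
Let Spi : Sh T pi. Proof. by have [] := interpP tr u. Qed.

Lemma mesh_diff_Sh0 : Sh0 T v.
Proof.
have [cu au] := Suh; have [cp ap] := Spi; split; last first.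
  move=> x bx; have [[_ E] _] := fs; by rewrite /v /= E // subrr.
split; first by move=> x; apply: cvgB; [exact: cu|exact: cp].
move=> k Tk; have [a [b [c E]]] := au k Tk; have [a' [b' [c' E']]] := ap k Tk.
exists (a - a'), (b - b'), (c - c') => x kx; rewrite /v /= E // E' //; ring.
Qed.

Let Sv := mesh_diff_Sh0.

Lemma pgrad_diff i x : pgrad T i v x = pgrad T i uh x - pgrad T i pi x.
Proof.
have [[k Tk kx]|nS] := pselect (S x).
  by rewrite !(pgradE tr _ _ Tk kx) /pslope /lin /v /=; ring.
by rewrite !pgrad_out // subr0.
Qed.

Lemma pgrad_interp k x : T k -> opent k x -> pgrad2 T pi x = slope u k.
Proof.
move=> Tk kx; have [_ E] := interpP tr u.
have L y : lin pi k y = lin u k y.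
  have d0 := tr_dt tr Tk; have V i : pi (k i) = u (k i).
    rewrite /pi (E k) //; [exact: lin_vertex|exact: vertex_closedt].
  by rewrite /lin !V.
by rewrite /pgrad2 /slope !(pgradE tr _ _ Tk kx) /pslope !L.
Qed.

Local Notation G := (cgrad u).
Local Notation zeta := (pgrad2 T uh).
Local Notation eta := (pgrad2 T pi).
Local Notation W := (weight p (cgrad u) (Hc u)).

Lemma pgrad2_diff x : pgrad2 T v x = zeta x - eta x.
Proof. by rewrite /pgrad2 !pgrad_diff. Qed.

Let mg2 w (A : set (R * R)) : meas2 A ->
  mfun2 A (fun x => (pgrad2 T w x).1) /\
  mfun2 A (fun x => (pgrad2 T w x).2).
Proof. by move=> mA; split; exact: (measurable_pgrad tr). Qed.

Let mdot (A : set (R * R)) (F F' : T2 -> R * R) : meas2 A ->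
  measurable_fun (A : set T2) (fun x => (F x).1) -> measurable_fun (A : set T2) (fun x => (F x).2) ->
  measurable_fun (A : set T2) (fun x => (F' x).1) -> measurable_fun (A : set T2) (fun x => (F' x).2) ->
  measurable_fun (A : set T2) p ->
  measurable_fun (A : set T2) (fun x => enorm (F x) `^ (p x - 2) * dot (F x) (F' x)).
Proof.
move=> mA m1 m2 m3 m4 m5; apply: measurable_funM.
  by apply: measurable_powR2 => //; [exact: measurable_enorm|exact: measurable_funB].
by apply: measurable_funD; exact: measurable_funM.
Qed.

Let mcg1 : mfun2 S (fun x => (G x).1). Proof. exact: (measurable_cgrad tr C2 0). Qed.
Let mcg2 : mfun2 S (fun x => (G x).2). Proof. exact: (measurable_cgrad tr C2 1). Qed.

Let pgrad2_weak w : Sh T w -> is_weak_grad poly w (pgrad2 T w).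
Proof.
move=> Sw i; have := Sh_weak_partial tr i Sw.
by rewrite (_ : coord i \o pgrad2 T w = pgrad T i w) //; apply/funext => x; have [->|->] := I2_cases i.
Qed.

Let poly_mesh : {ae leb2, forall x : T2, poly x -> S x}.
Proof. by apply: filterS (mesh_ae tr) => x H /(polygon_sub tr); exact: H. Qed.

(** Here and in [plapP], the form is reduced to the open triangles, where the gradient of [u] is
    classical and those of finite element functions are constant; off the triangles the gradient of
    the extension is 0. *)
Let plapO : plap_form Omega p u (ext0 T v) = \int[leb2]_(x in S) (enorm (G x) `^ (p x - 2) * dot (G x) (pgrad2 T v x)).
Proof.
rewrite /plap_form /Rintegral; congr fine.
have wE := ext0_weak_grad tr Sv oO.
have mW i := measurable_wgrad i oO wG; have mV i := measurable_wgrad i oO wE.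
have [m1 m2] := mg2 v mS.
apply: (@integral_ae_sub _ Omega S) => //.
- apply/measurable_EFinP; apply: mdot => //; [exact: (mW 0)|exact: (mW 1)|exact: (mV 0)|exact: (mV 1)].
- by apply/measurable_EFinP; apply: mdot.
- have a1 : {ae leb2, forall x : T2, Omega x -> wgrad Omega (ext0 T v) x = pgrad2 T v x} := wgrad_ae oO wE.
  have a2 := mesh_classical tr oO wG wD C2.
  apply: ae2S (ae_and a1 a2) => x [b1 b2] Ox; split=> [Sx|nS].
    by have [-> _] := b2 Sx; rewrite (b1 Ox).
  rewrite (b1 Ox) /pgrad2 !pgrad_out // /dot /= !mulr0 addr0 mulr0 //.
Qed.

Let plapP : plap_form poly p uh v = \int[leb2]_(x in S) (enorm (zeta x) `^ (p x - 2) * dot (zeta x) (pgrad2 T v x)).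
Proof.
rewrite /plap_form /Rintegral; congr fine.
have wu := pgrad2_weak Suh; have [Sv' _] := Sv; have wv := pgrad2_weak Sv'.
have mW i := measurable_wgrad i oP wu; have mV i := measurable_wgrad i oP wv.
have [m1 m2] := mg2 v mS; have [m3 m4] := mg2 uh mS.
apply: (@integral_ae_sub _ poly S) => //.
- apply/measurable_EFinP; apply: mdot => //; [exact: (mW 0)|exact: (mW 1)|exact: (mV 0)|exact: (mV 1)|].
  exact: measurable_funS mO PO mp.
- by apply/measurable_EFinP; apply: mdot.
- have a1 : {ae leb2, forall x : T2, poly x -> wgrad poly uh x = zeta x} := wgrad_ae oP wu.
  have a2 : {ae leb2, forall x : T2, poly x -> wgrad poly v x = pgrad2 T v x} := wgrad_ae oP wv.
  apply: ae2S (ae_and poly_mesh (ae_and a1 a2)) => x [b0 [b1 b2]] Px; split=> [Sx|nS].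
    by rewrite (b1 Px) (b2 Px).
  by case: nS; exact: b0.
Qed.

(** The continuous problem is tested with the extension of [v] by zero, the discrete one with [v].
    The right-hand sides agree because the extension vanishes off the polygon. *)
Lemma galerkin_orth : \int[leb2]_(x in S) (enorm (G x) `^ (p x - 2) * dot (G x) (pgrad2 T v x)) =
  \int[leb2]_(x in S) (enorm (zeta x) `^ (p x - 2) * dot (zeta x) (pgrad2 T v x)).
Proof.
rewrite -plapO -plapP.
have [_ /(_ _ (ext0_W1p0 tr bO oO Sv Ofin mp p12))[_ ->]] := ws.
have [_ /(_ _ Sv)[_ ->]] := fs.
rewrite (Rintegral_out PO); last by move=> x _ nP; rewrite ext0_out // mulr0.
by apply: eq_Rintegral => x; rewrite inE => Px; rewrite ext0_in.
Qed.

Variables (J hh cx : R).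
Hypothesis HJ : (\int[leb2]_(x in Omega) weight p (wgrad Omega u) (hess_sum D) x <= J%:E)%E.
Hypotheses (hh0 : 0 < hh) (cx0 : 0 <= cx).
Hypothesis HX : forall k, T k -> (\int[leb2]_(x in opent k) (quasi (p x) (G x) (slope u k))%:E <=
  (cx * hh ^+ 2)%:E * \int[leb2]_(x in opent k) W x)%E.

Let mW : measurable_fun (S : set T2) (W : T2 -> \bar R). Proof. exact: (measurable_cweight tr oO mp C2). Qed.

Let WJ : (\int[leb2]_(x in S) W x <= J%:E)%E.
Proof. by apply: le_trans HJ; exact: (mesh_weight tr oO mp wG wD C2). Qed.

Lemma J_ge0 : 0 <= J.
Proof. by rewrite -lee_fin; apply: le_trans WJ; apply: integral_ge0 => x _; exact: weight_ge0. Qed.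

Lemma mesh_one : ible S (fun=> 1) J.
Proof.
apply: (ible_leE mS (g := W) _ mW _ WJ); first exact: nnm_cst.
move=> x _; rewrite /weight -[leLHS]adde0; apply: leeD; first by rewrite lee_fin lerDl powR_ge0.
by apply: mule_ge0; [exact: epow_ge0 (enorm_ge0 _)|rewrite lee_fin sqr_ge0].
Qed.

Let mt := measurable_ct tr C2.

Lemma mesh_tp : nnm S (fun x => enorm (G x) `^ p x) /\ ible S (fun x => enorm (G x) `^ p x) J.
Proof.
have n : nnm S (fun x => enorm (G x) `^ p x) by split=> [|x _]; [exact: measurable_powR2|exact: powR_ge0].
split=> //; apply: (ible_leE mS (g := W) n mW _ WJ) => x _.
rewrite /weight -[leLHS]adde0; apply: leeD; first by rewrite lee_fin lerDr.
by apply: mule_ge0; [exact: epow_ge0 (enorm_ge0 _)|rewrite lee_fin sqr_ge0].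
Qed.

Local Notation X := (fun x => quasi (p x) (G x) (eta x)).

Let mGb w : mfun2 S (fun x => enorm (G x - pgrad2 T w x)).
Proof. by have [m1 m2] := mg2 w mS; exact: (measurable_cenorm tr C2). Qed.

Lemma mesh_quasi : nnm S X /\ ible S X (cx * hh ^+ 2 * J).
Proof.
have n : nnm S X.
  split=> [|x _]; last exact: mulr_ge0 (powR_ge0 _ _) (sqr_ge0 _).
  apply: measurable_funM; last by apply: measurable_funX; exact: mGb.
  by apply: measurable_powR2 => //; [apply: measurable_funD => //; exact: mGb|exact: measurable_funB].
split=> //; have [m1 n0] := n.
have c0 : 0 <= cx * hh ^+ 2 by rewrite mulr_ge0 // sqr_ge0.
have m1' : measurable_fun (S : set T2) (fun x : T2 => (X x)%:E) by exact/measurable_EFinP.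
have n0' x : S x -> (0 <= (X x)%:E)%E by move=> Sx; rewrite lee_fin n0.
apply: le_trans (mesh_integral_le tr c0 m1' mW n0' (fun x _ => weight_ge0 p G (Hc u) x) _) _.
  move=> k Tk; rewrite (eq_integral (fun x : T2 => (quasi (p x) (G x) (slope u k))%:E)); first exact: HX.
  by move=> x; rewrite inE => kx; rewrite (pgrad_interp Tk kx).
rewrite (_ : (cx * hh ^+ 2 * J)%:E = (cx * hh ^+ 2)%:E * J%:E)%E //.
by apply: lee_wpmul2l; rewrite ?lee_fin.
Qed.

(** [|xi|^(P-1) <= 1 + |xi|^P]. This makes the two sides of the orthogonality relation integrable,
    so that they may be subtracted. *)
Lemma flux_bound (P L : R) (xi w : R * R) : 1 <= P <= 2 -> enorm w <= L ->
  `|enorm xi `^ (P - 2) * dot xi w| <= L * (1 + enorm xi `^ P).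
Proof.
move=> /andP[P1 P2] wL; have L0 : 0 <= L := le_trans (enorm_ge0 w) wL.
have t0 := enorm_ge0 xi; rewrite normrM ger0_norm ?powR_ge0 //.
have [tz|tn] := eqVneq (enorm xi) 0.
  have := dot_le xi w; rewrite tz mul0r normr_le0 => /eqP ->.
  by rewrite normr0 mulr0 mulr_ge0 // addr_ge0 // powR_ge0.
have tp : 0 < enorm xi by rewrite lt_neqAle eq_sym tn.
apply: le_trans (_ : enorm xi `^ (P - 2) * (enorm xi * L) <= _).
  rewrite ler_wpM2l ?powR_ge0 //; apply: le_trans (dot_le _ _) _.
  by rewrite ler_wpM2l.
rewrite mulrA mulrC; apply: ler_wpM2l => //.
rewrite (_ : _ * enorm xi = enorm xi `^ (P - 1)).
  by apply: powR_le1D => //; rewrite subr_ge0 P1 /= lerBlDr lerDl.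
by rewrite -{2}(powRr1 t0) -powR_split //; congr (_ `^ _); ring.
Qed.

Let kap := p1 - 1.
Let kap0 : 0 < kap. Proof. by rewrite subr_gt0. Qed.

Definition maxn2 (w : R * R -> R * R) x : R := Num.max (enorm (G x)) (enorm (w x)).
Local Notation Y := (fun x => maxn2 zeta x `^ (p x - 2) * enorm (G x - zeta x) ^+ 2).
Let cK := 8 / kap + 6.
Let Q x := enorm (G x) `^ (p x - 2) * dot (G x) (pgrad2 T v x) - enorm (zeta x) `^ (p x - 2) * dot (zeta x) (pgrad2 T v x).

(** Monotonicity of the flux, with constant [p - 1 >= kap], is applied to [grad u] and [grad uh].
    Their difference is [(grad u - grad pi u) - (grad uh - grad pi u)]: the second part is the
    orthogonality term [Q], and in the first Young's inequality leaves half of [kap Y]. *)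
Lemma galerkin_pointwise x : S x -> kap / 2 * Y x <= cK * X x - Q x.
Proof.
move=> /SO Ox; have /andP[px1 px2] := hp Ox; have px12 := p12 Ox.
have s01 : 0 <= 2 - p x <= 1 by have /andP[q1 q2] := px12; apply/andP; split; move: q1 q2; lra.
have kp : kap <= p x - 1 by rewrite lerD2r.
have [h1 h2] := powvec_mono (G x) (zeta x) (lexx 0) s01.
rewrite !nrm0 opprB -/(maxn2 zeta x) in h1 h2.
set AG := powvec 0 _ (G x) in h1 h2; set Az := powvec 0 _ (zeta x) in h1 h2.
have QE : Q x = dot (AG - Az) (zeta x - eta x).
  by rewrite /Q pgrad2_diff dotBl /AG /Az /powvec !dotZl !nrm0 opprB.
have E : dot (AG - Az) (G x - zeta x) = dot (AG - Az) (G x - eta x) - Q x.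
  by rewrite QE -dotBr; congr dot; rewrite opprB addrA subrK.
have h3 : dot (AG - Az) (G x - eta x) <= 2 * maxn2 zeta x `^ (p x - 2) * enorm (G x - zeta x) * enorm (G x - eta x).
  apply: le_trans (ler_norm _) _; apply: le_trans (dot_le _ _) _.
  by rewrite ler_wpM2r ?enorm_ge0.
have h4 : 2 * maxn2 zeta x `^ (p x - 2) * enorm (G x - zeta x) * enorm (G x - eta x) <=
    kap / 2 * Y x + cK * X x := @galerkin_young _ (p x) kap (G x) (eta x) (zeta x) px12 kap0.
have Y0 : 0 <= Y x by rewrite mulr_ge0 ?powR_ge0 ?sqr_ge0.
have h5 : kap * Y x <= (1 + (p x - 2)) * maxn2 zeta x `^ (p x - 2) * enorm (G x - zeta x) ^+ 2.
  by rewrite -mulrA; apply: ler_wpM2r => //; rewrite (_ : 1 + _ = p x - 1) //; ring.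
rewrite E in h1.
exact: (galerkin_aux h5 h1 h3 h4).
Qed.

Lemma ible_integrable F a : nnm S F -> ible S F a -> leb2.-integrable (S : set T2) (EFin \o (F : T2 -> R)).
Proof.
move=> [mF F0] iF; apply/integrableP; split; first exact/measurable_EFinP.
apply: le_lt_trans (ltry a); apply: le_trans iF.
apply: eqle; apply: eq_integral => x; rewrite inE => Sx /=.
by rewrite ger0_norm // F0.
Qed.

Let q1 x := enorm (G x) `^ (p x - 2) * dot (G x) (pgrad2 T v x).
Let q2 x := enorm (zeta x) `^ (p x - 2) * dot (zeta x) (pgrad2 T v x).

Lemma pgrad2_bound w : exists L : R, 0 <= L /\ forall x, enorm (pgrad2 T w x) <= L.
Proof.
have [L0 [L00 H0]] := pgrad_bound tr 0 w; have [L1 [L10 H1]] := pgrad_bound tr 1 w.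
exists (L0 + L1); split=> [|x]; first exact: addr_ge0.
apply: le_trans (enorm_le _) _; apply: lerD; [exact: H0|exact: H1].
Qed.

Let iq1 : leb2.-integrable (S : set T2) (EFin \o (q1 : T2 -> R)).
Proof.
have [L [L0 HL]] := pgrad2_bound v; have [nt it] := mesh_tp; have [m1 m2] := mg2 v mS.
have n1 : nnm S (fun=> 1) by exact: nnm_cst.
have nb := nnm_scale L0 (nnm_add n1 nt).
have ib := ible_scale mS L0 (nnm_add n1 nt) (ible_add mS n1 nt mesh_one it).
apply: (le_integrable mS _ _ (ible_integrable nb ib)).
  by apply/measurable_EFinP; apply: mdot.
move=> x Sx; rewrite /= lee_fin; apply: le_trans (ler_norm _).
by apply: flux_bound => //; exact: p12 (SO Sx).
Qed.

Let iq2 : leb2.-integrable (S : set T2) (EFin \o (q2 : T2 -> R)).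
Proof.
have [L [L0 HL]] := pgrad2_bound v; have [Lz [Lz0 HLz]] := pgrad2_bound uh.
have [m1 m2] := mg2 v mS; have [m3 m4] := mg2 uh mS.
have c0 : 0 <= L * (1 + (1 + Lz `^ 2)) by rewrite mulr_ge0 // !addr_ge0 ?powR_ge0.
have n1 : nnm S (fun=> 1) by exact: nnm_cst.
apply: (le_integrable mS _ _ (ible_integrable (nnm_scale c0 n1) (ible_scale mS c0 n1 mesh_one))).
  by apply/measurable_EFinP; apply: mdot.
move=> x Sx; have /andP[px1 px2] := p12 (SO Sx); have p0 := le_trans ler01 px1.
rewrite /= lee_fin mulr1; apply: le_trans (ler_norm _).
rewrite /q2; apply: le_trans (flux_bound (zeta x) (p12 (SO Sx)) (HL x)) _.
apply: ler_wpM2l => //; rewrite lerD2l; apply: le_trans (powR_le1D (enorm_ge0 _) _) _; last first.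
  by rewrite lerD2l; apply: ge0_ler_powR; rewrite ?nnegrE ?enorm_ge0.
by rewrite p0.
Qed.

(** The pointwise estimate is integrated; [Q] has integral zero by orthogonality. *)
Lemma mesh_Y : nnm S Y /\ ible S Y (2 / kap * cK * (cx * hh ^+ 2 * J)).
Proof.
have [nX iX] := mesh_quasi; have [mX X0] := nX; have [m3 m4] := mg2 uh mS.
have cK0 : 0 <= cK by rewrite addr_ge0 // divr_ge0 // ltW.
have nY : nnm S Y.
  split=> [|x _]; last exact: mulr_ge0 (powR_ge0 _ _) (sqr_ge0 _).
  apply: measurable_funM; last by apply: measurable_funX; exact: mGb.
  apply: measurable_powR2 => //; last exact: measurable_funB.
  by apply: measurable_maxr => //; exact: measurable_enorm.
split=> //; have k2 : 0 <= kap / 2 by rewrite divr_ge0 // ltW.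
have nKY := nnm_scale k2 nY; have [mKY KY0] := nKY.
have IX := ible_integrable (nnm_scale cK0 nX) (ible_scale mS cK0 nX iX).
have IQ := integrableB mS iq1 iq2.
have IR := integrableB mS IX IQ.
have KY : ible S (fun x => kap / 2 * Y x) (cK * (cx * hh ^+ 2 * J)).
  apply: le_trans (_ : \int[leb2]_(x in S) (cK * X x - (q1 x - q2 x))%:E <= _)%E.
    apply: ge0_le_integral => //; first exact/measurable_EFinP.
      by have /integrableP[] := IR.
    by move=> x Sx; rewrite lee_fin; exact: galerkin_pointwise.
  have fn : (\int[leb2]_(x in S) (cK * X x - (q1 x - q2 x))%:E)%E \is a fin_num by exact: (integrable_fin_num mS IR).
  rewrite -(fineK fn) lee_fin.
  have -> : fine (\int[leb2]_(x in S) (cK * X x - (q1 x - q2 x))%:E)%E =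
    \int[leb2]_(x in S) (cK * X x) - \int[leb2]_(x in S) (q1 x - q2 x).
    exact: (RintegralB mS IX IQ).
  rewrite (RintegralB mS iq1 iq2) {1}/q1 galerkin_orth subrr subr0.
  rewrite -lee_fin /Rintegral fineK; last exact: (integrable_fin_num mS IX).
  exact: (ible_scale mS cK0 nX iX).
have c2 : 0 <= 2 / kap by rewrite divr_ge0 // ltW.
have := ible_scale mS c2 nKY KY; rewrite mulrA; congr (ible _ _ _).
apply/funext => x; rewrite mulrA; rewrite (_ : 2 / kap * (kap / 2) = 1) ?mul1r //.
by field; exact: lt0r_neq0.
Qed.

Variables (Hd ce : R).
Hypotheses (hhd : hh ^+ 2 <= Hd) (ce0 : 0 <= ce).
Hypothesis HE : forall k, T k -> (\int[leb2]_(x in opent k) ((`|u x - lin u k x| / hh) `^ p x)%:E <=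
  ce%:E * \int[leb2]_(x in opent k) W x)%E.

(** [cY hh^2] bounds the quasi-norm of the gradient error; [cG] and [cB] bound the modulars, after
    division by [hh], of [grad u - grad uh] and [grad u - grad pi u]; [hh cD] bounds the [L^1] norm
    of the derivatives of [v = uh - pi u]; and [cU] bounds the modular of [(u - uh) / hh]. *)
Definition cY : R := 2 / kap * cK * (cx * J).
Definition cG : R := cY + (4 * J + 4 * (cY * Hd)).
Definition cB : R := cx * J + (8 * J + 8 * (cx * Hd * J)).
Definition cD : R := J + cG + (J + cB).
Definition cU : R := 4 * (ce * J + (J + cD ^+ 2)).

Let Hd0 : 0 <= Hd. Proof. exact: le_trans (sqr_ge0 _) hhd. Qed.
Let Jge0 := J_ge0.
Let cY0 : 0 <= cY.
Proof.
by apply: mulr_ge0; [apply: mulr_ge0; [rewrite divr_ge0 // ltW|rewrite addr_ge0 // divr_ge0 // ltW]|exact: mulr_ge0].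
Qed.

Let iY : ible S Y (cY * hh ^+ 2).
Proof. by have [_ iY] := mesh_Y; apply: ible_trans iY _; rewrite /cY le_eqVlt; apply/orP; left; apply/eqP; ring. Qed.

Lemma mesh_max : nnm S (fun x => maxn2 zeta x `^ p x) /\ ible S (fun x => maxn2 zeta x `^ p x) (4 * J + 4 * (cY * Hd)).
Proof.
have [nt it] := mesh_tp; have [nY _] := mesh_Y; have [m3 m4] := mg2 uh mS.
have n : nnm S (fun x => maxn2 zeta x `^ p x).
  split=> [|x _]; last exact: powR_ge0.
  by apply: measurable_powR2 => //; apply: measurable_maxr => //; exact: measurable_enorm.
split=> //; have n4 : 0 <= 4 :> R by [].
apply: (ible_le mS n (nnm_add (nnm_scale n4 nt) (nnm_scale n4 nY))).
  by move=> x Sx; exact: max_powR_le (p12 (SO Sx)).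
apply: (ible_add mS); [exact: nnm_scale|exact: nnm_scale|exact: ible_scale|].
apply: ible_scale => //; apply: ible_trans iY _; exact: ler_wpM2l.
Qed.

Let hh2 : 0 <= (hh ^+ 2)^-1. Proof. by rewrite invr_ge0 sqr_ge0. Qed.
Let hh2n : hh ^+ 2 != 0. Proof. by rewrite expf_neq0 // lt0r_neq0. Qed.

(** Young's inequality with base [max (|grad u|, |grad uh|)]: the quasi-norm, divided by [hh^2], is
    bounded, and so is the modular of the base, by [mesh_max]. *)
Lemma mesh_grad : nnm S (fun x => (enorm (G x - zeta x) / hh) `^ p x) /\
  ible S (fun x => (enorm (G x - zeta x) / hh) `^ p x) cG.
Proof.
have [nm im] := mesh_max; have [nY _] := mesh_Y.
have n : nnm S (fun x => (enorm (G x - zeta x) / hh) `^ p x).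
  split=> [|x _]; last exact: powR_ge0.
  by apply: measurable_powR2 => //; apply: measurable_funM => //; exact: mGb.
split=> //; apply: (ible_le mS n (nnm_add (nnm_scale hh2 nY) nm)).
  move=> x Sx; apply: le_trans (@diff_powR_le _ _ _ _ (p12 (SO Sx)) _ hh0) _.
  by rewrite -/(maxn2 zeta x) lerD2r mulrC.
apply: (ible_add mS) => //; first exact: nnm_scale.
by apply: ible_trans (ible_scale mS hh2 nY iY) _; rewrite mulrC mulfK.
Qed.

(** The same argument with base [|grad u| + |grad u - grad pi u|], the one that appears in
    [quasi]. *)
Lemma mesh_interp_grad : nnm S (fun x => (enorm (G x - eta x) / hh) `^ p x) /\
  ible S (fun x => (enorm (G x - eta x) / hh) `^ p x) cB.
Proof.
have [nt it] := mesh_tp; have [nX iX] := mesh_quasi.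
have n : nnm S (fun x => (enorm (G x - eta x) / hh) `^ p x).
  split=> [|x _]; last exact: powR_ge0.
  by apply: measurable_powR2 => //; apply: measurable_funM => //; exact: mGb.
have n8 : 0 <= 8 :> R by [].
have nn := nnm_add (nnm_scale hh2 nX) (nnm_add (nnm_scale n8 nt) (nnm_scale n8 nX)).
split=> //; apply: (ible_le mS n nn).
  move=> x Sx; have px12 := p12 (SO Sx); have /andP[px1 px2] := px12.
  have t0 := enorm_ge0 (G x); have b0 := enorm_ge0 (G x - eta x).
  have p0 : 0 < p x := lt_le_trans ltr01 px1.
  have h1 : (enorm (G x) + enorm (G x - eta x)) `^ p x <= 4 * (enorm (G x) `^ p x + enorm (G x - eta x) `^ p x).
    by apply: powR_add_le => //; rewrite ltW.
  have h2 := powR_drop_ge t0 b0 px12.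
  have [z|nz] := eqVneq (enorm (G x) + enorm (G x - eta x)) 0.
    have bz : enorm (G x - eta x) = 0 by apply: le_anti; rewrite b0 andbT -z lerDr.
    rewrite bz mul0r powR0 ?lt0r_neq0 //.
    have X0 : 0 <= X x by exact: mulr_ge0 (powR_ge0 _ _) (sqr_ge0 _).
    apply: addr_ge0; first exact: mulr_ge0.
    by apply: addr_ge0; [exact: mulr_ge0 n8 (powR_ge0 _ _)|exact: mulr_ge0].
  have tb : 0 < enorm (G x) + enorm (G x - eta x) by rewrite lt_neqAle eq_sym nz addr_ge0.
  have h3 : (enorm (G x - eta x) / hh) `^ p x <= (hh ^+ 2)^-1 * X x + (enorm (G x) + enorm (G x - eta x)) `^ p x.
    apply: le_trans (powR_young tb (_ : 0 <= enorm (G x - eta x) / hh) _) _.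
    - by rewrite divr_ge0 // ltW.
    - by rewrite p0.
    - rewrite lerD2r /quasi expr_div_n [leRHS]mulrC mulrA //.
  by apply: le_trans h3 _; rewrite lerD2l; exact: mix_aux2 h1 h2.
apply: (ible_add mS); [exact: nnm_scale|exact: nnm_add (nnm_scale n8 nt) (nnm_scale n8 nX)| |].
  apply: ible_trans (ible_scale mS hh2 nX iX) _; apply: eqle; field.
  exact: lt0r_neq0.
apply: (ible_add mS); [exact: nnm_scale|exact: nnm_scale|exact: ible_scale|].
apply: ible_scale => //; apply: ible_trans iX _; apply: ler_wpM2r => //; exact: ler_wpM2l.
Qed.

Let cG0 : 0 <= cG.
Proof. by have [n i] := mesh_grad; exact: ible_ge0 n i. Qed.

Let cB0 : 0 <= cB.
Proof. by have [n i] := mesh_interp_grad; exact: ible_ge0 n i. Qed.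

Let cD0 : 0 <= cD.
Proof. exact: addr_ge0 (addr_ge0 Jge0 cG0) (addr_ge0 Jge0 cB0). Qed.

(** [a <= hh (1 + (a / hh)^p)] for [p >= 1] turns the scaled modulars into an [L^1] bound of order
    [hh]. *)
Lemma mesh_pgrad i : nnm S (fun x => `|pgrad T i v x|) /\ ible S (fun x => `|pgrad T i v x|) (hh * cD).
Proof.
have [n1 i1] := mesh_grad; have [n2 i2] := mesh_interp_grad; have hh0' := ltW hh0.
have n : nnm S (fun x => `|pgrad T i v x|).
  by split=> // ; apply: measurableT_comp => //; exact: (measurable_pgrad tr).
have n0 : nnm S (fun=> 1) by exact: nnm_cst.
have nn := nnm_add (nnm_add n0 n1) (nnm_add n0 n2).
split=> //; apply: (ible_le mS n (nnm_scale hh0' nn)); last first.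
  exact: (ible_scale mS hh0' nn (ible_add mS (nnm_add n0 n1) (nnm_add n0 n2)
    (ible_add mS n0 n1 mesh_one i1) (ible_add mS n0 n2 mesh_one i2))).
move=> x Sx; have /andP[px1 _] := p12 (SO Sx).
have H (a : R) : 0 <= a -> a <= hh * (1 + (a / hh) `^ p x).
  move=> a0; rewrite mulrC -ler_pdivrMr //; have ah : 0 <= a / hh by rewrite divr_ge0.
  by rewrite -{1}(powRr1 ah); apply: powR_le1D => //; rewrite ler01.
rewrite mulrDr; apply: le_trans (_ : enorm (zeta x - eta x) <= _).
  rewrite -pgrad2_diff; have := coord_le i (pgrad2 T v x).
  by rewrite /pgrad2 /coord; have [->|->] := I2_cases i.
apply: le_trans (_ : enorm (G x - zeta x) + enorm (G x - eta x) <= _).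
  rewrite (enormB (G x) (zeta x)) (_ : zeta x - eta x = (zeta x - G x) + (G x - eta x)); first exact: enormD.
  by rewrite addrA subrK.
by apply: lerD; exact: H (enorm_ge0 _).
Qed.

Lemma ext0_bounded : exists C : R, forall x, `|ext0 T v x| <= C.
Proof.
have [phi [L [L0 tphi H _ _]]] := ext0_sequence tr bO Sv.
have [C [C0 HC]] := test_bound (tphi 0%N); exists (C + L) => x.
rewrite (_ : ext0 T v x = phi 0%N x - (phi 0%N x - ext0 T v x)); last by rewrite opprB addrC subrK.
by apply: le_trans (ler_normB _ _) _; apply: lerD; [exact: HC|have := H 0%N x; rewrite divr1].
Qed.

Lemma mesh_v2 : nnm S (fun x => v x ^+ 2) /\ ible S (fun x => v x ^+ 2) (hh ^+ 2 * cD ^+ 2).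
Proof.
have E x : S x -> v x = ext0 T v x by move=> /SP Px; rewrite ext0_in.
have m0 : measurable_fun setT (ext0 T v : T2 -> R) by apply: continuous_measurable2; exact: (ext0_cont tr Sv).
have mv : mfun2 S v.
  apply: (@eq_measurable_fun _ _ _ _ _ (ext0 T v : T2 -> R)) => [x|]; first by rewrite inE => /E.
  exact: (measurable_funS measurableT (@subsetT _ _) m0).
have n : nnm S (fun x => v x ^+ 2) by split=> [|x _]; [exact: measurable_funX|exact: sqr_ge0].
split=> //.
have I i : \int[leb2]_(z in Omega) `|pgrad T i v z| <= hh * cD.
  have [[mi i0] ii] := mesh_pgrad i.
  rewrite (Rintegral_out SO); last by move=> x _ nS; rewrite pgrad_out // normr0.
  rewrite -lee_fin /Rintegral fineK //; rewrite ge0_fin_numE; first exact: le_lt_trans ii (ltry _).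
  by apply: integral_ge0 => x _; rewrite lee_fin.
have hcD : 0 <= hh * cD by rewrite mulr_ge0 // ltW.
have J1 : \int[leb2]_(z in Omega) (ext0 T v z ^+ 2) <= hh ^+ 2 * cD ^+ 2.
  apply: le_trans (gn_ext0 tr bO oO Ofin Sv) _; rewrite -exprMn expr2.
  by apply: ler_pM => //; apply: Rintegral_ge0.
have [C HC] := ext0_bounded.
have mO2 : measurable_fun (Omega : set T2) (fun x : T2 => ext0 T v x ^+ 2).
  by apply: measurable_funX; exact: (measurable_funS measurableT (@subsetT _ _) m0).
have int2 : leb2.-integrable (Omega : set T2) (EFin \o (fun x : T2 => ext0 T v x ^+ 2)).
  apply: (integrable_bounded mO Ofin (C := C ^+ 2)) => // x _.
  by rewrite normrX; apply: lerXn2r; rewrite ?nnegrE ?(le_trans (normr_ge0 _) (HC x)).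
rewrite /ible (eq_integral (fun x : T2 => (ext0 T v x ^+ 2)%:E)); last first.
  by move=> x; rewrite inE => /E ->.
have mOe : measurable_fun (Omega : set T2) (fun x : T2 => (ext0 T v x ^+ 2)%:E) by exact/measurable_EFinP.
apply: le_trans (ge0_subset_integral leb2 mS mO mOe (fun x _ => _ : (0 <= (ext0 T v x ^+ 2)%:E)%E) SO) _.
  by move=> x _; rewrite lee_fin sqr_ge0.
by rewrite -lee_fin in J1; rewrite /Rintegral fineK // in J1; exact: (integrable_fin_num mO int2).
Qed.

Let mu : mfun2 Omega u.
Proof. by have [l _ _] := wG 0; exact: loc_integrable_measurable oO l. Qed.

Let muh : mfun2 poly uh.
Proof. by have [l _ _] := pgrad2_weak Suh 0; exact: loc_integrable_measurable oP l. Qed.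

Let mpi : mfun2 poly pi.
Proof. by have [l _ _] := pgrad2_weak Spi 0; exact: loc_integrable_measurable oP l. Qed.

(** [u - uh] is the interpolation error minus [v]. For [v] the bound [t^p <= 1 + t^2] leads to the
    square integral, which the Gagliardo-Nirenberg inequality bounds by [hh^2 cD^2]. *)
Lemma mesh_err : nnm S (fun x => (`|u x - uh x| / hh) `^ p x) /\
  ible S (fun x => (`|u x - uh x| / hh) `^ p x) cU.
Proof.
have [n2 i2] := mesh_v2; have hi : 0 <= hh^-1 by rewrite invr_ge0 ltW.
have muS := measurable_funS mO SO mu; have muhS := measurable_funS mP SP muh; have mpiS := measurable_funS mP SP mpi.
have ma (w : T2 -> R) : measurable_fun (S : set T2) w -> nnm S (fun x => (`|w x| / hh) `^ p x).
  move=> mw; split=> [|x _]; last exact: powR_ge0.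
  by apply: measurable_powR2 => //; apply: measurable_funM => //; exact: measurableT_comp.
have n := ma (fun x => u x - uh x) (measurable_funB muS muhS).
have [mne ne0] := ma (fun x => u x - pi x) (measurable_funB muS mpiS).
have ie : ible S (fun x => (`|u x - pi x| / hh) `^ p x) (ce * J).
  have mne' : measurable_fun (S : set T2) (fun x : T2 => ((`|u x - pi x| / hh) `^ p x)%:E) by exact/measurable_EFinP.
  have ne0' x : S x -> (0 <= ((`|u x - pi x| / hh) `^ p x)%:E)%E by move=> Sx; rewrite lee_fin ne0.
  apply: le_trans (mesh_integral_le tr ce0 mne' mW ne0' (fun x _ => weight_ge0 p G (Hc u) x) _) _.
    move=> k Tk; rewrite (eq_integral (fun x : T2 => ((`|u x - lin u k x| / hh) `^ p x)%:E)); first exact: HE.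
    move=> x; rewrite inE => kx; have [_ E] := interpP tr u.
    by rewrite /pi (E k) //; exact: (opent_sub (tr_dt tr Tk)).
  by rewrite EFinM; apply: lee_wpmul2l; rewrite ?lee_fin.
have n1 : nnm S (fun=> 1) by exact: nnm_cst.
have hi2 : 0 <= (hh^-1) ^+ 2 := sqr_ge0 _.
have nv := nnm_add n1 (nnm_scale hi2 n2).
have iv := ible_add mS n1 (nnm_scale hi2 n2) mesh_one (ible_scale mS hi2 n2 i2).
have n4 : 0 <= 4 :> R by [].
have ne : nnm S (fun x => (`|u x - pi x| / hh) `^ p x) by [].
apply: conj => //; apply: (ible_le mS n (nnm_scale n4 (nnm_add ne nv))); last first.
  apply: ible_trans (ible_scale mS n4 (nnm_add ne nv) (ible_add mS ne nv ie iv)) _.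
  apply: ler_wpM2l => //; rewrite lerD2l lerD2l mulrA exprVn mulVf // mul1r //.
move=> x Sx; have /andP[px1 px2] := p12 (SO Sx); have p0 := le_trans ler01 px1.
apply: le_trans (_ : (`|u x - pi x| / hh + `|v x| / hh) `^ p x <= _).
  apply: ge0_ler_powR; rewrite ?nnegrE ?addr_ge0 ?mulr_ge0 //.
  rewrite -mulrDl; apply: ler_wpM2r => //.
  rewrite (_ : u x - uh x = (u x - pi x) - v x); first exact: ler_normB.
  by rewrite /v /= opprB addrA subrK.
apply: le_trans (powR_add_le _ _ _) _; rewrite ?mulr_ge0 //; first by rewrite p0.
apply: ler_wpM2l => //; rewrite lerD2l.
apply: le_trans (powR_le1D (q := 2) _ _) _; rewrite ?mulr_ge0 //; first by rewrite p0.
rewrite lerD2l powR_mulrn ?mulr_ge0 // exprMn real_normK ?num_real //.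
by rewrite mulrC.
Qed.

(** With [m = max (1, C)] and [p >= 1], dividing further by [m] multiplies the density by at most
    [1 / m], so the modular at [hh m] is at most [C / m <= 1]. *)
Lemma Lp_of_mesh (w w' : R * R -> R) (C : R) : mfun2 poly w ->
  mfun2 S w' -> {ae leb2, forall x : T2, S x -> w x = w' x} ->
  ible S (fun x => (`|w' x| / hh) `^ p x) C ->
  Lp poly p w /\ (Lp_norm poly p w <= (hh * Num.max 1 C)%:E)%E.
Proof.
move=> mw mw' E iC; have hi : 0 <= hh^-1 by rewrite invr_ge0 ltW.
have mpP := measurable_funS mO PO mp.
have n : nnm S (fun x => (`|w' x| / hh) `^ p x).
  split=> [|x _]; last exact: powR_ge0.
  by apply: measurable_powR2 => //; apply: measurable_funM => //; exact: measurableT_comp.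
have M (r a : R) : 0 < r -> 0 <= a -> (forall x, S x -> `|w' x / r| `^ p x <= a * (`|w' x| / hh) `^ p x) ->
    (modular poly p (fun x => (w x / r)%R) <= (a * C)%:E)%E.
  move=> r0 a0 H; rewrite /modular.
  have mr : measurable_fun (S : set T2) (fun x : T2 => `|w' x / r| `^ p x).
    by apply: measurable_modular => //; exact: measurable_funM.
  rewrite (@integral_ae_sub _ poly S _ (fun x => (`|w' x / r| `^ p x)%:E)) //.
  - apply: (ible_le mS _ (nnm_scale a0 n) H (ible_scale mS a0 n iC)).
    by split=> // x _; exact: powR_ge0.
  - by apply/measurable_EFinP; apply: measurable_modular => //; exact: measurable_funM.
  - exact/measurable_EFinP.
  - apply: ae2S (ae_and poly_mesh E) => x [b1 b2] Px; split=> [Sx|nS]; first by rewrite b2.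
    by case: nS; exact: b1.
have m1 : 1 <= Num.max 1 C by rewrite le_max lexx.
have m0 := lt_le_trans ltr01 m1.
split.
  split=> //; rewrite (_ : modular poly p w = modular poly p (fun x => (w x / 1)%R)).
    have a0 : 0 <= 1 + hh `^ 2 by rewrite addr_ge0 // powR_ge0.
    apply: le_lt_trans (M 1 _ ltr01 a0 _) (ltry _) => x Sx.
    have /andP[px1 px2] := p12 (SO Sx); have p0 := le_trans ler01 px1.
    rewrite divr1 -{1}(divfK (lt0r_neq0 hh0) `|w' x|) powRM ?mulr_ge0 // ?(ltW hh0) // mulrC.
    by apply: ler_wpM2r; [exact: powR_ge0|apply: powR_le1D; [exact: ltW|rewrite p0]].
  by congr modular; apply/funext => x; rewrite divr1.
apply: Lp_norm_le; first exact: mulr_gt0.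
have a0 : 0 <= (Num.max 1 C)^-1 by rewrite invr_ge0 ltW.
apply: le_trans (M _ _ (mulr_gt0 hh0 m0) a0 _) _.
  move=> x Sx; have /andP[px1 px2] := p12 (SO Sx).
  rewrite invfM mulrA !normrM (ger0_norm hi) (ger0_norm a0) powRM ?mulr_ge0 // mulrC.
  apply: ler_wpM2r; first exact: powR_ge0.
  rewrite -[leRHS]powRr1 //; apply: ger_powR => //.
  by rewrite invr_gt0 m0 /= invf_le1.
by rewrite lee_fin mulrC ler_pdivrMr // mul1r le_max lexx orbT.
Qed.

Lemma galerkin_estimate : W1p poly p (u \- uh) /\
  (W1p_norm poly p (u \- uh)%R <= ((Num.max 1 cU + Num.max 1 cG) * hh)%:E)%E.
Proof.
have wd : is_weak_grad poly (u \- uh) (fun x => wgrad Omega u x - zeta x).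
  move=> i; have h1 := weak_partial_subset PO (wgradP wG i); have h2 := pgrad2_weak Suh i.
  have := weak_partialB oP h1 h2.
  by congr (weak_partial _ _ _ _); apply/funext => x; have [->|->] := I2_cases i.
have ea : {ae leb2, forall x : T2, S x -> wgrad poly (u \- uh) x = G x - zeta x}.
  have a1 : {ae leb2, forall x : T2, poly x -> wgrad poly (u \- uh) x = wgrad Omega u x - zeta x} := wgrad_ae oP wd.
  apply: ae2S (ae_and a1 (mesh_classical tr oO wG wD C2)) => x [b1 b2] Sx.
  by rewrite (b1 (SP Sx)); have [-> _] := b2 Sx.
have mW' i := measurable_wgrad i oP wd.
have [mg1 mg2'] := mg2 uh mS.
have [nU iU] := mesh_err; have [nG iG] := mesh_grad; have hi : 0 <= hh^-1 by rewrite invr_ge0 ltW.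
have muS := measurable_funS mO SO mu; have muhS := measurable_funS mP SP muh.
have muP := measurable_funS mO PO mu.
have [L1 N1] := @Lp_of_mesh (u \- uh) (fun x => u x - uh x) cU (measurable_funB muP muh) (measurable_funB muS muhS)
  (aeW leb2 (fun x (_ : S x) => erefl)) iU.
have mE : mfun2 poly (fun x => enorm (wgrad poly (u \- uh) x)).
  by apply: measurable_enorm; [exact: (mW' 0)|exact: (mW' 1)].
have [L2 N2] : Lp poly p (fun x => enorm (wgrad poly (u \- uh)%R x)) /\
    (Lp_norm poly p (fun x => enorm (wgrad poly (u \- uh)%R x)) <= (hh * Num.max 1 cG)%:E)%E.
  have ea' : {ae leb2, forall x : T2, S x -> enorm (wgrad poly (u \- uh)%R x) = enorm (G x - zeta x)}.
    by apply: ae2S ea => x H Sx; rewrite H.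
  have iG' : ible S (fun x => (`|enorm (G x - zeta x)| / hh) `^ p x) cG.
    rewrite (_ : (fun x => _) = (fun x => (enorm (G x - zeta x) / hh) `^ p x)); first exact: iG.
    by apply/funext => x; rewrite ger0_norm ?enorm_ge0.
  exact: (Lp_of_mesh mE (mGb uh) ea' iG').
split; last first.
  rewrite /W1p_norm mulrDl EFinD (mulrC _ hh) (mulrC _ hh); exact: leeD.
split; [exact: L1|by exists (fun x => wgrad Omega u x - zeta x)|].
move=> i; have mi : mfun2 S (fun x => coord i (G x - zeta x)).
  by have [->|->] := I2_cases i; [exact: measurable_funB mcg1 mg1|exact: measurable_funB mcg2 mg2'].
have ni : nnm S (fun x => (`|coord i (G x - zeta x)| / hh) `^ p x).
  split=> [|x _]; last exact: powR_ge0.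
  by apply: measurable_powR2 => //; apply: measurable_funM => //; exact: measurableT_comp.
apply: (fun e1 e2 => (@Lp_of_mesh _ (fun x => coord i (G x - zeta x)) cG (mW' i) mi e1 e2).1).
  by apply: ae2S ea => x H Sx /=; rewrite H.
apply: (ible_le mS ni nG _ iG) => x Sx; have /andP[px1 px2] := p12 (SO Sx).
apply: ge0_ler_powR; rewrite ?nnegrE ?mulr_ge0 ?enorm_ge0 ?(le_trans ler01 px1) //.
by apply: ler_wpM2r => //; exact: coord_le.
Qed.

End Galerkin.

(** * Consequences of the hypotheses on the domain and the exponent *)

Section Domain.
Context {R : realType}.
Local Notation T2 := (plane R).
Implicit Types (x y : R * R).
Variables (Omega : set (R * R)) (p : R * R -> R).
Hypotheses (oO : open Omega) (bO : bounded_set Omega).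

Lemma bounded_leb2_fin : (leb2 (Omega : set T2) < +oo)%E.
Proof.
have [M HM] := bounded_leb2 bO.
pose Q : set T2 := [set x | `|x.1| <= M /\ `|x.2| <= M].
have mQ : measurable Q.
  rewrite (_ : Q = `[- M, M]%classic `*` `[- M, M]%classic); first exact: measurableX.
  by apply/seteqP; split=> x; rewrite /Q /= !in_itv /= !ler_norml.
have h : (leb2 (Omega : set T2) <= leb2 Q)%E.
  by apply: le_measure; rewrite ?inE //; exact: open_measurable2.
by apply: (le_lt_trans h); rewrite leb2_square ltry.
Qed.

Lemma bounded_enorm : exists2 D0 : R, 1 <= D0 & forall x y, Omega x -> Omega y -> enorm (x - y) <= D0.
Proof.
have [M HM] := bounded_leb2 bO; exists (1 + 4 * `|M|); first by rewrite lerDl mulr_ge0.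
move=> x y /HM[x1 x2] /HM[y1 y2]; have hM := ler_norm M.
apply: le_trans (enorm_le _) _.
have := ler_normB x.1 y.1; have := ler_normB x.2 y.2; rewrite /=; lra.
Qed.

Lemma compact_closure : compact (closure Omega).
Proof.
have [M HM] := bounded_leb2 bO.
pose Q : set (R * R) := `[- M, M]%classic `*` `[- M, M]%classic.
have cQ : compact Q by exact: compact_rect.
apply: (subclosed_compact _ cQ); first exact: closed_closure.
have clQ : closed Q by apply: compact_closed => //; exact: norm_hausdorff.
have OQ : Omega `<=` Q by move=> x /HM; rewrite /Q /= !in_itv /= !ler_norml.
by have := closureS OQ; rewrite -((closure_id Q).1 clQ).
Qed.

Lemma bounded_continuous (u : R * R -> R) : {within closure Omega, continuous u} ->
  exists2 U : R, 0 <= U & forall x, closure Omega x -> `|u x| <= U.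
Proof.
move=> cu; have /compact_bounded[M [_ HM]] := continuous_compact cu compact_closure.
exists (`|M| + 1) => [|x Cx]; first by rewrite addr_ge0.
by apply: HM; [apply: le_lt_trans (ler_norm M) _; rewrite ltrDl|exists x].
Qed.

Variable Clog : R.
Hypothesis lh : forall x y, Omega x -> Omega y -> `|p x - p y| <= Clog / ln (expR 1 + (enorm (x - y))^-1).

Lemma log_holder_max x y : Omega x -> Omega y ->
  `|p x - p y| <= Num.max 0 Clog / ln (expR 1 + (enorm (x - y))^-1).
Proof.
move=> Ox Oy; apply: le_trans (lh Ox Oy) _; apply: ler_wpM2r; last by rewrite le_max lexx orbT.
rewrite invr_ge0 ln_ge0 //; apply: le_trans (_ : expR 1 <= _); first by rewrite -[leLHS]expR0 ler_expR.
by rewrite lerDl invr_ge0 enorm_ge0.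
Qed.

Lemma log_holder_cont x : Omega x -> {for x, continuous p}.
Proof.
move=> Ox; apply: ball_cont => e e0.
have /nbhs_ballP[q0 /= q00 Hq0] : nbhs x Omega by exact: open_nbhs_nbhs.
set C := Num.max 0 Clog; have C0 : 0 <= C by rewrite le_max lexx.
(* With this [t], [|x - y| <= t] makes the logarithm at least [C / e]. *)
pose t := expR (- (C / e)); have t0 : 0 < t := expR_gt0 _.
exists (Num.min q0 (t / 2)); first by rewrite lt_min q00 divr_gt0.
move=> y By; have Oy : Omega y.
  by apply: Hq0; apply: le_ball By; rewrite ge_min lexx.
have yt : enorm (x - y) <= t.
  have {}By : ball x (t / 2) y by apply: le_ball By; rewrite ge_min lexx orbT.
  have [b1 b2] := By; rewrite /ball /= in b1 b2; apply: le_trans (enorm_le _) _.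
  by move: b1 b2; rewrite /ball /=; lra.
have [z|nz] := eqVneq (enorm (x - y)) 0.
  have /eqP : x - y = 0 by exact: enorm_eq0.
  by rewrite subr_eq0 => /eqP ->; rewrite subrr normr0 ltW.
have r0 : 0 < enorm (x - y) by rewrite lt_neqAle eq_sym nz enorm_ge0.
apply: le_trans (log_holder_max Ox Oy) _; rewrite -/C.
rewrite ler_pdivrMr ?(lt_le_trans ltr01 (log_ge1 r0)) //.
rewrite mulrC -ler_pdivrMr //; apply: le_trans (_ : ln t^-1 <= _).
  by rewrite lnV ?posrE // /t expRK opprK.
rewrite ler_ln ?posrE ?invr_gt0 ?addr_gt0 ?expR_gt0 ?invr_gt0 //.
apply: le_trans (_ : (enorm (x - y))^-1 <= _); first by rewrite lef_pV2.
by rewrite lerDr ltW // expR_gt0.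
Qed.

Lemma measurable_log_holder : mfun2 Omega p.
Proof. by apply: open_continuous_measurable2 => // x; exact: log_holder_cont. Qed.

(** [W1p] puts each component of the gradient in [L^p]; [powR_add_le] recovers the modular of its
    Euclidean norm. *)
Lemma weight_finite (G : R * R -> R * R) (H : R * R -> R) : (forall x, Omega x -> 1 <= p x <= 2) ->
  (forall i, Lp Omega p (coord i \o G)) -> mfun2 Omega H ->
  (\int[leb2]_(x in Omega) (epow (enorm (G x)) (p x - 2) * ((H x) ^+ 2)%:E) < +oo)%E ->
  (\int[leb2]_(x in Omega) weight p G H x < +oo)%E.
Proof.
move=> p12 LG mH HK; have mO : meas2 Omega := open_measurable2 oO.
have mp := measurable_log_holder.
have [m0 l0] := LG 0; have [m1 l1] := LG 1.
have mE : mfun2 Omega (fun x => enorm (G x)) by exact: measurable_enorm.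
have mK : measurable_fun (Omega : set T2) (fun x : T2 => (epow (enorm (G x)) (p x - 2) * ((H x) ^+ 2)%:E)%E).
  apply: emeasurable_funM; last by apply/measurable_EFinP; exact: measurable_funX.
  by apply: measurable_epow => //; exact: measurable_funB.
have K0 (x : T2) : Omega x -> (0 <= epow (enorm (G x)) (p x - 2) * ((H x) ^+ 2)%:E)%E.
  by move=> _; apply: mule_ge0; [exact: epow_ge0 (enorm_ge0 _)|rewrite lee_fin sqr_ge0].
have mT : measurable_fun (Omega : set T2) (fun x : T2 => (1 + enorm (G x) `^ p x)%:E).
  by apply/measurable_EFinP; apply: measurable_funD => //; exact: measurable_powR2.
have T0 (x : T2) : Omega x -> (0 <= (1 + enorm (G x) `^ p x)%:E)%E.
  by move=> _; rewrite lee_fin addr_ge0 // powR_ge0.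
rewrite (ge0_integralD leb2 mO T0 mT K0 mK) lte_add_pinfty //.
have fM i : modular Omega p (coord i \o G) \is a fin_num.
  rewrite ge0_fin_numE; first by have [_] := LG i.
  by apply: integral_ge0 => x _; rewrite lee_fin powR_ge0.
have nc i : nnm Omega (fun x => `|coord i (G x)| `^ p x).
  split=> [|x _]; last exact: powR_ge0.
  by have [mi _] := LG i; apply: measurable_powR2 => //; exact: measurableT_comp.
have n1 : nnm Omega (fun=> 1 : R) by exact: nnm_cst.
have OE : leb2 (Omega : set T2) = (fine (leb2 (Omega : set T2)))%:E.
  by rewrite fineK // ge0_fin_numE // bounded_leb2_fin.
have i1 := ible_cst mO OE 1.
have im i : ible Omega (fun x => `|coord i (G x)| `^ p x) (fine (modular Omega p (coord i \o G))).
  by rewrite /ible fineK.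
have n4 : 0 <= 4 :> R by [].
have nn := nnm_scale n4 (nnm_add (nc 0) (nc 1)).
have ii := ible_scale mO n4 (nnm_add (nc 0) (nc 1)) (ible_add mO (nc 0) (nc 1) (im 0) (im 1)).
have nT : nnm Omega (fun x => 1 + enorm (G x) `^ p x).
  by split=> [|x Ox]; [exact/measurable_EFinP|rewrite addr_ge0 // powR_ge0].
apply: le_lt_trans (ltry _); apply: (ible_le mO nT (nnm_add n1 nn) _ (ible_add mO n1 nn i1 ii)) => x Ox.
have /andP[px1 px2] := p12 x Ox; have p0 := le_trans ler01 px1.
rewrite lerD2l; apply: le_trans (_ : (`|coord 0 (G x)| + `|coord 1 (G x)|) `^ p x <= _).
  by apply: ge0_ler_powR; rewrite ?nnegrE ?enorm_ge0 ?addr_ge0 //; exact: enorm_le.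
by apply: powR_add_le => //; rewrite p0.
Qed.

End Domain.

Lemma opent_nonempty (R : realType) (k : @triangle R) : dt k != 0 -> opent k !=set0.
Proof.
move=> d0; exists (centroid k).
have := @shrink_opent _ k (k 0) 1 d0 (vertex_closedt 0 d0) ltr01 (lexx 1).
by rewrite subrr scale0r add0r scale1r.
Qed.

Lemma fin_num_between (R : realType) (a : \bar R) (r : R) : (0 <= a)%E -> (a <= r%:E)%E -> a \is a fin_num.
Proof. by move=> a0 ar; rewrite ge0_fin_numE // (le_lt_trans ar) ?ltry. Qed.

Lemma fine_le_real (R : realType) (a : \bar R) (r : R) : (0 <= a)%E -> (a <= r%:E)%E -> fine a <= r.
Proof. by move=> a0 ar; rewrite -lee_fin fineK //; exact: fin_num_between a0 ar. Qed.

Theorem theorem1p2 (R : realType)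
  (Omega : set (R * R))
  (hO_open : open Omega) (hO_conn : connected Omega) (hO_ne : Omega !=set0)
  (hO_bnd : bounded_set Omega) (hO_conv : convex_set Omega)
  (hO_lip : lipschitz_boundary Omega)
  (p : R * R -> R) (p1 p2 : R)
  (hp1 : 1 < p1) (hp12 : p1 <= p2) (hp2 : p2 <= 2)
  (hp : forall x, Omega x -> p1 <= p x <= p2)
  (hp_log : log_holder Omega p)
  (f g u : R * R -> R)
  (hu : unique_weak_solution Omega p f g u)
  (hu_cont : {within closure Omega, continuous u})
  (sigma : R) (T : R -> set (@triangle R))
  (hT : forall h, 0 < h -> triangulation Omega sigma h (T h))
  (uh : R -> R * R -> R)
  (huh : forall h, 0 < h -> unique_fe_solution (T h) p f u (uh h))
  (hH : exists2 D, is_weak_hess Omega u D &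
     (\int[leb2]_(x in Omega)
        (epow (enorm (wgrad Omega u x)) (p x - 2)%R * ((hess_sum D x) ^+ 2)%:E)
      < +oo)%E)
  (hC2 : forall h, 0 < h -> forall k, T h k ->
     let pp := pplus (opent k) p in
     C2alpha (opent k) ((2 - pp) / pp) u) :
  exists C : R, forall h, 0 < h ->
    W1p (polygon (T h)) p (u \- uh h) /\
    (W1p_norm (polygon (T h)) p (u \- uh h)%R <= (C * h)%:E)%E.
Proof.
have [Clog lh0] := hp_log; have [D wD HK] := hH; have [ws _] := hu.
have [[_ [_ [Gu wG] LG] _] _] := ws.
pose Cl := Num.max 0 Clog; have Cl0 : 0 <= Cl by rewrite le_max lexx.
have lh := log_holder_max lh0.
have mO : meas2 Omega := open_measurable2 hO_open.
have mp := measurable_log_holder hO_open lh0.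
have Ofin := bounded_leb2_fin hO_open hO_bnd.
have hp' x : Omega x -> p1 <= p x <= 2.
  by move=> /hp/andP[-> h]; exact: le_trans h hp2.
have p12 x : Omega x -> 1 <= p x <= 2.
  by move=> /hp'/andP[h ->]; rewrite andbT; apply: le_trans h; exact: ltW.
have [U U0 HU] := bounded_continuous hO_bnd hu_cont.
have [D0 D1 HD0] := bounded_enorm hO_bnd.
have mH : mfun2 Omega (hess_sum D).
  have mD i j : mfun2 Omega (D i j).
    by have [_ l _] := wD i j; exact: loc_integrable_measurable hO_open l.
  by apply: measurable_funD; [apply: measurable_funD|]; apply: measurableT_comp.
have Wfin := weight_finite hO_open hO_bnd lh0 p12 LG mH HK.
have [J [J0 HJ]] : exists J : R, 0 <= J /\ (\int[leb2]_(x in Omega) weight p (wgrad Omega u) (hess_sum D) x <= J%:E)%E.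
  have I0 : (0 <= \int[leb2]_(x in Omega) weight p (wgrad Omega u) (hess_sum D) x)%E.
    by apply: integral_ge0 => x _; exact: weight_ge0.
  exists (fine (\int[leb2]_(x in Omega) weight p (wgrad Omega u) (hess_sum D) x)%E).
  by rewrite fine_ge0 // fineK // ge0_fin_numE.
have [Sg [Sg1 HSg]] : exists Sg : R, 1 <= Sg /\ 4 * sigma ^+ 2 <= Sg.
  exists (1 + 4 * sigma ^+ 2); have h := sqr_ge0 sigma.
  by rewrite lerDl lerDr mulr_ge0.
(* The power of [1/d] in the upper cut-off; it grows as [p1] approaches 1. *)
have [N N2 Np] : exists2 N : nat, (2 <= N)%N & 2 <= N%:R * (p1 - 1).
  have q0 : 0 < p1 - 1 by rewrite subr_gt0.
  have a0 : 0 <= 2 / (p1 - 1) by rewrite divr_ge0 // ltW.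
  exists (Num.Def.archi_bound (2 / (p1 - 1))).+2 => //.
  rewrite -ler_pdivrMr //; apply: le_trans (ltW (archi_boundP a0)) _.
  by rewrite ler_nat; exact: (leq_trans (leqnSn _) (leqnSn _)).
(* These bounds put the upper cut-off above 1, above the slopes of interpolants of [u], and above
   twice the base value of [norm_poincare]. *)
have [M [M1 MU MJ]] : exists M, [/\ 1 <= M, 8 * U * Sg <= M & 32 * (9 * J + cT1 Sg * J ^+ 2) * Sg <= M].
  exists (Num.max 1 (Num.max (8 * U * Sg) (32 * (9 * J + cT1 Sg * J ^+ 2) * Sg))).
  by rewrite !le_max !lexx !orbT.
pose Cf := cost D0 Cl M N; pose cx := cX Sg Cf J; pose ce := 1 + 256 * Cf * (44 + (8 * cx + 4) * D0 ^+ 2).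
have Cf0 : 0 <= Cf by apply: le_trans (cost_ge1 N D1 Cl0 M1).
have cx0 : 0 <= cx by apply: cX_ge0 => //; exact: le_trans Sg1.
have ce0 : 0 <= ce.
  apply: addr_ge0; first exact: ler01.
  apply: mulr_ge0; first exact: mulr_ge0 (ler0n _ _) Cf0.
  apply: addr_ge0; first exact: ler0n.
  apply: mulr_ge0 (sqr_ge0 _); apply: addr_ge0; [exact: mulr_ge0 (ler0n _ _) cx0|exact: ler0n].
pose C := Num.max 1 (cU p1 J cx (D0 ^+ 2) ce) + Num.max 1 (cG p1 J cx (D0 ^+ 2)).
have C0 : 0 <= C by rewrite addr_ge0 // le_max ler01.
exists C => h h0; have tr := hT h h0; have [fs _] := huh h h0.
have C2 k : T h k -> Ck 2 (opent k) u by move=> Tk; have [] := hC2 h h0 k Tk.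
(* No triangle in [Omega] has diameter above [D0], so [hh] still bounds the mesh size. With
   [hh^2 <= D0^2] one constant serves all [h], large ones included. *)
pose hh := Num.min h D0; have hh0 : 0 < hh by rewrite lt_min h0 (lt_le_trans ltr01 D1).
have hhd : hh ^+ 2 <= D0 ^+ 2.
  by apply: lerXn2r; rewrite ?nnegrE ?(ltW hh0) ?(le_trans ler01 D1) // ge_min lexx orbT.
have SO : mesh_in (T h) `<=` Omega by move=> x /(mesh_in_polygon tr); exact: tr_sub tr x.
have mW := measurable_cweight tr hO_open mp C2.
have WJ := le_trans (mesh_weight tr hO_open mp wG wD C2) HJ.
have tri k : T h k ->
  ible (opent k) (fun x => quasi (p x) (cgrad u x) (slope u k)) (cx * hh ^+ 2 * fine (\int[leb2]_(x in opent k) weight p (cgrad u) (Hc u) x)%E) /\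
  ible (opent k) (fun x => (`|u x - lin u k x| / hh) `^ p x) (ce * fine (\int[leb2]_(x in opent k) weight p (cgrad u) (Hc u) x)%E) /\
  (\int[leb2]_(x in opent k) weight p (cgrad u) (Hc u) x)%E \is a fin_num.
  move=> Tk; have d0 := tr_dt tr Tk.
  have kS : opent k `<=` mesh_in (T h) by move=> x kx; exists k.
  have kO : opent k `<=` Omega by move=> x /kS; exact: SO.
  have [dp sg _ _ dr] := regular_dt d0 (tr_regular tr Tk).
  have dh : diam (opent k) <= hh.
    rewrite le_min (tr_diam tr Tk) /=; apply: ge_sup.
      by have [x kx] := opent_nonempty d0; exists (enorm (x - x)), x => //; exists x.
    by move=> _ [x kx [y ky <-]]; apply: HD0; exact: kO.
  have dD : diam (opent k) <= D0 by apply: le_trans dh _; rewrite ge_min lexx orbT.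
  have mk : meas2 (opent k) by apply: open_measurable2; exact: opent_open.
  have Wle : (\int[leb2]_(x in opent k) weight p (cgrad u) (Hc u) x <= J%:E)%E.
    apply: le_trans WJ; apply: (ge0_subset_integral leb2 mk (measurable_mesh tr) mW _ kS) => x _.
    exact: weight_ge0.
  have Wk0 : (0 <= \int[leb2]_(x in opent k) weight p (cgrad u) (Hc u) x)%E.
    by apply: integral_ge0 => x _; exact: weight_ge0.
  have fn : (\int[leb2]_(x in opent k) weight p (cgrad u) (Hc u) x)%E \is a fin_num.
    exact: fin_num_between Wk0 Wle.
  have HSk : 4 * diam (opent k) ^+ 2 <= Sg * `|dt k|.
    apply: le_trans (ler_wpM2l (ler0n _ _) dr) _.
    by rewrite mulrA; apply: ler_wpM2r.
  have HW := esym (fineK fn); have Jk : fine (\int[leb2]_(x in opent k) weight p (cgrad u) (Hc u) x)%E <= J.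
    exact: fine_le_real Wk0 Wle.
  set Jt := fine _ in HW Jk *; have Jt0 : 0 <= Jt by rewrite fine_ge0.
  have q := triangle_quasi mO mp hp' hp1 lh hu_cont HU U0 D1 Cl0 Sg1 J0 M1 N2 Np MU MJ d0 kO (C2 k Tk) dp dD HSk HW Jk.
  have e := triangle_err mO mp hp' hp1 lh hu_cont HU U0 D1 Cl0 Sg1 J0 M1 N2 Np MU MJ d0 kO (C2 k Tk) dp dD HSk HW Jk.
  split; [|split; last exact: fn].
    apply: ible_trans q _; rewrite -mulrA; apply: ler_wpM2l => //; apply: ler_wpM2r => //.
    by apply: lerXn2r; rewrite ?nnegrE ?(ltW dp) ?(ltW hh0).
  have mpk := measurable_funS mO kO mp.
  have me r : nnm (opent k) (fun x => (`|u x - lin u k x| / r) `^ p x).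
    split=> [|x _]; last exact: powR_ge0.
    apply: measurable_powR2 => //; apply: measurable_funM => //; apply: measurableT_comp => //.
    apply: open_continuous_measurable2; first exact: opent_open.
    move=> x kx; apply: cvgB; last exact: lin_cont.
    exact: (Ck_cont (opent_open d0) (C2 k Tk) kx (s := [::])).
  apply: (ible_le mk (me hh) (me (diam (opent k))) _ e) => x kx.
  have /andP[px1 _] := p12 x (kO x kx).
  apply: ge0_ler_powR; rewrite ?nnegrE ?divr_ge0 ?(ltW dp) ?(ltW hh0) ?(le_trans ler01 px1) //.
  by apply: ler_wpM2l => //; rewrite lef_pV2 ?posrE.
have HX k : T h k -> (\int[leb2]_(x in opent k) (quasi (p x) (cgrad u x) (slope u k))%:E <=
  (cx * hh ^+ 2)%:E * \int[leb2]_(x in opent k) weight p (cgrad u) (Hc u) x)%E.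
  by move=> /tri[i1 [_ fn]]; apply: le_trans i1 _; rewrite EFinM fineK.
have HE k : T h k -> (\int[leb2]_(x in opent k) ((`|u x - lin u k x| / hh) `^ p x)%:E <=
  ce%:E * \int[leb2]_(x in opent k) weight p (cgrad u) (Hc u) x)%E.
  by move=> /tri[_ [i1 fn]]; apply: le_trans i1 _; rewrite EFinM fineK.
have [W1 W2] := galerkin_estimate tr hO_open hO_bnd Ofin mp hp' hp1 wG wD C2 ws fs HJ hh0 cx0 HX hhd ce0 HE.
split=> //; apply: le_trans W2 _; rewrite lee_fin; apply: ler_wpM2l => //.
by rewrite ge_min lexx.
Qed.
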